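(* Let $\Omega\subset\mathbb R^2$ be a bounded Lipschitz domain with connected complement, $\Gamma$ an open subset of $\partial\Omega$, $k\in\mathbb R_+$, and let $v,w\in H^1(\Omega)$ be a pair of conductive transmission eigenfunctions associated with $k$, i.e. a nontrivial pair satisfying $$\Delta w+k^2 q w=0\ \text{ in }\Omega,\qquad \Delta v+k^2 v=0\ \text{ in }\Omega,\qquad w=v,\ \ \partial_\nu w=\partial_\nu v+\eta v\ \text{ on }\Gamma .$$ Suppose $\mathbf 0\in\Gamma$ and $\Omega\cap B_h=\mathcal K\cap B_h=S_h$, where $\mathcal K=\{\mathbf x\in\mathbb R^2:\theta_m<\arg(x_1+\mathrm i x_2)<\theta_M\}$ and $h\in\mathbb R_+$ is sufficiently small such that $q\in H^2(\overline{S_h})$ and $\eta\in C^\alpha(\overline{\Gamma_h^\pm})$ for some $\alpha\in(0,1)$. Assume: (a) for given positive constants $\beta,\gamma$ with $\gamma<\alpha\beta$, $v$ can be approximated in $H^1(S_h)$ by Herglotz wave functions $$v_j(\mathbf x)=\int_{\mathbb S^1}e^{\mathrm i k\xi\cdot\mathbf x}g_j(\xi)\,\mathrm d\xi,\quad j=1,2,\dots,$$ with kernels $g_j\in L^2(\mathbb S^1)$ satisfying $\|v-v_j\|_{H^1(S_h)}\le j^{-\beta}$ and $\|g_j\|_{L^2(\mathbb S^1)}\le j^{\gamma}$; (b) $\eta(\mathbf 0)\neq 0$, where $\mathbf 0$ is the vertex of $S_h$; (c) $-\pi<\theta_m<\theta_M<\pi$ and $0<\theta_M-\theta_m<\pi$.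 Then $$\lim_{\lambda\to+0}\frac{1}{m(B(\mathbf 0,\lambda)\cap\Omega)}\int_{B(\mathbf 0,\lambda)\cap\Omega}|v(\mathbf x)|\,\mathrm d\mathbf x=0,$$ where $m(B(\mathbf 0,\lambda)\cap\Omega)$ is the area of $B(\mathbf 0,\lambda)\cap\Omega$.
   Context: $q=1+V$ with $V\in L^\infty(\Omega)$ complex-valued; $\eta\in L^\infty(\partial\Omega)$ is complex-valued; $\nu$ is the exterior unit normal to $\partial\Omega$. $B_h=B(\mathbf 0,h)$ is the open disc of radius $h$ centered at the origin, $B(\mathbf 0,\lambda)$ the one of radius $\lambda$. $\Gamma^\pm$ are the two boundary half-lines of $\mathcal K$ (at angles $\theta_m$ and $\theta_M$), $S_h=\mathcal K\cap B_h$, and $\Gamma_h^\pm=\Gamma^\pm\cap B_h$ (used to denote the union of the two segments, so that $\eta$ is $\alpha$-Hölder continuous there up to the vertex $\mathbf 0$). *)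

(* Defs.v *)
From HB Require Import structures.
From mathcomp Require Import all_boot all_order all_algebra.
From mathcomp Require Import complex.
From mathcomp Require Import all_classical all_reals all_analysis.

Set Implicit Arguments.
Unset Strict Implicit.
Unset Printing Implicit Defensive.

Import Order.TTheory GRing.Theory Num.Theory.
Import numFieldNormedType.Exports.

Local Open Scope classical_set_scope.
Local Open Scope ring_scope.
Local Open Scope complex_scope.

Section plane.
Context {R : realType}.

(* The topology of R * R is that of the max norm, hence the usual one; discs,
   diameters and Hoelder conditions below use the Euclidean norm. *)
Definition enorm (x : R * R) : R := Num.sqrt (x.1 ^+ 2 + x.2 ^+ 2).

Definition edot (x y : R * R) : R := x.1 * y.1 + x.2 * y.2.

Definition disc (p : R * R) (r : R) : set (R * R) :=
  [set x | enorm (x - p) < r].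

Definition e1 : R * R := (1, 0).
Definition e2 : R * R := (0, 1).

Definition boundary (A : set (R * R)) : set (R * R) := closure A `\` interior A.

Definition expi (t : R) : R[i] := cos t +i* sin t.

(* Principal argument; only meaningful for z != 0. *)
Definition carg (z : R[i]) : R :=
  xget 0 [set t | - pi < t <= pi /\ z = (Normc.normc z)%:C * expi t].

Definition sector (tm tM : R) : set (R * R) :=
  [set x | x != 0 /\ tm < carg (x.1 +i* x.2) < tM].

Definition truncated_sector (tm tM h : R) : set (R * R) :=
  sector tm tM `&` disc 0 h.

Definition ray (t : R) : set (R * R) :=
  [set x | x != 0 /\ carg (x.1 +i* x.2) = t].

Definition rot (t : R) (x : R * R) : R * R :=
  (cos t * x.1 + sin t * x.2, - sin t * x.1 + cos t * x.2).

Definition bounded_lipschitz_domain (A : set (R * R)) : Prop :=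
  [/\ A !=set0, open A, connected A, bounded_set A &
    forall p, boundary A p ->
      exists (t r : R) (g : R -> R),
        [/\ 0 < r, lipschitz g &
          forall x, disc p r x ->
            (A x <-> g (rot t (x - p)).1 < (rot t (x - p)).2)]].

(* Plane Lebesgue measure, on the Borel sets of the plane. *)
Definition leb2 : set (measurableTypeR R * measurableTypeR R) -> \bar R :=
  (@lebesgue_measure R \x @lebesgue_measure R)%E.

Definition diam (A : set (R * R)) : \bar R :=
  ereal_sup (0%E |` [set (enorm (x - y))%:E | x in A & y in A]).

(* One-dimensional Hausdorff outer measure; no normalising factor is needed in
   dimension 1, and on the boundary of a Lipschitz domain it is arc length.
   It is a measure on Borel sets only, and the integral of a function depends
   only on its values on these. *)
Definition hausdorff1 (A : set (measurableTypeR R * measurableTypeR R)) :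
    \bar R :=
  ereal_sup [set ereal_inf
    [set (\sum_(0 <= i <oo) diam (C i))%E | C in
      [set C : nat -> set (R * R) |
        A `<=` \bigcup_i C i /\ forall i, (diam (C i) <= d%:E)%E]]
    | d in [set d : R | 0 < d]].

End plane.

Section complex_integration.
Context {R : realType} {d : measure_display} {T : measurableType d}.
Variable mu : set T -> \bar R.

Definition cmeasurable (A : set T) (f : T -> R[i]) : Prop :=
  measurable_fun A (fun x => complex.Re (f x)) /\
  measurable_fun A (fun x => complex.Im (f x)).

Definition cintegral (A : set T) (f : T -> R[i]) : R[i] :=
  fine (\int[mu]_(x in A) (complex.Re (f x))%:E)%E +i*
  fine (\int[mu]_(x in A) (complex.Im (f x))%:E)%E.

Definition L2norm (A : set T) (f : T -> R[i]) : \bar R :=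
  ((\int[mu]_(x in A) (Normc.normc (f x) ^+ 2)%:E) `^ 2^-1)%E.

Definition L2 (A : set T) (f : T -> R[i]) : Prop :=
  cmeasurable A f /\ (L2norm A f < +oo)%E.

Definition Linfty (A : set T) (f : T -> R[i]) : Prop :=
  cmeasurable A f /\
  exists M : R, \forall x \ae mu, A x -> Normc.normc (f x) <= M.

End complex_integration.

Section sobolev.
Context {R : realType}.
Implicit Types (A : set (R * R)) (e : R * R) (phi : R * R -> R).
Implicit Types (u g f : R * R -> R[i]).

Fixpoint Ck (n : nat) phi : Prop :=
  continuous phi /\
  if n is m.+1 then
    forall e, e = e1 \/ e = e2 ->
      (forall x, derivable phi x e) /\ Ck m (fun x => 'D_e phi x)
  else True.

Definition smooth phi : Prop := forall n, Ck n phi.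

Definition csmooth u : Prop :=
  smooth (fun x => complex.Re (u x)) /\ smooth (fun x => complex.Im (u x)).

Definition supp phi : set (R * R) := closure [set x | phi x != 0].

(* Real-valued test functions suffice, by linearity of all the pairings. *)
Definition test_function A phi : Prop :=
  [/\ smooth phi, compact (supp phi) & supp phi `<=` A].

Definition weak_partial A e u g : Prop :=
  L2 leb2 A g /\
  forall phi, test_function A phi ->
    cintegral leb2 A (fun x => u x * ('D_e phi x)%:C) =
    - cintegral leb2 A (fun x => g x * (phi x)%:C).

Definition wpartial A e u : R * R -> R[i] :=
  xget (fun=> 0) [set g | weak_partial A e u g].

Fixpoint sobolev (m : nat) A u : Prop :=
  L2 leb2 A u /\
  if m is n.+1 then
    forall e, e = e1 \/ e = e2 ->
      weak_partial A e u (wpartial A e u) /\ sobolev n A (wpartial A e u)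
  else True.

(* Only meaningful when sobolev 1 A u holds. *)
Definition H1norm A u : \bar R :=
  ((\int[leb2]_(x in A) (Normc.normc (u x) ^+ 2 +
      Normc.normc (wpartial A e1 u x) ^+ 2 +
      Normc.normc (wpartial A e2 u x) ^+ 2)%:E) `^ 2^-1)%E.

(* The integral over A of  grad u . grad phi + f phi. *)
Definition green_pairing A u f phi : R[i] :=
  cintegral leb2 A (fun x =>
    wpartial A e1 u x * ('D_e1 phi x)%:C +
    wpartial A e2 u x * ('D_e2 phi x)%:C + f x * (phi x)%:C).

Definition weak_laplacian A u f : Prop :=
  L2 leb2 A f /\ forall phi, test_function A phi -> green_pairing A u f phi = 0.

(* The trace of u in H^1(A), A a bounded Lipschitz domain: the L^2 limit of the
   boundary values of smooth functions that converge to u in H^1(A). *)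
Definition is_trace A u g : Prop :=
  L2 hausdorff1 (boundary A) g /\
  exists u_ : nat -> R * R -> R[i],
    [/\ forall n, csmooth (u_ n),
        (fun n => H1norm A (fun x => u_ n x - u x)) @ \oo --> 0%E &
        (fun n => L2norm hausdorff1 (boundary A) (fun x => u_ n x - g x))
          @ \oo --> 0%E].

(* The exterior normal derivative of u (u in H^1(A), with weak Laplacian f) as
   a functional on the boundary: by Green's formula, its value at phi is the
   integral of grad u . grad phi + f phi over A. *)
Definition normal_derivative A u f phi : R[i] := green_pairing A u f phi.

Definition boundary_test_function A (G : set (R * R)) phi : Prop :=
  [/\ smooth phi, compact (supp phi) & supp phi `&` boundary A `<=` G].

Definition conductive_transmission_eigenfunctions
    (Omega Gamma : set (R * R)) (k : R) (q eta v w : R * R -> R[i]) : Prop :=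
  let lap_w := fun x => - ((k ^+ 2)%:C * q x * w x) in
  let lap_v := fun x => - ((k ^+ 2)%:C * v x) in
  [/\ sobolev 1 Omega v /\ sobolev 1 Omega w,
      ~ \forall x \ae leb2, Omega x -> v x = 0 /\ w x = 0,
      weak_laplacian Omega w lap_w,
      weak_laplacian Omega v lap_v &
      exists tv tw : R * R -> R[i],
        [/\ is_trace Omega v tv, is_trace Omega w tw,
            \forall x \ae hausdorff1, Gamma x -> tw x = tv x &
            forall phi, boundary_test_function Omega Gamma phi ->
              normal_derivative Omega w lap_w phi =
              normal_derivative Omega v lap_v phi +
              cintegral hausdorff1 Gamma
                (fun x => eta x * tv x * (phi x)%:C)]].

Definition holder_on A (a : R) u : Prop :=
  exists C : R, forall x y, A x -> A y ->
    Normc.normc (u x - u y) <= C * enorm (x - y) `^ a.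

End sobolev.

Section herglotz.
Context {R : realType}.

(* The unit circle is parametrised by arc length; only the values of g on the
   circle are used. *)
Definition on_circle (g : R * R -> R[i]) (t : R) : R[i] := g (cos t, sin t).

Definition herglotz (k : R) (g : R * R -> R[i]) (x : R * R) : R[i] :=
  cintegral lebesgue_measure `[- pi, pi]
    (on_circle (fun xi => expi (k * edot xi x) * g xi)).

Definition L2norm_circle (g : R * R -> R[i]) : \bar R :=
  L2norm lebesgue_measure `[- pi, pi] (on_circle g).

Definition L2_circle (g : R * R -> R[i]) : Prop :=
  L2 lebesgue_measure `[- pi, pi] (on_circle g).

End herglotz.

(* Main.v *)
Require Import Defs.
From HB Require Import structures.
From mathcomp Require Import all_boot all_order all_algebra.
From mathcomp Require Import complex.
From mathcomp Require Import all_classical all_reals all_analysis.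
From mathcomp Require Import measurable_realfun.
From mathcomp Require Import ring lra.

Set Implicit Arguments.
Unset Strict Implicit.
Unset Printing Implicit Defensive.

Import Order.TTheory GRing.Theory Num.Theory.
Import numFieldNormedType.Exports.

Local Open Scope classical_set_scope.
Local Open Scope ring_scope.

(* The difference w - v has zero Cauchy data near the corner up to the jump
   eta v. Testing with chi * exp (- s p.x) cos (s p^perp.x), where p is the sum
   of the two unit side directions and chi a cutoff near the vertex, the
   harmonic exponential leaves only a pairing of L^2 functions over the sector,
   so the integral of eta v against the exponential over the two sides is
   o (1 / s). Holder continuity replaces eta by eta 0 there, and Green's
   identity moves v back into the sector, where it is close to v_j, hence to
   the constant v_j 0. The exponential integrates to 1 / s + O (1 / s ^ 2) over
   the two sides, so v_j 0 = o (1) + O (s j^-beta + j^gamma s^-alpha). Taking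
   s = 1 / lambda and j about s^th with 1 / beta < th < alpha / gamma makes v_j 0
   vanish in the limit, and the mean of |v| over the disc differs from that of
   |v_j 0| by O (s j^-beta + j^gamma / s). *)

(** The boundary data are weak: traces are L^2 limits, the normal derivative is a functional, arc
    length is an outer measure. Hence nothing is differentiated on the boundary: Green's identity is
    proved for smooth functions in the coordinates [r a + t b] of the two side directions, and
    reaches [v] and [w] through the sequences that define their traces. The choice of [p] serves the
    leading term. As [p.a = p.b], the exponential decays at the same rate on both sides, with
    opposite phases that the cosine does not see; the two contributions are equal in the limit and
    cannot cancel. Cauchy-Schwarz alone bounds the pairing over the sector by [O (1 / s)], which is
    the size of the leading term. The gain to [o (1 / s)] comes from the concentration of the
    exponential at the vertex, where a fixed L^2 function has little mass. The argument runs on real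
    and imaginary parts; a complex [eta] couples them by a 2x2 system whose determinant at the
    vertex is [|eta 0|^2]. *)

Section square_integrable.
Context d (T : measurableType d) (R : realType).
Variables (mu : {measure set T -> \bar R}) (D : set T).
Hypothesis mD : measurable D.
Implicit Types f g : T -> R.

Definition rintegrable f := mu.-integrable D (EFin \o f).

Definition sqint f :=
  measurable_fun D f /\ rintegrable (fun x => f x ^+ 2).

Lemma rintegrable_measurable f : rintegrable f -> measurable_fun D f.
Proof. by move=> /measurable_int/measurable_EFinP. Qed.

Lemma rintegrableD f g : rintegrable f -> rintegrable g ->
  rintegrable (fun x => f x + g x).
Proof. exact: (@integrableD _ _ _ mu D mD (EFin \o f) (EFin \o g)). Qed.

Lemma rintegrableB f g : rintegrable f -> rintegrable g ->
  rintegrable (fun x => f x - g x).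
Proof. exact: (@integrableB _ _ _ mu D mD (EFin \o f) (EFin \o g)). Qed.

Lemma rintegrableZ (c : R) f : rintegrable f -> rintegrable (fun x => c * f x).
Proof. exact: (@integrableZl _ _ _ mu D mD c (EFin \o f)). Qed.

Lemma le_rintegrable f g : measurable_fun D f -> rintegrable g ->
  (forall x, D x -> `|f x| <= g x) -> rintegrable f.
Proof.
move=> mf ig fg; apply: (le_integrable mD _ _ ig); first exact/measurable_EFinP.
by move=> x /fg fgx; rewrite /= lee_fin (le_trans fgx)// ler_norm.
Qed.

Lemma rintegrable_norm f : rintegrable f -> rintegrable (fun x => `|f x|).
Proof. exact: integrable_norm. Qed.

Lemma eq_rintegrable f g : (forall x, D x -> f x = g x) ->
  rintegrable f -> rintegrable g.
Proof.
by move=> fg; apply: (eq_integrable mD) => x /set_mem/= xD; rewrite fg.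
Qed.

Lemma sqint_mul f g : sqint f -> sqint g -> rintegrable (fun x => f x * g x).
Proof.
move=> [mf if2] [mg ig2].
apply: (le_rintegrable _ (rintegrableD if2 ig2)).
  exact: measurable_funM.
by move=> x _; rewrite normrM -[f x ^+ 2]real_normK ?num_real//
  -[g x ^+ 2]real_normK ?num_real//; nra.
Qed.

Lemma sqintZ (c : R) f : sqint f -> sqint (fun x => c * f x).
Proof.
move=> [mf if2]; split; first exact: measurable_funM.
apply: (eq_rintegrable _ (rintegrableZ (c ^+ 2) if2)).
by move=> x _; rewrite exprMn.
Qed.

Lemma sqintD f g : sqint f -> sqint g -> sqint (fun x => f x + g x).
Proof.
move=> [mf if2] [mg ig2]; split; first exact: measurable_funD.
apply: (le_rintegrable _ (rintegrableZ 2 (rintegrableD if2 ig2))).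
  exact/measurable_funX/measurable_funD.
by move=> x _; rewrite ger0_norm ?sqr_ge0//; have := sqr_ge0 (f x - g x); nra.
Qed.

Lemma sqintN f : sqint f -> sqint (fun x => - f x).
Proof.
move=> /(sqintZ (-1)); congr sqint.
by apply/funext => x; rewrite mulN1r.
Qed.

Lemma sqintB f g : sqint f -> sqint g -> sqint (fun x => f x - g x).
Proof. by move=> sf /sqintN; exact: sqintD. Qed.

Lemma le_sqint f g : measurable_fun D f -> sqint g ->
  (forall x, D x -> `|f x| <= `|g x|) -> sqint f.
Proof.
move=> mf [mg ig] fg; split=> //.
apply: (le_rintegrable _ ig) => [|x Dx]; first exact: measurable_funX.
rewrite ger0_norm ?sqr_ge0// -[f x ^+ 2]real_normK ?num_real//.
by rewrite -[g x ^+ 2]real_normK ?num_real// lerXn2r ?nnegrE ?fg.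
Qed.

Lemma sqint_norm f : sqint f -> sqint (fun x => `|f x|).
Proof.
move=> sf; apply: (le_sqint _ sf) => [|x _]; last by rewrite normr_id.
by apply: measurableT_comp => //; case: sf.
Qed.

Definition bdmeas f :=
  measurable_fun D f /\ exists M, forall x, D x -> `|f x| <= M.

Lemma sqint_bdmeas f g : sqint f -> bdmeas g -> sqint (fun x => f x * g x).
Proof.
move=> sf [mg [M gM]]; apply: (le_sqint _ (sqintZ M sf)) => [|x Dx].
  by apply: measurable_funM => //; case: sf.
rewrite !normrM mulrC ler_wpM2r// (le_trans (gM _ Dx))// ler_norm//.
Qed.

Lemma bdmeas_sqint f : (mu D < +oo)%E -> bdmeas f -> sqint f.
Proof.
move=> muD [mf [M fM]]; split=> //.
apply: measurable_bounded_integrable => //; first exact: measurable_funX.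
exists (M ^+ 2); split; first exact: num_real.
move=> y My x Dx /=; apply: le_trans (ltW My).
rewrite ger0_norm ?sqr_ge0// -real_normK ?num_real// lerXn2r ?nnegrE//.
  by rewrite (le_trans (normr_ge0 _) (fM _ Dx)).
exact: fM.
Qed.

Lemma sqint_rintegrable f : (mu D < +oo)%E -> sqint f -> rintegrable f.
Proof.
move=> muD sf.
have s1 : sqint (fun=> 1).
  by apply: bdmeas_sqint => //; split=> //; exists 1 => x _; rewrite normr1.
apply: (eq_rintegrable _ (sqint_mul sf s1)) => x _.
by rewrite mulr1.
Qed.

(** The quadratic [t ^+ 2 * F - 2 * t * H + G] is the integral of a square, hence nonnegative; its
    value at the minimum [H / F] is the inequality. *)
Lemma Rintegral_CauchySchwarz f g : sqint f -> sqint g ->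
  (\int[mu]_(x in D) `|f x * g x|) ^+ 2 <=
  (\int[mu]_(x in D) f x ^+ 2) * (\int[mu]_(x in D) g x ^+ 2).
Proof.
move=> sf sg; set H := (X in X ^+ 2 <= _); set F := (X in X * _); set G := (X in _ * X).
have H0 : 0 <= H by apply: Rintegral_ge0.
have F0 : 0 <= F by apply: Rintegral_ge0 => x _; exact: sqr_ge0.
have G0 : 0 <= G by apply: Rintegral_ge0 => x _; exact: sqr_ge0.
have iH : rintegrable (fun x => `|f x * g x|).
  exact: rintegrable_norm (sqint_mul sf sg).
have quad t : 0 <= t ^+ 2 * F - 2 * t * H + G.
  have iF := rintegrableZ (t ^+ 2) sf.2.
  have iH2 := rintegrableZ (2 * t) iH.
  rewrite /F /H /G -RintegralZl//; last exact: sf.2.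
  rewrite -RintegralZl// -RintegralB// -RintegralD//; [|exact: rintegrableB|exact: sg.2].
  apply: Rintegral_ge0 => x _; rewrite normrM.
  have := sqr_ge0 (t * `|f x| - `|g x|).
  rewrite -[f x ^+ 2]real_normK ?num_real// -[g x ^+ 2]real_normK ?num_real//.
  by nra.
have [F0'|F0'] := eqVneq F 0.
  have H00 : H = 0.
    apply/eqP; rewrite eq_le H0 andbT leNgt; apply/negP => Hpos.
    (* With [F = 0] the quadratic is affine in [t]; at this point it takes the value [-1]. *)
    have := quad ((G + 1) / (2 * H)); rewrite F0' mulr0.
    have -> : 2 * ((G + 1) / (2 * H)) * H = G + 1 by field; rewrite gt_eqF.
    by lra.
  by rewrite H00 F0' mul0r expr0n.
have Fpos : 0 < F by rewrite lt_def F0'.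
have := quad (H / F).
have -> : (H / F) ^+ 2 * F - 2 * (H / F) * H + G = G - H ^+ 2 / F.
  by field; rewrite gt_eqF.
by rewrite subr_ge0 ler_pdivrMr// mulrC.
Qed.

(* Stated with upper bounds so that it chains without square roots. *)
Lemma Rintegral_le_CauchySchwarz f g (A B : R) : 0 <= A -> 0 <= B ->
  sqint f -> sqint g ->
  \int[mu]_(x in D) f x ^+ 2 <= A ^+ 2 -> \int[mu]_(x in D) g x ^+ 2 <= B ^+ 2 ->
  \int[mu]_(x in D) `|f x * g x| <= A * B.
Proof.
move=> A0 B0 sf sg fA gB.
rewrite -(@ler_pXn2r _ 2)// ?nnegrE ?mulr_ge0//; last exact: Rintegral_ge0.
apply: (le_trans (Rintegral_CauchySchwarz sf sg)); rewrite exprMn.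
by apply: ler_pM => //; apply: Rintegral_ge0 => x _; exact: sqr_ge0.
Qed.

Lemma Rintegral_dominated_cvg (F : nat -> T -> R) f g :
  (forall n, measurable_fun D (F n)) -> measurable_fun D f -> rintegrable g ->
  (forall x, D x -> F ^~ x @ \oo --> f x) ->
  (forall n x, D x -> `|F n x| <= g x) ->
  (fun n => \int[mu]_(x in D) F n x) @ \oo --> \int[mu]_(x in D) f x.
Proof.
move=> mF mf ig Ff Fg.
have [] := @dominated_convergence _ _ _ mu D mD (fun n => EFin \o F n)
  (EFin \o f) (EFin \o g).
- by move=> n; exact/measurable_EFinP.
- exact/measurable_EFinP.
- apply: aeW => x Dx; apply: cvg_comp (Ff _ Dx) _.
  by [].
- exact: ig.
- by apply: aeW => x Dx n /=; rewrite lee_fin Fg.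
move=> iff _ cv.
have -> : \int[mu]_(x in D) f x = fine (\int[mu]_(x in D) (f x)%:E) by [].
apply: fine_cvg; rewrite fineK; first exact: cv.
by apply: integrable_fin_num.
Qed.

End square_integrable.
Arguments rintegrable {d T R} mu D f.
Arguments sqint {d T R} mu D f.
Arguments bdmeas {d T R} D f.

(** [leb2] unfolds to a product measure; the instance carries that structure over to the name, so
    that measure lemmas apply to it. *)
HB.instance Definition _ (R : realType) := Measure.on (@leb2 R).

(** * The plane measure *)

Section plane_measure.
Context {R : realType}.
Local Notation mu := (@lebesgue_measure R).

Let near_ball (x u e : R) : x < u -> u < x + e -> ball u e x.
Proof. by rewrite /ball /= ltr_norml => *; apply/andP; split; lra. Qed.

Let near_ball2 (x u d e y : R) : x < u -> u < x + d -> d < e / 2 ->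
  ball u d y -> ball x e y.
Proof.
by rewrite /ball /= !ltr_norml => ? ? ? /andP[? ?]; apply/andP; split; lra.
Qed.

(** The sigma-algebra of the plane is generated by rectangles, so an open set is written as a
    countable union of boxes with rational centres and radii [1 / (n + 1)]. *)
Lemma open_measurable2 (U : set (R * R)) : open U ->
  measurable (U : set (measurableTypeR R * measurableTypeR R)).
Proof.
move=> oU.
pose box (i : rat * rat * nat) : set (R * R) :=
  ball (ratr i.1.1 : R) (i.2.+1%:R^-1) `*` ball (ratr i.1.2 : R) (i.2.+1%:R^-1).
have -> : U = \bigcup_i (box i `&` [set _ | box i `<=` U]).
  apply/seteqP; split=> [x Ux|x [i _ [xi]]]; last exact.
  move: oU; rewrite openE => /(_ _ Ux)/nbhs_ballP[e /= e0 xeU].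
  have [n ne] : exists n, n.+1%:R^-1 < e / 2.
    have /cvgrPdist_lt/(_ (e / 2)) := @cvg_harmonic R.
    rewrite divr_gt0// => /(_ isT)[n _ /(_ n (leqnn _))] /=.
    by rewrite sub0r normrN ger0_norm ?invr_ge0// => ?; exists n.
  have n0 : 0 < n.+1%:R^-1 :> R by rewrite invr_gt0.
  have [q1] : exists q, ratr q \in `]x.1, (x.1 + n.+1%:R^-1)[.
    by apply: rat_in_itvoo; rewrite ltrDl.
  rewrite in_itv/= => /andP[q1x q1x'].
  have [q2] : exists q, ratr q \in `]x.2, (x.2 + n.+1%:R^-1)[.
    by apply: rat_in_itvoo; rewrite ltrDl.
  rewrite in_itv/= => /andP[q2x q2x'].
  exists (q1, q2, n) => //; split.
    by split; exact: near_ball.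
  move=> y [] /= y1 y2; apply: xeU; split.
    exact: (near_ball2 q1x q1x' ne).
  exact: (near_ball2 q2x q2x' ne).
apply: countable_bigcupT_measurable => // i.
have [iU|iU] := pselect (box i `<=` U).
  rewrite (_ : _ `&` _ = box i); last by apply/seteqP; split=> // x [].
  by apply: measurableX; exact: measurable_ball.
rewrite (_ : _ `&` _ = set0)//.
by apply/seteqP; split=> // x [].
Qed.

Lemma continuous_measurable2 (f : R * R -> R) D : continuous f ->
  measurable_fun (D : set (measurableTypeR R * measurableTypeR R)) f.
Proof.
move=> /continuousP cf; apply: measurable_funTS.
apply: (measurability _ (RGenOpens.measurableE R)) => _ [_ [a [b ->] <-]].
by rewrite setTI; apply: open_measurable2; apply: cf; exact: interval_open.
Qed.

Lemma measurable_affine (c e : R) :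
  measurable_fun setT (fun t : measurableTypeR R => (c * t + e : measurableTypeR R)).
Proof. by apply: measurable_funD => //; exact: measurable_funM. Qed.

(** The left-hand side is a scaled pushforward that agrees with Lebesgue measure on the intervals
    []a, b]], so uniqueness applies. A negative [c] exchanges the open and the closed end, hence the
    two cases. *)
Lemma lebesgue_measure_affine (c e : R) (A : set (measurableTypeR R)) :
  c != 0 -> measurable A ->
  (`|c|%:E * mu [set t | A (c * t + e)%R] = mu A)%E.
Proof.
move=> c0 mA.
pose phi (t : measurableTypeR R) : measurableTypeR R := c * t + e.
have mphi : measurable_fun setT phi := measurable_affine c e.
pose nu_ := mscale (NngNum (normr_ge0 c)) (pushforward mu phi).
pose nu := nu_ mphi.
have -> : (`|c|%:E * mu [set t | A (c * t + e)%R])%E = nu A by [].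
apply/esym/lebesgue_measure_unique => //= _ [[a b]] _ <-.
rewrite /nu /nu_ /mscale /pushforward /= lebesgue_measure_itv/=.
have [c_gt0|c_lt0|c_eq0] := ltgtP 0 c; last by rewrite c_eq0 eqxx in c0.
  have -> : pushforward mu phi `]a, b] = mu `](a - e) / c, (b - e) / c].
    congr (mu _); apply/seteqP; split=> t /=; rewrite !in_itv/= /phi;
      by rewrite ltr_pdivrMr// ler_pdivlMr// ltrBlDr lerBrDr mulrC.
  rewrite lebesgue_measure_itv/= !lte_fin ltr_pM2r ?invr_gt0//.
  rewrite ltrD2r; case: ifP => ab; rewrite ?mule0// -!EFinD -EFinM.
  by congr EFin; rewrite gtr0_norm//; field; rewrite gt_eqF.
have -> : pushforward mu phi `]a, b] = mu `[(b - e) / c, (a - e) / c[.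
  congr (mu _); apply/seteqP; split=> t /=; rewrite !in_itv/= /phi;
    by rewrite ltr_ndivlMr// ler_ndivrMr// ltrBlDr lerBrDr mulrC andbC.
rewrite lebesgue_measure_itv/= !lte_fin ltr_nM2r ?invr_lt0//.
rewrite ltrD2r; case: ifP => ab; rewrite ?mule0// -!EFinD -EFinM.
by congr EFin; rewrite ltr0_norm//; field; rewrite lt_eqF.
Qed.

Lemma ge0_integral_affine (c e : R) (f : R -> \bar R) : c != 0 ->
  measurable_fun setT f -> (forall x, 0 <= f x)%E ->
  (\int[mu]_x f x = `|c|%:E * \int[mu]_x f (c * x + e)%R)%E.
Proof.
move=> c0 mf f0.
pose phi (t : measurableTypeR R) : measurableTypeR R := c * t + e.
have mphi : measurable_fun setT phi := measurable_affine c e.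
pose nu_ := mscale (NngNum (normr_ge0 c)) (pushforward mu phi).
pose nu := nu_ mphi.
transitivity (\int[nu]_x f x)%E.
  apply: eq_measure_integral => A mA _.
  by rewrite -[LHS](lebesgue_measure_affine e c0 mA).
rewrite ge0_integral_mscale//=.
by rewrite (ge0_integral_pushforward mphi)// preimage_setT.
Qed.

Local Notation line := (measurableTypeR R).
Local Notation plane := (measurableTypeR R * measurableTypeR R)%type.

Lemma measurable_linear2 (a1 a2 b1 b2 : R) :
  measurable_fun (setT : set plane)
    (fun z : plane => (z.1 * a1 + z.2 * b1, z.1 * a2 + z.2 * b2) : plane).
Proof.
by apply: measurable_fun_pair => //=; apply: measurable_funD;
  apply: measurable_funM.
Qed.

(* Two affine substitutions in one variable each, with Tonelli in between. *)
Let linear_change_aux (a1 a2 b1 b2 : R) (f : plane -> \bar R) :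
  a1 != 0 -> a1 * b2 - a2 * b1 != 0 ->
  measurable_fun (setT : set plane) f -> (forall x, 0 <= f x)%E ->
  (\int[mu]_x \int[mu]_y f (x, y) = `|a1 * b2 - a2 * b1|%:E *
     \int[mu]_t \int[mu]_r f (r * a1 + t * b1, r * a2 + t * b2)%R)%E.
Proof.
move=> a10 D0 mf f0; set D := a1 * b2 - a2 * b1 in D0 *.
have Da0 : D / a1 != 0 by rewrite mulf_neq0// invr_eq0.
pose g (z : plane) := f (z.1 * 1 + z.2 * 0, z.1 * (a2 / a1) + z.2 * (D / a1)).
pose h (z : plane) := f (z.1 * a1 + z.2 * b1, z.1 * a2 + z.2 * b2).
have mg : measurable_fun setT g.
  exact: measurableT_comp mf (measurable_linear2 _ _ _ _).
have mh : measurable_fun setT h.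
  exact: measurableT_comp mf (measurable_linear2 _ _ _ _).
have g0 z : (0 <= g z)%E by exact: f0.
have h0 z : (0 <= h z)%E by exact: f0.
transitivity (\int[mu]_x (`|D / a1|%:E * \int[mu]_y g (x, y)))%E.
  apply: eq_integral => x _.
  rewrite (@ge0_integral_affine (D / a1) (a2 / a1 * x) (fun y => f (x, y)) Da0
    (measurableT_comp mf (pair1_measurable x)) (fun y => f0 _)).
  congr (_ * _)%E; apply: eq_integral => y _; rewrite /g/=.
  by congr (f (_, _)); ring.
have -> := ge0_integralZl_EFin mu measurableT
  (fun x _ => integral_ge0 _ (fun y _ => g0 (x, y)))
  (@measurable_fun_fubini_tonelli_F _ _ line line R mu g mg g0)
  (normr_ge0 (D / a1)).
rewrite (@fubini_tonelli _ _ line line R mu mu g mg g0).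
transitivity (`|D / a1|%:E * \int[mu]_y (`|a1|%:E * \int[mu]_x h (x, y)))%E.
  congr (_ * _)%E; apply: eq_integral => y _.
  rewrite (@ge0_integral_affine a1 (b1 * y) (fun x => g (x, y)) a10
    (measurableT_comp mg (pair2_measurable y)) (fun x => g0 _)).
  congr (_ * _)%E; apply: eq_integral => x _; rewrite /g /h /=.
  by congr (f (_, _)); rewrite /D; field.
have -> := ge0_integralZl_EFin mu measurableT
  (fun y _ => integral_ge0 _ (fun x _ => h0 (x, y)))
  (@measurable_fun_fubini_tonelli_G _ _ line line R mu h mh h0)
  (normr_ge0 a1).
by rewrite muleA -EFinM -normrM divfK.
Qed.

(** The auxiliary form divides by [a1]. If [a1 = 0], the determinant forces [b1 != 0] and the roles
    of the two columns are exchanged. *)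
Lemma ge0_integral_linear2 (a1 a2 b1 b2 : R) (f : plane -> \bar R) :
  a1 * b2 - a2 * b1 != 0 ->
  measurable_fun (setT : set plane) f -> (forall x, 0 <= f x)%E ->
  (\int[leb2]_x f x = `|a1 * b2 - a2 * b1|%:E *
     \int[leb2]_z f (z.1 * a1 + z.2 * b1, z.1 * a2 + z.2 * b2)%R)%E.
Proof.
move=> D0 mf f0.
pose h (z : plane) := f (z.1 * a1 + z.2 * b1, z.1 * a2 + z.2 * b2).
have mh : measurable_fun setT h.
  exact: measurableT_comp mf (measurable_linear2 _ _ _ _).
have h0 z : (0 <= h z)%E by exact: f0.
rewrite /leb2 (@fubini_tonelli1 _ _ line line R mu mu f mf f0).
have [a10|a10] := eqVneq a1 0; last first.
  rewrite -[X in (_ * X)%E]/(\int[mu \x mu]_z h z)%E.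
  rewrite (@fubini_tonelli2 _ _ line line R mu mu h mh h0).
  exact: linear_change_aux.
have b10 : b1 != 0.
  by apply: contraNneq D0 => ->; rewrite a10 mul0r mulr0 subr0.
have D0' : b1 * a2 - b2 * a1 != 0.
  by move: D0; rewrite -oppr_eq0 opprB mulrC [b2 * _]mulrC.
rewrite -[X in (_ * X)%E]/(\int[mu \x mu]_z h z)%E.
rewrite (@fubini_tonelli1 _ _ line line R mu mu h mh h0).
rewrite /fubini_F (linear_change_aux b10 D0' mf f0).
have -> : b1 * a2 - b2 * a1 = - (a1 * b2 - a2 * b1) by ring.
rewrite normrN; congr (_ * _)%E; apply: eq_integral => t _.
apply: eq_integral => r _ /=.
by rewrite /h /= addrC [r * b2 + _]addrC.
Qed.

End plane_measure.

(** * Smooth functions and cutoffs *)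

Section smooth_functions.
Context {R : realType}.
Implicit Types (F G : R * R -> R) (x v : R * R).

Lemma is_derive_cvg (V : normedModType R) (f : V -> R) (a v : V) (l : R) :
  (fun h => h^-1 *: ((f \o shift a) (h *: v) - f a)) @ 0^' --> l ->
  is_derive a v f l.
Proof.
by move=> fl; apply: DeriveDef; [apply/cvg_ex; exists l|exact/cvg_lim].
Qed.

(* The difference quotients at [t] coincide as functions of the increment. *)
Lemma is_derive_line (V W : normedModType R) (f : W -> R) (g : V -> W)
    (a v : V) (w : W) (l : R) :
  (forall h : R, g (h *: v + a) = h *: w + g a) ->
  is_derive (g a) w f l -> is_derive a v (f \o g) l.
Proof.
move=> gE [df <-]; apply: is_derive_cvg.
rewrite (_ : (fun _ => _) =
  (fun h => h^-1 *: ((f \o shift (g a)) (h *: w) - f (g a)))); first exact: df.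
by apply/funext => h /=; rewrite gE.
Qed.

Lemma eq_Ck n F G : F =1 G -> Ck n F -> Ck n G.
Proof. by move=> /funext ->. Qed.

Lemma CkW n F : Ck n.+1 F -> Ck n F.
Proof.
elim: n F => [|n IH] F [cF dF]; split=> //.
by move=> e /dF[? /IH ?].
Qed.

Lemma Ck_partial n F e : e = e1 \/ e = e2 -> Ck n.+1 F ->
  Ck n (fun x => 'D_e F x).
Proof. by move=> ee [_ /(_ _ ee)[]]. Qed.

Lemma Ck_derivable n F e x : e = e1 \/ e = e2 -> Ck n.+1 F -> derivable F x e.
Proof. by move=> ee [_ /(_ _ ee)[]]. Qed.

Lemma smooth_partial F e : e = e1 \/ e = e2 -> smooth F ->
  smooth (fun x => 'D_e F x).
Proof. by move=> ee sF n; apply: Ck_partial. Qed.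

Let MVT_any (f df : R -> R) (a b : R) :
  (forall x : R, is_derive x 1 f (df x)) ->
  exists2 c, `|c - a| <= `|b - a| & f b - f a = df c * (b - a).
Proof.
move=> fdf; have cf : continuous f.
  by move=> x; apply/differentiable_continuous/derivable1_diffP;
    case: (fdf x).
have [ab|ba] := leP a b.
  have [c] := @MVT_segment R f df a b ab (fun (x : R) _ => fdf x)
    (continuous_subspaceT cf).
  rewrite in_itv/= => /andP[ac cb] E; exists c => //.
  by rewrite !ger0_norm ?subr_ge0// lerB.
have [c] := @MVT_segment R f df b a (ltW ba) (fun (x : R) _ => fdf x)
  (continuous_subspaceT cf).
rewrite in_itv/= => /andP[ac cb] E; exists c.
  rewrite !ler0_norm ?subr_le0// ?(ltW ba)// lerN2 lerB//.
by rewrite -opprB E -mulrN opprB.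
Qed.

Let slice1 F (y s : R) : Ck 1 F ->
  is_derive s 1 (fun s => F (s, y)) ('D_e1 F (s, y)).
Proof.
move=> F1; apply: (@is_derive_line _ _ F (fun s => (s, y)) s 1 e1).
  by move=> h; rewrite -[RHS]/(h *: 1 + s, h *: 0 + y) scaler0 add0r.
by apply: DeriveDef => //; apply: Ck_derivable F1; left.
Qed.

Let slice2 F (y s : R) : Ck 1 F ->
  is_derive s 1 (fun s => F (y, s)) ('D_e2 F (y, s)).
Proof.
move=> F1; apply: (@is_derive_line _ _ F (fun s => (y, s)) s 1 e2).
  by move=> h; rewrite -[RHS]/(h *: 0 + y, h *: 1 + s) scaler0 add0r.
by apply: DeriveDef => //; apply: Ck_derivable F1; right.
Qed.

(** [Ck] speaks only of the partials along [e1] and [e2]. Their continuity yields every directional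
    derivative: the increment is split into a vertical and a horizontal leg, with the mean value
    theorem on each. *)
Lemma is_derive_dir F x v : Ck 1 F ->
  is_derive x v F (v.1 * 'D_e1 F x + v.2 * 'D_e2 F x).
Proof.
move=> F1; apply: is_derive_cvg; apply/cvgrPdist_le => /= e e0.
have D1c : continuous (fun x => 'D_e1 F x).
  by have := @Ck_partial 0 F e1 (or_introl erefl) F1; case.
have D2c : continuous (fun x => 'D_e2 F x).
  by have := @Ck_partial 0 F e2 (or_intror erefl) F1; case.
pose e' := e / (1 + `|v.1| + `|v.2|).
have v0 : 0 < 1 + `|v.1| + `|v.2|.
  by have := normr_ge0 v.1; have := normr_ge0 v.2; lra.
have e'0 : 0 < e' by rewrite divr_gt0.
have /cvgrPdist_lt/(_ _ e'0)/nbhs_ballP[d1 /= d10 D1x] := D1c x.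
have /cvgrPdist_lt/(_ _ e'0)/nbhs_ballP[d2 /= d20 D2x] := D2c x.
pose d := Num.min d1 d2 / (1 + `|v.1| + `|v.2|).
have d0 : 0 < d by rewrite divr_gt0// lt_min d10.
near=> h.
have h0 : h != 0 by near: h; exact: nbhs_dnbhs_neq.
have hd : `|h| < d.
  near: h; apply: nbhs_dnbhs; exists d => //= z /=.
  by rewrite sub0r normrN.
have hdv : `|h| * (1 + `|v.1| + `|v.2|) < Num.min d1 d2 by rewrite -ltr_pdivlMr.
have hv1 : `|h * v.1| < Num.min d1 d2.
  apply: le_lt_trans hdv; rewrite normrM ler_wpM2l//.
  by have := normr_ge0 v.2; lra.
have hv2 : `|h * v.2| < Num.min d1 d2.
  apply: le_lt_trans hdv; rewrite normrM ler_wpM2l//.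
  by have := normr_ge0 v.1; lra.
have [c1 c1x E1] := @MVT_any _ _ x.1 (x.1 + h * v.1)
  (fun s => slice1 (x.2 + h * v.2) s F1).
have [c2 c2x E2] := @MVT_any _ _ x.2 (x.2 + h * v.2)
  (fun s => slice2 x.1 s F1).
rewrite /= in E1 E2; rewrite !(addrC x.1) !(addrC x.2) !addrK in c1x c2x E1 E2.
have -> : F (h *: v + x) = F (h * v.1 + x.1, h * v.2 + x.2) by [].
have -> : F (h * v.1 + x.1, h * v.2 + x.2) - F x =
   h * (v.1 * 'D_e1 F (c1, h * v.2 + x.2) + v.2 * 'D_e2 F (x.1, c2)).
  rewrite -[F (h * _ + _, _)](subrK (F (x.1, h * v.2 + x.2))) E1 -addrA.
  by case: x {D1x D2x} E1 E2 c1x c2x => x1 x2 /= E1 E2 c1x c2x; rewrite E2; ring.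
rewrite /= [_ *: _]mulrA mulVf// mul1r.
have B1 : `|'D_e1 F x - 'D_e1 F (c1, h * v.2 + x.2)| < e'.
  apply: D1x; split; rewrite /ball /= distrC.
    by apply: le_lt_trans c1x _; move: hv1; rewrite lt_min => /andP[].
  by rewrite addrK; move: hv2; rewrite lt_min => /andP[].
have B2 : `|'D_e2 F x - 'D_e2 F (x.1, c2)| < e'.
  apply: D2x; split; rewrite /ball /= distrC ?subrr ?normr0//.
  by apply: le_lt_trans c2x _; move: hv2; rewrite lt_min => /andP[].
have -> : forall a b a' b' : R, v.1 * a + v.2 * b - (v.1 * a' + v.2 * b') =
  v.1 * (a - a') + v.2 * (b - b') by move=> *; ring.
apply: (le_trans (ler_normD _ _)); rewrite !normrM.
have : `|v.1| * `|'D_e1 F x - 'D_e1 F (c1, h * v.2 + x.2)| <= `|v.1| * e'.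
  by rewrite ler_wpM2l// ltW.
have : `|v.2| * `|'D_e2 F x - 'D_e2 F (x.1, c2)| <= `|v.2| * e'.
  by rewrite ler_wpM2l// ltW.
have : e = e' * (1 + `|v.1| + `|v.2|) by rewrite /e' divfK// gt_eqF.
have := ltW e'0.
move: `|_ - 'D_e1 F (c1, _)| `|_ - 'D_e2 F (_, c2)| => A B.
by nra.
Unshelve. all: by end_near. Qed.

Lemma Ck_cst n (c : R) : Ck n (fun=> c).
Proof.
elim: n c => [|n IH] c; split=> //; first exact: cst_continuous.
- by move=> ?; exact: cvg_cst.
- move=> e _; split=> [x|]; first exact: derivable_cst.
  apply: (@eq_Ck n (fun=> 0)) => [x|]; last exact: IH.
  by rewrite derive_cst.
Qed.

Lemma CkD n F G : Ck n F -> Ck n G -> Ck n (fun x => F x + G x).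
Proof.
elim: n F G => [|n IH] F G [cF dF] [cG dG]; split=> //.
- by move=> x; apply: cvgD; [exact: cF|exact: cG].
- by move=> x; apply: cvgD; [exact: cF|exact: cG].
move=> e ee; have [dFe CF] := dF _ ee; have [dGe CG] := dG _ ee.
split=> [x|]; first exact: (derivableD (dFe x) (dGe x)).
apply: (@eq_Ck n (fun x => 'D_e F x + 'D_e G x)) => [x|]; last exact: IH.
by rewrite (deriveD (dFe x) (dGe x)).
Qed.

Lemma CkM n F G : Ck n F -> Ck n G -> Ck n (fun x => F x * G x).
Proof.
elim: n F G => [|n IH] F G CF CG; have [cF dF] := CF; have [cG dG] := CG; split=> //.
- by move=> x; apply: cvgM; [exact: cF|exact: cG].
- by move=> x; apply: cvgM; [exact: cF|exact: cG].
move=> e ee; have [dFe CFe] := dF _ ee; have [dGe CGe] := dG _ ee.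
split=> [x|]; first exact: (derivableM (dFe x) (dGe x)).
apply: (@eq_Ck n (fun x => F x * 'D_e G x + G x * 'D_e F x)) => [x|].
  by rewrite (deriveM (dFe x) (dGe x)).
by apply: CkD; apply: IH => //; exact: CkW.
Qed.

Lemma smooth_cst (c : R) : smooth (fun=> c : R).
Proof. by move=> n; exact: Ck_cst. Qed.

Lemma smoothD F G : smooth F -> smooth G -> smooth (fun x => F x + G x).
Proof. by move=> sF sG n; apply: CkD. Qed.

Lemma smoothM F G : smooth F -> smooth G -> smooth (fun x => F x * G x).
Proof. by move=> sF sG n; apply: CkM. Qed.

Lemma smoothZ (c : R) F : smooth F -> smooth (fun x => c * F x).
Proof. by move=> sF; apply: smoothM => //; exact: smooth_cst. Qed.

Lemma smooth_partialM F G e x : e = e1 \/ e = e2 -> smooth F -> smooth G ->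
  'D_e (fun x => F x * G x) x = F x * 'D_e G x + G x * 'D_e F x.
Proof.
move=> ee sF sG.
by rewrite (deriveM (Ck_derivable ee (sF 1%N)) (Ck_derivable ee (sG 1%N))).
Qed.

Lemma smooth_partialD F G e x : e = e1 \/ e = e2 -> smooth F -> smooth G ->
  'D_e (fun x => F x + G x) x = 'D_e F x + 'D_e G x.
Proof.
move=> ee sF sG.
by rewrite (deriveD (Ck_derivable ee (sF 1%N)) (Ck_derivable ee (sG 1%N))).
Qed.

(** One-variable counterpart of [Ck], with the derivative as a witness, so that it can be built by
    induction from [is_derive] facts; [Ck_affine] lifts it to the plane. *)
Fixpoint Cn (n : nat) (f : R -> R) : Prop :=
  continuous f /\
  if n is m.+1 then exists2 df, forall x : R, is_derive x 1 f (df x) & Cn m df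
  else True.

Lemma is_derive_affine (f : R -> R) (df p q c : R) x v :
  is_derive (p * x.1 + q * x.2 + c) 1 f df ->
  is_derive x v (fun x => f (p * x.1 + q * x.2 + c)) (df * (p * v.1 + q * v.2)).
Proof.
move=> [fd <-].
apply: (@is_derive_line _ _ f (fun x => p * x.1 + q * x.2 + c) x v
  (p * v.1 + q * v.2)).
  move=> h; change (p * (h * v.1 + x.1) + q * (h * v.2 + x.2) + c =
    h * (p * v.1 + q * v.2) + (p * x.1 + q * x.2 + c)); ring.
move/derivable1_diffP in fd.
apply: DeriveDef; first exact: diff_derivable.
rewrite !deriveE// [RHS]mulrC.
have -> : p * v.1 + q * v.2 = (p * v.1 + q * v.2) *: (1 : R) by rewrite [RHS]mulr1.
by rewrite linearZ/= [X in _ = X * _]mulr1.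
Qed.

Lemma Ck_affine n (f : R -> R) (p q c : R) : Cn n f ->
  Ck n (fun x => f (p * x.1 + q * x.2 + c)).
Proof.
have caff (g : R -> R) : continuous g ->
    continuous (fun x : R * R => g (p * x.1 + q * x.2 + c)).
  move=> cg x; apply: (@continuous_comp _ _ _
    (fun x : R * R => p * x.1 + q * x.2 + c) g); last exact: cg.
  apply: cvgD; last exact: cvg_cst.
  by apply: cvgD; apply: cvgM; try exact: cvg_cst; [exact: cvg_fst|exact: cvg_snd].
elim: n f => [|n IH] f [cf df]; split=> //; [exact: caff|exact: caff|].
have {df} [df fdf Cdf] := df.
move=> e _; split=> [x|].
  by case: (is_derive_affine e (fdf (p * x.1 + q * x.2 + c))).
apply: (@eq_Ck n (fun x => df (p * x.1 + q * x.2 + c) * (p * e.1 + q * e.2))).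
  by move=> x; case: (is_derive_affine e (fdf (p * x.1 + q * x.2 + c))).
by apply: CkM; [exact: IH|exact: Ck_cst].
Qed.

End smooth_functions.

(** * Flat exponentials and bump functions *)

Section bump_functions.
Context {R : realType}.

(** The functions [t^-m exp (- 1 / t)], extended by 0. Derivatives of members of the family are
    linear combinations of members, which makes smoothness a plain induction. *)
Definition flat_exp (m : nat) (t : R) : R :=
  if 0 < t then t^-1 ^+ m * expR (- t^-1) else 0.

Lemma flat_exp_ge0 m t : 0 <= flat_exp m t.
Proof.
rewrite /flat_exp; case: ifP => // t0.
by rewrite mulr_ge0 ?expR_ge0// exprn_ge0// invr_ge0 ltW.
Qed.

Lemma flat_exp_gt0 m t : 0 < t -> 0 < flat_exp m t.
Proof.
by move=> t0; rewrite /flat_exp t0 mulr_gt0 ?expR_gt0// exprn_gt0// invr_gt0.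
Qed.

Lemma flat_exp_le0 m t : t <= 0 -> flat_exp m t = 0.
Proof. by rewrite /flat_exp ltNge => ->. Qed.

Lemma flat_exp_le1 t : flat_exp 0 t <= 1.
Proof.
rewrite /flat_exp; case: ifP => // t0; rewrite expr0 mul1r -expR0 ler_expR.
by rewrite oppr_le0 invr_ge0 ltW.
Qed.

(** With [y = 1 / t], this is [exp y >= y^(m+1) / (m+1)!]. *)
Lemma flat_exp_lin m t : flat_exp m t <= (m.+1)`!%:R * `|t|.
Proof.
rewrite /flat_exp; case: ifP => [t0|_]; last by rewrite mulr_ge0.
rewrite gtr0_norm//; have s0 : 0 < t^-1 by rewrite invr_gt0.
have := expR_ge1Dxn m (ltW s0) => ge.
have fac0 : 0 < (m.+1)`!%:R :> R by rewrite ltr0n fact_gt0.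
rewrite expRN ler_pdivrMr ?expR_gt0//.
apply: (@le_trans _ _ ((m.+1)`!%:R * t * (t^-1 ^+ m.+1 / (m.+1)`!%:R))).
  rewrite exprS le_eqVlt; apply/orP; left; apply/eqP.
  by field; rewrite !gt_eqF.
rewrite ler_wpM2l ?mulr_ge0 ?ltW//.
by apply: lt_le_trans ge; rewrite ltrDr.
Qed.

Lemma is_derive_expN (t : R) : is_derive t 1 (fun s => expR (- s)) (- expR (- t)).
Proof.
have dN : is_derive t 1 (-%R : R -> R) (-1).
  exact: (@is_deriveN _ _ _ id t 1 1 (is_derive_id _ _)).
apply: is_derive_eq (is_derive1_comp (is_derive_expR (- t)) dN) _.
by rewrite mulrN1.
Qed.

(** The delicate point is 0: there the difference quotient of [flat_exp m] is [flat_exp m.+1], which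
    is [O (|h|)] by [flat_exp_lin]. *)
Lemma is_derive_flat_exp m (t : R) :
  is_derive t 1 (flat_exp m) (flat_exp m.+2 t - m%:R * flat_exp m.+1 t).
Proof.
have [t0|t0|t0] := ltgtP t 0.
- rewrite !(flat_exp_le0 _ (ltW t0)) mulr0 subr0.
  apply: (near_eq_is_derive (f := cst 0)) => //.
  by near=> z; rewrite flat_exp_le0// ltW//; near: z; exact: lt_nbhsl.
- pose g (s : R) := s ^+ m * expR (- s).
  have dg (s : R) : is_derive s 1 g
      (m%:R * s ^+ m.-1 * expR (- s) - s ^+ m * expR (- s)).
    have dX : is_derive s 1 (fun x : R => x ^+ m) (m%:R * s ^+ m.-1).
      have := @is_deriveX _ _ id m s 1 1 (is_derive_id _ _).
      by rewrite exprfctE [_ *: 1]mulr1.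
    apply: is_derive_eq (is_deriveM dX (is_derive_expN s)) _.
    rewrite -![_ *: _]/(_ * _); ring.
  have dV : is_derive t 1 (fun z : R => z^-1) (- t ^- 2).
    apply: is_derive_eq (is_deriveV _ (is_derive_id t 1)) _.
      by rewrite gt_eqF.
    by rewrite [LHS]mulr1.
  apply: (@near_eq_is_derive _ _ _ (g \o (fun z : R => z^-1))).
    near=> z; rewrite /g /flat_exp /= ifT//.
    by near: z; exact: lt_nbhsr.
  apply: is_derive_eq (is_derive1_comp (dg _) dV) _.
  rewrite /flat_exp t0 !exprS; case: m {g dg} => [|m] /=.
    by rewrite !expr0; field; rewrite gt_eqF.
  by rewrite !exprS; field; rewrite gt_eqF.
- rewrite t0 !(flat_exp_le0 _ (lexx _)) mulr0 subr0.
  apply: is_derive_cvg; apply/cvgrPdist_le => /= e e0.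
  pose C : R := (m.+2)`!%:R.
  have C0 : 0 < C by rewrite ltr0n fact_gt0.
  near=> h.
  have he : `|h| <= e / C.
    near: h; apply: nbhs_dnbhs; apply/nbhs_ballP; exists (e / C).
      exact: divr_gt0.
    by move=> z; rewrite /ball /= sub0r normrN => /ltW.
  rewrite sub0r normrN addr0 [h *: 1]mulr1 (flat_exp_le0 _ (lexx _)) subr0.
  rewrite (_ : h^-1 *: _ = flat_exp m.+1 h).
    rewrite ger0_norm ?flat_exp_ge0// (le_trans (flat_exp_lin _ _))//.
    by rewrite mulrC -ler_pdivlMr.
  rewrite /flat_exp; case: ifP => // _; last exact: mulr0.
  by rewrite exprS -mulrA.
Unshelve. all: by end_near. Qed.

Lemma Cn_lin n (f g : R -> R) (c : R) :
  Cn n f -> Cn n g -> Cn n (fun x => f x + c * g x).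
Proof.
elim: n f g => [|n IH] f g [cf df] [cg dg]; split=> //.
- by move=> x; apply: cvgD; [exact: cf|apply: cvgM; [exact: cvg_cst|exact: cg]].
- by move=> x; apply: cvgD; [exact: cf|apply: cvgM; [exact: cvg_cst|exact: cg]].
have [df' fd Cdf] := df; have [dg' gd Cdg] := dg.
exists (fun x => df' x + c * dg' x) => [x|]; last exact: IH.
exact: (is_deriveD (fd x) (is_deriveZ c (gd x))).
Qed.

Lemma is_derive_cont (f df : R -> R) :
  (forall x : R, is_derive x 1 f (df x)) -> continuous f.
Proof.
by move=> fd x; apply/differentiable_continuous/derivable1_diffP; case: (fd x).
Qed.

Lemma Cn_flat_exp n m : Cn n (flat_exp m).
Proof.
elim: n m => [|n IH] m; split=> //; try exact: is_derive_cont (is_derive_flat_exp m).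
exists (fun t => flat_exp m.+2 t + - m%:R * flat_exp m.+1 t).
  by move=> x; apply: is_derive_eq (is_derive_flat_exp m x) _; rewrite mulNr.
exact: Cn_lin.
Qed.

Lemma Cn_expR n : Cn n (@expR R).
Proof.
elim: n => [|n IH]; split=> //; try exact: continuous_expR.
exists expR => // x; exact: is_derive_expR.
Qed.

Lemma Cn_cos_sin n (c s : R) : Cn n (fun x => c * cos x + s * sin x).
Proof.
have dcs : forall (c s x : R), is_derive x 1 (fun x : R => c * cos x + s * sin x)
    (s * cos x + (- c) * sin x).
  move=> {}c {}s x.
  apply: is_derive_eq (is_deriveD (is_deriveZ c (is_derive_cos x))
    (is_deriveZ s (is_derive_sin x))) _.
  by rewrite -![_ *: _]/(_ * _); ring.
elim: n c s => [|n IH] c s; split=> //; try exact: is_derive_cont (dcs c s).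
by exists (fun x => s * cos x + (- c) * sin x).
Qed.

Lemma Cn_cos n : Cn n (@cos R).
Proof.
rewrite (_ : cos = (fun x => 1 * cos x + 0 * sin x)); first exact: Cn_cos_sin.
by apply/funext => x; rewrite mul1r mul0r addr0.
Qed.

Lemma Cn_sin n : Cn n (@sin R).
Proof.
rewrite (_ : sin = (fun x => 0 * cos x + 1 * sin x)); first exact: Cn_cos_sin.
by apply/funext => x; rewrite mul1r mul0r add0r.
Qed.

(** A product of one-variable factors, so that smoothness comes from [Ck_affine]. It is not constant
    near the vertex; the terms with its derivatives are kept and treated as L^2 data. *)
Definition square_bump (dl : R) (x : R * R) : R :=
  flat_exp 0 (dl - x.1) * flat_exp 0 (dl + x.1) *
  (flat_exp 0 (dl - x.2) * flat_exp 0 (dl + x.2)).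

Lemma square_bump_smooth dl : smooth (square_bump dl).
Proof.
have aff p q : smooth (fun x : R * R => flat_exp 0 (p * x.1 + q * x.2 + dl)).
  by move=> n; apply: Ck_affine; exact: Cn_flat_exp.
have := smoothM (smoothM (aff (-1) 0) (aff 1 0)) (smoothM (aff 0 (-1)) (aff 0 1)).
congr smooth; apply/funext => x; rewrite /square_bump.
by congr (flat_exp 0 _ * flat_exp 0 _ * (flat_exp 0 _ * flat_exp 0 _)); ring.
Qed.

Lemma square_bump_ge0 dl x : 0 <= square_bump dl x.
Proof. by rewrite !mulr_ge0 ?flat_exp_ge0. Qed.

Lemma square_bump_le1 dl x : square_bump dl x <= 1.
Proof.
have H (a b : R) : 0 <= a <= 1 -> 0 <= b <= 1 -> 0 <= a * b <= 1.
  by move=> /andP[? ?] /andP[? ?]; apply/andP; split; nra.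
have E t : 0 <= flat_exp 0 t <= 1 by rewrite flat_exp_ge0 flat_exp_le1.
by have /andP[] := H _ _ (H _ _ (E (dl - x.1)) (E (dl + x.1)))
  (H _ _ (E (dl - x.2)) (E (dl + x.2))).
Qed.

Lemma square_bump_gt0 dl : 0 < dl -> 0 < square_bump dl 0.
Proof.
by move=> dl0; rewrite /square_bump /= !subr0 !addr0 !mulr_gt0 ?flat_exp_gt0.
Qed.

Definition in_square (dl : R) (x : R * R) := `|x.1| <= dl /\ `|x.2| <= dl.

Definition square_supported (dl : R) (F : R * R -> R) :=
  forall x, F x != 0 -> in_square dl x.

Lemma square_bump_supported dl : square_supported dl (square_bump dl).
Proof.
move=> x; rewrite /square_bump !mulf_eq0 !negb_or => /andP[/andP[a b] /andP[c d]].
have pos t : flat_exp 0 t != 0 -> 0 <= t.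
  by apply: contraNT; rewrite -ltNge => /ltW/(flat_exp_le0 0) ->.
move: a b c d => /pos a /pos b /pos c /pos d.
by split; rewrite ler_norml; apply/andP; split; lra.
Qed.

End bump_functions.

(** * The wedge in the coordinates of its sides *)

Section wedge.
Context {R : realType}.
Local Notation mu := (@lebesgue_measure R).
Local Notation line := (measurableTypeR R).
Local Notation plane := (measurableTypeR R * measurableTypeR R)%type.

Lemma continuous_linear2 (F : R * R -> R) (a b : R * R) (r : R) :
  continuous F ->
  continuous (fun t : R => F (r * a.1 + t * b.1, r * a.2 + t * b.2)).
Proof.
move=> cF t; apply: (@continuous_comp _ _ _
  (fun t : R => (r * a.1 + t * b.1, r * a.2 + t * b.2)) F); last exact: cF.
have c (p q : R) : (fun t : R => r * p + t * q) @ t --> r * p + t * q.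
  by apply: cvgD; [exact: cvg_cst|apply: cvgM => //; exact: cvg_cst].
exact: (cvg_pair (c a.1 b.1) (c a.2 b.2)).
Qed.

Lemma open_posf (f : R * R -> R) : continuous f -> open [set x | 0 < f x].
Proof.
move=> cf; rewrite -[X in open X]/(f @^-1` [set y | 0 < y]).
by apply: open_comp => [x _|]; [exact: cf|exact: open_gt].
Qed.

Lemma FTC_halfline (f df : R -> R) (T : R) :
  (forall t : R, is_derive t 1 f (df t)) -> continuous df ->
  (forall t, T <= t -> f t = 0) ->
  (\int[mu]_(t in `]0%R, +oo[) (df t)%:E = (- f 0)%:E)%E.
Proof.
move=> fd cdf f0; pose T' := Num.max T 0 + 1.
(* [T'] is positive, to give a nondegenerate interval, and strictly beyond [T], where [f] vanishes
   on a whole neighbourhood and so does [df]. *)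
have T'0 : 0 < T' by rewrite ltr_wpDl// le_max lexx orbT.
have TT' : T < T' by rewrite ltr_pwDr// le_max lexx.
have df0 t : T < t -> df t = 0.
  move=> Tt; have : is_derive t 1 f 0.
    apply: (near_eq_is_derive (f := cst 0)) => //.
    by near=> z; rewrite f0// ltW//; near: z; exact: lt_nbhsr.
  by case=> _; case: (fd t) => _ ->.
have cf := is_derive_cont fd.
transitivity (\int[mu]_(t in `]0%R, T']) (df t)%:E)%E.
  rewrite integral_mkcond [RHS]integral_mkcond; apply: eq_integral => t _.
  rewrite /patch !mem_setE !in_itv/= andbT; case: (ltP 0 t) => //= t0.
  by case: leP => // T't; rewrite df0// (lt_trans TT').
rewrite integral_itv_obnd_cbnd; last first.
  apply/measurable_EFinP; apply: (@measurable_funTS _ _ _ _ _ df).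
  exact: continuous_measurable_fun.
rewrite (continuous_FTC2 T'0 (F := f)).
- by rewrite f0 ?sub0e// ltW.
- exact: continuous_subspaceT.
- split.
  + by move=> x _; case: (fd x).
  + by apply: cvg_at_right_filter; exact: cf.
  + by apply: cvg_at_left_filter; exact: cf.
- by move=> x _; rewrite derive1E; case: (fd x) => _ ->.
Unshelve. all: by end_near. Qed.

Variables (a b : R * R).
Hypothesis D0 : 0 < a.1 * b.2 - a.2 * b.1.
Let D := a.1 * b.2 - a.2 * b.1.

(** The open cone of positive combinations of [a] and [b], given by two linear inequalities so that
    openness and measurability are immediate. *)
Definition wedge : set (R * R) :=
  [set x | 0 < a.1 * x.2 - a.2 * x.1 /\ 0 < x.1 * b.2 - x.2 * b.1].

Definition wpt (r t : R) : R * R := (r * a.1 + t * b.1, r * a.2 + t * b.2).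

Lemma wedge_wpt r t : wedge (wpt r t) <-> 0 < r /\ 0 < t.
Proof.
rewrite /wedge /wpt /=.
have -> : a.1 * (r * a.2 + t * b.2) - a.2 * (r * a.1 + t * b.1) = t * D.
  by rewrite /D; ring.
have -> : (r * a.1 + t * b.1) * b.2 - (r * a.2 + t * b.2) * b.1 = r * D.
  by rewrite /D; ring.
by rewrite !pmulr_lgt0//; split=> -[].
Qed.

Lemma wptE x : x = wpt ((x.1 * b.2 - x.2 * b.1) / D) ((a.1 * x.2 - a.2 * x.1) / D).
Proof.
by case: x => x y; rewrite /wpt /D /=; congr pair; field; rewrite gt_eqF.
Qed.

Lemma measurable_wedge : measurable (wedge : set plane).
Proof.
have -> : wedge = [set x | 0 < a.1 * x.2 - a.2 * x.1] `&`
    [set x | 0 < x.1 * b.2 - x.2 * b.1] by [].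
by apply: measurableI; apply: open_measurable2; apply: open_posf => x;
  apply: cvgB; apply: cvgM; do ?[exact: cvg_cst|exact: cvg_fst|exact: cvg_snd].
Qed.

Let iterated_patch (f : plane -> \bar R) :
  (\int[mu]_r \int[mu]_t (f \_ wedge) (wpt r t) =
    \int[mu]_(r in `]0%R, +oo[) \int[mu]_(t in `]0%R, +oo[) f (wpt r t))%E /\
  (\int[mu]_t \int[mu]_r (f \_ wedge) (wpt r t) =
    \int[mu]_(t in `]0%R, +oo[) \int[mu]_(r in `]0%R, +oo[) f (wpt r t))%E.
Proof.
split; rewrite [RHS]integral_mkcond; apply: eq_integral => r _;
  rewrite [in RHS]/patch mem_setE in_itv/= andbT; case: ltP => r0.
- rewrite [RHS]integral_mkcond; apply: eq_integral => t _.
  rewrite /patch mem_setE in_itv/= andbT; case: ltP => t0.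
    by rewrite mem_set//; exact/wedge_wpt.
  by rewrite memNset// => /wedge_wpt[_]; rewrite ltNge t0.
- apply: integral0_eq => t _; rewrite /patch memNset// => /wedge_wpt[].
  by rewrite ltNge r0.
- rewrite [RHS]integral_mkcond; apply: eq_integral => t _.
  rewrite /patch mem_setE in_itv/= andbT; case: ltP => t0.
    by rewrite mem_set//; exact/wedge_wpt.
  by rewrite memNset// => /wedge_wpt[]; rewrite ltNge t0.
- apply: integral0_eq => t _; rewrite /patch memNset// => /wedge_wpt[_].
  by rewrite ltNge r0.
Qed.

(** Both orders of integration are recorded: [t] innermost reaches the side along [a], [r] innermost
    the side along [b]. *)
Lemma ge0_integral_wedge (f : plane -> \bar R) :
  measurable_fun (wedge : set plane) f -> (forall x, 0 <= f x)%E ->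
  (\int[leb2]_(x in wedge) f x = D%:E *
     \int[mu]_(r in `]0%R, +oo[) \int[mu]_(t in `]0%R, +oo[) f (wpt r t))%E /\
  (\int[leb2]_(x in wedge) f x = D%:E *
     \int[mu]_(t in `]0%R, +oo[) \int[mu]_(r in `]0%R, +oo[) f (wpt r t))%E.
Proof.
move=> mf f0; rewrite integral_mkcond.
have mfw : measurable_fun setT (f \_ wedge).
  by apply/(measurable_restrictT _ _).1 => //; exact: measurable_wedge.
have f0w x : (0 <= (f \_ wedge) x)%E by apply: erestrict_ge0.
rewrite (@ge0_integral_linear2 _ a.1 a.2 b.1 b.2)// ?gt_eqF//.
pose h (z : plane) := (f \_ wedge) (z.1 * a.1 + z.2 * b.1, z.1 * a.2 + z.2 * b.2).
have mh : measurable_fun setT h.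
  exact: measurableT_comp mfw (measurable_linear2 _ _ _ _).
have [pr pt] := iterated_patch f.
rewrite gtr0_norm//; split; congr (_ * _)%E;
  rewrite -[LHS]/(\int[mu \x mu]_z h z)%E.
- by rewrite -pr (@fubini_tonelli1 _ _ line line R mu mu h mh (fun z => f0w _)).
- by rewrite -pt (@fubini_tonelli2 _ _ line line R mu mu h mh (fun z => f0w _)).
Qed.

Lemma integral_wedge (f : plane -> R) :
  rintegrable leb2 wedge f ->
  (\int[leb2]_(x in wedge) (f x)%:E = D%:E *
    \int[mu]_(r in `]0%R, +oo[) \int[mu]_(t in `]0%R, +oo[) (f (wpt r t))%:E)%E /\
  (\int[leb2]_(x in wedge) (f x)%:E = D%:E *
    \int[mu]_(t in `]0%R, +oo[) \int[mu]_(r in `]0%R, +oo[) (f (wpt r t))%:E)%E.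
Proof.
move=> fi; have mW := measurable_wedge.
pose g := (EFin \o f) \_ wedge.
have gi : leb2.-integrable setT g := (integrable_mkcond _ mW).1 fi.
have [mg gfin] := integrableP _ _ _ gi.
pose h (z : plane) := g (z.1 * a.1 + z.2 * b.1, z.1 * a.2 + z.2 * b.2).
have mh : measurable_fun setT h.
  exact: measurableT_comp mg (measurable_linear2 _ _ _ _).
have Dn : a.1 * b.2 - a.2 * b.1 != 0 by rewrite gt_eqF.
have chg (p : plane -> \bar R) : measurable_fun setT p -> (forall x, 0 <= p x)%E ->
  (\int[leb2]_x p x = D%:E *
    \int[leb2]_z p (z.1 * a.1 + z.2 * b.1, z.1 * a.2 + z.2 * b.2)%R)%E.
  by move=> mp p0; rewrite (ge0_integral_linear2 Dn mp p0) gtr0_norm.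
have hi : (mu \x mu)%E.-integrable setT h.
  apply/integrableP; split=> //.
  have aux (X : \bar R) : (0 <= X)%E -> (D%:E * X < +oo)%E -> (X < +oo)%E.
    by case: X => [r| |] X0; rewrite ?ltry// gt0_muley ?lte_fin.
  apply: aux; first exact: integral_ge0.
  have := gfin; rewrite (chg (fun x => `|g x|%E)) //; exact: measurableT_comp.
rewrite integral_mkcond -/g integralE.
rewrite (chg g^\+%E)//; last exact: measurable_funepos.
rewrite (chg g^\-%E)//; last exact: measurable_funeneg.
have posE : (fun z : plane => g^\+%E (z.1 * a.1 + z.2 * b.1, z.1 * a.2 + z.2 * b.2)) =
  h^\+%E by apply/funext => z; rewrite !funeposE.
have negE : (fun z : plane => g^\-%E (z.1 * a.1 + z.2 * b.1, z.1 * a.2 + z.2 * b.2)) =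
  h^\-%E by apply/funext => z; rewrite !funenegE.
rewrite posE negE -muleBr//; last first.
  apply: fin_num_adde_defl; rewrite fin_numN.
  exact: (integrable_neg_fin_num measurableT hi).
have [pr pt] := iterated_patch (EFin \o f).
have -> : (\int[leb2]_z h^\+ z - \int[leb2]_z h^\- z)%E = (\int[mu \x mu]_z h z)%E.
  by rewrite [RHS]integralE.
split; congr (_ * _)%E.
- by rewrite -[RHS]pr -(@integral12_prod_meas1 _ _ line line R mu mu h hi).
- by rewrite -[RHS]pt -(@integral21_prod_meas1 _ _ line line R mu mu h hi).
Qed.

End wedge.

(** * Integrals against set functions that are not measures *)

Section integral_set_function.
Context d (T : measurableType d) (R : realType).
Implicit Types (D E : set T) (f g : T -> \bar R).
Local Open Scope ereal_scope.

Import HBNNSimple.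

Let sintegral_npos (mu : set T -> \bar R) (h : {nnsfun T >-> R}) :
  mu set0 = 0 -> (forall x, (h x <= 0)%R) -> sintegral mu h = 0.
Proof.
move=> mu0 h0; rewrite /sintegral fsbig1// => x _.
have [->|x0] := eqVneq x 0%R; first by rewrite mul0e.
rewrite (_ : _ @^-1` _ = set0) ?mu0 ?mule0//.
apply/seteqP; split=> // t /= htx; move: x0; rewrite -htx => /eqP; apply.
by apply/eqP; rewrite eq_le h0 fun_ge0.
Qed.

(* For a set function that need not be a measure, the integral of a
   nonnegative function is still a supremum over simple functions. *)
Lemma ge0_integralE_set (mu : set T -> \bar R) D f : mu set0 = 0 ->
  (forall x, D x -> 0 <= f x) ->
  integral mu D f = ereal_sup [set sintegral mu h | h in
    [set h : {nnsfun T >-> R} | forall x, (h x)%:E <= (f \_ D) x]].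
Proof.
move=> mu0 f0; have fD0 x : 0 <= (f \_ D) x by apply: erestrict_ge0.
rewrite /integral (_ : (f \_ D)^\+ = f \_ D); last first.
  by apply/funext => x; rewrite funeposE; apply/max_idPl.
rewrite (_ : (f \_ D)^\- = cst 0); last first.
  by apply/funext => x; rewrite funenegE; apply/max_idPr; rewrite leeNl oppe0.
rewrite [X in _ - X](_ : _ = 0) ?sube0//.
apply/eqP; rewrite eq_le; apply/andP; split.
  apply/ge_ereal_sup => _ [h /= h0 <-].
  by rewrite sintegral_npos// => x; have := h0 x; rewrite lee_fin.
apply: ereal_sup_ubound; exists (@nnsfun0 _ T R); first by move=> x.
by rewrite sintegral_npos.
Qed.

(** By the description as a supremum: a simple function below [f] on [D] is also below [g] on [E].
    This works for functions and set functions without measurability or additivity. *)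
Lemma ge0_le_integral_set (mu : set T -> \bar R) D E f g : mu set0 = 0 ->
  (forall x, D x -> 0 <= f x) -> (forall x, E x -> 0 <= g x) ->
  (forall x, D x -> f x <= (g \_ E) x) ->
  integral mu D f <= integral mu E g.
Proof.
move=> mu0 f0 g0 fg; rewrite !ge0_integralE_set//.
apply: le_ereal_sup => _ [h /= hf <-]; exists h => // x /=.
apply: (le_trans (hf x)).
have [Dx|Dx] := pselect (D x); first by rewrite {1}/patch mem_set//; exact: fg.
by rewrite {1}/patch memNset//; exact: erestrict_ge0.
Qed.

Let eq_set_integral0 (m1 m2 : set T -> \bar R) D f :
  m1 set0 = 0 -> m2 set0 = 0 ->
  (forall A, measurable A -> A `<=` D -> m1 A = m2 A) ->
  [set sintegral m1 h | h in
    [set h : {nnsfun T >-> R} | (forall x, (h x)%:E <= (f \_ D) x)]] `<=`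
  [set sintegral m2 h | h in
    [set h : {nnsfun T >-> R} | (forall x, (h x)%:E <= (f \_ D) x)]].
Proof.
move=> m10 m20 m12 _ [h hfD <-] /=; exists h => //; apply: eq_fsbigr => r _.
have [hrD|hrD] := pselect (h @^-1` [set r] `<=` D); first by rewrite m12.
suff : r = 0%R by move=> ->; rewrite !mul0e.
apply: contra_notP hrD => /eqP r0 t/= htr.
have := hfD t.
rewrite /patch/=; case: ifPn; first by rewrite inE.
move=> tD; move: r0; rewrite -htr => ht0.
by rewrite le_eqVlt eqe (negbTE ht0)/= lte_fin// ltNge// fun_ge0.
Qed.

(** The nonzero level sets of a nonnegative simple function below a restriction to [D] lie in [D].
    This is how [hausdorff1] gets replaced by a pushforward of Lebesgue measure. *)
Lemma eq_set_integral (m1 m2 : set T -> \bar R) D f :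
  m1 set0 = 0 -> m2 set0 = 0 ->
  (forall A, measurable A -> A `<=` D -> m1 A = m2 A) ->
  integral m1 D f = integral m2 D f.
Proof.
move=> m10 m20 m12; rewrite /integral funepos_restrict funeneg_restrict.
by congr (ereal_sup _ - ereal_sup _); rewrite eqEsubset; split;
  apply: eq_set_integral0 => // A /m12 // /[apply].
Qed.

End integral_set_function.

(** * Green's identity near a corner *)

Section corner_domain.
Context {R : realType}.
Local Notation mu := (@lebesgue_measure R).
Local Notation plane := (measurableTypeR R * measurableTypeR R)%type.
(** [W] stands for the truncated sector. It lies between the wedge and the part of the wedge in the
    square of half-side [dl], so a function supported in that square does not see the truncation.
    From [rho] on, both rays have left the square. *)
Variables (a b : R * R) (W : set (R * R)) (dl bd rho : R).
Hypothesis D0 : 0 < a.1 * b.2 - a.2 * b.1.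
Hypothesis mW : measurable (W : set plane).
Hypothesis W_wedge : W `<=` wedge a b.
Hypothesis wedge_W : wedge a b `&` in_square dl `<=` W.
Hypothesis W_bounded : W `<=` in_square bd.
Hypothesis rho_a : forall r, rho <= r -> ~ in_square dl (r * a.1, r * a.2).
Hypothesis rho_b : forall r, rho <= r -> ~ in_square dl (r * b.1, r * b.2).
Let D := a.1 * b.2 - a.2 * b.1.

Lemma leb2_W_fin : (leb2 W < +oo)%E.
Proof.
apply: (@le_lt_trans _ _ (leb2 (`[- bd, bd]%classic `*` `[- bd, bd]%classic : set plane))).
  apply: le_measure; rewrite ?inE//; first by apply: measurableX.
  move=> x /W_bounded[]; rewrite !ler_norml => /andP[? ?] /andP[? ?].
  by split; rewrite /= in_itv/=; apply/andP.
rewrite [X in (X < _)%E]product_measure1E//= !lebesgue_measure_itv/=.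
by case: ifP => _; rewrite ?mul0e ?ltry// -!EFinD -EFinM ltry.
Qed.

Lemma square_compact (c : R) : compact (in_square c : set (R * R)).
Proof.
rewrite (_ : in_square c = `[- c, c]%classic `*` `[- c, c]%classic).
  by apply: compact_setX; exact: segment_compact.
by apply/seteqP; split=> x; rewrite /in_square /= !in_itv/= !ler_norml.
Qed.

Lemma continuous_bounded_square (c : R) (F : R * R -> R) : continuous F ->
  exists2 M, 0 <= M & forall x, in_square c x -> `|F x| <= M.
Proof.
move=> cF; have : compact (F @` in_square c).
  by apply: continuous_compact; [exact: continuous_subspaceT|exact: square_compact].
move=> /compact_bounded[M [_ HM]].
exists (`|M| + 1); first by rewrite addr_ge0.
move=> x cx; apply: HM; last by exists x.
by rewrite ltr_pwDr// ler_norm.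
Qed.

Lemma continuous_bdmeas (F : R * R -> R) : continuous F ->
  bdmeas (W : set plane) F.
Proof.
move=> cF; split; first exact: continuous_measurable2.
have [M _ FM] := continuous_bounded_square bd cF.
by exists M => x /W_bounded; exact: FM.
Qed.

Lemma continuous_sqint (F : R * R -> R) : continuous F ->
  sqint leb2 (W : set plane) F.
Proof. by move=> cF; apply: bdmeas_sqint leb2_W_fin (continuous_bdmeas cF). Qed.

Lemma continuous_rintegrable (F : R * R -> R) : continuous F ->
  rintegrable leb2 (W : set plane) F.
Proof. by move=> cF; apply: sqint_rintegrable leb2_W_fin (continuous_sqint cF). Qed.

Lemma patch_W_wedge (F : R * R -> R) : square_supported dl F ->
  (F \_ (W : set plane)) = F \_ (wedge a b).
Proof.
move=> sF; apply/funext => x; rewrite /patch.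
have [Wx|Wx] := pselect (W x); first by rewrite !mem_set//; exact: W_wedge.
rewrite memNset//; case: ifPn => // /set_mem wx.
apply/esym/eqP; apply: contra_notT Wx => /sF Fx; exact: wedge_W.
Qed.

Lemma supported_wedge_rintegrable (F : R * R -> R) : continuous F ->
  square_supported dl F -> rintegrable leb2 (wedge a b : set plane) F.
Proof.
move=> cF sF; apply/(integrable_mkcond _ (measurable_wedge a b)).
rewrite restrict_EFin -patch_W_wedge// -restrict_EFin.
by apply/(integrable_mkcond _ mW); exact: continuous_rintegrable.
Qed.

Lemma supported_partial (F : R * R -> R) e : e = e1 \/ e = e2 -> smooth F ->
  square_supported dl F -> square_supported dl (fun x => 'D_e F x).
Proof.
move=> ee sF suppF x; apply: contra_neqP => nx.
have [e' e'0 ball0] : exists2 e' : R, 0 < e' & forall y, ball x e' y -> F y = 0.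
  have : closed (in_square dl : set (R * R)).
    by apply: compact_closed; [exact: norm_hausdorff|exact: square_compact].
  move=> /closed_openC; rewrite openE => /(_ _ nx)/nbhs_ballP[e' /= e'0 He'].
  by exists e' => // y /He' ny; apply/eqP; apply: contra_notT ny => /suppF.
rewrite (near_eq_derive (g := cst 0)) ?derive_cst//.
by apply/nbhs_ballP; exists e' => // y /ball0.
Qed.

(** By Cramer's rule the quotient bounds both coordinates [r] and [t] of a point of the square; the
    [+ 1] makes the bound strict. *)
Let T := (`|a.1| + `|a.2| + `|b.1| + `|b.2|) * dl / D + 1.

Let wpt_out r t : T <= r \/ T <= t -> ~ in_square dl (wpt a b r t).
Proof.
move=> rt [/= x1 x2].
have dl0 : 0 <= dl := le_trans (normr_ge0 _) x1.
have aux (c d x y : R) : `|x| <= dl -> `|y| <= dl ->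
    c * y - d * x <= (`|c| + `|d|) * dl.
  move=> xl yl; apply: (le_trans (ler_norm _)); apply: (le_trans (ler_normB _ _)).
  by rewrite !normrM mulrDl lerD// ler_wpM2l.
have bound (u : R) : u * D <= (`|a.1| + `|a.2| + `|b.1| + `|b.2|) * dl -> u < T.
  by move=> uD; rewrite ltr_pwDr// ler_pdivlMr.
have tT : t < T.
  apply: bound; have := aux a.1 a.2 _ _ x1 x2.
  rewrite (_ : _ - _ = t * D); last by rewrite /D; ring.
  move=> /le_trans; apply; rewrite ler_wpM2r//.
  by have := normr_ge0 b.1; have := normr_ge0 b.2; lra.
have rT : r < T.
  apply: bound; have := aux b.2 b.1 _ _ x2 x1.
  rewrite (_ : _ - _ = r * D); last by rewrite /D; ring.
  move=> /le_trans; apply; rewrite ler_wpM2r//.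
  by have := normr_ge0 a.1; have := normr_ge0 a.2; lra.
by case: rt; rewrite leNgt ?tT ?rT.
Qed.

Let supp0 F x : square_supported dl F -> ~ in_square dl x -> F x = 0.
Proof. by move=> sF nx; apply/eqP; apply: contra_notT nx => /sF. Qed.

Definition Ddir (v : R * R) (F : R * R -> R) (x : R * R) : R :=
  v.1 * 'D_e1 F x + v.2 * 'D_e2 F x.

Lemma Ddir_smooth v F : smooth F -> smooth (Ddir v F).
Proof.
by move=> sF; apply: smoothD; apply: smoothZ; apply: smooth_partial => //;
  [left|right].
Qed.

Lemma smooth_continuous (F : R * R -> R) : smooth F -> continuous F.
Proof. by move=> /(_ 0%N)[]. Qed.

Lemma Ddir_supported v F : smooth F -> square_supported dl F ->
  square_supported dl (Ddir v F).
Proof.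
move=> sF suppF x; rewrite /Ddir => H; apply: contrapT => nx; move: H.
rewrite (supp0 (supported_partial (or_introl erefl) sF suppF) nx).
by rewrite (supp0 (supported_partial (or_intror erefl) sF suppF) nx) !mulr0 addr0 eqxx.
Qed.

Lemma halfline_rho (G : R * R -> R) (v : R * R) :
  (forall r, rho <= r -> ~ in_square dl (r * v.1, r * v.2)) ->
  square_supported dl G ->
  (\int[mu]_(r in `]0%R, +oo[) (G (r * v.1, r * v.2)%R)%:E =
   \int[mu]_(r in `]0%R, rho[) (G (r * v.1, r * v.2)%R)%:E)%E.
Proof.
move=> rv sG; rewrite integral_mkcond [RHS]integral_mkcond.
apply: eq_integral => r _; rewrite /patch !mem_setE !in_itv/= andbT.
case: ltP => //= r0; case: ltP => // rr.
by rewrite (supp0 sG (rv _ rr)).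
Qed.

Let Rintegral_W (G : R * R -> R) : square_supported dl G ->
  \int[leb2]_(x in (W : set plane)) G x =
  fine (\int[leb2]_(x in (wedge a b : set plane)) (G x)%:E).
Proof.
by move=> sG; rewrite Rintegral_mkcond patch_W_wedge// -Rintegral_mkcond.
Qed.

Let derive_b F r : smooth F -> forall t : R,
  is_derive t 1 (fun t => F (wpt a b r t)) (Ddir b F (wpt a b r t)).
Proof.
move=> sF t; apply: (@is_derive_line _ _ _ F (wpt a b r) t 1 b).
  move=> h; rewrite -[RHS]/(h * b.1 + (r * a.1 + t * b.1),
    h * b.2 + (r * a.2 + t * b.2)) /wpt.
  by rewrite -[h *: 1]/(h * 1); congr pair; ring.
exact: is_derive_dir.
Qed.

Let derive_a F t : smooth F -> forall r : R,
  is_derive r 1 (fun r => F (wpt a b r t)) (Ddir a F (wpt a b r t)).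
Proof.
move=> sF r; apply: (@is_derive_line _ _ _ F (fun r => wpt a b r t) r 1 a).
  move=> h; rewrite -[RHS]/(h * a.1 + (r * a.1 + t * b.1),
    h * a.2 + (r * a.2 + t * b.2)) /wpt.
  by rewrite -[h *: 1]/(h * 1); congr pair; ring.
exact: is_derive_dir.
Qed.

Let line_b (G : R * R -> R) r : continuous G -> continuous (fun t => G (wpt a b r t)).
Proof. exact: continuous_linear2. Qed.

Let line_a (G : R * R -> R) t : continuous G -> continuous (fun r => G (wpt a b r t)).
Proof.
move=> cG; rewrite (_ : (fun r => _) =
    (fun r => G (t * b.1 + r * a.1, t * b.2 + r * a.2))).
  exact: (@continuous_linear2 R G b a t cG).
by apply/funext => r; rewrite /wpt addrC [X in (_, X)]addrC.
Qed.

Let inner_b F r : smooth F -> square_supported dl F ->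
  (\int[mu]_(t in `]0%R, +oo[) (Ddir b F (wpt a b r t))%:E =
   (- F (r * a.1, r * a.2))%:E)%E.
Proof.
move=> sF suppF; rewrite (FTC_halfline (T := T) (derive_b r sF)).
- by rewrite /wpt !mul0r !addr0.
- exact: line_b (smooth_continuous (Ddir_smooth b sF)).
- by move=> t Tt; apply: supp0 suppF _; apply: wpt_out; right.
Qed.

Let inner_a F t : smooth F -> square_supported dl F ->
  (\int[mu]_(r in `]0%R, +oo[) (Ddir a F (wpt a b r t))%:E =
   (- F (t * b.1, t * b.2))%:E)%E.
Proof.
move=> sF suppF; rewrite (FTC_halfline (T := T) (derive_a t sF)).
- by rewrite /wpt !mul0r !add0r.
- exact: line_a (smooth_continuous (Ddir_smooth a sF)).
- by move=> r Tr; apply: supp0 suppF _; apply: wpt_out; left.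
Qed.

Lemma continuous_ray_measurable (G : R * R -> R) (v : R * R) (I : set R) :
  continuous G -> measurable_fun I (fun r : measurableTypeR R => G (r * v.1, r * v.2)).
Proof.
move=> cG; apply: measurable_funTS; apply: continuous_measurable_fun.
rewrite (_ : (fun r => _) =
    (fun r : R => G (0 * v.1 + r * v.1, 0 * v.2 + r * v.2))).
  exact: (@continuous_linear2 R G v v 0 cG).
by apply/funext => r; rewrite !mul0r !add0r.
Qed.

Lemma continuous_ray_integrable (G : R * R -> R) (v : R * R) : continuous G ->
  rintegrable mu `]0%R, rho[ (fun r => G (r * v.1, r * v.2)).
Proof.
move=> cG; apply: measurable_bounded_integrable => //.
- by rewrite /= lebesgue_measure_itv/=; case: ifP => _; rewrite ?ltry// -EFinD ltry.
- exact: continuous_ray_measurable.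
have [M M0 GM] := continuous_bounded_square (`|rho| * (`|v.1| + `|v.2|)) cG.
exists M; split; first exact: num_real.
move=> y My r /=; rewrite in_itv/= => /andP[r0 rrho].
have rr : `|r| <= `|rho|.
  by rewrite gtr0_norm// gtr0_norm ?(lt_trans r0)// ltW.
apply: le_trans (ltW My); apply: GM; split; rewrite /= normrM ler_pM//.
  by rewrite lerDl.
by rewrite lerDr.
Qed.

Let Rintegral_ray_opp (G : R * R -> R) (v : R * R) : continuous G ->
  (\int[mu]_(r in `]0%R, rho[) (- G (r * v.1, r * v.2))%:E =
   (- \int[mu]_(r in `]0%R, rho[) G (r * v.1, r * v.2))%:E)%E.
Proof.
move=> cG; have iG := continuous_ray_integrable v cG.
rewrite -mulN1r -RintegralZl// /Rintegral fineK.
  by apply: eq_integral => r _; rewrite mulN1r.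
by apply: integrable_fin_num => //; exact: (rintegrableZ _ (-1) iG).
Qed.

(** Green's identity without normal vectors: the direction [b] is tangent to one side, so its
    derivative has flux through the side along [a] only. Each line parallel to [b] contributes minus
    its boundary value; [D] is the Jacobian of [wpt]. *)
Lemma divergence_b F : smooth F -> square_supported dl F ->
  \int[leb2]_(x in (W : set plane)) Ddir b F x =
  - (D * \int[mu]_(r in `]0%R, rho[) F (r * a.1, r * a.2)).
Proof.
move=> sF suppF; have sD := Ddir_supported sF suppF : square_supported dl (Ddir b F).
rewrite Rintegral_W//.
have [-> _] := integral_wedge D0 (supported_wedge_rintegrable
  (smooth_continuous (Ddir_smooth b sF)) sD).
under eq_integral => r _ do rewrite inner_b//.
rewrite (@halfline_rho (fun x => - F x) a rho_a); last first.
  by move=> x; rewrite oppr_eq0; exact: suppF.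
by rewrite Rintegral_ray_opp; [rewrite -EFinM/= mulrN|exact: smooth_continuous].
Qed.

Lemma divergence_a F : smooth F -> square_supported dl F ->
  \int[leb2]_(x in (W : set plane)) Ddir a F x =
  - (D * \int[mu]_(r in `]0%R, rho[) F (r * b.1, r * b.2)).
Proof.
move=> sF suppF; have sD := Ddir_supported sF suppF : square_supported dl (Ddir a F).
rewrite Rintegral_W//.
have [_ ->] := integral_wedge D0 (supported_wedge_rintegrable
  (smooth_continuous (Ddir_smooth a sF)) sD).
under eq_integral => r _ do rewrite inner_a//.
rewrite (@halfline_rho (fun x => - F x) b rho_b); last first.
  by move=> x; rewrite oppr_eq0; exact: suppF.
by rewrite Rintegral_ray_opp; [rewrite -EFinM/= mulrN|exact: smooth_continuous].
Qed.

Let norm_supported (G : R * R -> R) : square_supported dl G ->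
  square_supported dl (fun x => `|G x|).
Proof. by move=> sG x; rewrite normr_eq0; exact: sG. Qed.

Let norm_continuous2 (G : R * R -> R) : continuous G -> continuous (fun x => `|G x|).
Proof. by move=> cG x; apply: cvg_norm; exact: cG. Qed.

Let trace_bound (v : R * R) (G F : R * R -> R) (X : \bar R) :
  smooth F -> square_supported dl F -> continuous G -> square_supported dl G ->
  (forall r, rho <= r -> ~ in_square dl (r * v.1, r * v.2)) ->
  (\int[leb2]_(x in (wedge a b : set plane)) `|G x|%:E = D%:E * X)%E ->
  (\int[mu]_(r in `]0%R, +oo[) `|F (r * v.1, r * v.2)|%:E <= X)%E ->
  D * \int[mu]_(r in `]0%R, rho[) `|F (r * v.1, r * v.2)| <=
  \int[leb2]_(x in (W : set plane)) `|G x|.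
Proof.
move=> sF suppF cG sG rv EX; rewrite (halfline_rho rv (norm_supported suppF)) => FX.
have cF := norm_continuous2 (smooth_continuous sF).
have finX : (D%:E * X)%E \is a fin_num.
  rewrite -EX; apply: integrable_fin_num; first exact: measurable_wedge.
  by apply: supported_wedge_rintegrable; [exact: norm_continuous2|exact: norm_supported].
have finF : (\int[mu]_(r in `]0%R, rho[) `|F (r * v.1, r * v.2)|%:E)%E \is a fin_num.
  by apply: integrable_fin_num => //; exact: continuous_ray_integrable cF.
rewrite (Rintegral_W (norm_supported sG)) EX -lee_fin EFinM (fineK finX).
by rewrite /Rintegral (fineK finF) lee_pmul2l ?lte_fin.
Qed.

Let le_inner (df : R -> R) (c : R) : continuous df ->
  (\int[mu]_(t in `]0%R, +oo[) (df t)%:E = (- c)%:E)%E ->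
  (`|c|%:E <= \int[mu]_(t in `]0%R, +oo[) `|df t|%:E)%E.
Proof.
move=> cdf E; rewrite -normrN -abse_EFin -E.
apply: le_abse_integral => //; apply/measurable_EFinP.
by apply: measurable_funTS; exact: continuous_measurable_fun.
Qed.

(** On each line parallel to [b] the boundary value is an integral of the derivative, hence at most
    the integral of its absolute value. *)
Lemma trace_b F : smooth F -> square_supported dl F ->
  D * \int[mu]_(r in `]0%R, rho[) `|F (r * a.1, r * a.2)| <=
  \int[leb2]_(x in (W : set plane)) `|Ddir b F x|.
Proof.
move=> sF suppF; have sD := Ddir_supported sF suppF : square_supported dl (Ddir b F).
have cD := smooth_continuous (Ddir_smooth b sF).
have mD : measurable_fun (wedge a b : set plane) (fun x => `|Ddir b F x|%:E).
  by apply/measurable_EFinP; apply: continuous_measurable2; exact: norm_continuous2.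
have D_ge0 x : (0 <= `|Ddir b F x|%:E)%E by rewrite lee_fin.
have [E _] := ge0_integral_wedge D0 mD D_ge0.
apply: trace_bound E _ => //.
apply: ge0_le_integral_set => [|r _|r _|r r0].
- exact: measure0.
- by rewrite lee_fin.
- exact: integral_ge0.
rewrite /patch mem_set//.
by apply: le_inner (inner_b r sF suppF); exact: line_b.
Qed.

Lemma trace_a F : smooth F -> square_supported dl F ->
  D * \int[mu]_(r in `]0%R, rho[) `|F (r * b.1, r * b.2)| <=
  \int[leb2]_(x in (W : set plane)) `|Ddir a F x|.
Proof.
move=> sF suppF; have sD := Ddir_supported sF suppF : square_supported dl (Ddir a F).
have cD := smooth_continuous (Ddir_smooth a sF).
have mD : measurable_fun (wedge a b : set plane) (fun x => `|Ddir a F x|%:E).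
  by apply/measurable_EFinP; apply: continuous_measurable2; exact: norm_continuous2.
have D_ge0 x : (0 <= `|Ddir a F x|%:E)%E by rewrite lee_fin.
have [_ E] := ge0_integral_wedge D0 mD D_ge0.
apply: trace_bound E _ => //.
apply: ge0_le_integral_set => [|r _|r _|r r0].
- exact: measure0.
- by rewrite lee_fin.
- exact: integral_ge0.
rewrite /patch mem_set//.
by apply: le_inner (inner_a r sF suppF); exact: line_a.
Qed.

End corner_domain.

Section limits.
Context d (T : measurableType d) (R : realType).
Variables (mu : {measure set T -> \bar R}) (D : set T).
Hypothesis mD : measurable D.

Lemma Rintegral_mul_cvg0 (F : nat -> T -> R) (g : T -> R) :
  (forall n, sqint mu D (F n)) -> sqint mu D g ->
  (fun n => \int[mu]_(x in D) F n x ^+ 2) @ \oo --> (0 : R) ->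
  (fun n => \int[mu]_(x in D) `|F n x * g x|) @ \oo --> (0 : R).
Proof.
move=> sF sg F0; pose B := \int[mu]_(x in D) g x ^+ 2.
have sqB : (fun n => Num.sqrt (\int[mu]_(x in D) F n x ^+ 2 * B)) @ \oo --> (0 : R).
  rewrite -(sqrtr0 R); apply: continuous_cvg; first exact: sqrt_continuous.
  by rewrite -(mul0r B); apply: cvgM => //; exact: cvg_cst.
apply: (squeeze_cvgr _ (cvg_cst 0) sqB); apply: nearW => n.
rewrite Rintegral_ge0//= -[leLHS]ger0_norm; last exact: Rintegral_ge0.
rewrite -sqrtr_sqr ler_wsqrtr//.
exact: Rintegral_CauchySchwarz.
Qed.

End limits.

Lemma cvg0_le0 {R : realType} (x : R) (e : nat -> R) :
  e @ \oo --> (0 : R) -> (forall n, x <= e n) -> x <= 0.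
Proof.
by move=> e0 xe; apply: (cvgr_to_ge e0); exact: nearW.
Qed.

Lemma cvg0D {R : realType} (x y : nat -> R) : x @ \oo --> (0 : R) ->
  y @ \oo --> (0 : R) -> (fun n => x n + y n) @ \oo --> (0 : R).
Proof. by move=> x0 y0; rewrite -[X in _ --> X]addr0; exact: cvgD. Qed.

Lemma cvg0Z {R : realType} (c : R) (x : nat -> R) : x @ \oo --> (0 : R) ->
  (fun n => c * x n) @ \oo --> (0 : R).
Proof. by move=> x0; rewrite -[X in _ --> X](mulr0 c); exact: cvgMr. Qed.

Lemma flat_exp_cvg1 {R : realType} (c : R) : 0 < c ->
  (fun n : nat => flat_exp 0 (n%:R * c - 1)) @ \oo --> (1 : R).
Proof.
move=> c0; apply/cvgrPdist_le => /= e e0.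
near=> n.
have ne : (1 + e^-1) / c <= n%:R by near: n; exact: nbhs_infty_ger.
have nc : e^-1 <= n%:R * c - 1.
  by rewrite lerBrDl -ler_pdivrMr.
have ei0 : 0 < e^-1 by rewrite invr_gt0.
have t0 := lt_le_trans ei0 nc.
rewrite ger0_norm ?subr_ge0 ?flat_exp_le1//.
rewrite /flat_exp t0 expr0 mul1r lerBlDl -lerBlDr.
apply: (le_trans _ (expR_ge1Dx _)).
by rewrite lerD2l lerN2 -[e]invrK lef_pV2.
Unshelve. all: by end_near. Qed.

Lemma closed_gef {R : realType} (f : R * R -> R) (c : R) : continuous f ->
  closed [set x | c <= f x].
Proof.
move=> cf; rewrite -[X in closed X]/(f @^-1` [set y | c <= y]).
by apply: preimage_closed; [move=> x _; exact: cf|exact: closed_ge].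
Qed.

(** * From test functions to functions that reach the sides *)

Section corner_domain_traces.
Context {R : realType}.
Local Notation mu := (@lebesgue_measure R).
Local Notation plane := (measurableTypeR R * measurableTypeR R)%type.
Variables (a b : R * R) (W : set (R * R)) (dl bd rho : R).
Hypothesis D0 : 0 < a.1 * b.2 - a.2 * b.1.
Hypothesis mW : measurable (W : set plane).
Hypothesis W_wedge : W `<=` wedge a b.
Hypothesis wedge_W : wedge a b `&` in_square dl `<=` W.
Hypothesis W_bounded : W `<=` in_square bd.
Hypothesis rho_a : forall r, rho <= r -> ~ in_square dl (r * a.1, r * a.2).
Hypothesis rho_b : forall r, rho <= r -> ~ in_square dl (r * b.1, r * b.2).
Let D := a.1 * b.2 - a.2 * b.1.

Let cont_sqint := continuous_sqint mW W_bounded.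

Lemma supported_test_function (K : set (R * R)) (phi : R * R -> R) :
  smooth phi -> closed K -> K `<=` in_square dl -> K `<=` W ->
  (forall x, phi x != 0 -> K x) -> test_function W phi.
Proof.
move=> sphi cK Kdl KW phiK.
have sK : supp phi `<=` K.
  by rewrite ((closure_id K).1 cK); apply: closureS => x /phiK.
split=> //; last exact: subset_trans KW.
exact: (subclosed_compact (@closed_closure _ _) (@square_compact R dl)
  (subset_trans sK Kdl)).
Qed.

(* A function orthogonal to the test functions is orthogonal to the smooth
   functions that do not vanish near the sides: multiply these by cutoffs. *)
Lemma weak_orthogonal (g : R * R -> R) :
  sqint leb2 (W : set plane) g ->
  (forall phi, test_function W phi ->
    \int[leb2]_(x in (W : set plane)) (g x * phi x) = 0) ->
  forall psi, smooth psi -> square_supported dl psi ->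
    \int[leb2]_(x in (W : set plane)) (g x * psi x) = 0.
Proof.
move=> sg g0 psi spsi suppsi.
pose al (x : R * R) := a.1 * x.2 - a.2 * x.1.
pose be (x : R * R) := x.1 * b.2 - x.2 * b.1.
(* [al] and [be] are both positive exactly inside the wedge. For [n > 0], [z n] vanishes where one
   of them is at most [1 / n]; it tends to 1 pointwise in the wedge. *)
pose z (n : nat) (x : R * R) := flat_exp 0 (n%:R * al x - 1) * flat_exp 0 (n%:R * be x - 1).
have sz n : smooth (z n).
  move=> k; apply: (@eq_Ck _ _ (fun x => flat_exp 0 (- n%:R * a.2 * x.1 + n%:R * a.1 * x.2 + -1) *
    flat_exp 0 (n%:R * b.2 * x.1 + - n%:R * b.1 * x.2 + -1))) => [x|].
    by rewrite /z /al /be; congr (flat_exp 0 _ * flat_exp 0 _); ring.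
  by apply: CkM; apply: Ck_affine; exact: Cn_flat_exp.
have cal : continuous al.
  by move=> x; apply: cvgB; apply: cvgM; do ?[exact: cvg_cst|exact: cvg_fst|exact: cvg_snd].
have cbe : continuous be.
  by move=> x; apply: cvgB; apply: cvgM; do ?[exact: cvg_cst|exact: cvg_fst|exact: cvg_snd].
have tz n : test_function W (fun x => psi x * z n.+1 x).
  pose K := in_square dl `&` ([set x | n.+1%:R^-1 <= al x] `&` [set x | n.+1%:R^-1 <= be x]).
  have n0 : 0 < n.+1%:R^-1 :> R by rewrite invr_gt0.
  apply: (@supported_test_function K).
  - exact: smoothM.
  - apply: closedI.
      by apply: compact_closed; [exact: norm_hausdorff|exact: square_compact].
    by apply: closedI; exact: closed_gef.
  - by move=> x [].
  - move=> x [dx [/= ax bx]]; apply: wedge_W; split=> //.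
    by split; [exact: lt_le_trans ax|exact: lt_le_trans bx].
  - move=> x; rewrite /z !mulf_eq0 !negb_or => /and3P[px ax bx].
    have pos t : flat_exp 0 (n.+1%:R * t - 1) != 0 -> n.+1%:R^-1 <= t.
      apply: contraNT; rewrite -ltNge => tn; rewrite flat_exp_le0//.
      by rewrite subr_le0 -ler_pdivlMl// mulr1 ltW.
    by split; [exact: suppsi|split; exact: pos].
have cpsi := cont_sqint (smooth_continuous spsi).
have ipsi := sqint_mul mW sg cpsi.
have mg : measurable_fun (W : set plane) g by case: sg.
have cvz : (fun n => \int[leb2]_(x in (W : set plane)) (g x * (psi x * z n.+1 x))) @ \oo -->
    \int[leb2]_(x in (W : set plane)) (g x * psi x).
  apply: (@Rintegral_dominated_cvg _ _ _ leb2 (W : set plane) mW _ _ (fun x => `|g x * psi x|)).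
  - move=> n; apply: measurable_funM => //; apply: continuous_measurable2.
    by apply: smooth_continuous; exact: smoothM.
  - by apply: measurable_funM => //; case: cpsi.
  - exact: rintegrable_norm.
  - move=> x /W_wedge[ax bx].
    have ca : (fun n => flat_exp 0 (n.+1%:R * al x - 1)) @ \oo --> (1 : R).
      by rewrite (cvg_shiftS (fun n => flat_exp 0 (n%:R * al x - 1))); exact: flat_exp_cvg1.
    have cb : (fun n => flat_exp 0 (n.+1%:R * be x - 1)) @ \oo --> (1 : R).
      by rewrite (cvg_shiftS (fun n => flat_exp 0 (n%:R * be x - 1))); exact: flat_exp_cvg1.
    have := cvgM (cvg_cst (g x)) (cvgM (cvg_cst (psi x)) (cvgM ca cb)).
    by rewrite !mulr1; apply.
  - move=> n x _; rewrite mulrA normrM ler_piMr// ger0_norm ?mulr_ge0 ?flat_exp_ge0//.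
    by rewrite mulr_ile1 ?flat_exp_ge0 ?flat_exp_le1.
move: cvz; under eq_fun do rewrite g0//.
by move=> /(cvg_unique _ (cvg_cst 0)) => /(_ (@Rhausdorff R)).
Qed.

End corner_domain_traces.

(** * Traces of limits of smooth functions *)

Section approximable_traces.
Context {R : realType}.
Local Notation mu := (@lebesgue_measure R).
Local Notation plane := (measurableTypeR R * measurableTypeR R)%type.
Variables (a b : R * R) (W : set (R * R)) (dl bd rho : R).
Hypothesis D0 : 0 < a.1 * b.2 - a.2 * b.1.
Hypothesis mW : measurable (W : set plane).
Hypothesis W_wedge : W `<=` wedge a b.
Hypothesis wedge_W : wedge a b `&` in_square dl `<=` W.
Hypothesis W_bounded : W `<=` in_square bd.
Hypothesis rho_a : forall r, rho <= r -> ~ in_square dl (r * a.1, r * a.2).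
Hypothesis rho_b : forall r, rho <= r -> ~ in_square dl (r * b.1, r * b.2).
Let D := a.1 * b.2 - a.2 * b.1.
Let I : set (measurableTypeR R) := `]0%R, rho[%classic.
Local Notation W' := (W : set plane).

Let cont_sqint := continuous_sqint mW W_bounded.
Let mI : measurable I. Proof. exact: measurable_itv. Qed.

(** [g1 n] and [g2 n] play the weak partials of [U n - u]. Such a partial is only chosen among the
    functions that satisfy the defining identity, so it is tied to ['D_e (U n)] and the partial of
    [u] by orthogonality to test functions instead of an equation. *)
Variables (u u1 u2 : R * R -> R) (U g1 g2 : nat -> R * R -> R).
Hypothesis su : sqint leb2 W' u.
Hypothesis su1 : sqint leb2 W' u1.
Hypothesis su2 : sqint leb2 W' u2.
Hypothesis sU : forall n, smooth (U n).
Hypothesis sg1 : forall n, sqint leb2 W' (g1 n).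
Hypothesis sg2 : forall n, sqint leb2 W' (g2 n).
Hypothesis Uu : (fun n => \int[leb2]_(x in W') (U n x - u x) ^+ 2) @ \oo --> (0 : R).
Hypothesis g1_0 : (fun n => \int[leb2]_(x in W') g1 n x ^+ 2) @ \oo --> (0 : R).
Hypothesis g2_0 : (fun n => \int[leb2]_(x in W') g2 n x ^+ 2) @ \oo --> (0 : R).
Hypothesis ort1 : forall n phi, test_function W phi ->
  \int[leb2]_(x in W') (('D_e1 (U n) x - u1 x - g1 n x) * phi x) = 0.
Hypothesis ort2 : forall n phi, test_function W phi ->
  \int[leb2]_(x in W') (('D_e2 (U n) x - u2 x - g2 n x) * phi x) = 0.

Let uv (v : R * R) x := v.1 * u1 x + v.2 * u2 x.
Let gv (v : R * R) n x := v.1 * g1 n x + v.2 * g2 n x.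

Let suv v : sqint leb2 W' (uv v).
Proof. by apply: sqintD => //; exact: sqintZ. Qed.

Let sgv v n : sqint leb2 W' (gv v n).
Proof. by apply: sqintD => //; apply: sqintZ. Qed.

Let cU n : continuous (U n). Proof. exact: smooth_continuous. Qed.

Let cDU v n : continuous (Ddir v (U n)).
Proof. by apply: smooth_continuous; exact: Ddir_smooth. Qed.

Let gv_0 v : (fun n => \int[leb2]_(x in W') gv v n x ^+ 2) @ \oo --> (0 : R).
Proof.
have B : (fun n => 2 * (v.1 ^+ 2 * (\int[leb2]_(x in W') g1 n x ^+ 2)) +
    2 * (v.2 ^+ 2 * (\int[leb2]_(x in W') g2 n x ^+ 2))) @ \oo --> (0 : R).
  by apply: cvg0D; do 2 apply: cvg0Z.
apply: (squeeze_cvgr _ (cvg_cst 0) B); apply: nearW => n.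
rewrite Rintegral_ge0/=; last by move=> x _; exact: sqr_ge0.
have i1 := (sg1 n).2; have i2 := (sg2 n).2.
rewrite -!RintegralZl//; try by do ?apply: rintegrableZ.
rewrite -RintegralD//; try by do ?apply: rintegrableZ.
apply: le_Rintegral => //; first exact: (sgv v n).2.
- by apply: rintegrableD => //; do ?apply: rintegrableZ.
- move=> x _; rewrite /gv; have := sqr_ge0 (v.1 * g1 n x - v.2 * g2 n x).
  by rewrite -!exprMn; nra.
Qed.

Let ort v n psi : smooth psi -> square_supported dl psi ->
  \int[leb2]_(x in W') ((Ddir v (U n) x - uv v x - gv v n x) * psi x) = 0.
Proof.
move=> spsi suppsi.
have H e (ue : R * R -> R) ge : e = e1 \/ e = e2 -> sqint leb2 W' ue -> sqint leb2 W' (ge n) ->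
    (forall phi, test_function W phi ->
      \int[leb2]_(x in W') (('D_e (U n) x - ue x - ge n x) * phi x) = 0) ->
    rintegrable leb2 W' (fun x => ('D_e (U n) x - ue x - ge n x) * psi x) /\
    \int[leb2]_(x in W') (('D_e (U n) x - ue x - ge n x) * psi x) = 0.
  move=> ee sue sge He.
  have cD : continuous ('D_e (U n)) := smooth_continuous (smooth_partial ee (sU n)).
  have s : sqint leb2 W' (fun x => 'D_e (U n) x - ue x - ge n x).
    by apply: sqintB => //; apply: sqintB => //; exact: cont_sqint.
  split; first by apply: sqint_mul => //; exact: cont_sqint (smooth_continuous spsi).
  exact: (weak_orthogonal mW W_wedge wedge_W W_bounded s He spsi suppsi).
have [i1 E1] := H e1 u1 g1 (or_introl erefl) su1 (sg1 n) (ort1 n).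
have [i2 E2] := H e2 u2 g2 (or_intror erefl) su2 (sg2 n) (ort2 n).
transitivity (v.1 * \int[leb2]_(x in W') (('D_e1 (U n) x - u1 x - g1 n x) * psi x) +
  v.2 * \int[leb2]_(x in W') (('D_e2 (U n) x - u2 x - g2 n x) * psi x)).
  rewrite -!RintegralZl// -RintegralD//; [|exact: rintegrableZ|exact: rintegrableZ].
  by apply: eq_Rintegral => x _; rewrite /Ddir /uv /gv; ring.
by rewrite E1 E2 !mulr0 addr0.
Qed.

Let DdirM v n psi x : smooth psi ->
  Ddir v (fun x => U n x * psi x) x = U n x * Ddir v psi x + Ddir v (U n) x * psi x.
Proof.
by move=> sp; rewrite /Ddir !smooth_partialM//; [ring|right|left].
Qed.

Let UM_supported n psi : square_supported dl psi ->
  square_supported dl (fun x => U n x * psi x).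
Proof. by move=> sp x; rewrite mulf_eq0 negb_or => /andP[_ /sp]. Qed.

Section side.
(** One side of the corner: [c] is its direction, [v] the direction of the other side, [tc] the
    trace. The pairs [(a, b)] and [(b, a)] are the two instances. *)
Variables (c v : R * R) (tc : R -> R).
Hypothesis stc : sqint mu I tc.
Hypothesis Utc :
  (fun n => \int[mu]_(r in I) (U n (r * c.1, r * c.2) - tc r) ^+ 2) @ \oo --> (0 : R).
Hypothesis div : forall F, smooth F -> square_supported dl F ->
  \int[leb2]_(x in W') Ddir v F x = - (D * \int[mu]_(r in I) F (r * c.1, r * c.2)).
Hypothesis tr : forall F, smooth F -> square_supported dl F ->
  D * \int[mu]_(r in I) `|F (r * c.1, r * c.2)| <= \int[leb2]_(x in W') `|Ddir v F x|.

Let sray (G : R * R -> R) : continuous G -> sqint mu I (fun r => G (r * c.1, r * c.2)).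
Proof.
move=> cG; split; first exact: continuous_ray_measurable.
have cG2 : continuous (fun x => G x ^+ 2) by move=> x; apply: cvgM; exact: cG.
exact: (continuous_ray_integrable rho c cG2).
Qed.

(** The divergence identity for the smooth product [U n * psi], rewritten by [ort], is this identity
    up to errors bounded by [E1], [E2] and [D * E3]. Each is a Cauchy-Schwarz pairing with a
    sequence that tends to 0. *)
Lemma side_identity psi : smooth psi -> square_supported dl psi ->
  \int[leb2]_(x in W') (u x * Ddir v psi x + uv v x * psi x) =
  - (D * \int[mu]_(r in I) (tc r * psi (r * c.1, r * c.2))).
Proof.
move=> sp supp_p.
have cp := smooth_continuous sp.
have cDp := smooth_continuous (Ddir_smooth v sp).
have s1 := cont_sqint cp; have s2 := cont_sqint cDp.
have iuD := sqint_mul mW su s2; have iup := sqint_mul mW (suv v) s1.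
pose E1 n := \int[leb2]_(x in W') `|(U n x - u x) * Ddir v psi x|.
pose E2 n := \int[leb2]_(x in W') `|gv v n x * psi x|.
pose E3 n := \int[mu]_(r in I) `|(U n (r * c.1, r * c.2) - tc r) * psi (r * c.1, r * c.2)|.
have sUu n : sqint leb2 W' (fun x => U n x - u x).
  by apply: sqintB => //; exact: cont_sqint.
have sUt n : sqint mu I (fun r => U n (r * c.1, r * c.2) - tc r).
  by apply: sqintB => //; exact: sray.
have E1_0 : E1 @ \oo --> (0 : R) by exact: Rintegral_mul_cvg0.
have E2_0 : E2 @ \oo --> (0 : R) by exact: Rintegral_mul_cvg0.
have E3_0 : E3 @ \oo --> (0 : R) by apply: Rintegral_mul_cvg0 => //; exact: sray.
set L := LHS; set Rr := RHS.
suff : `|L - Rr| <= 0 by rewrite normr_le0 subr_eq0 => /eqP.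
apply: (@cvg0_le0 _ _ (fun n => E1 n + E2 n + D * E3 n)).
  by apply: cvg0D; [exact: cvg0D|exact: cvg0Z].
move=> n.
have i1 := sqint_mul mW (sUu n) s2; have i2 := sqint_mul mW (sgv v n) s1.
have i3 := sqint_mul mI (sUt n) (sray cp).
have i4 := sqint_mul mI stc (sray cp).
have i5 := sqint_mul mW (cont_sqint (@cU n)) s2.
have sd : sqint leb2 W' (fun x => Ddir v (U n) x - uv v x - gv v n x).
  by apply: sqintB => //; apply: sqintB => //; exact: cont_sqint.
have i6 := sqint_mul mW sd s1.
have eqL : L = - (D * \int[mu]_(r in I) (U n (r * c.1, r * c.2) * psi (r * c.1, r * c.2)))
    - \int[leb2]_(x in W') ((U n x - u x) * Ddir v psi x)
    - \int[leb2]_(x in W') (gv v n x * psi x).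
  rewrite -(div (smoothM (sU n) sp) (UM_supported supp_p)).
  rewrite -[LHS]addr0 -(ort v n sp supp_p) /L.
  have iD : rintegrable leb2 W' (Ddir v (fun x => U n x * psi x)).
    apply: (continuous_rintegrable mW W_bounded); apply: smooth_continuous.
    by apply: Ddir_smooth; exact: smoothM.
  rewrite -RintegralD//; last exact: rintegrableD.
  rewrite -RintegralB// -RintegralB//; last exact: rintegrableB.
  by apply: eq_Rintegral => x _; rewrite DdirM//; ring.
have eqR : Rr = - (D * \int[mu]_(r in I) (U n (r * c.1, r * c.2) * psi (r * c.1, r * c.2)))
   + D * \int[mu]_(r in I) ((U n (r * c.1, r * c.2) - tc r) * psi (r * c.1, r * c.2)).
  rewrite /Rr -[X in _ = - (D * X) + _]addr0.
  have -> : \int[mu]_(r in I) (tc r * psi (r * c.1, r * c.2)) =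
    \int[mu]_(r in I) (U n (r * c.1, r * c.2) * psi (r * c.1, r * c.2)) -
    \int[mu]_(r in I) ((U n (r * c.1, r * c.2) - tc r) * psi (r * c.1, r * c.2)).
    rewrite -RintegralB//; last exact: sqint_mul (sray (@cU n)) (sray cp).
    by apply: eq_Rintegral => r _; ring.
  by ring.
rewrite eqL eqR.
set X1 := \int[leb2]_(x in W') ((U n x - u x) * _).
set X2 := \int[leb2]_(x in W') (gv _ _ _ * _).
set X3 := \int[mu]_(r in I) ((_ - tc r) * _).
set X0 := \int[mu]_(r in I) (U n _ * _).
have -> : - (D * X0) - X1 - X2 - (- (D * X0) + D * X3) = - X1 - X2 - D * X3 by ring.
apply: (le_trans (ler_normB _ _)); apply: lerD.
  apply: (le_trans (ler_normB _ _)); rewrite normrN.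
  by apply: lerD; [exact: (le_normr_Rintegral mW i1)|exact: (le_normr_Rintegral mW i2)].
have Dp : 0 < D := D0.
rewrite normrM (gtr0_norm Dp); apply: ler_wpM2l; first exact: ltW.
exact: (le_normr_Rintegral mI i3).
Qed.

(* Testing the derivative of the approximation against itself bounds its norm
   by that of the weak derivative. *)
Let energy chi n : smooth chi -> square_supported dl chi ->
  (forall x, 0 <= chi x <= 1) ->
  \int[leb2]_(x in W') (Ddir v (U n) x ^+ 2 * chi x) <=
  \int[leb2]_(x in W') (uv v x + gv v n x) ^+ 2.
Proof.
move=> schi supp_chi chi01.
set G := Ddir v (U n).
have sG : smooth G by exact: Ddir_smooth.
have cG := smooth_continuous sG; have cchi := smooth_continuous schi.
have cGchi : continuous (fun x => G x * chi x) by move=> x; apply: cvgM; [exact: cG|exact: cchi].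
have sw : sqint leb2 W' (fun x => uv v x + gv v n x) by exact: sqintD.
have suppGchi : square_supported dl (fun x => G x * chi x).
  by move=> x; rewrite mulf_eq0 negb_or => /andP[_ /supp_chi].
have := ort v n (smoothM sG schi) suppGchi; rewrite -/G => E.
have iwG := sqint_mul mW sw (cont_sqint cGchi).
have iG2 : rintegrable leb2 W' (fun x => G x ^+ 2 * chi x).
  apply: (continuous_rintegrable mW W_bounded) => x.
  by apply: cvgM; [apply: cvgM; exact: cG|exact: cchi].
have E2 : \int[leb2]_(x in W') (G x ^+ 2 * chi x) =
    \int[leb2]_(x in W') ((uv v x + gv v n x) * (G x * chi x)).
  apply/eqP; rewrite -subr_eq0 -RintegralB// -[X in _ == X]E; apply/eqP.
  by apply: eq_Rintegral => x _; ring.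
have : \int[leb2]_(x in W') ((uv v x + gv v n x) * (G x * chi x)) <=
   2^-1 * \int[leb2]_(x in W') (uv v x + gv v n x) ^+ 2 +
   2^-1 * \int[leb2]_(x in W') (G x ^+ 2 * chi x).
  have isw := sw.2.
  rewrite -!RintegralZl// -RintegralD//; [|exact: rintegrableZ|exact: rintegrableZ].
  apply: le_Rintegral => //.
    by apply: rintegrableD => //; exact: rintegrableZ.
  move=> x _; have /andP[c0 c1] := chi01 x.
  have : (G x * chi x) ^+ 2 <= G x ^+ 2 * chi x.
    rewrite exprMn [leRHS]mulrC [leLHS]mulrC; apply: ler_wpM2r; first exact: sqr_ge0.
    by rewrite expr2 ler_piMr.
  have := sqr_ge0 (uv v x + gv v n x - G x * chi x).
  move: (uv v x + gv v n x) (G x * chi x) (G x ^+ 2 * chi x) => p q r.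
  by rewrite sqrrB; lra.
by rewrite -E2; lra.
Qed.

(** The L^1 trace inequality for [U n * chi * kappa], in the limit. The term with the derivative of
    [U n] is split by Cauchy-Schwarz with a factor [sqrt chi] on each side, so that [energy] bounds
    it with a constant independent of [kappa]. *)
Lemma side_trace chi : smooth chi -> square_supported dl chi ->
  (forall x, 0 <= chi x <= 1) ->
  exists2 M, 0 <= M & forall kappa A, smooth kappa -> (forall x, 0 <= kappa x) -> 0 <= A ->
    \int[leb2]_(x in W') (kappa x ^+ 2 * chi x) <= A ^+ 2 ->
    D * \int[mu]_(r in I) (`|tc r| * (chi (r * c.1, r * c.2) * kappa (r * c.1, r * c.2))) <=
    M * A + \int[leb2]_(x in W') (`|u x| * `|Ddir v (fun x => chi x * kappa x) x|).
Proof.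
move=> schi supp_chi chi01.
have cchi := smooth_continuous schi.
pose N := \int[leb2]_(x in W') uv v x ^+ 2.
have N0 : 0 <= N by apply: Rintegral_ge0 => x _; exact: sqr_ge0.
(* From [(p + q)^2 <= 2 p^2 + 2 q^2] in [energy], with [n] so large that the integral of
   [gv v n ^+ 2] is at most 1. *)
exists (Num.sqrt (2 * N + 2)); first exact: sqrtr_ge0.
move=> kappa A sk k0 A0 kA.
have ck := smooth_continuous sk.
pose th x := chi x * kappa x.
have sth : smooth th by exact: smoothM.
have cth := smooth_continuous sth.
have cDth := smooth_continuous (Ddir_smooth v sth).
have th0 x : 0 <= th x by rewrite mulr_ge0//; case/andP: (chi01 x).
have suppth : square_supported dl th.
  by move=> x; rewrite mulf_eq0 negb_or => /andP[/supp_chi].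
pose E1 n := \int[leb2]_(x in W') `|(U n x - u x) * Ddir v th x|.
pose E3 n := \int[mu]_(r in I) `|(U n (r * c.1, r * c.2) - tc r) * th (r * c.1, r * c.2)|.
have sUu n : sqint leb2 W' (fun x => U n x - u x).
  by apply: sqintB => //; exact: cont_sqint.
have sUt n : sqint mu I (fun r => U n (r * c.1, r * c.2) - tc r).
  by apply: sqintB => //; exact: sray.
have E1_0 : E1 @ \oo --> (0 : R) by apply: Rintegral_mul_cvg0 => //; exact: cont_sqint.
have E3_0 : E3 @ \oo --> (0 : R) by apply: Rintegral_mul_cvg0 => //; exact: sray.
have [n0 _ Hn0] : \forall n \near \oo, \int[leb2]_(x in W') gv v n x ^+ 2 <= 1.
  by have /cvgr_le := gv_0 v; apply; exact: ltr01.
rewrite -subr_le0; apply: (@cvg0_le0 _ _ (fun n => D * E3 (n + n0)%N + E1 (n + n0)%N)).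
  by rewrite (cvg_shiftn n0 (fun n => D * E3 n + E1 n)); apply: cvg0D => //; exact: cvg0Z.
move=> m; set n := (m + n0)%N.
have gn1 : \int[leb2]_(x in W') gv v n x ^+ 2 <= 1 by apply: Hn0; rewrite /= leq_addl.
set M := Num.sqrt _.
set G := Ddir v (U n).
have cG : continuous G := @cDU v n.
have chi_sq x : Num.sqrt (chi x) ^+ 2 = chi x by rewrite sqr_sqrtr//; case/andP: (chi01 x).
have csq : continuous (fun x => Num.sqrt (chi x)).
  by move=> x; apply: continuous_comp; [exact: cchi|exact: sqrt_continuous].
have i1 := sqint_mul mW (sUu n) (cont_sqint cDth).
have i3 := sqint_mul mI (sUt n) (sray cth).
have i4 := sqint_mul mI (sqint_norm mI stc) (sray cth).
have i6 := sqint_mul mW (sqint_norm mW su) (sqint_norm mW (cont_sqint cDth)).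
have Gk : \int[leb2]_(x in W') `|G x * Num.sqrt (chi x) * (kappa x * Num.sqrt (chi x))| <= M * A.
  apply: Rintegral_le_CauchySchwarz => //.
  - by rewrite sqrtr_ge0.
  - by apply: cont_sqint => x; apply: cvgM; [exact: cG|exact: csq].
  - by apply: cont_sqint => x; apply: cvgM; [exact: ck|exact: csq].
  - under eq_Rintegral => x _ do rewrite exprMn chi_sq.
    rewrite sqr_sqrtr; last by rewrite addr_ge0// mulr_ge0.
    apply: (le_trans (energy n schi supp_chi chi01)).
    apply: (@le_trans _ _ (2 * N + 2 * \int[leb2]_(x in W') gv v n x ^+ 2)); last first.
      by rewrite lerD2l; lra.
    have iu := (suv v).2; have ig := (sgv v n).2.
    rewrite /N -!RintegralZl// -RintegralD//; [|exact: rintegrableZ|exact: rintegrableZ].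
    apply: le_Rintegral => //; first exact: (sqintD mW (suv v) (sgv v n)).2.
      by apply: rintegrableD => //; exact: rintegrableZ.
    move=> x _; move: (uv v x) (gv v n x) => p q.
    by have := sqr_ge0 (p - q); nra.
  - by under eq_Rintegral => x _ do rewrite exprMn chi_sq.
have T := tr (smoothM (sU n) sth) (UM_supported suppth).
have cUth : continuous (fun x => U n x * th x) by move=> x; apply: cvgM; [exact: cU|exact: cth].
have i7 : rintegrable mu I (fun r => `|U n (r * c.1, r * c.2) * th (r * c.1, r * c.2)|).
  exact: rintegrable_norm (continuous_ray_integrable rho c cUth).
have step1 : \int[mu]_(r in I) (`|tc r| * th (r * c.1, r * c.2)) <=
    \int[mu]_(r in I) `|U n (r * c.1, r * c.2) * th (r * c.1, r * c.2)| + E3 n.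
  rewrite /E3 -RintegralD//; last exact: rintegrable_norm.
  apply: le_Rintegral => //; first by apply: rintegrableD => //; exact: rintegrable_norm.
  move=> r _; rewrite [X in _ <= X + _]normrM [X in _ <= _ + X]normrM.
  rewrite (ger0_norm (th0 _)) -mulrDl; apply: ler_wpM2r; first exact: th0.
  have := ler_normB (U n (r * c.1, r * c.2)) (U n (r * c.1, r * c.2) - tc r).
  by rewrite opprB addrC subrK.
have i8 : rintegrable leb2 W' (fun x => `|G x * Num.sqrt (chi x) * (kappa x * Num.sqrt (chi x))|).
  apply: rintegrable_norm; apply: (continuous_rintegrable mW W_bounded) => x.
  by apply: cvgM; apply: cvgM; by [exact: cG|exact: csq|exact: ck].
have step2 : \int[leb2]_(x in W') `|Ddir v (fun x => U n x * th x) x| <=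
    M * A + (\int[leb2]_(x in W') (`|u x| * `|Ddir v th x|) + E1 n).
  apply: (le_trans _ (lerD Gk (lexx _))).
  rewrite /E1 -!RintegralD//; [|exact: rintegrableD i6 (rintegrable_norm i1)|exact: rintegrable_norm].
  apply: le_Rintegral => //.
  - apply: rintegrable_norm; apply: (continuous_rintegrable mW W_bounded).
    by apply: smooth_continuous; apply: Ddir_smooth; exact: smoothM.
  - by apply: rintegrableD => //; apply: rintegrableD => //; exact: rintegrable_norm.
  move=> x _; rewrite DdirM// -/G.
  have -> : G x * Num.sqrt (chi x) * (kappa x * Num.sqrt (chi x)) = G x * th x.
    rewrite /th; have := chi_sq x.
    by move: (Num.sqrt (chi x)) => s; move: (chi x) => y <-; ring.
  rewrite addrC; apply: (le_trans (ler_normD _ _)); rewrite lerD2l.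
  rewrite [X in X <= _]normrM [X in _ <= _ + X]normrM -mulrDl; apply: ler_wpM2r => //.
  have := ler_normD (u x) (U n x - u x).
  by rewrite addrC subrK.
have := le_trans T step2.
have : D * \int[mu]_(r in I) (`|tc r| * th (r * c.1, r * c.2)) <=
  D * (\int[mu]_(r in I) `|U n (r * c.1, r * c.2) * th (r * c.1, r * c.2)| + E3 n).
  by apply: ler_wpM2l => //; exact: ltW D0.
rewrite mulrDr /th.
set Y1 := D * _ ; set Y2 := D * _; set Y3 := D * _; set Y4 := \int[_]_(x in _) _.
by lra.
Qed.

End side.

End approximable_traces.

Lemma integral_expR_halfline {R : realType} (k : R) : 0 < k ->
  (\int[@lebesgue_measure R]_(t in `]0%R, +oo[) (expR (- k * t))%:E = k^-1%:E)%E.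
Proof.
move=> k0; have mf : measurable_fun setT (fun t : R => (expR (- k * t))).
  by apply: measurableT_comp => //; exact: measurable_funM.
rewrite integral_itv_obnd_cbnd; last first.
  by apply: measurable_funTS; exact/measurable_EFinP.
have := integral_exponential_pdf k0.
have -> : (fun x : R => (exponential_pdf k x)%:E) =
    (fun t : R => (k%:E * (expR (- k * t))%:E)%E) \_ `[0%R, +oo[.
  by apply/funext => t; rewrite /exponential_pdf /patch; case: ifP.
rewrite -integral_mkcond ge0_integralZl_EFin//; last 2 first.
- by apply: measurable_funTS; exact/measurable_EFinP.
- exact: ltW.
set X := (\int[_]_(_ in _) _)%E => E.
have -> : X = (k^-1%:E * (k%:E * X))%E by rewrite muleA -EFinM mulVf ?mul1e// gt_eqF.
by rewrite E mule1.
Qed.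

(** * Oscillating exponentials *)

Section corner_exponentials.
Context {R : realType}.
Local Notation mu := (@lebesgue_measure R).
Local Notation plane := (measurableTypeR R * measurableTypeR R)%type.
Variables (a b : R * R).
Hypothesis a_unit : a.1 ^+ 2 + a.2 ^+ 2 = 1.
Hypothesis b_unit : b.1 ^+ 2 + b.2 ^+ 2 = 1.
Hypothesis D0 : 0 < a.1 * b.2 - a.2 * b.1.
Let D := a.1 * b.2 - a.2 * b.1.
(** As [a] and [b] are unit vectors, [p.a = p.b = c]: the exponential decays at the same rate along
    both sides. *)
Let p : R * R := (a.1 + b.1, a.2 + b.2).
Let c := 1 + (a.1 * b.1 + a.2 * b.2).

(** Lagrange's identity gives [(a.b)^2 + D^2 = 1], and [D > 0] excludes [a.b = -1]. *)
Lemma corner_c_gt0 : 0 < 1 + (a.1 * b.1 + a.2 * b.2).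
Proof.
have := a_unit; have := b_unit; have := D0.
move: (a.1) (a.2) (b.1) (b.2) => x y z w d0 e1 e2.
have E : (x * z + y * w) ^+ 2 + (x * w - y * z) ^+ 2 = 1.
  have -> : (x * z + y * w) ^+ 2 + (x * w - y * z) ^+ 2 =
    (x ^+ 2 + y ^+ 2) * (z ^+ 2 + w ^+ 2) by ring.
  by rewrite e1 e2 mulr1.
have : 0 < (x * w - y * z) ^+ 2 by rewrite exprn_gt0.
move: E; move: (x * z + y * w) ((x * w - y * z) ^+ 2) => u v uv v0.
by nra.
Qed.

(** Both sides are [|p|^2]: up to sign, [c] and [D] are the components of [p] along and across
    [a]. *)
Lemma corner_cD : (1 + (a.1 * b.1 + a.2 * b.2)) ^+ 2 + D ^+ 2 = 2 * c.
Proof.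
rewrite /D /c; have := a_unit; have := b_unit.
move: (a.1) (a.2) (b.1) (b.2) => x y z w e1 e2.
have -> : (1 + (x * z + y * w)) ^+ 2 + (x * w - y * z) ^+ 2 =
  (x ^+ 2 + y ^+ 2) * (z ^+ 2 + w ^+ 2) + 1 + 2 * (x * z + y * w) by ring.
by rewrite e1 e2; ring.
Qed.

(** The [+ 0] gives the argument the affine shape that [Ck_affine] and [is_derive_affine] expect. *)
Definition kap (s : R) (x : R * R) : R :=
  expR (- s * p.1 * x.1 + - s * p.2 * x.2 + 0).

(** On the complex plane, the real part of the holomorphic function [exp (- s conj(p) z)];
    [corner_phi'] is minus its imaginary part. The span of the two is closed under partial
    derivatives. *)
Definition corner_phi (s : R) (x : R * R) : R :=
  kap s x * cos (- s * p.2 * x.1 + s * p.1 * x.2 + 0).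

Definition corner_phi' (s : R) (x : R * R) : R :=
  kap s x * sin (- s * p.2 * x.1 + s * p.1 * x.2 + 0).

Lemma kap_smooth s : smooth (kap s).
Proof. by move=> n; apply: Ck_affine; exact: Cn_expR. Qed.

Lemma corner_phi_smooth s : smooth (corner_phi s).
Proof.
apply: smoothM; first exact: kap_smooth.
by move=> n; apply: Ck_affine; exact: Cn_cos.
Qed.

Lemma corner_phi'_smooth s : smooth (corner_phi' s).
Proof.
apply: smoothM; first exact: kap_smooth.
by move=> n; apply: Ck_affine; exact: Cn_sin.
Qed.

Let derive_val_of (f : R * R -> R) x e l : is_derive x e f l -> 'D_e f x = l.
Proof. by case. Qed.

Let e1or : @e1 R = e1 \/ @e1 R = e2. Proof. by left. Qed.
Let e2or : @e2 R = e1 \/ @e2 R = e2. Proof. by right. Qed.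

Lemma kap_partial s x : 'D_e1 (kap s) x = - s * p.1 * kap s x /\
  'D_e2 (kap s) x = - s * p.2 * kap s x.
Proof.
have H e := derive_val_of (is_derive_affine e (is_derive_expR
  (- s * p.1 * x.1 + - s * p.2 * x.2 + 0))).
by rewrite /kap !H /=; split; ring.
Qed.

Let cos_partial s x : 'D_e1 (fun x => cos (- s * p.2 * x.1 + s * p.1 * x.2 + 0)) x =
    s * p.2 * sin (- s * p.2 * x.1 + s * p.1 * x.2 + 0) /\
  'D_e2 (fun x => cos (- s * p.2 * x.1 + s * p.1 * x.2 + 0)) x =
    - s * p.1 * sin (- s * p.2 * x.1 + s * p.1 * x.2 + 0).
Proof.
have H e := derive_val_of (is_derive_affine e (is_derive_cos
  (- s * p.2 * x.1 + s * p.1 * x.2 + 0))).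
by rewrite !H /=; split; ring.
Qed.

Let sin_partial s x : 'D_e1 (fun x => sin (- s * p.2 * x.1 + s * p.1 * x.2 + 0)) x =
    - s * p.2 * cos (- s * p.2 * x.1 + s * p.1 * x.2 + 0) /\
  'D_e2 (fun x => sin (- s * p.2 * x.1 + s * p.1 * x.2 + 0)) x =
    s * p.1 * cos (- s * p.2 * x.1 + s * p.1 * x.2 + 0).
Proof.
have H e := derive_val_of (is_derive_affine e (is_derive_sin
  (- s * p.2 * x.1 + s * p.1 * x.2 + 0))).
by rewrite !H /=; split; ring.
Qed.

Let cos_smooth s : smooth (fun x : R * R => cos (- s * p.2 * x.1 + s * p.1 * x.2 + 0)).
Proof. by move=> n; apply: Ck_affine; exact: Cn_cos. Qed.

Let sin_smooth s : smooth (fun x : R * R => sin (- s * p.2 * x.1 + s * p.1 * x.2 + 0)).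
Proof. by move=> n; apply: Ck_affine; exact: Cn_sin. Qed.

Lemma corner_phi_partial s x :
  'D_e1 (corner_phi s) x = s * (- p.1 * corner_phi s x + p.2 * corner_phi' s x) /\
  'D_e2 (corner_phi s) x = s * (- p.2 * corner_phi s x - p.1 * corner_phi' s x).
Proof.
have [k1 k2] := kap_partial s x; have [c1 c2] := cos_partial s x.
split; rewrite (smooth_partialM x _ (kap_smooth s) (cos_smooth s))//
  ?k1 ?k2 ?c1 ?c2 /corner_phi /corner_phi'; ring.
Qed.

Lemma corner_phi'_partial s x :
  'D_e1 (corner_phi' s) x = s * (- p.1 * corner_phi' s x - p.2 * corner_phi s x) /\
  'D_e2 (corner_phi' s) x = s * (- p.2 * corner_phi' s x + p.1 * corner_phi s x).
Proof.
have [k1 k2] := kap_partial s x; have [c1 c2] := sin_partial s x.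
split; rewrite (smooth_partialM x _ (kap_smooth s) (sin_smooth s))//
  ?k1 ?k2 ?c1 ?c2 /corner_phi /corner_phi'; ring.
Qed.

Lemma corner_phi_harmonic s x :
  'D_e1 (fun y => 'D_e1 (corner_phi s) y) x +
  'D_e2 (fun y => 'D_e2 (corner_phi s) y) x = 0.
Proof.
have lin e (al be : R) : e = e1 \/ e = e2 ->
    'D_e (fun y => al * corner_phi s y + be * corner_phi' s y) x =
    al * 'D_e (corner_phi s) x + be * 'D_e (corner_phi' s) x.
  move=> ee.
  rewrite (smooth_partialD x ee (smoothZ al (corner_phi_smooth s))
    (smoothZ be (corner_phi'_smooth s))).
  rewrite (smooth_partialM x ee (smooth_cst al) (corner_phi_smooth s)).
  rewrite (smooth_partialM x ee (smooth_cst be) (corner_phi'_smooth s)).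
  by rewrite !derive_cst; ring.
have E1 : (fun y => 'D_e1 (corner_phi s) y) = (fun y => - s * p.1 * corner_phi s y +
    s * p.2 * corner_phi' s y).
  by apply/funext => y; have [-> _] := corner_phi_partial s y; ring.
have E2 : (fun y => 'D_e2 (corner_phi s) y) = (fun y => - s * p.2 * corner_phi s y +
    - s * p.1 * corner_phi' s y).
  by apply/funext => y; have [_ ->] := corner_phi_partial s y; ring.
rewrite E1 E2 (lin e1 _ _ e1or) (lin e2 _ _ e2or).
have [-> ->] := corner_phi_partial s x; have [-> ->] := corner_phi'_partial s x.
by ring.
Qed.

Lemma kap_gt0 s x : 0 < kap s x. Proof. exact: expR_gt0. Qed.

Lemma kapM s t x : kap s x * kap t x = kap (s + t) x.
Proof. by rewrite /kap -expRD; congr expR; ring. Qed.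

Lemma corner_phi_le s x : `|corner_phi s x| <= kap s x.
Proof.
rewrite normrM (gtr0_norm (kap_gt0 _ _)) ler_piMr ?(ltW (kap_gt0 _ _))//.
by rewrite ler_norml cos_geN1 cos_le1.
Qed.

Lemma corner_phi'_le s x : `|corner_phi' s x| <= kap s x.
Proof.
rewrite normrM (gtr0_norm (kap_gt0 _ _)) ler_piMr ?(ltW (kap_gt0 _ _))//.
by rewrite ler_norml sin_geN1 sin_le1.
Qed.

Lemma kap_wpt s r t : kap s (wpt a b r t) = expR (- (s * c) * r) * expR (- (s * c) * t).
Proof.
rewrite /kap -expRD; congr expR; rewrite /wpt /c /=.
have := a_unit; have := b_unit; move: (a.1) (a.2) (b.1) (b.2) => x y z w e1 e2.
have -> : - s * (x + z) * (r * x + t * z) + - s * (y + w) * (r * y + t * w) + 0 =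
  - s * (r * (x ^+ 2 + y ^+ 2) + t * (z ^+ 2 + w ^+ 2) + (r + t) * (x * z + y * w)) by ring.
by rewrite e1 e2; ring.
Qed.

(** The phase is [- s D r] on this side and [s D r] on the other. The cosine is even, so both sides
    carry the same function. *)
Lemma corner_phi_ray_a s r : corner_phi s (r * a.1, r * a.2) =
  expR (- (s * c) * r) * cos (s * D * r).
Proof.
have -> : (r * a.1, r * a.2) = wpt a b r 0 by rewrite /wpt !mul0r !addr0.
rewrite /corner_phi kap_wpt mulr0 expR0 mulr1; congr (_ * _).
by rewrite -[in RHS]cosN; congr cos; rewrite /wpt /D /=; ring.
Qed.

Lemma corner_phi_ray_b s r : corner_phi s (r * b.1, r * b.2) =
  expR (- (s * c) * r) * cos (s * D * r).
Proof.
have -> : (r * b.1, r * b.2) = wpt a b 0 r by rewrite /wpt !mul0r !add0r.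
rewrite /corner_phi kap_wpt mulr0 expR0 mul1r; congr (_ * _).
by congr cos; rewrite /wpt /D /=; ring.
Qed.

Lemma kap_decr s t x : wedge a b x -> s <= t -> kap t x <= kap s x.
Proof.
rewrite (wptE D0 x) => /(wedge_wpt D0)[r0 t0] st.
rewrite !kap_wpt; have := corner_c_gt0; rewrite -/c => c0.
have sc : - (t * c) <= - (s * c) by rewrite lerN2; apply: ler_wpM2r => //; exact: ltW.
by apply: ler_pM; rewrite ?expR_ge0// ler_expR; apply: ler_wpM2r => //; exact: ltW.
Qed.

(** In wedge coordinates the integral is a product of two exponential integrals, each [1 / (s c)]. A
    mass of order [s^-2] means an L^2 norm of [kap s] of order [1 / s]. *)
Lemma integral_kap (W : set plane) s : measurable W -> W `<=` wedge a b -> 0 < s ->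
  rintegrable leb2 W (kap s) /\
  \int[leb2]_(x in W) kap s x <= D / c ^+ 2 / s ^+ 2.
Proof.
move=> mW WS s0; have := corner_c_gt0; rewrite -/c => c0.
have sc0 : 0 < s * c by exact: mulr_gt0.
have mk (A : set plane) : measurable_fun A (kap s).
  by apply: continuous_measurable2; exact: smooth_continuous (kap_smooth s).
have mke (A : set plane) : measurable_fun A (EFin \o kap s) by exact/measurable_EFinP.
have k0 x : (0 <= (kap s x)%:E)%E by rewrite lee_fin ltW// kap_gt0.
have E : (\int[leb2]_(x in (wedge a b : set plane)) (kap s x)%:E =
    (D / c ^+ 2 / s ^+ 2)%:E)%E.
  have [-> _] := ge0_integral_wedge D0 (mke _) k0; rewrite -/D.
  under eq_integral => r _.
    under eq_integral => t _ do rewrite /= kap_wpt EFinM.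
    rewrite ge0_integralZl_EFin//; last first.
      apply: measurable_funTS; apply/measurable_EFinP.
      by apply: measurableT_comp => //; exact: measurable_funM.
    rewrite integral_expR_halfline// muleC; over.
  rewrite ge0_integralZl_EFin//; last 2 first.
  - apply: measurable_funTS; apply/measurable_EFinP.
    by apply: measurableT_comp => //; exact: measurable_funM.
  - by rewrite invr_ge0 ltW.
  rewrite integral_expR_halfline// -!EFinM; congr EFin; field.
  by rewrite !gt_eqF.
have le : (\int[leb2]_(x in W) (kap s x)%:E <= (D / c ^+ 2 / s ^+ 2)%:E)%E.
  by rewrite -E; apply: ge0_subset_integral => //; exact: measurable_wedge.
have iW : rintegrable leb2 W (kap s).
  apply/integrableP; split=> //; apply: le_lt_trans (ltry (D / c ^+ 2 / s ^+ 2)).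
  rewrite (_ : (fun x => _) = (fun x => (kap s x)%:E)); first exact: le.
  by apply/funext => x; rewrite gee0_abs//; exact: k0.
split=> //; rewrite -lee_fin /Rintegral fineK//.
exact: integrable_fin_num.
Qed.

(* [y <= 2 exp (y / 2)] for [y >= 0], with [y = s c (r + t)]. *)
Lemma kap_lin s x : 0 < s -> wedge a b x ->
  (`|x.1| + `|x.2|) * kap s x <= 4 / (c * s) * kap (s / 2) x.
Proof.
move=> s0; have := corner_c_gt0; rewrite -/c => c0.
suff gen r t : 0 < r -> 0 < t ->
    (`|(wpt a b r t).1| + `|(wpt a b r t).2|) * kap s (wpt a b r t) <=
    4 / (c * s) * kap (s / 2) (wpt a b r t).
  by rewrite (wptE D0 x) => /(wedge_wpt D0)[r0 t0]; exact: gen.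
move=> r0 t0.
have aux (y z : R) : y ^+ 2 + z ^+ 2 = 1 -> `|y| <= 1 /\ `|z| <= 1.
  by move=> yz; split; rewrite ler_norml; apply/andP; split; nra.
have [A1 A2] := aux _ _ a_unit; have [B1 B2] := aux _ _ b_unit.
have le (y z : R) : `|y| <= 1 -> `|z| <= 1 -> `|r * y + t * z| <= r + t.
  move=> y1 z1; apply: (le_trans (ler_normD _ _)); rewrite !normrM.
  by rewrite (gtr0_norm r0) (gtr0_norm t0); apply: lerD; rewrite ler_piMr// ltW.
have x1 := le _ _ A1 B1; have x2 := le _ _ A2 B2.
have ks : kap s (wpt a b r t) = kap (s / 2) (wpt a b r t) * kap (s / 2) (wpt a b r t).
  by rewrite kapM -splitr.
rewrite ks mulrA; apply: ler_wpM2r; first exact: ltW (kap_gt0 _ _).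
apply: (@le_trans _ _ (2 * (r + t) * kap (s / 2) (wpt a b r t))).
  apply: ler_wpM2r; first exact: ltW (kap_gt0 _ _).
  by have := lerD x1 x2; rewrite /wpt /=; lra.
rewrite kap_wpt -expRD -mulrDr.
set y := s / 2 * c * (r + t).
have y0 : 0 < y by rewrite /y !mulr_gt0// ?divr_gt0// addr_gt0.
have -> : - (s / 2 * c) * (r + t) = - y by rewrite /y; ring.
rewrite expRN ler_pdivrMr ?expR_gt0//.
apply: (@le_trans _ _ (4 / (c * s) * (1 + y))).
  rewrite (_ : 2 * (r + t) = 4 / (c * s) * y).
    apply: ler_wpM2l; last by rewrite lerDr.
    by rewrite divr_ge0// mulr_ge0// ltW.
  by rewrite /y; field; rewrite !gt_eqF.
by rewrite ler_wpM2l ?expR_ge1Dx// divr_ge0// mulr_ge0// ltW.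
Qed.

End corner_exponentials.

Section corner_oscillation.
Context {R : realType}.
Local Notation mu := (@lebesgue_measure R).
Local Notation plane := (measurableTypeR R * measurableTypeR R)%type.
Variables (a b : R * R) (W : set (R * R)) (dl bd rho : R).
Hypothesis a_unit : a.1 ^+ 2 + a.2 ^+ 2 = 1.
Hypothesis b_unit : b.1 ^+ 2 + b.2 ^+ 2 = 1.
Hypothesis D0 : 0 < a.1 * b.2 - a.2 * b.1.
Hypothesis dl0 : 0 < dl.
Hypothesis mW : measurable (W : set plane).
Hypothesis W_wedge : W `<=` wedge a b.
Hypothesis wedge_W : wedge a b `&` in_square dl `<=` W.
Hypothesis W_bounded : W `<=` in_square bd.
Hypothesis rho_a : forall r, rho <= r -> ~ in_square dl (r * a.1, r * a.2).
Hypothesis rho_b : forall r, rho <= r -> ~ in_square dl (r * b.1, r * b.2).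
Let D := a.1 * b.2 - a.2 * b.1.
Let c := 1 + (a.1 * b.1 + a.2 * b.2).
Local Notation W' := (W : set plane).
Let I : set (measurableTypeR R) := `]0%R, rho[%classic.
Let chi := square_bump dl.
Let K := D / c ^+ 2.

Let cont_sqint := continuous_sqint mW W_bounded.
Let c0 : 0 < c := corner_c_gt0 a_unit b_unit D0.
Let K0 : 0 < K. Proof. by rewrite divr_gt0// exprn_gt0. Qed.

Let ckap s : continuous (kap a b s) := @smooth_continuous _ _ (kap_smooth a b s).
Let skap s : sqint leb2 W' (kap a b s) := cont_sqint (@ckap s).

Let kap2 s x : kap a b s x ^+ 2 = kap a b (2 * s) x.
Proof. by rewrite expr2 kapM; congr (kap a b _ x); rewrite mulrDl mul1r. Qed.

(** The mass of [kap (2 * s)] is at most [K / (4 s^2)]; the cruder bound is already a square, which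
    spares a square root of [K] in Cauchy-Schwarz. *)
Lemma integral_kap2 s : 0 < s ->
  \int[leb2]_(x in W') kap a b s x ^+ 2 <= ((1 + K) / s) ^+ 2.
Proof.
move=> s0; under eq_Rintegral => x _ do rewrite kap2.
have s20 : 0 < 2 * s by rewrite mulr_gt0.
have [_ +] := integral_kap a_unit b_unit D0 mW W_wedge s20; rewrite -/D -/c -/K.
move=> /le_trans; apply.
rewrite (_ : K / (2 * s) ^+ 2 = K / 4 * (s ^+ 2)^-1); last by field; rewrite gt_eqF.
rewrite expr_div_n ler_pM2r ?invr_gt0 ?exprn_gt0//.
by move: K K0 => k k0; nra.
Qed.

Lemma integral_mul_kap (F : R * R -> R) (B s : R) : 0 <= B -> 0 < s ->
  sqint leb2 W' F -> \int[leb2]_(x in W') F x ^+ 2 <= B ^+ 2 ->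
  \int[leb2]_(x in W') (`|F x| * kap a b s x) <= B * ((1 + K) / s).
Proof.
move=> B0 s0 sF FB.
have -> : \int[leb2]_(x in W') (`|F x| * kap a b s x) =
    \int[leb2]_(x in W') `|F x * kap a b s x|.
  by apply: eq_Rintegral => x _; rewrite normrM (gtr0_norm (kap_gt0 _ _ _ _)).
apply: (Rintegral_le_CauchySchwarz mW B0 _ sF (skap s) FB (integral_kap2 s0)).
by rewrite divr_ge0 ?ltW// addr_gt0.
Qed.

(** Cauchy-Schwarz with [kap s] gives a bounded quantity only. Writing [kap s] as the square of
    [kap (s / 2)] and leaving one factor with [F] gains the rest: the square of [F * kap (s / 2)] is
    [F ^+ 2 * kap s], whose integral tends to 0 by dominated convergence. Monotonicity in [s] passes
    from integers to reals. *)
Lemma kap_littleo (F : R * R -> R) (e : R) : sqint leb2 W' F -> 0 < e ->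
  exists2 s0, 0 < s0 & forall s, s0 <= s ->
    s * \int[leb2]_(x in W') (`|F x| * kap a b s x) <= e.
Proof.
move=> sF e0.
have iF2 := sF.2.
have mF2 : measurable_fun W' (fun x => F x ^+ 2) := rintegrable_measurable iF2.
have mk s : measurable_fun W' (kap a b s) by case: (skap s).
pose G n := \int[leb2]_(x in W') (F x ^+ 2 * kap a b n.+1%:R x).
have kap_le1 s x : W x -> 0 <= s -> kap a b s x <= 1.
  move=> Wx s0; have := kap_decr a_unit b_unit D0 (W_wedge Wx) s0.
  by rewrite {2}/kap oppr0 !mul0r !addr0 expR0.
have Fk0 s x : 0 <= F x ^+ 2 * kap a b s x := mulr_ge0 (sqr_ge0 _) (ltW (kap_gt0 _ _ _ _)).
have iFk s : 0 <= s -> rintegrable leb2 W' (fun x => F x ^+ 2 * kap a b s x).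
  move=> s0; apply: (le_rintegrable mW _ iF2); first exact: measurable_funM.
  move=> x Wx; rewrite (ger0_norm (Fk0 _ _)).
  by apply: ler_piMr; [exact: sqr_ge0|exact: kap_le1].
have G0 : G @ \oo --> (0 : R).
  have -> : (0 : R) = \int[leb2]_(x in W') (fun=> 0) x.
    by rewrite /Rintegral integral0.
  apply: (@Rintegral_dominated_cvg _ _ _ leb2 W' mW _ _ (fun x => F x ^+ 2)) => //.
  - by move=> n; exact: measurable_funM.
  - move=> x Wx; rewrite -[X in _ --> X](mulr0 (F x ^+ 2)); apply: cvgM; first exact: cvg_cst.
    have := W_wedge Wx; rewrite (wptE D0 x) => /(wedge_wpt D0)[r0 t0].
    set r := (_ / _) in r0 *; set t := (_ / _) in t0 *.
    have -> : (fun n : nat => kap a b n.+1%:R (wpt a b r t)) =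
        (fun n : nat => expR (- (c * (r + t))) ^+ n.+1).
      apply/funext => n; rewrite kap_wpt// -expRD -expRM_natl; congr expR.
      by rewrite /c; ring.
    rewrite (cvg_shiftS (fun n => expR (- (c * (r + t))) ^+ n)).
    apply: cvg_expr; rewrite ger0_norm ?expR_ge0// -expR0 ltr_expR oppr_lt0.
    by rewrite mulr_gt0// addr_gt0.
  - move=> n x Wx; rewrite (ger0_norm (Fk0 _ _)).
    by apply: ler_piMr; [exact: sqr_ge0|exact: kap_le1].
have K1 : 0 < 1 + K by rewrite addr_gt0.
(* Chosen so that [e' * ((1 + K) / (s / 2)) = e / s]. *)
pose e' := e / (2 * (1 + K)).
have e'0 : 0 < e' by rewrite divr_gt0// mulr_gt0.
have [n Gn] : exists n, G n <= e' ^+ 2.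
  have /cvgr_le/(_ (e' ^+ 2)) := G0.
  by rewrite exprn_gt0// => /(_ isT)[n _ H]; exists n; apply: H => /=.
exists n.+1%:R => // s ns.
have s0 : 0 < s by apply: lt_le_trans ns.
have s20 : 0 < s / 2 by rewrite divr_gt0.
have sFk : sqint leb2 W' (fun x => F x * kap a b (s / 2) x).
  exact: (sqint_bdmeas mW sF (continuous_bdmeas W_bounded (@ckap _))).
have Fk2 x : (F x * kap a b (s / 2) x) ^+ 2 = F x ^+ 2 * kap a b s x.
  by rewrite exprMn kap2 (_ : 2 * (s / 2) = s)//; field.
have FB : \int[leb2]_(x in W') (F x * kap a b (s / 2) x) ^+ 2 <= e' ^+ 2.
  under eq_Rintegral => x _ do rewrite Fk2.
  apply: le_trans Gn; apply: le_Rintegral => //; [exact: iFk (ltW s0)|exact: iFk|].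
  move=> x Wx; apply: ler_wpM2l; first exact: sqr_ge0.
  exact: kap_decr (W_wedge Wx) ns.
have := integral_mul_kap (ltW e'0) s20 sFk FB.
under eq_Rintegral => x _.
  rewrite normrM (gtr0_norm (kap_gt0 _ _ _ _)) -mulrA kapM -splitr; over.
move=> H; rewrite mulrC -ler_pdivlMr//; apply: (le_trans H).
rewrite (_ : e' * ((1 + K) / (s / 2)) = e / s)// /e'.
by field; rewrite !gt_eqF.
Qed.

Let e1or : @e1 R = e1 \/ @e1 R = e2. Proof. by left. Qed.
Let e2or : @e2 R = e1 \/ @e2 R = e2. Proof. by right. Qed.
Let schi : smooth chi. Proof. exact: square_bump_smooth. Qed.
Let supp_chi : square_supported dl chi. Proof. exact: square_bump_supported. Qed.
Let schie e : e = e1 \/ e = e2 -> smooth (fun x => 'D_e chi x).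
Proof. by move=> ee; exact: smooth_partial. Qed.
Let supp_chie e : e = e1 \/ e = e2 -> square_supported dl (fun x => 'D_e chi x).
Proof. by move=> ee; exact: supported_partial. Qed.

Let suppM (F G : R * R -> R) : square_supported dl F ->
  square_supported dl (fun x => F x * G x).
Proof. by move=> sF x; rewrite mulf_eq0 negb_or => /andP[/sF]. Qed.

Definition corner_psi s x := chi x * corner_phi a b s x.

Lemma corner_psi_smooth s : smooth (corner_psi s).
Proof. by apply: smoothM => //; exact: corner_phi_smooth. Qed.

Lemma corner_psi_supported s : square_supported dl (corner_psi s).
Proof. exact: suppM. Qed.

(** [k] is to be the cutoff and [p] the exponential. The last two lines are differences of
    integrands of the zero-trace identity, tested with [k * p_i] and [k_i * p]; they integrate to 0
    and leave [p] without derivatives. *)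
Let green_pointwise (k k1 k2 p p1 p2 : R * R -> R) x (v v1 v2 f : R) :
  smooth k -> smooth p -> smooth k1 -> smooth k2 -> smooth p1 -> smooth p2 ->
  'D_e1 k x = k1 x -> 'D_e2 k x = k2 x -> 'D_e1 p x = p1 x -> 'D_e2 p x = p2 x ->
  'D_e1 p1 x + 'D_e2 p2 x = 0 ->
  v1 * 'D_e1 (fun y => k y * p y) x + v2 * 'D_e2 (fun y => k y * p y) x + f * (k x * p x) =
  (f * k x + 2 * (v1 * k1 x + v2 * k2 x) + (v * 'D_e1 k1 x + v * 'D_e2 k2 x)) * p x +
  ((v * 'D_e1 (fun y => k y * p1 y) x + v1 * (k x * p1 x)) -
   (v * 'D_e1 (fun y => k1 y * p y) x + v1 * (k1 x * p x))) +
  ((v * 'D_e2 (fun y => k y * p2 y) x + v2 * (k x * p2 x)) -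
   (v * 'D_e2 (fun y => k2 y * p y) x + v2 * (k2 x * p x))).
Proof.
move=> sk sp sk1 sk2 sp1 sp2 K1 K2 P1 P2 H.
rewrite !(smooth_partialM x e1or sk) ?(smooth_partialM x e2or sk)//.
rewrite (smooth_partialM x e1or sk1 sp) (smooth_partialM x e2or sk2 sp) K1 K2 P1 P2.
have -> : 'D_e2 p2 x = - 'D_e1 p1 x by apply/eqP; rewrite -addr_eq0 addrC; apply/eqP.
ring.
Qed.

Let Rintegral_combine (f f1 f2 g1 g2 : R * R -> R) :
  rintegrable leb2 W' f -> rintegrable leb2 W' f1 -> rintegrable leb2 W' f2 ->
  rintegrable leb2 W' g1 -> rintegrable leb2 W' g2 ->
  \int[leb2]_(x in W') f1 x = 0 -> \int[leb2]_(x in W') f2 x = 0 ->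
  \int[leb2]_(x in W') g1 x = 0 -> \int[leb2]_(x in W') g2 x = 0 ->
  \int[leb2]_(x in W') (f x + (f1 x - f2 x) + (g1 x - g2 x)) =
  \int[leb2]_(x in W') f x.
Proof.
move=> i i1 i2 j1 j2 F1 F2 G1 G2; have k1 := rintegrableB mW i1 i2; have k2 := rintegrableB mW j1 j2.
have k := rintegrableD mW i k1.
by rewrite (RintegralD mW k k2) (RintegralD mW i k1) (RintegralB mW i1 i2) (RintegralB mW j1 j2)
  F1 F2 G1 G2 !subr0 !addr0.
Qed.

(* Two integrations by parts against the derivatives of the cutoff remove
   every derivative of the harmonic exponential. *)
Lemma corner_pde_small (u u1 u2 F : R * R -> R) :
  sqint leb2 W' u -> sqint leb2 W' u1 -> sqint leb2 W' u2 -> sqint leb2 W' F ->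
  (forall psi, smooth psi -> square_supported dl psi ->
    \int[leb2]_(x in W') (u x * 'D_e1 psi x + u1 x * psi x) = 0) ->
  (forall psi, smooth psi -> square_supported dl psi ->
    \int[leb2]_(x in W') (u x * 'D_e2 psi x + u2 x * psi x) = 0) ->
  forall e, 0 < e -> exists2 s0, 0 < s0 & forall s, s0 <= s ->
    s * `|\int[leb2]_(x in W') (u1 x * 'D_e1 (corner_psi s) x +
      u2 x * 'D_e2 (corner_psi s) x + F x * corner_psi s x)| <= e.
Proof.
move=> su su1 su2 sF z1 z2 e e0.
pose chi1 x := 'D_e1 chi x; pose chi2 x := 'D_e2 chi x.
pose chi11 x := 'D_e1 chi1 x; pose chi22 x := 'D_e2 chi2 x.
have s1 : smooth chi1 by exact: schie.
have s2 : smooth chi2 by exact: schie.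
have s11 : smooth chi11 by exact: smooth_partial.
have s22 : smooth chi22 by exact: smooth_partial.
pose G x := F x * chi x + 2 * (u1 x * chi1 x + u2 x * chi2 x) +
  (u x * chi11 x + u x * chi22 x).
have bd_of f : smooth f -> bdmeas W' f.
  by move=> sf; exact: (continuous_bdmeas W_bounded (smooth_continuous sf)).
have sG : sqint leb2 W' G.
  apply: sqintD => //; last by apply: sqintD => //; apply: sqint_bdmeas => //; exact: bd_of.
  apply: sqintD => //; first by apply: sqint_bdmeas => //; exact: bd_of.
  by apply: sqintZ => //; apply: sqintD => //; apply: sqint_bdmeas => //; exact: bd_of.
have [s0 s00 Hs] := kap_littleo sG e0.
exists s0 => // s ss; apply: le_trans (Hs _ ss).
have sgt0 : 0 < s by exact: lt_le_trans ss.
apply: ler_wpM2l; first exact: ltW.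
set phi := corner_phi a b s.
have sphi : smooth phi by exact: corner_phi_smooth.
pose phi1 x := 'D_e1 phi x; pose phi2 x := 'D_e2 phi x.
have sp1 : smooth phi1 by exact: smooth_partial.
have sp2 : smooth phi2 by exact: smooth_partial.
have int2 (f g : R * R -> R) : sqint leb2 W' f -> smooth g -> rintegrable leb2 W' (fun x => f x * g x).
  by move=> sf sg; apply: sqint_mul => //; exact: cont_sqint (smooth_continuous sg).
have iz (f f' psi : R * R -> R) e' : e' = e1 \/ e' = e2 -> sqint leb2 W' f -> sqint leb2 W' f' ->
    smooth psi -> rintegrable leb2 W' (fun x => f x * 'D_e' psi x + f' x * psi x).
  move=> ee sf sf' sp; apply: rintegrableD => //; apply: int2 => //.
  exact: smooth_partial.
have Z1 := z1 _ (smoothM schi sp1) (suppM supp_chi).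
have Z1' := z1 _ (smoothM s1 sphi) (suppM (supp_chie e1or)).
have Z2 := z2 _ (smoothM schi sp2) (suppM supp_chi).
have Z2' := z2 _ (smoothM s2 sphi) (suppM (supp_chie e2or)).
have i1 := iz _ _ _ _ e1or su su1 (smoothM schi sp1).
have i1' := iz _ _ _ _ e1or su su1 (smoothM s1 sphi).
have i2 := iz _ _ _ _ e2or su su2 (smoothM schi sp2).
have i2' := iz _ _ _ _ e2or su su2 (smoothM s2 sphi).
have iG := int2 _ _ sG sphi.
have -> : \int[leb2]_(x in W') (u1 x * 'D_e1 (corner_psi s) x +
    u2 x * 'D_e2 (corner_psi s) x + F x * corner_psi s x) =
  \int[leb2]_(x in W') (G x * phi x).
  rewrite -(Rintegral_combine iG i1 i1' i2 i2' Z1 Z1' Z2 Z2').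
  apply: eq_Rintegral => x _.
  exact: (green_pointwise (u x) (u1 x) (u2 x) (F x) schi sphi s1 s2 sp1 sp2
      erefl erefl erefl erefl (corner_phi_harmonic a b s x)).
apply: (le_trans (le_normr_Rintegral mW iG)); apply: le_Rintegral => //.
- exact: rintegrable_norm.
- exact: sqint_mul (sqint_norm mW sG) (skap s).
- move=> x _; rewrite normrM ler_wpM2l//; exact: corner_phi_le.
Qed.

Lemma smooth_Ddir_bound (F : R * R -> R) v : smooth F ->
  exists2 M, 0 <= M & forall x, W x -> `|Ddir v F x| <= M.
Proof.
move=> sF; have [M M0 HM] := continuous_bounded_square bd
  (smooth_continuous (Ddir_smooth v sF)).
by exists M => // x /W_bounded; exact: HM.
Qed.

Let DdirM v (F G : R * R -> R) x : smooth F -> smooth G ->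
  Ddir v (fun y => F y * G y) x = F x * Ddir v G x + G x * Ddir v F x.
Proof.
move=> sF sG; rewrite /Ddir (smooth_partialM x e1or sF sG) (smooth_partialM x e2or sF sG).
by move: ('D_e1 F x) ('D_e1 G x) ('D_e2 F x) ('D_e2 G x) (F x) (G x) => *; ring.
Qed.

Let chi01 x : 0 <= chi x <= 1.
Proof. by rewrite square_bump_ge0 square_bump_le1. Qed.

Let cutoff_bound (d f q k s x M N : R) : 0 <= M -> 0 <= N -> 0 <= s -> 0 <= x <= 1 -> 0 <= k ->
  `|d| <= M -> `|f| <= k -> `|q| <= N * k -> `|d * f + s * x * q| <= (M + N) * (1 + s) * k.
Proof.
move=> M0 N0 s0 /andP[x0 x1] k0 dM fk qN.
apply: (le_trans (ler_normD _ _)); rewrite !normrM (ger0_norm s0) (ger0_norm x0).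
have T1 : `|d| * `|f| <= M * k by exact: ler_pM.
have T2 : s * x * `|q| <= s * (N * k).
  by rewrite -mulrA ler_wpM2l// -[leRHS]mul1r ler_pM.
apply: (le_trans (lerD T1 T2)).
rewrite (_ : M * _ + _ = (M + s * N) * k); last by ring.
by apply: ler_wpM2r => //; nra.
Qed.

(** Differentiating the cutoff costs a constant, differentiating the exponential a factor [s]. *)
Lemma Ddir_chi_kap v : exists2 M, 0 <= M & forall s x, 0 <= s -> W x ->
  `|Ddir v (fun y => chi y * kap a b s y) x| <= M * (1 + s) * kap a b s x.
Proof.
have [M M0 HM] := smooth_Ddir_bound v schi.
pose N := (`|v.1| + `|v.2|) * (`|a.1 + b.1| + `|a.2 + b.2|).
have N0 : 0 <= N by rewrite mulr_ge0// addr_ge0.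
exists (M + N); first exact: addr_ge0.
move=> s x s0 Wx.
have [k1 k2] := kap_partial a b s x.
have -> : Ddir v (fun y => chi y * kap a b s y) x = Ddir v chi x * kap a b s x +
  s * chi x * (- (v.1 * (a.1 + b.1) + v.2 * (a.2 + b.2)) * kap a b s x).
  by rewrite (DdirM v x schi (kap_smooth a b s)) {1}/Ddir k1 k2 /=; ring.
have k0 := kap_gt0 a b s x.
apply: (cutoff_bound M0 N0 s0 (chi01 x) (ltW k0) (HM _ Wx)); first by rewrite gtr0_norm.
rewrite normrM normrN (gtr0_norm k0); apply: ler_wpM2r; first exact: ltW.
apply: (le_trans (ler_normD _ _)); rewrite !normrM /N.
rewrite mulrDl; apply: lerD; apply: ler_wpM2l => //.
- by rewrite lerDl.
- by rewrite lerDr.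
Qed.

Lemma Ddir_psi v : exists2 M, 0 <= M & forall s x, 0 <= s -> W x ->
  `|Ddir v (corner_psi s) x| <= M * (1 + s) * kap a b s x.
Proof.
have [M M0 HM] := smooth_Ddir_bound v schi.
pose N := (`|v.1| + `|v.2|) * (`|a.1 + b.1| + `|a.2 + b.2|).
have N0 : 0 <= N by rewrite mulr_ge0// addr_ge0.
exists (M + N); first exact: addr_ge0.
move=> s x s0 Wx.
have [k1 k2] := corner_phi_partial a b s x.
pose A1 := - (a.1 + b.1) * corner_phi a b s x + (a.2 + b.2) * corner_phi' a b s x.
pose A2 := - (a.2 + b.2) * corner_phi a b s x - (a.1 + b.1) * corner_phi' a b s x.
have -> : Ddir v (corner_psi s) x =
  Ddir v chi x * corner_phi a b s x + s * chi x * (v.1 * A1 + v.2 * A2).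
  by rewrite (DdirM v x schi (corner_phi_smooth a b s)) {1}/Ddir k1 k2 /A1 /A2 /=; ring.
have l1 := corner_phi_le a b s x; have l2 := corner_phi'_le a b s x.
have k0 := kap_gt0 a b s x.
have lA (y z : R) : `|y| + `|z| <= `|a.1 + b.1| + `|a.2 + b.2| ->
    `|y * corner_phi a b s x + z * corner_phi' a b s x| <=
    (`|a.1 + b.1| + `|a.2 + b.2|) * kap a b s x.
  move=> yz; move: (corner_phi a b s x) (corner_phi' a b s x) l1 l2 => f f' l1 l2.
  apply: (le_trans (ler_normD _ _)); rewrite !normrM.
  apply: (@le_trans _ _ ((`|y| + `|z|) * kap a b s x)).
    by rewrite mulrDl lerD// ler_wpM2l.
  by rewrite ler_wpM2r// ltW.
have LA1 : `|A1| <= (`|a.1 + b.1| + `|a.2 + b.2|) * kap a b s x by apply: lA; rewrite normrN.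
have LA2 : `|A2| <= (`|a.1 + b.1| + `|a.2 + b.2|) * kap a b s x.
  by rewrite /A2 -mulNr; apply: lA; rewrite !normrN addrC.
have Q : `|v.1 * A1 + v.2 * A2| <= N * kap a b s x.
  apply: (le_trans (ler_normD _ _)); rewrite !normrM /N -mulrA mulrDl.
  by apply: lerD; rewrite ler_wpM2l.
exact: (cutoff_bound M0 N0 s0 (chi01 x) (ltW k0) (HM _ Wx)).
Qed.

End corner_oscillation.

(** * The oscillating exponential on one side *)

Section ray_oscillation.
Context {R : realType}.
Local Notation mu := (@lebesgue_measure R).
Variables (e : R * R) (dl rho c D : R).
Hypothesis c0 : 0 < c.
Hypothesis cD : c ^+ 2 + D ^+ 2 = 2 * c.
Hypothesis rho_e : forall r, rho <= r -> ~ in_square dl (r * e.1, r * e.2).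
Let I : set (measurableTypeR R) := `]0%R, rho[%classic.
Let mI : measurable I. Proof. exact: measurable_itv. Qed.

Let E (s r : R) : R := expR (- (s * c) * r).
(* An antiderivative of [E s r * cos (s * D * r)]; its value at [0] is
   [- (2 * s)^-1]. *)
Let G (s r : R) : R := (2 * c * s)^-1 * (E s r * (D * sin (s * D * r) - c * cos (s * D * r))).

Let dlin (k r : R) : is_derive r 1 (fun x => k * x) k.
Proof.
have -> : (fun x : R => k * x) = k \*: (id : R -> R) by apply/funext => x.
by apply: is_derive_eq; rewrite -[LHS]/(k * 1) mulr1.
Qed.

Let dE (s r : R) : is_derive r (1 : R) (E s) (- (s * c) * E s r).
Proof. by rewrite mulrC; exact: (is_derive1_comp (is_derive_expR _) (dlin _ r)). Qed.

Let dcos (k r : R) : is_derive r (1 : R) (fun x => cos (k * x)) (- k * sin (k * r)).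
Proof.
rewrite (_ : - k * _ = k * - sin (k * r)); last by ring.
by rewrite mulrC; exact: (is_derive1_comp (is_derive_cos _) (dlin _ r)).
Qed.

Let dsin (k r : R) : is_derive r (1 : R) (fun x => sin (k * x)) (k * cos (k * r)).
Proof. by rewrite mulrC; exact: (is_derive1_comp (is_derive_sin _) (dlin _ r)). Qed.

Let dM (f g : R -> R) (r df dg : R) : is_derive r 1 f df -> is_derive r 1 g dg ->
  is_derive r 1 (fun x => f x * g x) (f r * dg + g r * df).
Proof. by move=> F H; apply: is_deriveM. Qed.

Let dB (f g : R -> R) (r df dg : R) : is_derive r 1 f df -> is_derive r 1 g dg ->
  is_derive r 1 (fun x => f x - g x) (df - dg).
Proof. by move=> F H; apply: is_deriveB. Qed.

Let dG (s r : R) : 0 < s -> is_derive r (1 : R) (G s) (E s r * cos (s * D * r)).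
Proof.
move=> s0.
have dc (k : R) (f : R -> R) df : is_derive r 1 f df -> is_derive r 1 (fun x => k * f x) (k * df).
  by move=> F; apply: is_deriveZ.
have := dc (2 * c * s)^-1 _ _ (dM (dE s r)
  (dB (dc D _ _ (dsin (s * D) r)) (dc c _ _ (dcos (s * D) r)))).
move=> /is_derive_eq; apply => /=.
have cD' : D ^+ 2 = 2 * c - c ^+ 2 by rewrite -cD; ring.
move: (E s r) (cos (s * D * r)) (sin (s * D * r)) => x y z.
rewrite (_ : x * _ + _ = s * (c ^+ 2 + D ^+ 2) * (x * y)); last by ring.
by rewrite cD; field; rewrite !gt_eqF.
Qed.

(** Integration by parts against the cutoff: the antiderivative [G] contributes its value at 0, and
    the remaining integral of [G] times the derivative of the cutoff has order [s^-2]. The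
    coefficient [1 / (2 s)] is the real part of [1 / (s (c - i D))], simplified by
    [c^2 + D^2 = 2 c]. *)
Lemma ray_oscillation : exists2 C, 0 <= C & forall s, 0 < s ->
  `|\int[mu]_(r in I) (square_bump dl (r * e.1, r * e.2) *
      (expR (- (s * c) * r) * cos (s * D * r))) - square_bump dl 0 / (2 * s)| <= C / s ^+ 2.
Proof.
pose chi := square_bump dl.
have schi : smooth chi by exact: square_bump_smooth.
have suppchi : square_supported dl chi by exact: square_bump_supported.
pose ch (r : R) := chi (r * e.1, r * e.2); pose ch' (r : R) := Ddir e chi (r * e.1, r * e.2).
have sD := Ddir_smooth e schi; have suppD := Ddir_supported (v := e) schi suppchi.
have dch (r : R) : is_derive r (1 : R) ch (ch' r).
  apply: (is_derive_line (g := fun r : R => (r * e.1, r * e.2)) _ (is_derive_dir _ e (schi 1%N))).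
  by move=> h; rewrite -[RHS]/(h * e.1 + r * e.1, h * e.2 + r * e.2)
    -[h *: _]/(h * 1) mulr1 !(mulrDl h).
have ch0 r : rho <= r -> ch r = 0 by move=> /rho_e ?; apply/eqP; apply: contrapT => /negP/suppchi.
have ch'0 r : rho <= r -> ch' r = 0 by move=> /rho_e ?; apply/eqP; apply: contrapT => /negP/suppD.
have cray (F : R * R -> R) : continuous F -> continuous (fun r : R => F (r * e.1, r * e.2)).
  move=> cF; rewrite (_ : (fun r : R => F (r * e.1, r * e.2)) =
    (fun r : R => F (0 * e.1 + r * e.1, 0 * e.2 + r * e.2))).
    exact: (@continuous_linear2 R F e e 0 cF).
  by apply/funext => r; rewrite !mul0r !add0r.
have cch := cray _ (smooth_continuous schi); have cch' := cray _ (smooth_continuous sD).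
have [M M0 HM] := continuous_bounded_square (`|rho| * (`|e.1| + `|e.2|)) (smooth_continuous sD).
have cE s : continuous (E s) := is_derive_cont (dE s).
have ccos s : continuous (fun r : R => cos (s * D * r)) := is_derive_cont (dcos (s * D)).
have csin s : continuous (fun r : R => sin (s * D * r)) := is_derive_cont (dsin (s * D)).
pose k := `|D| + c.
have k0 : 0 < k by rewrite ltr_wpDl.
(* [G] is at most [k * E / (2 * c * s)], the derivative of the cutoff at most [M], and [E] has
   integral at most [1 / (s * c)]. *)
exists (M * k / (2 * c ^+ 2)); first by rewrite !mulr_ge0// ?invr_ge0 ?mulr_ge0// ?exprn_ge0 ltW.
move=> s s0.
have cG : continuous (G s) := is_derive_cont (fun r => dG r s0).
pose df (r : R) := ch r * (E s r * cos (s * D * r)) + G s r * ch' r.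
have cdf : continuous df.
  move=> r; apply: cvgD; last by apply: cvgM; [exact: cG|exact: cch'].
  by apply: cvgM; [exact: cch|apply: cvgM; [exact: cE|exact: ccos]].
have dfg (r : R) : is_derive r (1 : R) (fun r => ch r * G s r) (df r) by exact: dM (dch r) (dG r s0).
have iI (f : R -> R) : continuous f -> rintegrable mu I f.
  move=> cf; have i : mu.-integrable `[0%R, rho] (EFin \o f).
    by apply: continuous_compact_integrable;
      [exact: segment_compact|exact: continuous_subspaceT].
  apply: (integrableS _ mI _ i); first exact: measurable_itv.
  by apply: subset_itv; rewrite bnd_simp.
have Iall : \int[mu]_(r in I) df r = chi 0 / (2 * s).
  have := FTC_halfline (T := rho) dfg cdf; rewrite integral_mkcond.
  have -> : (EFin \o df) \_ `]0%R, +oo[%classic = (EFin \o df) \_ I.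
    apply/funext => r; rewrite /patch !mem_setE !in_itv/= andbT.
    case: ltP => //= r0; case: ltP => // rr.
    by rewrite /df ch0// ch'0// mul0r mulr0 addr0.
  rewrite -integral_mkcond /Rintegral => ->; last by move=> r /ch0 ->; rewrite mul0r.
  rewrite /= /G /E /ch !mul0r !mulr0 sin0 cos0 expR0 -[(0, 0)]/(0 : R * R).
  by field; rewrite !gt_eqF.
have i1 : rintegrable mu I (fun r => ch r * (E s r * cos (s * D * r))).
  by apply: iI => r; apply: cvgM; [exact: cch|apply: cvgM; [exact: cE|exact: ccos]].
have cGc : continuous (fun r : R => G s r * ch' r) by move=> r; apply: cvgM; [exact: cG|exact: cch'].
have i2 := iI _ cGc.
rewrite -[X in `|_ - X|]Iall /df (RintegralD mI i1 i2) opprD addrA.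
rewrite -/chi -/(ch _); under eq_Rintegral => r _ do rewrite -/(ch r) -/(E s r).
rewrite subrr add0r normrN.
apply: (le_trans (le_normr_Rintegral mI i2)).
have sc0 : 0 < s * c by rewrite mulr_gt0.
have K0 : 0 <= M * k / (2 * c * s) by rewrite !mulr_ge0// ?invr_ge0 ?mulr_ge0// ltW.
have iE : rintegrable mu I (E s) := iI _ (cE s).
apply: (@le_trans _ _ (\int[mu]_(r in I) (M * k / (2 * c * s) * E s r))).
  apply: le_Rintegral => //; [exact: rintegrable_norm|exact: rintegrableZ|].
  move=> r; rewrite /I /= in_itv/= => /andP[r0 rrho].
  rewrite !normrM (ger0_norm (expR_ge0 _)) gtr0_norm ?invr_gt0 ?mulr_gt0//.
  have Hch : `|ch' r| <= M.
    have rr : `|r| <= `|rho| by rewrite gtr0_norm// gtr0_norm ?(lt_trans r0)// ltW.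
    by apply: HM; split; rewrite /= normrM ler_pM// ?lerDl ?lerDr.
  have Hk : `|D * sin (s * D * r) - c * cos (s * D * r)| <= k.
    apply: (le_trans (ler_normB _ _)); rewrite !normrM (gtr0_norm c0).
    by apply: lerD; rewrite ler_piMr// ?ler_norml ?sin_geN1 ?sin_le1 ?cos_geN1 ?cos_le1// ltW.
  have q0 : 0 <= (2 * c * s)^-1 * E s r by rewrite mulr_ge0 ?expR_ge0// invr_ge0 !mulr_ge0// ltW.
  rewrite -/(E s r); have := ler_pM (normr_ge0 _) (normr_ge0 _) Hk Hch.
  move=> /(ler_wpM2l q0); congr (_ <= _); ring.
rewrite RintegralZl//.
have Ele : \int[mu]_(r in I) E s r <= (s * c)^-1.
  have mE : measurable_fun setT (fun r : measurableTypeR R => (E s r)%:E).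
    by apply/measurable_EFinP; exact: continuous_measurable_fun (cE s).
  rewrite -lee_fin fineK; last exact: integrable_fin_num iE.
  rewrite -integral_expR_halfline//; apply: ge0_subset_integral => //.
  - exact: (measurable_funS measurableT (@subsetT _ _) mE).
  - by move=> r _; rewrite lee_fin expR_ge0.
  - by apply: subset_itvl.
apply: (le_trans (ler_wpM2l K0 Ele)).
rewrite le_eqVlt; apply/orP; left; apply/eqP.
by field; rewrite !gt_eqF.
Qed.

End ray_oscillation.

(** * The corner estimate *)

Section corner_estimate.
Context {R : realType}.
Local Notation mu := (@lebesgue_measure R).
Local Notation plane := (measurableTypeR R * measurableTypeR R)%type.
Variables (a b : R * R) (W : set (R * R)) (dl bd rho : R).
Hypothesis a_unit : a.1 ^+ 2 + a.2 ^+ 2 = 1.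
Hypothesis b_unit : b.1 ^+ 2 + b.2 ^+ 2 = 1.
Hypothesis D0 : 0 < a.1 * b.2 - a.2 * b.1.
Hypothesis dl0 : 0 < dl.
Hypothesis mW : measurable (W : set plane).
Hypothesis W_wedge : W `<=` wedge a b.
Hypothesis wedge_W : wedge a b `&` in_square dl `<=` W.
Hypothesis W_bounded : W `<=` in_square bd.
Hypothesis rho_a : forall r, rho <= r -> ~ in_square dl (r * a.1, r * a.2).
Hypothesis rho_b : forall r, rho <= r -> ~ in_square dl (r * b.1, r * b.2).
Let D := a.1 * b.2 - a.2 * b.1.
Let c := 1 + (a.1 * b.1 + a.2 * b.2).
Local Notation W' := (W : set plane).
Let I : set (measurableTypeR R) := `]0%R, rho[%classic.
Let chi := square_bump dl.
Let K := D / c ^+ 2.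
Let mI : measurable I. Proof. exact: measurable_itv. Qed.

Let cont_sqint := continuous_sqint mW W_bounded.
Let c0 : 0 < c := corner_c_gt0 a_unit b_unit D0.
Let Dgt0 : 0 < D := D0.
Let K0 : 0 < K. Proof. by rewrite divr_gt0// exprn_gt0. Qed.
Let schi : smooth chi. Proof. exact: square_bump_smooth. Qed.
Let supp_chi : square_supported dl chi. Proof. exact: square_bump_supported. Qed.
Let ckap s : continuous (kap a b s) := @smooth_continuous _ _ (kap_smooth a b s).
Let skap s : sqint leb2 W' (kap a b s) := cont_sqint (@ckap s).
Let k0 s x : 0 < kap a b s x := kap_gt0 a b s x.
Let ik s : 0 < s -> rintegrable leb2 W' (kap a b s).
Proof. by move=> s0; case: (integral_kap a_unit b_unit D0 mW W_wedge s0). Qed.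
Let le_ik s : 0 < s -> \int[leb2]_(x in W') kap a b s x <= K / s ^+ 2.
Proof. by move=> s0; case: (integral_kap a_unit b_unit D0 mW W_wedge s0). Qed.

Let RintZ (k : R) (f : R * R -> R) : rintegrable leb2 W' f ->
  \int[leb2]_(x in W') (k * f x) = k * \int[leb2]_(x in W') f x.
Proof. by move=> i; rewrite RintegralZl. Qed.

(** In the application [h] is a part of the Herglotz wave [v_j] and [h0] its value at the vertex;
    [B] is [j^-beta] and [L] a multiple of [j^gamma]. One constant [L] bounds both the value and the
    variation of [h]. *)
Definition corner_approx (v h : R * R -> R) (h0 B L : R) : Prop :=
  [/\ continuous h, 0 <= B, 0 <= L, \int[leb2]_(x in W') (v x - h x) ^+ 2 <= B ^+ 2 &
    `|h0| <= L /\ forall x, W x -> `|h x - h0| <= L * (`|x.1| + `|x.2|)].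

(** Dominates [1 + K] and [16 * K / c], the constants of the two parts of [approx_mass]. *)
Let C1 := 1 + K + 64 * (K / c).

Let Kc0 : 0 < K / c. Proof. exact: divr_gt0. Qed.

Let C1_ge0 : 0 <= C1.
Proof. by rewrite /C1; move: (K / c) Kc0 K0 => q; lra. Qed.

(** [v - h] is paired with [kap s] by Cauchy-Schwarz; for [h - h0] the Lipschitz bound brings in
    [|x|], which [kap_lin] trades for a factor [1 / s] and half of the decay. *)
Lemma approx_mass (v h : R * R -> R) (h0 B L s : R) : sqint leb2 W' v ->
  corner_approx v h h0 B L -> 0 < s ->
  \int[leb2]_(x in W') (`|v x - h0| * kap a b s x) <= C1 * (B / s + L / s ^+ 3).
Proof.
move=> sv [ch B0 L0 vB [_ hL]] s0.
have sh := cont_sqint ch.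
have svh : sqint leb2 W' (fun x => v x - h x) by exact: sqintB.
have shh : sqint leb2 W' (fun x => h x - h0).
  by apply: cont_sqint => x; apply: cvgB; [exact: ch|exact: cvg_cst].
have I1 := integral_mul_kap a_unit b_unit D0 mW W_wedge W_bounded B0 s0 svh vB.
have s20 : 0 < s / 2 by rewrite divr_gt0.
have i1 : rintegrable leb2 W' (fun x => `|v x - h x| * kap a b s x).
  exact: (sqint_mul mW (sqint_norm mW svh) (skap s)).
have i2 : rintegrable leb2 W' (fun x => `|h x - h0| * kap a b s x).
  exact: (sqint_mul mW (sqint_norm mW shh) (skap s)).
have i3 : rintegrable leb2 W' (fun x => L * (4 / (c * s)) * kap a b (s / 2) x).
  by apply: rintegrableZ => //; exact: ik.
have i12 := rintegrableD mW i1 i2.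
have iv : rintegrable leb2 W' (fun x => `|v x - h0| * kap a b s x).
  apply: (sqint_mul mW (sqint_norm mW _) (skap s)).
  by apply: sqintB => //; apply: cont_sqint; exact: cst_continuous.
have I2 : \int[leb2]_(x in W') (`|h x - h0| * kap a b s x) <=
    L * (4 / (c * s)) * (K / (s / 2) ^+ 2).
  apply: (@le_trans _ _ (\int[leb2]_(x in W') (L * (4 / (c * s)) * kap a b (s / 2) x))).
    apply: le_Rintegral => // x Wx.
    apply: (@le_trans _ _ (L * (`|x.1| + `|x.2|) * kap a b s x)).
      by apply: ler_wpM2r; [exact: ltW|exact: hL].
    rewrite -!mulrA; apply: ler_wpM2l => //.
    have := kap_lin a_unit b_unit D0 s0 (W_wedge Wx); rewrite -/c -!mulrA.
    exact.
  rewrite RintegralZl//; last exact: ik.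
  apply: ler_wpM2l; last exact: le_ik.
  by rewrite !mulr_ge0// invr_ge0 mulr_ge0// ltW.
have I3 : \int[leb2]_(x in W') (`|v x - h0| * kap a b s x) <=
    B * ((1 + K) / s) + L * (4 / (c * s)) * (K / (s / 2) ^+ 2).
  apply: le_trans (lerD I1 I2); rewrite -(RintegralD mW i1 i2).
  apply: le_Rintegral => // x Wx; rewrite -mulrDl; apply: ler_wpM2r; first exact: ltW.
  by rewrite -[v x - h0](subrKA (h x)) ler_normD.
apply: (le_trans I3).
have -> : B * ((1 + K) / s) + L * (4 / (c * s)) * (K / (s / 2) ^+ 2) =
    (1 + K) * (B / s) + 16 * K / c * (L / s ^+ 3) by field; rewrite !gt_eqF.
rewrite mulrDr; apply: lerD; apply: ler_wpM2r.
- by rewrite divr_ge0// ltW.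
- by rewrite /C1 lerDl mulr_ge0// ltW.
- by rewrite divr_ge0// exprn_ge0// ltW.
- by rewrite /C1 -mulrA; move: (K / c) Kc0 K0 => q; lra.
Qed.

Lemma approx_mass1 (v h : R * R -> R) (h0 B L s : R) : sqint leb2 W' v ->
  corner_approx v h h0 B L -> 1 <= s ->
  \int[leb2]_(x in W') (`|v x| * kap a b s x) <= 2 * C1 * (B / s + L / s ^+ 2).
Proof.
move=> sv ap s1; have s0 : 0 < s by exact: lt_le_trans s1.
have := approx_mass sv ap s0; case: ap => ch B0 L0 vB [h0L hL] I1.
have sc : sqint leb2 W' (fun=> h0) by apply: cont_sqint; exact: cst_continuous.
have i1 : rintegrable leb2 W' (fun x => `|v x - h0| * kap a b s x).
  by apply: (sqint_mul mW (sqint_norm mW _) (skap s)); exact: sqintB.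
have i2 : rintegrable leb2 W' (fun x => L * kap a b s x) by apply: rintegrableZ => //; exact: ik.
have iv : rintegrable leb2 W' (fun x => `|v x| * kap a b s x).
  exact: (sqint_mul mW (sqint_norm mW _) (skap s)).
apply: (@le_trans _ _ (C1 * (B / s + L / s ^+ 3) + L * (K / s ^+ 2))).
  apply: (@le_trans _ _ (\int[leb2]_(x in W') (`|v x - h0| * kap a b s x + L * kap a b s x))).
    apply: le_Rintegral => //; first exact: rintegrableD.
    move=> x Wx; rewrite -mulrDl; apply: ler_wpM2r; first exact: ltW.
    by rewrite -{1}[v x](subrK h0) (le_trans (ler_normD _ _))// lerD.
  rewrite (RintegralD mW i1 i2); apply: lerD => //.
  by rewrite RintegralZl//; [apply: ler_wpM2l => //; exact: le_ik|exact: ik].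
have L3 : L / s ^+ 3 <= L / s ^+ 2.
  by apply: ler_wpM2l => //; rewrite lef_pV2 ?posrE ?exprn_gt0// ler_weXn2l.
have Bs : 0 <= B / s by rewrite divr_ge0// ltW.
have L2 : 0 <= L / s ^+ 2 by rewrite divr_ge0// exprn_ge0// ltW.
have L30 : 0 <= L / s ^+ 3 by rewrite divr_ge0// exprn_ge0// ltW.
have KC : K <= C1.
  by rewrite /C1; move: (K / c) Kc0 K0 => q; lra.
rewrite (_ : L * (K / s ^+ 2) = K * (L / s ^+ 2)); last by ring.
have T1 := ler_wpM2r L2 KC; have T2 := ler_wpM2l C1_ge0 L3; have T3 := mulr_ge0 C1_ge0 Bs.
move: T1 T2 T3; rewrite (mulrDr C1 (B / s)) (mulrDr (2 * C1) (B / s)).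
have -> : 2 * C1 * (B / s) = 2 * (C1 * (B / s)) by ring.
have -> : 2 * C1 * (L / s ^+ 2) = 2 * (C1 * (L / s ^+ 2)) by ring.
move: (C1 * (L / s ^+ 2)) (C1 * (L / s ^+ 3)) (C1 * (B / s)) (K * (L / s ^+ 2)) => *.
lra.
Qed.

(** The conclusion of [side_identity], with [c] the side and [d] the transversal direction;
    [trace_ineq] is that of [side_trace]. Together with square integrability these are all that the
    corner estimate asks of a trace. *)
Definition trace_green (v v1 v2 : R * R -> R) (c d : R * R) (t : R -> R) : Prop :=
  forall psi, smooth psi -> square_supported dl psi ->
  \int[leb2]_(x in W') (v x * Ddir d psi x + (d.1 * v1 x + d.2 * v2 x) * psi x) =
  - (D * \int[mu]_(r in I) (t r * psi (r * c.1, r * c.2))).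

Definition trace_ineq (v : R * R -> R) (c d : R * R) (t : R -> R) : Prop :=
  exists2 M, 0 <= M & forall kappa A, smooth kappa -> (forall x, 0 <= kappa x) -> 0 <= A ->
    \int[leb2]_(x in W') (kappa x ^+ 2 * chi x) <= A ^+ 2 ->
    D * \int[mu]_(r in I) (`|t r| * (chi (r * c.1, r * c.2) * kappa (r * c.1, r * c.2))) <=
    M * A + \int[leb2]_(x in W') (`|v x| * `|Ddir d (fun x => chi x * kappa x) x|).

Let ray_mass (t : R -> R) (e : R * R) s :=
  \int[mu]_(r in I) (`|t r| * (chi (r * e.1, r * e.2) * kap a b s (r * e.1, r * e.2))).

(** [trace_ineq] with [kappa] equal to [kap s]: its L^2 norm gives the term [1 / s], and the
    derivative multiplies the mass [B / s + L / s^2] of [|v| kap s] by [1 + s]. *)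
Lemma ray_mass_le (v : R * R -> R) (e d : R * R) (t : R -> R) : sqint leb2 W' v ->
  trace_ineq v e d t -> exists2 C, 0 <= C & forall s h h0 B L,
    1 <= s -> corner_approx v h h0 B L -> ray_mass t e s <= C * (s^-1 + B + L / s).
Proof.
move=> sv [M M0 HM].
have [N N0 HN] := Ddir_chi_kap a b dl W_bounded d.
exists ((M * (1 + K) + 4 * N * C1) / D).
  by rewrite divr_ge0 ?(ltW Dgt0)// addr_ge0// !mulr_ge0// addr_ge0// ltW.
move=> s h h0 B L s1 ap; have s0 : 0 < s by exact: lt_le_trans s1.
have sk2 : rintegrable leb2 W' (fun x => kap a b s x ^+ 2) by case: (skap s).
have A2 : \int[leb2]_(x in W') (kap a b s x ^+ 2 * chi x) <= ((1 + K) / s) ^+ 2.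
  apply: le_trans (integral_kap2 a_unit b_unit D0 mW W_wedge s0).
  apply: le_Rintegral => //.
    apply: (continuous_rintegrable mW W_bounded) => x.
    by apply: cvgM; [apply: cvgM; exact: ckap|exact: (smooth_continuous schi)].
  by move=> x _; rewrite ler_piMr ?sqr_ge0// square_bump_le1.
have A0 : 0 <= (1 + K) / s by rewrite divr_ge0 ?(ltW s0)// addr_ge0// ltW.
have := HM _ _ (@kap_smooth _ a b s) (fun x => ltW (k0 s x)) A0 A2.
have sD : smooth (fun x => chi x * kap a b s x) by apply: smoothM => //; exact: kap_smooth.
have cD := smooth_continuous (Ddir_smooth d sD).
have i1 : rintegrable leb2 W' (fun x => `|v x| * `|Ddir d (fun x => chi x * kap a b s x) x|).
  exact: (sqint_mul mW (sqint_norm mW sv) (sqint_norm mW (cont_sqint cD))).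
have i2 : rintegrable leb2 W' (fun x => `|v x| * kap a b s x).
  exact: (sqint_mul mW (sqint_norm mW sv) (skap s)).
have I2 : \int[leb2]_(x in W') (`|v x| * `|Ddir d (fun x => chi x * kap a b s x) x|) <=
    N * (1 + s) * (2 * C1 * (B / s + L / s ^+ 2)).
  apply: (@le_trans _ _ (\int[leb2]_(x in W') (N * (1 + s) * (`|v x| * kap a b s x)))).
    apply: le_Rintegral => //; first exact: rintegrableZ.
    move=> x Wx; rewrite mulrCA; apply: ler_wpM2l => //.
    exact: (HN s x (ltW s0) Wx).
  rewrite RintegralZl//; apply: ler_wpM2l; last exact: approx_mass1 ap s1.
  by rewrite mulr_ge0// addr_ge0// ltW.
rewrite -/(ray_mass t e s) => H.
rewrite mulrAC ler_pdivlMr// mulrC; apply: (le_trans H).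
apply: (le_trans (lerD (lexx _) I2)).
case: ap => _ B0 L0 _ _.
have -> : M * ((1 + K) / s) = M * (1 + K) * s^-1 by ring.
have E : N * (1 + s) * (2 * C1 * (B / s + L / s ^+ 2)) <= 4 * N * C1 * (B + L / s).
  have -> : 4 * N * C1 * (B + L / s) = N * (s + s) * (2 * C1 * (B / s + L / s ^+ 2)).
    by field; rewrite gt_eqF.
  apply: ler_wpM2r; first by rewrite !mulr_ge0// addr_ge0// divr_ge0 ?exprn_ge0// ltW.
  by apply: ler_wpM2l => //; rewrite lerD2r.
have p1 : 0 <= M * (1 + K) by rewrite mulr_ge0// addr_ge0// ltW.
have p2 : 0 <= 4 * N * C1 by rewrite !mulr_ge0.
have q1 : 0 <= s^-1 by rewrite invr_ge0 ltW.
have q2 : 0 <= B + L / s by rewrite addr_ge0// divr_ge0// ltW.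
apply: (le_trans (lerD (lexx _) E)); rewrite -(addrA s^-1 B).
move: (M * (1 + K)) (4 * N * C1) (s^-1) (B + L / s) p1 p2 q1 q2 => p q x y p1 p2 q1 q2.
have := mulr_ge0 p1 q2; have := mulr_ge0 p2 q1; rewrite mulrDl !mulrDr; lra.
Qed.

Let psi s := corner_psi a b dl s.
Let spsi s : smooth (psi s). Proof. exact: corner_psi_smooth. Qed.
Let supp_psi s : square_supported dl (psi s). Proof. exact: corner_psi_supported. Qed.

Let ray_test (t : R -> R) (e : R * R) s :=
  \int[mu]_(r in I) (t r * psi s (r * e.1, r * e.2)).

Let ray_psi (e : R * R) s := \int[mu]_(r in I) psi s (r * e.1, r * e.2).

(** Green's identity for [v] minus [h0] times that for the constant 1. Only [v - h0] then meets the
    derivative of the test function, of size [s * kap s], and [approx_mass] yields [s B + L / s].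
    The gradient of [v] meets the test function itself and falls under [kap_littleo]. *)
Lemma green_sum (v v1 v2 : R * R -> R) (ta tb : R -> R) :
  sqint leb2 W' v -> sqint leb2 W' v1 -> sqint leb2 W' v2 ->
  trace_green v v1 v2 a b ta -> trace_green v v1 v2 b a tb ->
  exists2 C, 0 <= C & forall e, 0 < e -> exists2 s0, 1 <= s0 &
    forall s h h0 B L, s0 <= s -> corner_approx v h h0 B L ->
    s * `|ray_test ta a s + ray_test tb b s - h0 * (ray_psi a s + ray_psi b s)| <=
    e + C * (s * B + L / s).
Proof.
move=> sv sv1 sv2 Ga Gb.
have [Ma Ma0 HMa] := Ddir_psi a b dl W_bounded a.
have [Mb Mb0 HMb] := Ddir_psi a b dl W_bounded b.
pose G x := (b.1 * v1 x + b.2 * v2 x) + (a.1 * v1 x + a.2 * v2 x).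
have sGb : sqint leb2 W' (fun x => b.1 * v1 x + b.2 * v2 x).
  by apply: sqintD => //; exact: sqintZ.
have sGa : sqint leb2 W' (fun x => a.1 * v1 x + a.2 * v2 x).
  by apply: sqintD => //; exact: sqintZ.
have sG : sqint leb2 W' G by exact: sqintD.
exists (2 * (Ma + Mb) * C1 / D).
  by rewrite divr_ge0 ?(ltW Dgt0)// !mulr_ge0// addr_ge0.
move=> e e0; have De : 0 < D * e by rewrite mulr_gt0.
have [s0 s00 Hs0] := kap_littleo a_unit b_unit D0 mW W_wedge W_bounded sG De.
exists (1 + s0); first by rewrite lerDl ltW.
move=> s h h0 B L ss ap.
have s1 : 1 <= s by apply: le_trans ss; rewrite lerDl ltW.
have ss0 : s0 <= s by apply: le_trans ss; rewrite lerDr.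
have sgt0 : 0 < s by exact: lt_le_trans s1.
have cDa := smooth_continuous (Ddir_smooth a (spsi s)).
have cDb := smooth_continuous (Ddir_smooth b (spsi s)).
have sDa := cont_sqint cDa; have sDb := cont_sqint cDb.
have sp := cont_sqint (smooth_continuous (spsi s)).
have svh : sqint leb2 W' (fun x => v x - h0).
  by apply: sqintB => //; apply: cont_sqint; exact: cst_continuous.
pose X x := (v x - h0) * (Ddir b (psi s) x + Ddir a (psi s) x) + G x * psi s x.
have iX1 : rintegrable leb2 W' (fun x => v x * Ddir b (psi s) x +
    (b.1 * v1 x + b.2 * v2 x) * psi s x).
  by apply: rintegrableD => //; exact: sqint_mul.
have iX2 : rintegrable leb2 W' (fun x => v x * Ddir a (psi s) x +
    (a.1 * v1 x + a.2 * v2 x) * psi s x).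
  by apply: rintegrableD => //; exact: sqint_mul.
have iDb : rintegrable leb2 W' (Ddir b (psi s)) := continuous_rintegrable mW W_bounded cDb.
have iDa : rintegrable leb2 W' (Ddir a (psi s)) := continuous_rintegrable mW W_bounded cDa.
have iZ1 := rintegrableZ mW h0 iDb; have iZ2 := rintegrableZ mW h0 iDa.
have iX12 := rintegrableD mW iX1 iX2; have iZ12 := rintegrableD mW iZ1 iZ2.
have EX : D * (ray_test ta a s + ray_test tb b s - h0 * (ray_psi a s + ray_psi b s)) =
    - \int[leb2]_(x in W') X x.
  have := Ga _ (spsi s) (@supp_psi s); have := Gb _ (spsi s) (@supp_psi s).
  rewrite -/(ray_test ta a s) -/(ray_test tb b s) => E2 E1.
  have := divergence_b D0 mW W_wedge wedge_W W_bounded rho_a (spsi s) (@supp_psi s).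
  have := divergence_a D0 mW W_wedge wedge_W W_bounded rho_b (spsi s) (@supp_psi s).
  rewrite -/D -/(ray_psi a s) -/(ray_psi b s) => E4 E3.
  have -> : \int[leb2]_(x in W') X x =
    \int[leb2]_(x in W') ((v x * Ddir b (psi s) x + (b.1 * v1 x + b.2 * v2 x) * psi s x +
      (v x * Ddir a (psi s) x + (a.1 * v1 x + a.2 * v2 x) * psi s x)) -
      (h0 * Ddir b (psi s) x + h0 * Ddir a (psi s) x)).
    apply: eq_Rintegral => x _; rewrite /X /G.
    by move: (Ddir b _ x) (Ddir a _ x) (psi s x) => p q r; ring.
  rewrite (RintegralB mW iX12 iZ12) (RintegralD mW iX1 iX2) (RintegralD mW iZ1 iZ2).
  rewrite (RintZ h0 iDb) (RintZ h0 iDa) E1 E2 E3 E4; ring.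
have iX : rintegrable leb2 W' X.
  by apply: rintegrableD => //; apply: sqint_mul => //; exact: sqintD.
have i1 : rintegrable leb2 W' (fun x => (Ma + Mb) * (1 + s) * (`|v x - h0| * kap a b s x)).
  by apply: rintegrableZ => //; exact: (sqint_mul mW (sqint_norm mW svh) (skap s)).
have i2 : rintegrable leb2 W' (fun x => `|G x| * kap a b s x).
  exact: (sqint_mul mW (sqint_norm mW sG) (skap s)).
have iv := sqint_mul mW (sqint_norm mW svh) (skap s).
have bX : `|\int[leb2]_(x in W') X x| <=
    (Ma + Mb) * (1 + s) * (C1 * (B / s + L / s ^+ 3)) +
    \int[leb2]_(x in W') (`|G x| * kap a b s x).
  apply: (le_trans (le_normr_Rintegral mW iX)).
  apply: (@le_trans _ _ (\int[leb2]_(x in W') ((Ma + Mb) * (1 + s) * (`|v x - h0| * kap a b s x) +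
      `|G x| * kap a b s x))).
    apply: le_Rintegral => //; [exact: rintegrable_norm|exact: rintegrableD|].
    move=> x Wx; apply: (le_trans (ler_normD _ _)); rewrite !(normrM _ (psi s x)).
    apply: lerD; last first.
      rewrite ler_wpM2l// normrM (ger0_norm (square_bump_ge0 _ _)).
      apply: (le_trans (ler_piMl _ (square_bump_le1 _ _))) => //.
      exact: corner_phi_le.
    rewrite normrM mulrCA; apply: ler_wpM2l => //.
    rewrite -mulrA mulrDl; apply: (le_trans (ler_normD _ _)); rewrite addrC !mulrA.
    by apply: lerD; [exact: (HMa s x (ltW sgt0) Wx)|exact: (HMb s x (ltW sgt0) Wx)].
  rewrite (RintegralD mW i1 i2) lerD2r (RintZ _ iv).
  apply: ler_wpM2l; last exact: approx_mass ap sgt0.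
  by rewrite mulr_ge0// addr_ge0// ltW.
have Hs := Hs0 _ ss0.
case: ap => _ B0 L0 _ _.
rewrite -(ler_pM2l Dgt0) mulrCA -{1}(gtr0_norm Dgt0) -normrM EX normrN.
apply: (le_trans (ler_wpM2l (ltW sgt0) bX)); rewrite (mulrDr s) (mulrDr D) addrC.
apply: lerD => //.
have -> : D * (2 * (Ma + Mb) * C1 / D * (s * B + L / s)) =
    s * ((Ma + Mb) * (s + s) * (C1 * (B / s + L / s ^+ 3))).
  by field; rewrite !gt_eqF.
apply: ler_wpM2l; first exact: ltW.
apply: ler_wpM2r.
  by rewrite !mulr_ge0// addr_ge0// divr_ge0 ?exprn_ge0// ltW.
by apply: ler_wpM2l; [rewrite addr_ge0|rewrite lerD2r].
Qed.

(** Each side contributes [chi 0 / (2 s)] up to [O (1 / s^2)], with the same sign; the threshold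
    makes the error at most half of the sum. *)
Lemma ray_psi_large : exists2 s0, 1 <= s0 & forall s, s0 <= s ->
  chi 0 / 2 <= s * (ray_psi a s + ray_psi b s).
Proof.
have cD := corner_cD a_unit b_unit; rewrite -/D -/c in cD.
have [Ca Ca0 HCa] := ray_oscillation c0 cD rho_a.
have [Cb Cb0 HCb] := ray_oscillation c0 cD rho_b.
have x0 : 0 < chi 0 by apply: square_bump_gt0 => //=; rewrite normr0.
exists (1 + 2 * (Ca + Cb) / chi 0); first by rewrite lerDl divr_ge0 ?(ltW x0)// mulr_ge0// addr_ge0.
move=> s ss.
have s0 : 0 < s.
  by apply: lt_le_trans ss; rewrite ltr_pwDl// divr_ge0 ?(ltW x0)// mulr_ge0// addr_ge0.
have := HCa _ s0; have := HCb _ s0.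
have -> : \int[mu]_(r in `]0%R, rho[) (square_bump dl (r * a.1, r * a.2) *
      (expR (- (s * c) * r) * cos (s * D * r))) = ray_psi a s.
  apply: eq_Rintegral => r _; rewrite /psi /corner_psi.
  by congr (_ * _); rewrite corner_phi_ray_a.
have -> : \int[mu]_(r in `]0%R, rho[) (square_bump dl (r * b.1, r * b.2) *
      (expR (- (s * c) * r) * cos (s * D * r))) = ray_psi b s.
  apply: eq_Rintegral => r _; rewrite /psi /corner_psi.
  by congr (_ * _); rewrite corner_phi_ray_b.
rewrite -/chi !ler_distl => /andP[lb _] /andP[la _].
have {la lb} := ler_wpM2l (ltW s0) (lerD la lb).
apply: le_trans.
have -> : s * (chi 0 / (2 * s) - Ca / s ^+ 2 + (chi 0 / (2 * s) - Cb / s ^+ 2)) =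
  chi 0 - (Ca + Cb) / s by field; rewrite gt_eqF.
have : (Ca + Cb) / s <= chi 0 / 2.
  rewrite ler_pdivrMr// -ler_pdivrMl ?divr_gt0//.
  apply: le_trans ss; rewrite (_ : (chi 0 / 2)^-1 * (Ca + Cb) = 2 * (Ca + Cb) / chi 0) ?lerDr//.
  by field; rewrite gt_eqF.
by lra.
Qed.

End corner_estimate.

(** * Bounding the approximation at the vertex *)

Section corner_value.
Context {R : realType}.
Local Notation mu := (@lebesgue_measure R).
Local Notation plane := (measurableTypeR R * measurableTypeR R)%type.
Variables (a b : R * R) (W : set (R * R)) (dl bd rho : R).
Hypothesis a_unit : a.1 ^+ 2 + a.2 ^+ 2 = 1.
Hypothesis b_unit : b.1 ^+ 2 + b.2 ^+ 2 = 1.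
Hypothesis D0 : 0 < a.1 * b.2 - a.2 * b.1.
Hypothesis dl0 : 0 < dl.
Hypothesis mW : measurable (W : set plane).
Hypothesis W_wedge : W `<=` wedge a b.
Hypothesis wedge_W : wedge a b `&` in_square dl `<=` W.
Hypothesis W_bounded : W `<=` in_square bd.
Hypothesis rho_a : forall r, rho <= r -> ~ in_square dl (r * a.1, r * a.2).
Hypothesis rho_b : forall r, rho <= r -> ~ in_square dl (r * b.1, r * b.2).
Let D := a.1 * b.2 - a.2 * b.1.
Let c := 1 + (a.1 * b.1 + a.2 * b.2).
Local Notation W' := (W : set plane).
Let I : set (measurableTypeR R) := `]0%R, rho[%classic.
Let chi := square_bump dl.
Let mI : measurable I. Proof. exact: measurable_itv. Qed.

Let cont_sqint := continuous_sqint mW W_bounded.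
Let c0 : 0 < c := corner_c_gt0 a_unit b_unit D0.
Let Dgt0 : 0 < D := D0.
Let schi : smooth chi. Proof. exact: square_bump_smooth. Qed.
Let supp_chi : square_supported dl chi. Proof. exact: square_bump_supported. Qed.
Let ckap s : continuous (kap a b s) := @smooth_continuous _ _ (kap_smooth a b s).
Let skap s : sqint leb2 W' (kap a b s) := cont_sqint (@ckap s).
Let k0 s x : 0 < kap a b s x := kap_gt0 a b s x.

Let psi s := corner_psi a b dl s.
Let spsi s : smooth (psi s). Proof. exact: corner_psi_smooth. Qed.
Let supp_psi s : square_supported dl (psi s). Proof. exact: corner_psi_supported. Qed.

Let ray_test (t : R -> R) (e : R * R) s :=
  \int[mu]_(r in I) (t r * psi s (r * e.1, r * e.2)).
Let ray_psi (e : R * R) s := \int[mu]_(r in I) psi s (r * e.1, r * e.2).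
Let ray_mass (t : R -> R) (e : R * R) s :=
  \int[mu]_(r in I) (`|t r| * (chi (r * e.1, r * e.2) * kap a b s (r * e.1, r * e.2))).

Variables (al H : R).
Hypothesis al0 : 0 < al.
Hypothesis al1 : al < 1.
Hypothesis H0 : 0 <= H.

Let P : R := (2 / c) `^ al.
Let P0 : 0 <= P. Proof. exact: powR_ge0. Qed.

(* [y ^ al <= 1 + y <= exp y] with [y = s * c * r / 2]. *)
Lemma powR_mul_expR (s r : R) : 0 < s -> 0 <= r ->
  r `^ al * expR (- (s * c) * r) <= P * s `^ (- al) * expR (- (s / 2 * c) * r).
Proof.
move=> s0 r0; pose y := s / 2 * c * r.
have y0 : 0 <= y by rewrite !mulr_ge0// ltW.
have -> : r = 2 / c * (s^-1 * y) by rewrite /y; field; rewrite !gt_eqF.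
have c20 : 0 <= 2 / c by rewrite divr_ge0// ltW.
have si0 : 0 <= s^-1 by rewrite invr_ge0 ltW.
rewrite (powRM al c20 (mulr_ge0 si0 y0)) (powRM al si0 y0) -/P.
have -> : s^-1 `^ al = s `^ (- al) by rewrite -powR_inv1 ?(ltW s0)// -powRrM mulN1r.
have -> : - (s * c) * (2 / c * (s^-1 * y)) = - y + - y by field; rewrite !gt_eqF.
have -> : - (s / 2 * c) * (2 / c * (s^-1 * y)) = - y by field; rewrite !gt_eqF.
rewrite -!mulrA; apply: ler_wpM2l => //; apply: ler_wpM2l; first exact: powR_ge0.
rewrite expRD mulrA ler_piMl ?expR_ge0// expRN ler_pdivrMr ?expR_gt0// mul1r.
apply: le_trans (expR_ge1Dx y).
have [y1|y1] := leP y 1.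
  have : y `^ al <= 1 `^ al by apply: ge0_ler_powR; rewrite ?nnegrE// ltW.
  by rewrite powR1 => /le_trans; apply; rewrite lerDl.
have : y `^ al <= y `^ 1 by apply: ler_powR; exact: ltW.
by rewrite powRr1// => /le_trans; apply; rewrite lerDr.
Qed.

Let ray_sqint (F : R * R -> R) (e : R * R) : continuous F ->
  bdmeas I (fun r => F (r * e.1, r * e.2)).
Proof.
move=> cF; split; first exact: continuous_ray_measurable.
have [M M0 HM] := continuous_bounded_square (`|rho| * (`|e.1| + `|e.2|)) cF.
exists M => r; rewrite /I /= in_itv/= => /andP[r0 rrho].
have rr : `|r| <= `|rho| by rewrite gtr0_norm// gtr0_norm ?(lt_trans r0)// ltW.
by apply: HM; split; rewrite /= normrM ler_pM// ?lerDl ?lerDr.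
Qed.

Let sqintI_rintegrable (t : R -> R) : sqint mu I t -> rintegrable mu I t.
Proof.
apply: sqint_rintegrable => //.
by rewrite /= lebesgue_measure_itv/=; case: ifP => _; rewrite ?ltry// -EFinD ltry.
Qed.

(** Freezing the coefficient at the vertex costs [r ^ al] under the integral. The exponential
    absorbs it for a factor [s ^ (- al)] and half of its decay, whence the mass at [s / 2]. *)
Lemma ray_holder (t m : R -> R) (m0 : R) (e : R * R) s :
  (forall s r, kap a b s (r * e.1, r * e.2) = expR (- (s * c) * r)) ->
  sqint mu I t -> measurable_fun I m ->
  (forall r, I r -> `|m r - m0| <= H * r `^ al) -> 0 < s ->
  rintegrable mu I (fun r => m r * t r * psi s (r * e.1, r * e.2)) /\
  `|ray_test (fun r => m r * t r) e s - m0 * ray_test t e s| <=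
  H * P * s `^ (- al) * ray_mass t e (s / 2).
Proof.
move=> ke st mm mH s0.
have psi_bd := ray_sqint e (smooth_continuous (spsi s)).
have stp : sqint mu I (fun r => t r * psi s (r * e.1, r * e.2)) := sqint_bdmeas mI st psi_bd.
have itp := sqintI_rintegrable stp.
have bm : bdmeas I m.
  split=> //; exists (`|m0| + H * rho `^ al) => r Ir.
  rewrite -[m r](subrK m0) addrC; apply: (le_trans (ler_normD _ _)).
  rewrite lerD2l; apply: (le_trans (mH _ Ir)); apply: ler_wpM2l => //.
  move: Ir; rewrite /I /= in_itv/= => /andP[r0 rrho].
  by apply: ge0_ler_powR; rewrite ?nnegrE ltW// (lt_trans r0).
have imtp : rintegrable mu I (fun r => m r * t r * psi s (r * e.1, r * e.2)).
  apply: (eq_rintegrable mI _ (sqintI_rintegrable (sqint_bdmeas mI stp bm))) => r _.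
  by rewrite mulrC mulrA.
split=> //.
have iz := rintegrableZ mI m0 itp.
have EZ : m0 * ray_test t e s = \int[mu]_(r in I) (m0 * (t r * psi s (r * e.1, r * e.2))).
  by rewrite RintegralZl.
rewrite EZ /ray_test -(RintegralB mI imtp iz).
have ib := rintegrableB mI imtp iz.
apply: (le_trans (le_normr_Rintegral mI ib)).
have chik_bd : bdmeas I (fun r => chi (r * e.1, r * e.2) * kap a b (s / 2) (r * e.1, r * e.2)).
  apply: (ray_sqint e (F := fun x => chi x * kap a b (s / 2) x)).
  by apply: smooth_continuous; apply: smoothM => //; exact: kap_smooth.
have ic := sqintI_rintegrable (sqint_bdmeas mI (sqint_norm mI st) chik_bd).
have -> : H * P * s `^ (- al) * ray_mass t e (s / 2) =
  \int[mu]_(r in I) (H * P * s `^ (- al) * (`|t r| *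
    (chi (r * e.1, r * e.2) * kap a b (s / 2) (r * e.1, r * e.2)))).
  by rewrite RintegralZl.
apply: le_Rintegral => //; [exact: rintegrable_norm|exact: rintegrableZ|].
move=> r Ir; have r0 : 0 <= r by move: Ir; rewrite /I /= in_itv/= => /andP[/ltW].
have -> : m r * t r * psi s (r * e.1, r * e.2) - m0 * (t r * psi s (r * e.1, r * e.2)) =
    (m r - m0) * (t r * psi s (r * e.1, r * e.2)).
  by move: (psi s _) => q; ring.
have ch0 : 0 <= chi (r * e.1, r * e.2) by exact: square_bump_ge0.
rewrite normrM; apply: (@le_trans _ _ (H * r `^ al *
  (`|t r| * (chi (r * e.1, r * e.2) * kap a b s (r * e.1, r * e.2))))).
  apply: ler_pM => //; first exact: mH.
  rewrite normrM; apply: ler_wpM2l => //.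
  rewrite /psi /corner_psi -/chi normrM (ger0_norm ch0).
  by apply: ler_wpM2l => //; exact: corner_phi_le.
have := powR_mul_expR s0 r0; rewrite -!ke.
move: (kap a b s _) (kap a b (s / 2) _) (chi _) ch0 => k1 k2 x x0 Hp.
have := ler_wpM2l (mulr_ge0 H0 (mulr_ge0 (normr_ge0 (t r)) x0)) Hp.
by congr (_ <= _); ring.
Qed.

Let kap_a s r : kap a b s (r * a.1, r * a.2) = expR (- (s * c) * r).
Proof.
have -> : (r * a.1, r * a.2) = wpt a b r 0 by rewrite /wpt !mul0r !addr0.
by rewrite kap_wpt// mulr0 expR0 mulr1.
Qed.

Let kap_b s r : kap a b s (r * b.1, r * b.2) = expR (- (s * c) * r).
Proof.
have -> : (r * b.1, r * b.2) = wpt a b 0 r by rewrite /wpt !mul0r !add0r.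
by rewrite kap_wpt// mulr0 expR0 mul1r.
Qed.

Definition corner_trace (v v1 v2 : R * R -> R) (ta tb : R -> R) : Prop :=
  [/\ sqint leb2 W' v, sqint leb2 W' v1, sqint leb2 W' v2, sqint mu I ta & sqint mu I tb] /\
  [/\ trace_green a b W dl rho v v1 v2 a b ta, trace_green a b W dl rho v v1 v2 b a tb,
    trace_ineq a b W dl rho v a b ta & trace_ineq a b W dl rho v b a tb].

Definition ray_holder_at (m : R -> R) (m0 : R) : Prop :=
  measurable_fun I m /\ forall r, I r -> `|m r - m0| <= H * r `^ al.

(** Here [v] and [w] are to be the real and imaginary parts of one eigenfunction, [m] and [n] those
    of [eta] up to order and sign, and [u] one part of the difference of the pair.
    [corner_pde_small] bounds the pairing, and four uses of [ray_holder] freeze the coefficients. *)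
Lemma boundary_small (u u1 u2 F v v1 v2 w w1 w2 : R * R -> R)
    (ta tb za zb ma mb na nb : R -> R) (m0 n0 : R) :
  sqint leb2 W' u -> sqint leb2 W' u1 -> sqint leb2 W' u2 -> sqint leb2 W' F ->
  (forall psi, smooth psi -> square_supported dl psi ->
    \int[leb2]_(x in W') (u x * 'D_e1 psi x + u1 x * psi x) = 0) ->
  (forall psi, smooth psi -> square_supported dl psi ->
    \int[leb2]_(x in W') (u x * 'D_e2 psi x + u2 x * psi x) = 0) ->
  corner_trace v v1 v2 ta tb -> corner_trace w w1 w2 za zb ->
  ray_holder_at ma m0 -> ray_holder_at mb m0 -> ray_holder_at na n0 -> ray_holder_at nb n0 ->
  (forall psi, smooth psi -> square_supported dl psi ->
    \int[leb2]_(x in W') (u1 x * 'D_e1 psi x + u2 x * 'D_e2 psi x + F x * psi x) =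
    \int[mu]_(r in I) ((ma r * ta r + na r * za r) * psi (r * a.1, r * a.2)) +
    \int[mu]_(r in I) ((mb r * tb r + nb r * zb r) * psi (r * b.1, r * b.2))) ->
  exists2 C, 0 <= C & forall e, 0 < e -> exists2 s0, 1 <= s0 &
    forall s h h' h0 h0' B L, s0 <= s ->
    corner_approx W v h h0 B L -> corner_approx W w h' h0' B L ->
    s * `|m0 * (ray_test ta a s + ray_test tb b s) + n0 * (ray_test za a s + ray_test zb b s)|
      <= e + C * (s `^ (- al) * (1 + s * B + L)).
Proof.
move=> su su1 su2 sF z1 z2 [[sv sv1 sv2 sta stb] [_ _ Ia Ib]]
  [[sw sw1 sw2 sza szb] [_ _ Ja Jb]] [mma Hma] [mmb Hmb] [mna Hna] [mnb Hnb] rel.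
have [Ca Ca0 HCa] := ray_mass_le a_unit b_unit D0 mW W_wedge W_bounded sv Ia.
have [Cb Cb0 HCb] := ray_mass_le a_unit b_unit D0 mW W_wedge W_bounded sv Ib.
have [Ea Ea0 HEa] := ray_mass_le a_unit b_unit D0 mW W_wedge W_bounded sw Ja.
have [Eb Eb0 HEb] := ray_mass_le a_unit b_unit D0 mW W_wedge W_bounded sw Jb.
pose C := Ca + Cb + Ea + Eb.
exists (2 * (H * P) * C); first by rewrite !mulr_ge0// !addr_ge0.
move=> e e0.
have [s0 s00 Hs0] := corner_pde_small a_unit b_unit D0 mW W_wedge W_bounded
  su su1 su2 sF z1 z2 e0.
(* The summand 2 ensures [1 <= s / 2], as [ray_mass_le] is applied at [s / 2]. *)
exists (2 + s0); first by rewrite -[leLHS]addr0 lerD// ?ler1n// ltW.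
move=> s h h' h0 h0' B L ss ap ap'.
have s2 : 2 <= s by apply: le_trans ss; rewrite lerDl ltW.
have sgt0 : 0 < s by exact: lt_le_trans s2.
have sh1 : 1 <= s / 2 by rewrite ler_pdivlMr// mul1r.
have ss0 : s0 <= s by apply: le_trans ss; rewrite lerDr.
have [i1 B1] := ray_holder kap_a sta mma Hma sgt0.
have [i2 B2] := ray_holder kap_b stb mmb Hmb sgt0.
have [i3 B3] := ray_holder kap_a sza mna Hna sgt0.
have [i4 B4] := ray_holder kap_b szb mnb Hnb sgt0.
have R1 := HCa _ _ _ _ _ sh1 ap; have R2 := HCb _ _ _ _ _ sh1 ap.
have R3 := HEa _ _ _ _ _ sh1 ap'; have R4 := HEb _ _ _ _ _ sh1 ap'.
have := Hs0 _ ss0; rewrite (rel _ (spsi s) (@supp_psi s)).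
have -> : \int[mu]_(r in I) ((ma r * ta r + na r * za r) * psi s (r * a.1, r * a.2)) =
  ray_test (fun r => ma r * ta r) a s + ray_test (fun r => na r * za r) a s.
  by rewrite /ray_test -(RintegralD mI i1 i3); apply: eq_Rintegral => r _; rewrite mulrDl.
have -> : \int[mu]_(r in I) ((mb r * tb r + nb r * zb r) * psi s (r * b.1, r * b.2)) =
  ray_test (fun r => mb r * tb r) b s + ray_test (fun r => nb r * zb r) b s.
  by rewrite /ray_test -(RintegralD mI i2 i4); apply: eq_Rintegral => r _; rewrite mulrDl.
case: ap => _ B0 L0 _ _.
pose X := s^-1 + B + L / s.
have X0 : 0 <= X by rewrite !addr_ge0// ?divr_ge0 ?invr_ge0// ltW.
have HX : (s / 2)^-1 + B + L / (s / 2) <= 2 * X.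
  have -> : (s / 2)^-1 + B + L / (s / 2) = 2 * X - B by rewrite /X; field; rewrite gt_eqF.
  by rewrite lerBlDr lerDl.
pose Y := H * P * s `^ (- al).
have Y0 : 0 <= Y by rewrite !mulr_ge0// powR_ge0.
have bound t t0 m e' E : 0 <= E ->
    `|ray_test (fun r => m r * t r) e' s - t0 * ray_test t e' s| <=
      H * P * s `^ (- al) * ray_mass t e' (s / 2) ->
    ray_mass t e' (s / 2) <= E * ((s / 2)^-1 + B + L / (s / 2)) ->
    `|ray_test (fun r => m r * t r) e' s - t0 * ray_test t e' s| <= Y * (E * (2 * X)).
  move=> E0 T1 T2; apply: (le_trans T1); apply: ler_wpM2l => //.
  by apply: (le_trans T2); apply: ler_wpM2l.
have {B1 R1}B1 := bound _ _ _ _ _ Ca0 B1 R1.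
have {B2 R2}B2 := bound _ _ _ _ _ Cb0 B2 R2.
have {B3 R3}B3 := bound _ _ _ _ _ Ea0 B3 R3.
have {B4 R4}B4 := bound _ _ _ _ _ Eb0 B4 R4.
set M1 := ray_test _ _ _ in B1 *; set M2 := ray_test _ _ _ in B2 *.
set M3 := ray_test _ _ _ in B3 *; set M4 := ray_test _ _ _ in B4 *.
set T1 := ray_test ta a s in B1 *; set T2 := ray_test tb b s in B2 *.
set T3 := ray_test za a s in B3 *; set T4 := ray_test zb b s in B4 *.
move=> HM.
have HT : `|m0 * (T1 + T2) + n0 * (T3 + T4)| <=
    `|M1 + M3 + (M2 + M4)| + Y * (C * (2 * X)).
  have -> : m0 * (T1 + T2) + n0 * (T3 + T4) = (M1 + M3 + (M2 + M4)) -
    ((M1 - m0 * T1) + (M2 - m0 * T2) + ((M3 - n0 * T3) + (M4 - n0 * T4))) by ring.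
  apply: (le_trans (ler_normB _ _)); rewrite lerD2l.
  have -> : Y * (C * (2 * X)) = Y * (Ca * (2 * X)) + Y * (Cb * (2 * X)) +
    (Y * (Ea * (2 * X)) + Y * (Eb * (2 * X))) by rewrite /C; ring.
  apply: (le_trans (ler_normD _ _)); apply: lerD.
    by apply: (le_trans (ler_normD _ _)); exact: lerD.
  by apply: (le_trans (ler_normD _ _)); exact: lerD.
apply: (le_trans (ler_wpM2l (ltW sgt0) HT)); rewrite mulrDr; apply: lerD => //.
rewrite /X /Y le_eqVlt; apply/orP; left; apply/eqP.
by field; rewrite gt_eqF.
Qed.

(** The two relations are the real and imaginary parts of one jump condition. Their frozen form is a
    linear system for the trace integrals [T] and [T'] with determinant [m0 ^+ 2 + n0 ^+ 2], so both
    integrals are small; [green_sum] compares them with [h0 * Z] and [h0' * Z], and [ray_psi_large]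
    allows the division by [Z]. *)
Lemma corner_value_small (u u1 u2 F y y1 y2 G v v1 v2 w w1 w2 : R * R -> R)
    (ta tb za zb ma mb na nb : R -> R) (m0 n0 : R) :
  [/\ sqint leb2 W' u, sqint leb2 W' u1, sqint leb2 W' u2 & sqint leb2 W' F] ->
  [/\ sqint leb2 W' y, sqint leb2 W' y1, sqint leb2 W' y2 & sqint leb2 W' G] ->
  (forall psi, smooth psi -> square_supported dl psi ->
    [/\ \int[leb2]_(x in W') (u x * 'D_e1 psi x + u1 x * psi x) = 0,
    \int[leb2]_(x in W') (u x * 'D_e2 psi x + u2 x * psi x) = 0,
    \int[leb2]_(x in W') (y x * 'D_e1 psi x + y1 x * psi x) = 0 &
    \int[leb2]_(x in W') (y x * 'D_e2 psi x + y2 x * psi x) = 0]) ->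
  corner_trace v v1 v2 ta tb -> corner_trace w w1 w2 za zb ->
  ray_holder_at ma m0 -> ray_holder_at mb m0 -> ray_holder_at na n0 -> ray_holder_at nb n0 ->
  (forall psi, smooth psi -> square_supported dl psi ->
    \int[leb2]_(x in W') (u1 x * 'D_e1 psi x + u2 x * 'D_e2 psi x + F x * psi x) =
    \int[mu]_(r in I) ((ma r * ta r - na r * za r) * psi (r * a.1, r * a.2)) +
    \int[mu]_(r in I) ((mb r * tb r - nb r * zb r) * psi (r * b.1, r * b.2))) ->
  (forall psi, smooth psi -> square_supported dl psi ->
    \int[leb2]_(x in W') (y1 x * 'D_e1 psi x + y2 x * 'D_e2 psi x + G x * psi x) =
    \int[mu]_(r in I) ((na r * ta r + ma r * za r) * psi (r * a.1, r * a.2)) +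
    \int[mu]_(r in I) ((nb r * tb r + mb r * zb r) * psi (r * b.1, r * b.2))) ->
  0 < m0 ^+ 2 + n0 ^+ 2 ->
  exists2 C, 0 <= C & forall e, 0 < e -> exists2 s0, 1 <= s0 &
    forall s h h' h0 h0' B L, s0 <= s ->
    corner_approx W v h h0 B L -> corner_approx W w h' h0' B L ->
    `|h0| <= e + C * (s * B + L * s `^ (- al)) /\
    `|h0'| <= e + C * (s * B + L * s `^ (- al)).
Proof.
move=> [su su1 su2 sF] [sy sy1 sy2 sG] zer cv cw Hma Hmb Hna Hnb rel1 rel2 N0.
have negna m m' : ray_holder_at m m' -> ray_holder_at (fun r => - m r) (- m').
  move=> [mm Hm]; split; first exact: measurableT_comp.
  by move=> r Ir; rewrite -opprD normrN; exact: Hm.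
have rel1' psi' : smooth psi' -> square_supported dl psi' ->
    \int[leb2]_(x in W') (u1 x * 'D_e1 psi' x + u2 x * 'D_e2 psi' x + F x * psi' x) =
    \int[mu]_(r in I) ((ma r * ta r + - na r * za r) * psi' (r * a.1, r * a.2)) +
    \int[mu]_(r in I) ((mb r * tb r + - nb r * zb r) * psi' (r * b.1, r * b.2)).
  move=> sp q; rewrite (rel1 _ sp q).
  by congr (_ + _); apply: eq_Rintegral => r _; rewrite mulNr.
have [C1 C10 H1] := boundary_small su su1 su2 sF
  (fun p sp q => let: And4 z _ _ _ := zer p sp q in z)
  (fun p sp q => let: And4 _ z _ _ := zer p sp q in z)
  cv cw Hma Hmb (negna _ _ Hna) (negna _ _ Hnb)
  rel1'.
have [C2 C20 H2] := boundary_small sy sy1 sy2 sG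
  (fun p sp q => let: And4 _ _ z _ := zer p sp q in z)
  (fun p sp q => let: And4 _ _ _ z := zer p sp q in z)
  cv cw Hna Hnb Hma Hmb rel2.
case: (cv) (cw) => [[sv sv1 sv2 _ _] [Ga Gb _ _]] [[sw sw1 sw2 _ _] [Ja Jb _ _]].
have [C3 C30 H3] := green_sum a_unit b_unit D0 mW W_wedge wedge_W W_bounded rho_a rho_b
  sv sv1 sv2 Ga Gb.
have [C4 C40 H4] := green_sum a_unit b_unit D0 mW W_wedge wedge_W W_bounded rho_a rho_b
  sw sw1 sw2 Ja Jb.
have [sZ sZ1 HZ] := ray_psi_large a_unit b_unit D0 dl0 rho_a rho_b.
pose k := chi 0 / 2.
have k0' : 0 < k by rewrite divr_gt0//; apply: square_bump_gt0 => //=; rewrite normr0.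
pose N := m0 ^+ 2 + n0 ^+ 2.
pose Q := (`|m0| + `|n0|) / N.
have Q0 : 0 <= Q by rewrite divr_ge0 ?(ltW N0)// addr_ge0.
pose C := (Q * (C1 + C2) + C3 + C4) / k.
have C0 : 0 <= C by rewrite divr_ge0 ?(ltW k0')// !addr_ge0// mulr_ge0// addr_ge0.
exists C => // e e0.
(* A number here, shadowing the basis vector. Half of [e * k] pays for the [Q + 1] copies of [e1];
   the other half pays for the term in [p = s ^ (- al)], which [s >= s5] makes at most [d]. *)
pose e1 := e * k / (2 * (Q + 1)).
have Q1 : 0 < Q + 1 by rewrite ltr_wpDl.
have Q2 : 0 < 2 * (Q + 1) by exact: mulr_gt0.
have e10 : 0 < e1 := divr_gt0 (mulr_gt0 e0 k0') Q2.
have [s1 s11 K1] := H1 _ e10; have [s2 s21 K2] := H2 _ e10.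
have [s3 s31 K3] := H3 _ e10; have [s4 s41 K4] := H4 _ e10.
pose d := e / (2 * (C + 1)).
have d0 : 0 < d by rewrite divr_gt0// mulr_gt0// ltr_wpDl.
pose s5 := d^-1 `^ al^-1.
have s50 : 0 <= s5 by exact: powR_ge0.
exists (Num.max s1 (Num.max s2 (Num.max s3 (Num.max s4 (Num.max s5 sZ))))).
  by rewrite le_max s11.
move=> s h h' h0 h0' B L; rewrite !ge_max => /and5P[L1 L2 L3 L4 /andP[L5 LZ]] ap ap'.
have sg1 : 1 <= s by exact: le_trans L1.
have sgt0 : 0 < s by exact: lt_le_trans sg1.
have := K1 _ _ _ _ _ _ _ L1 ap ap'; have := K2 _ _ _ _ _ _ _ L2 ap ap'.
have := K3 _ _ _ _ _ L3 ap; have := K4 _ _ _ _ _ L4 ap'.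
have := HZ _ LZ.
rewrite -/(ray_test ta a s) -/(ray_test tb b s) -/(ray_test za a s) -/(ray_test zb b s).
rewrite -/(ray_psi a s) -/(ray_psi b s) -/k.
set T := ray_test ta a s + _; set T' := ray_test za a s + _; set Z := ray_psi a s + _.
pose p := s `^ (- al).
have p0 : 0 < p by exact: powR_gt0.
have p1 : p <= 1.
  rewrite /p powRN invf_le1 ?powR_gt0//.
  by rewrite -(powRr0 s); apply: ler_powR => //; exact: ltW.
have pd : p <= d.
  rewrite /p powRN -[leRHS]invrK lef_pV2 ?posrE ?powR_gt0 ?invr_gt0//.
  have -> : d^-1 = s5 `^ al.
    by rewrite /s5 -powRrM mulVf ?gt_eqF// powRr1// invr_ge0 ltW.
  by apply: ge0_ler_powR; rewrite ?nnegrE// ltW.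
have sp : s^-1 <= p.
  rewrite /p powRN lef_pV2 ?posrE ?powR_gt0//.
  by rewrite -[leRHS]powRr1 ?(ltW sgt0)//; apply: ler_powR => //; exact: ltW.
case: ap => _ B0 L0 _ _; rewrite -/p => ZZ A4 A3 A2 A1.
have sB0 : 0 <= s * B by rewrite mulr_ge0// ltW.
have Lp : L / s <= L * p by apply: ler_wpM2l.
pose E := s * B + L * p.
have E0 : 0 <= E by rewrite addr_ge0// mulr_ge0// ltW.
have pB : p * (1 + s * B + L) <= p + E.
  rewrite /E !mulrDr mulr1 -addrA lerD2l (mulrC p L) lerD2r.
  by rewrite ler_piMl.
have A1' : s * `|m0 * T + - n0 * T'| <= e1 + C1 * (p + E).
  by apply: (le_trans A1); rewrite lerD2l; apply: ler_wpM2l.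
have A2' : s * `|n0 * T + m0 * T'| <= e1 + C2 * (p + E).
  by apply: (le_trans A2); rewrite lerD2l; apply: ler_wpM2l.
have A3' : s * `|T - h0 * Z| <= e1 + C3 * E.
  by apply: (le_trans A3); rewrite lerD2l; apply: ler_wpM2l => //; rewrite lerD2l.
have A4' : s * `|T' - h0' * Z| <= e1 + C4 * E.
  by apply: (le_trans A4); rewrite lerD2l; apply: ler_wpM2l => //; rewrite lerD2l.
(* [N T] and [N T'] are combinations of the two boundary pairings, with
   coefficients [m0] and [n0] up to sign. *)
have comb x x1 x2 f f' : `|f| + `|f'| <= `|m0| + `|n0| -> N * x = f * x1 + f' * x2 ->
    s * `|x1| <= e1 + C1 * (p + E) -> s * `|x2| <= e1 + C2 * (p + E) ->
    s * `|x| <= Q * (e1 + (C1 + C2) * (p + E)).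
  move=> ff Nx x1E x2E.
  have -> : x = N^-1 * (f * x1 + f' * x2) by rewrite -Nx mulKf// gt_eqF.
  rewrite normrM (gtr0_norm (_ : 0 < N^-1)) ?invr_gt0// /Q mulrAC.
  rewrite mulrCA mulrC ler_wpM2r ?invr_ge0 ?(ltW N0)//.
  set Y := e1 + _.
  have c1 : 0 <= C1 * (p + E) by rewrite mulr_ge0// addr_ge0// ltW.
  have c2 : 0 <= C2 * (p + E) by rewrite mulr_ge0// addr_ge0// ltW.
  have x1Y : s * `|x1| <= Y by apply: (le_trans x1E); rewrite /Y (mulrDl C1) (addrA e1) lerDl.
  have x2Y : s * `|x2| <= Y by apply: (le_trans x2E); rewrite /Y (mulrDl C1) lerD2l lerDr.
  have Y0 : 0 <= Y by rewrite /Y (mulrDl C1) !addr_ge0// ltW.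
  apply: (@le_trans _ _ ((`|f| + `|f'|) * Y)); last exact: ler_wpM2r.
  rewrite mulrDl; apply: (@le_trans _ _ (s * (`|f| * `|x1| + `|f'| * `|x2|))).
    apply: ler_wpM2l; first exact: ltW.
    by rewrite -!normrM; exact: ler_normD.
  by rewrite mulrDr !(mulrCA s); apply: lerD; apply: ler_wpM2l.
have BT : s * `|T| <= Q * (e1 + (C1 + C2) * (p + E)).
  by apply: (comb _ _ _ m0 n0 _ _ A1' A2') => //; rewrite /N; ring.
have BT' : s * `|T'| <= Q * (e1 + (C1 + C2) * (p + E)).
  by apply: (comb _ _ _ (- n0) m0 _ _ A1' A2'); [rewrite normrN addrC|rewrite /N; ring].
(* Since [k <= s * Z], a bound on [s] times the modulus of [y' * Z] is a bound on that of [y'] times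
   [k]. *)
have fin x y' Cy : Cy <= C3 + C4 -> s * `|x| <= Q * (e1 + (C1 + C2) * (p + E)) ->
    s * `|x - y' * Z| <= e1 + Cy * E -> `|y'| <= e + C * E.
  move=> CyC xB xyB; rewrite -(ler_pM2r k0').
  apply: (@le_trans _ _ (`|y'| * (s * Z))); first exact: ler_wpM2l.
  have Z0 : 0 <= Z by rewrite -(pmulr_rge0 _ sgt0) (le_trans _ ZZ)// ltW.
  apply: (@le_trans _ _ (s * `|x| + s * `|x - y' * Z|)).
    rewrite -mulrDr mulrCA; apply: ler_wpM2l; first exact: ltW.
    have -> : `|y'| * Z = `|x - (x - y' * Z)| by rewrite subKr normrM (ger0_norm Z0).
    exact: ler_normB.
  apply: (le_trans (lerD xB xyB)).
  have CyE : Cy * E <= (C3 + C4) * E by exact: ler_wpM2r.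
  have -> : (e + C * E) * k = e * k + (Q * (C1 + C2) + C3 + C4) * E.
    by rewrite /C; field; rewrite gt_eqF.
  have e1Q : (Q + 1) * e1 = e * k / 2 by rewrite /e1; field; rewrite gt_eqF.
  have Cp : Q * ((C1 + C2) * p) <= e * k / 2.
    have Ce : (C + 1) * d * k = e * k / 2.
      by rewrite /d; field; rewrite gt_eqF// ltr_wpDl.
    apply: (@le_trans _ _ (C * k * p)).
      rewrite mulrA; apply: ler_wpM2r; first exact: ltW.
      by rewrite /C divfK ?gt_eqF// -addrA lerDl addr_ge0.
    rewrite -Ce.
    rewrite mulrAC; apply: ler_wpM2r; first exact: ltW.
    by apply: ler_pM => //; [exact: ltW|rewrite lerDl].
  have -> : Q * (e1 + (C1 + C2) * (p + E)) + (e1 + Cy * E) =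
    (Q + 1) * e1 + Q * ((C1 + C2) * p) + Q * (C1 + C2) * E + Cy * E by ring.
  rewrite e1Q (_ : (Q * (C1 + C2) + C3 + C4) * E = Q * (C1 + C2) * E + (C3 + C4) * E); last by ring.
  rewrite addrA; apply: lerD => //; rewrite lerD2r.
  by rewrite {2}(_ : e * k = e * k / 2 + e * k / 2) ?lerD2l//; field.
split.
  by apply: (fin _ _ _ _ BT A3'); rewrite lerDl.
by apply: (fin _ _ _ _ BT' A4'); rewrite lerDr.
Qed.

End corner_value.

(** * Hausdorff measure on the two sides *)

Section hausdorff_lines.
Context {R : realType}.
Local Notation mu := (@lebesgue_measure R).
Local Open Scope ereal_scope.

(** Reorders along a bijection between [nat] and its square, so that a doubly indexed cover becomes
    a sequence, as [hausdorff1] requires. *)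
Lemma nneseries_pair (F : nat * nat -> \bar R) : (forall ij, 0 <= F ij) ->
  exists2 f : nat -> nat * nat, (forall ij, exists n, f n = ij) &
    \sum_(n <oo) F (f n) = \sum_(i <oo) \sum_(j <oo) F (i, j).
Proof.
move=> F0; have /card_esym/ppcard_eqP[f] := card_nat2.
exists f; first by move=> ij; exists (f^-1%FUN ij); rewrite invK ?inE.
transitivity (\esum_(i in setT) F i).
  rewrite -(esum_pred_image F f xpredT) ?[fun=> _]set_true//; first by rewrite image_eq.
pose J : nat -> set (nat * nat) := fun i => [set (i, j) | j in setT].
rewrite (_ : setT = \bigcup_k J k); last first.
  by rewrite predeqE => -[x y]; split => // _; exists x => //; exists y.
rewrite esum_bigcupT //=; last first.
  apply/trivIsetP => i j _ _ ij.
  rewrite predeqE => -[n m] /=; split => //= -[] [_] _ [<-{n} _].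
  by move=> [m' _] [] /esym/eqP; rewrite (negbTE ij).
rewrite -(image_id [set: nat]) -fun_true esum_pred_image//; last first.
  by move=> n _; exact: esum_ge0.
apply: eq_eseriesr => /= j _.
rewrite -(esum_pred_image F (pair j) predT)//=; last first.
  by move=> ? ? _ _; exact: (@can_inj _ _ _ snd).
by congr esum; rewrite predeqE => -[x y]; split; move=> [i _ <-]; exists i.
Qed.

Lemma diam_ge0 (C : set (R * R)) : 0 <= diam C.
Proof. by apply: ereal_sup_ubound; left. Qed.

Lemma diam_ge (C : set (R * R)) x y : C x -> C y -> (enorm (x - y))%:E <= diam C.
Proof. by move=> Cx Cy; apply: ereal_sup_ubound; right; exists x => //; exists y. Qed.

Lemma diam_set0 : diam (set0 : set (R * R)) = 0.
Proof.
apply/eqP; rewrite eq_le diam_ge0 andbT.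
by apply/ge_ereal_sup => _ [->//|[x []]].
Qed.

Lemma hausdorff1_0 : hausdorff1 (set0 : set (R * R)) = 0.
Proof.
apply/eqP; rewrite eq_le; apply/andP; split.
  apply/ge_ereal_sup => _ [d /= d0 <-]; apply: ereal_inf_lbound.
  exists (fun=> set0); first by split=> // i; rewrite diam_set0 lee_fin ltW.
  by rewrite eseries0// => i _ _; rewrite diam_set0.
apply: (@le_trans _ _ (ereal_inf [set (\sum_(0 <= i <oo) diam (C i)) | C in
  [set C : nat -> set (R * R) |
        set0 `<=` \bigcup_i C i /\ forall i, (diam (C i) <= 1%:E)]])).
  by apply: le_ereal_inf_tmp => _ [C _ <-]; apply: nneseries_ge0 => i _ _; exact: diam_ge0.
by apply: ereal_sup_ubound; exists 1%R => //=.
Qed.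

Let convex_measure (J : set R) (r t : R) : measurable (J : set (measurableTypeR R)) ->
  is_interval J -> J r -> J t -> (`|r - t|%:E <= mu J)%E.
Proof.
move=> mJ iJ; wlog rt : r t / (r <= t)%R.
  by move=> H Jr Jt; have [rt|/ltW tr] := leP r t; [|rewrite distrC]; exact: H.
move=> Jr Jt; rewrite distrC ger0_norm ?subr_ge0//.
have -> : (t - r)%:E = mu `[r, t].
  rewrite lebesgue_measure_itv/= lte_fin; case: ltP => // tr.
  by rewrite (@le_anti _ _ t r) ?subrr// tr rt.
apply: le_measure; rewrite ?inE//.
by move=> z /=; rewrite in_itv/= => ?; exact: (iJ r t).
Qed.

(* A cover by intervals is cut along a mesh so that the pieces are short
   enough, which does not change the total length. *)
Lemma hausdorff1_lipschitz_le (f : R -> R * R) (P : set (measurableTypeR R)) (rho : R) :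
  (forall r t, enorm (f r - f t) <= `|r - t|)%R -> P `<=` `[rho, +oo[ ->
  hausdorff1 (f @` P) <= mu P.
Proof.
move=> f1 Prho; apply/ge_ereal_sup => _ [d /= d0 <-].
rewrite -[leRHS]/(((@wlength R idfun)^* P)%mu) outer_measure_open_itv_cover.
apply: le_ereal_inf_tmp => _ [F [/= itvF PF] <-].
have mF k : measurable (F k : set (measurableTypeR R)).
  by have [[x y] ->] := itvF k; exact: measurable_itv.
have iF k : is_interval (F k) by have [[x y] ->] := itvF k; exact: interval_is_interval.
(* Cells of length [d] from the lower bound [rho] of [P] on; [f] does not increase distances, so
   images of pieces have diameter at most [d]. *)
pose p (j : nat) := `[(rho + j%:R * d)%R, (rho + j.+1%:R * d)%R[%classic : set (measurableTypeR R).
have mp j : measurable (p j) by exact: measurable_itv.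
have tp : trivIset setT p.
  apply: ltn_trivIset => m n mn; apply/seteqP; split=> // z [].
  rewrite /p /= !in_itv/= => /andP[_ zm] /andP[nz _].
  suff : (z < z)%R by rewrite ltxx.
  apply: (lt_le_trans zm); apply: le_trans nz.
  by rewrite lerD2l ler_pM2r// ler_nat.
have pc : `[rho, +oo[ `<=` \bigcup_j p j.
  move=> z /=; rewrite in_itv/= andbT => rz.
  have zd : (0 <= (z - rho) / d)%R by rewrite divr_ge0 ?subr_ge0// ltW.
  exists (Num.trunc ((z - rho) / d)) => //=.
  have /andP[t1 t2] := trunc_itv zd.
  rewrite /p /= in_itv/= -lerBrDl -ltrBlDl; apply/andP; split.
    by rewrite -ler_pdivlMr.
  by rewrite -ltr_pdivrMr.
pose a ij := diam (f @` (F ij.1 `&` p ij.2)).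
have a0 ij : 0 <= a ij := diam_ge0 _.
have [g gs ag] := nneseries_pair a0.
have diam_le i j : a (i, j) <= mu (F i `&` p j).
  apply/ge_ereal_sup => _ [->|[_ [r [Fr pr] <-] [_ [t [Ft pt] <-] <-]]].
    exact: measure_ge0.
  apply: (@le_trans _ _ `|r - t|%:E); first by rewrite lee_fin.
  apply: convex_measure => //; first exact: measurableI.
  move=> x y [Fx px] [Fy py] z xzy; split; first exact: iF xzy.
  exact: (@interval_is_interval _ `[(rho + j%:R * d)%R, (rho + j.+1%:R * d)%R[ x y).
apply: (@le_trans _ _ (\sum_(n <oo) a (g n))).
  apply: ereal_inf_lbound; exists (fun n => f @` (F (g n).1 `&` p (g n).2)) => //; split.
    move=> _ [r Pr <-]; have [i _ Fr] := PF _ Pr; have [j _ pr] := pc _ (Prho _ Pr).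
    by have [n gn] := gs (i, j); exists n => //; exists r => //; rewrite gn.
  move=> n; apply: (le_trans (diam_le (g n).1 (g n).2)).
  apply: (@le_trans _ _ (mu (p (g n).2))).
    by apply: le_measure; rewrite ?inE//; exact: measurableI.
  rewrite /p lebesgue_measure_itv/= lte_fin ltrD2l ltr_pM2r// ltr_nat ltnS leqnn.
  by rewrite -EFinD lee_fin -natr1; lra.
rewrite ag; apply: lee_nneseries => [i _ _|i _].
  by apply: nneseries_ge0 => j _ _; exact: a0.
apply: (@le_trans _ _ (\sum_(j <oo) mu (F i `&` p j))).
  by apply: lee_nneseries => [j _ _|j _]; [exact: a0|exact: diam_le].
have <- : mu (\bigcup_j (F i `&` p j)) = \sum_(j <oo) mu (F i `&` p j).
  rewrite measure_bigcup//; first by apply: eq_eseriesl => j; rewrite in_setT.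
  - by move=> j _; exact: measurableI.
  - exact: trivIset_setIl.
rewrite -setI_bigcupr; apply: (@le_trans _ _ (mu (F i))).
  apply: le_measure; rewrite ?inE//.
  by apply: measurableI => //; exact: bigcupT_measurable.
have [[x y] ->] := itvF i.
by rewrite lebesgue_measure_itv wlength_itv.
Qed.

(** The set is arbitrary, so it is enclosed in [[inf P, sup P]] and monotonicity is that of the
    outer measure. *)
Let bounded_measure (P : set (measurableTypeR R)) (m : \bar R) : 0 <= m ->
  (forall r t, P r -> P t -> `|r - t|%:E <= m) -> mu P <= m.
Proof.
case: m => [m m0 Pm|_ _|//]; last by rewrite leey.
rewrite lee_fin in m0.
have [[r Pr]|/set0P/negP/negPn/eqP ->] := pselect (P !=set0); last by rewrite measure0 lee_fin.
have Prm t : P t -> (r - m <= t <= r + m)%R.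
  by move=> Pt; have := Pm _ _ Pt Pr; rewrite lee_fin ler_distl.
have supP : has_sup P.
  by split; [exists r|exists (r + m)%R => t /Prm/andP[]].
have infP : has_inf P.
  by split; [exists r|exists (r - m)%R => t /Prm/andP[]].
have sim : (sup P - inf P <= m)%R.
  rewrite lerBlDr -lerBlDl; apply: lb_le_inf; first by exists r.
  move=> t Pt; rewrite lerBlDl; apply: ge_sup; first by exists r.
  move=> z Pz; have := Pm _ _ Pz Pt; rewrite lee_fin => /(le_trans (ler_norm _)).
  by rewrite lerBlDr.
apply: (@le_trans _ _ (mu `[inf P, sup P]%classic)).
  rewrite -[leLHS]/(((@wlength R idfun)^* P)%mu) -[leRHS]/(((@wlength R idfun)^* _)%mu).
  apply: le_outer_measure => t Pt /=; rewrite in_itv/=; apply/andP; split.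
    by apply: ge_inf => //; case: infP.
  by apply: ub_le_sup => //; case: supP.
rewrite lebesgue_measure_itv/= lte_fin; case: ifP => _; last by rewrite lee_fin.
by rewrite -EFinD lee_fin.
Qed.

(* Away from the vertex, a set of small diameter meets only one half of the
   bent line, on which the parametrisation is isometric. *)
Lemma hausdorff1_bent_ge (f : R -> R * R) (D : R) (A : set (R * R)) : (0 < D)%R ->
  (forall r t, (0 <= r * t)%R -> (enorm (f r - f t) = `|r - t|)%R) ->
  (forall r t, (r * t < 0)%R -> (D * `|r| <= enorm (f r - f t))%R) ->
  mu (f @^-1` A) <= hausdorff1 A.
Proof.
move=> D0 fiso fsep; apply/lee_addgt0Pr => e e0.
pose dl : R := (e / 2)%R; have dl0 : (0 < dl)%R by rewrite divr_gt0.
(* Points with parameters of modulus above [dl] on opposite halves are at least [D * dl > d] apart,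
   so no set of diameter at most [d] meets both. The removed interval has length [2 * dl = e]. *)
pose d := (D * dl / 2)%R; have d0 : (0 < d)%R by rewrite divr_gt0// mulr_gt0.
have dlt : (d < D * dl)%R by rewrite /d; have := mulr_gt0 D0 dl0; lra.
suff H : mu (f @^-1` A `\` `[(- dl)%R, dl]%classic) <= hausdorff1 A.
  apply: (@le_trans _ _ (mu (f @^-1` A `\` `[(- dl)%R, dl]%classic) + mu `[(- dl)%R, dl]%classic)).
    rewrite -[leLHS]/(((@wlength R idfun)^* _)%mu).
    rewrite -[X in _ <= X + _]/(((@wlength R idfun)^* _)%mu).
    rewrite -[X in _ <= _ + X]/(((@wlength R idfun)^* _)%mu).
    apply: le_trans (outer_measureU2 _ _ _); apply: le_outer_measure => r Ar.
    by have [?|?] := pselect (`[(- dl)%R, dl]%classic r); [right|left].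
  apply: leeD => //; rewrite lebesgue_measure_itv/= lte_fin; case: ifP => _.
    by rewrite -EFinD lee_fin /dl; lra.
  by rewrite lee_fin ltW.
apply: (@le_trans _ _ (ereal_inf [set (\sum_(0 <= i <oo) diam (C i)) | C in
  [set C : nat -> set (R * R) |
        A `<=` \bigcup_i C i /\ forall i, (diam (C i) <= d%:E)]])); last first.
  by apply: ereal_sup_ubound; exists d.
apply: le_ereal_inf_tmp => _ [C [AC Cd] <-].
pose P i : set (measurableTypeR R) := f @^-1` C i `\` `[(- dl)%R, dl]%classic.
apply: (@le_trans _ _ (\sum_(i <oo) mu (P i))).
  rewrite -[leLHS]/(((@wlength R idfun)^* _)%mu).
  apply: le_trans (outer_measure_sigma_subadditive ((@wlength R idfun)^*)%mu P).
  apply: le_outer_measure => r [Ar nr].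
  by have [i _ Ci] := AC _ Ar; exists i.
apply: lee_nneseries => [i _ _|i _]; first exact: measure_ge0.
apply: bounded_measure; first exact: diam_ge0.
have out (r : R) : ~ `[(- dl)%R, dl]%classic r -> (dl < `|r|)%R.
  by move=> /negP; rewrite /= in_itv/= -ler_norml -ltNge.
move=> r t [Cr /out nr] [Ct _].
have [rt|rt] := leP 0%R (r * t)%R; first by rewrite -fiso//; exact: diam_ge.
have := le_trans (diam_ge Cr Ct) (Cd i); rewrite lee_fin => H.
have := lt_le_trans dlt (ler_wpM2l (ltW D0) (ltW nr)).
by move=> /lt_le_trans/(_ (fsep _ _ rt))/lt_le_trans/(_ H); rewrite ltxx.
Qed.

End hausdorff_lines.

Lemma integralE_set d (X : measurableType d) (R : realType) (m : set X -> \bar R)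
    (A : set X) (f : X -> \bar R) : m set0 = 0%E ->
  integral m A f = (integral m A f^\+ - integral m A f^\-)%E.
Proof.
move=> m0; rewrite (ge0_integralE_set m0 (fun x _ => funepos_ge0 f x)).
rewrite (ge0_integralE_set m0 (fun x _ => funeneg_ge0 f x)).
by rewrite /integral funepos_restrict funeneg_restrict.
Qed.

(** * The two sides as one curve *)

Section bent_line.
Context {R : realType}.
Local Notation mu := (@lebesgue_measure R).
Local Notation plane := (measurableTypeR R * measurableTypeR R)%type.
Variables (a b : R * R).
Hypothesis a_unit : a.1 ^+ 2 + a.2 ^+ 2 = 1.
Hypothesis b_unit : b.1 ^+ 2 + b.2 ^+ 2 = 1.
Hypothesis D0 : 0 < a.1 * b.2 - a.2 * b.1.
Let D := a.1 * b.2 - a.2 * b.1.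

(** Signed arc length from the vertex: nonnegative parameters run along [a], nonpositive ones along
    [b]. It turns arc length on the two sides into Lebesgue measure on an interval. *)
Definition bent (r : measurableTypeR R) : plane := wpt a b (Num.max r 0) (Num.max (- r) 0).

Lemma bent_ge0 r : 0 <= r -> bent r = (r * a.1, r * a.2).
Proof.
move=> r0; rewrite /bent (max_l r0) (max_r (_ : - r <= 0)) ?oppr_le0//.
by rewrite /wpt !mul0r !addr0.
Qed.

Lemma bent_le0 r : r <= 0 -> bent r = (- r * b.1, - r * b.2).
Proof.
move=> r0; rewrite /bent (max_r r0) (max_l (_ : 0 <= - r)) ?oppr_ge0//.
by rewrite /wpt !mul0r !add0r.
Qed.

Lemma measurable_bent : measurable_fun setT bent.
Proof.
have m0 : measurable_fun setT (fun r : measurableTypeR R => Num.max r 0).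
  by apply: measurable_maxr.
have m1 : measurable_fun setT (fun r : measurableTypeR R => Num.max (- r) 0).
  by apply: measurable_maxr => //; exact: oppr_measurable.
by apply/measurable_fun_pairP; split; apply: measurable_funD; apply: measurable_funM.
Qed.

Let norm_a (r : R) : enorm (r * a.1, r * a.2) = `|r|.
Proof. by rewrite /enorm /= !exprMn -mulrDr a_unit mulr1 sqrtr_sqr. Qed.

Let norm_b (r : R) : enorm (r * b.1, r * b.2) = `|r|.
Proof. by rewrite /enorm /= !exprMn -mulrDr b_unit mulr1 sqrtr_sqr. Qed.

Let enormN (x : R * R) : enorm (- x) = enorm x.
Proof. by rewrite /enorm /= !sqrrN. Qed.

Lemma bent_norm r : enorm (bent r) = `|r|.
Proof.
have [r0|/ltW r0] := leP 0 r; first by rewrite bent_ge0.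
by rewrite bent_le0// norm_b normrN.
Qed.

Lemma bent_isometric (r t : R) : 0 <= r * t -> enorm (bent r - bent t) = `|r - t|.
Proof.
have sub (e : R * R) (x y : R) : (x * e.1, x * e.2) - (y * e.1, y * e.2) =
    ((x - y) * e.1, (x - y) * e.2) by rewrite !mulrBl.
have [r0|r0|->] := ltgtP r 0.
- rewrite nmulr_rge0// => t0.
  by rewrite (bent_le0 (ltW r0)) (bent_le0 t0) sub norm_b -opprD normrN.
- rewrite pmulr_rge0// => t0.
  by rewrite (bent_ge0 (ltW r0)) (bent_ge0 t0) sub norm_a.
- have b0 : bent 0 = 0 by rewrite (bent_ge0 (lexx 0)) !mul0r.
  by move=> _; rewrite b0 !sub0r normrN enormN bent_norm.
Qed.

(** The law of cosines with [m] the cosine and [D] the sine of the opening: [D * r] is the distance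
    from [r a] to the line of [b], and the upper bound comes from [m >= -1]. *)
Let cross (r t : R) : 0 < r -> t < 0 ->
  D * r <= enorm (bent r - bent t) /\ D * - t <= enorm (bent r - bent t) /\
  enorm (bent r - bent t) <= r - t.
Proof.
move=> r0 t0; rewrite (bent_ge0 (ltW r0)) (bent_le0 (ltW t0)).
have : 0 < - t by rewrite oppr_gt0.
move: (- t) => q q0.
rewrite /enorm /=; set m := a.1 * b.1 + a.2 * b.2.
have mD : m ^+ 2 + D ^+ 2 = 1.
  rewrite -[RHS](mulr1 1) -{1}a_unit -b_unit /m /D; ring.
have E : (r * a.1 - q * b.1) ^+ 2 + (r * a.2 - q * b.2) ^+ 2 = r ^+ 2 + q ^+ 2 - 2 * r * q * m.
  transitivity (r ^+ 2 * (a.1 ^+ 2 + a.2 ^+ 2) + q ^+ 2 * (b.1 ^+ 2 + b.2 ^+ 2) - 2 * r * q * m).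
    by rewrite /m; ring.
  by rewrite a_unit b_unit !mulr1.
have m1 : -1 <= m.
  rewrite leNgt; apply/negP => mlt.
  have := sqr_ge0 D; have : 1 < m ^+ 2 by rewrite expr2; nra.
  by lra.
have Dr (x y : R) : 0 <= x -> (D * x) ^+ 2 <= y -> D * x <= Num.sqrt y.
  move=> x0 xy; have Dx0 : 0 <= D * x := mulr_ge0 (ltW D0) x0.
  rewrite -[leLHS](ger0_norm Dx0) -sqrtr_sqr; exact: ler_wsqrtr.
have D2 : D ^+ 2 = 1 - m ^+ 2 by rewrite -mD; ring.
rewrite E; split; [|split].
- apply: Dr; first exact: ltW.
  by rewrite exprMn D2; have := sqr_ge0 (q - r * m); nra.
- apply: Dr; first exact: ltW.
  by rewrite exprMn D2; have := sqr_ge0 (r - q * m); nra.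
- have rq : 0 <= r + q by rewrite addr_ge0// ltW.
  rewrite -[leRHS](ger0_norm rq) -sqrtr_sqr; apply: ler_wsqrtr.
  have := mulr_gt0 r0 q0; rewrite sqrrD; nra.
Qed.

Lemma bent_separated (r t : R) : r * t < 0 -> D * `|r| <= enorm (bent r - bent t).
Proof.
have [r0|r0|->] := ltgtP r 0; last by rewrite mul0r ltxx.
  rewrite nmulr_rlt0// => t0; rewrite -opprB enormN ltr0_norm//.
  by have [_ []] := cross t0 r0.
by rewrite pmulr_rlt0// => t0; rewrite gtr0_norm//; have [] := cross r0 t0.
Qed.

Lemma bent_lipschitz (r t : R) : enorm (bent r - bent t) <= `|r - t|.
Proof.
have [/bent_isometric ->//|] := leP 0 (r * t).
have [r0|r0|->] := ltgtP r 0; last by rewrite mul0r ltxx.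
  rewrite nmulr_rlt0// => t0; rewrite -opprB enormN distrC.
  by have [_ [_ /le_trans->]] := cross t0 r0; rewrite // ler_norm.
by rewrite pmulr_rlt0// => t0; have [_ [_ /le_trans->]] := cross r0 t0; rewrite // ler_norm.
Qed.

Variables (rho : R) (T : set plane).
Hypothesis rho0 : 0 < rho.
Hypothesis mT : measurable T.
Hypothesis TE : T = bent @` `]- rho, rho[.
Let I : set (measurableTypeR R) := `]0%R, rho[%classic.

Let preT : bent @^-1` T = `]- rho, rho[%classic.
Proof.
apply/seteqP; split => r /=; rewrite TE; last by move=> rI; exists r.
move=> [t /= tI tr]; rewrite in_itv/= -ltr_norml -bent_norm -tr bent_norm ltr_norml.
by move: tI; rewrite in_itv.
Qed.

(** One inequality holds because [bent] does not increase distances, the other because it is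
    isometric on each half and the halves are separated away from the vertex. *)
Lemma hausdorff1_bent (A : set plane) : A `<=` T -> hausdorff1 A = mu (bent @^-1` A).
Proof.
move=> AT; apply/eqP; rewrite eq_le; apply/andP; split; last first.
  exact: (@hausdorff1_bent_ge R bent D A D0 bent_isometric bent_separated).
have -> : hausdorff1 A = hausdorff1 (bent @` (bent @^-1` A)).
  congr hausdorff1; apply/seteqP; split=> [x Ax|_ [r Ar <-]//].
  by have := AT _ Ax; rewrite TE => -[r _ rx]; exists r => //; rewrite /preimage/= rx.
apply: (@hausdorff1_lipschitz_le R bent _ (- rho) bent_lipschitz).
move=> r /AT Tr; have : (bent @^-1` T) r by [].
by rewrite preT /= !in_itv/= andbT => /andP[/ltW].
Qed.

Let integral_bent (f : plane -> \bar R) :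
  integral hausdorff1 T f = (\int[pushforward mu bent]_(x in T) f x)%E.
Proof.
apply: eq_set_integral; first exact: hausdorff1_0.
  by rewrite /pushforward preimage_set0 measure0.
by move=> A _ AT; rewrite hausdorff1_bent.
Qed.

Lemma ge0_integral_hausdorff1 (f : plane -> \bar R) :
  measurable_fun T f -> (forall x, T x -> (0 <= f x)%E) ->
  integral hausdorff1 T f =
  (\int[mu]_(r in I) f (r * a.1, r * a.2)%R + \int[mu]_(r in I) f (r * b.1, r * b.2)%R)%E.
Proof.
move=> mf f0; rewrite integral_bent.
rewrite (ge0_integral_pushforward measurable_bent)//; last by move=> x /set_mem; exact: f0.
have mfb : measurable_fun `]- rho, rho[ (f \o bent).
  rewrite -preT; apply: (measurable_comp mT) => //; first by move=> _ [r /= ? <-].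
  exact: measurable_funTS measurable_bent.
have fb0 r : `]- rho, rho[%classic r -> (0 <= (f \o bent) r)%E.
  by rewrite -preT => Tr; exact: f0.
have I0 : `]- rho, rho[%classic = `]- rho, 0%R[ `|` `[0%R, rho[ :> set (measurableTypeR R).
  apply/seteqP; split=> r /=; rewrite !in_itv/=.
    by move=> /andP[x y]; have [r0|r0] := ltP r 0; [left; rewrite x|right; rewrite y].
  case=> /andP[x y]; first by rewrite x (lt_trans y).
  by rewrite y (lt_le_trans _ x)// oppr_lt0.
rewrite preT I0 ge0_integral_setU//; rewrite -?I0//; last first.
  apply/disj_setPLR => r /=; rewrite !in_itv/= => /andP[_ r0] /andP[].
  by rewrite leNgt r0.
have mfI : measurable_fun I (f \o bent).
  apply: measurable_funS mfb => //.
  by apply: subset_itvr; rewrite bnd_simp oppr_le0 ltW.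
rewrite addeC; congr (_ + _)%E.
  rewrite integral_itv_bndoo//; apply: eq_integral => r /set_mem.
  by rewrite /= in_itv/= => /andP[/ltW r0 _]; rewrite /= bent_ge0.
rewrite integral_mkcond [RHS]integral_mkcond.
rewrite (@ge0_integral_affine R (-1) 0) ?oppr_eq0 ?oner_eq0//.
- rewrite normrN1 mul1e; apply: eq_integral => r _.
  rewrite mulN1r addr0 /patch !mem_setE !in_itv/= ltrN2 oppr_lt0 andbC.
  by case: ifP => // /andP[/ltW r0 _]; rewrite bent_le0 ?oppr_le0// opprK.
- apply/(measurable_restrictT _ _).1 => //.
  apply: measurable_funS mfb => //.
  by apply: subset_itvl; rewrite bnd_simp ltW.
- move=> r; apply: erestrict_ge0 => {}r /= rI; apply: fb0.
  move: rI; rewrite /= !in_itv/= => /andP[-> /lt_trans]; apply.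
  by [].
Qed.

Lemma integral_hausdorff1 (f : plane -> R) : measurable_fun T f ->
  rintegrable mu I (fun r => f (r * a.1, r * a.2)) ->
  rintegrable mu I (fun r => f (r * b.1, r * b.2)) ->
  integral hausdorff1 T (EFin \o f) =
  (\int[mu]_(r in I) f (r * a.1, r * a.2) + \int[mu]_(r in I) f (r * b.1, r * b.2))%:E.
Proof.
move=> mf ia ib; have mf' : measurable_fun T (EFin \o f) by exact/measurable_EFinP.
rewrite (@integralE_set _ _ R hausdorff1 T (EFin \o f) hausdorff1_0).
rewrite ge0_integral_hausdorff1//; last exact: measurable_funepos.
rewrite ge0_integral_hausdorff1//; last exact: measurable_funeneg.
have ray (e : R * R) : rintegrable mu I (fun r => f (r * e.1, r * e.2)) ->
    exists p q : R, [/\ (\int[mu]_(r in I) (EFin \o f)^\+ (r * e.1, r * e.2)%R = p%:E)%E,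
      (\int[mu]_(r in I) (EFin \o f)^\- (r * e.1, r * e.2)%R = q%:E)%E &
      \int[mu]_(r in I) f (r * e.1, r * e.2) = p - q].
  move=> ie; pose F (r : measurableTypeR R) := f (r * e.1, r * e.2).
  have mI : measurable I by exact: measurable_itv.
  have fp := integrable_fin_num mI (integrable_funepos mI ie).
  have fn := integrable_fin_num mI (integrable_funeneg mI ie).
  exists (fine (\int[mu]_(r in I) (EFin \o F)^\+ r)%E).
  exists (fine (\int[mu]_(r in I) (EFin \o F)^\- r)%E).
  rewrite !fineK ?fp ?fn//; split=> //.
  - by apply: eq_integral => r _; rewrite !funeposE.
  - by apply: eq_integral => r _; rewrite !funenegE.
  - by rewrite /Rintegral integralE fineB ?fp ?fn.
have [p [q [-> -> ->]]] := ray _ ia; have [p' [q' [-> -> ->]]] := ray _ ib.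
by rewrite -!EFinD; congr (_%:E); ring.
Qed.

End bent_line.

(** * Polar angles and sectors *)

Section sectors.
Context {R : realType}.
Implicit Types (t th r : R) (x : R * R).

Lemma cos_sin_inj t t' : - pi < t <= pi -> - pi < t' <= pi ->
  cos t = cos t' -> sin t = sin t' -> t = t'.
Proof.
have neg (s : R) : - pi < s -> s < 0 -> sin s < 0.
  move=> s1 s2; rewrite -[s]opprK sinN oppr_lt0; apply: sin_gt0_pi.
  by rewrite oppr_gt0 s2 ltrNl.
move=> /andP[t1 t2] /andP[t1' t2'] ct st.
have [t0|t0] := leP 0 t; have [t0'|t0'] := leP 0 t'.
- have p : 0 <= t <= pi by rewrite t0.
  have p' : 0 <= t' <= pi by rewrite t0'.
  by rewrite -(cosK p) ct (cosK p').
- have := neg _ t1' t0'; rewrite -st ltNge sin_ge0_pi//.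
  by rewrite t0.
- have := neg _ t1 t0; rewrite st ltNge sin_ge0_pi//.
  by rewrite t0'.
- have p : - pi <= t <= 0 by rewrite !ltW.
  have p' : - pi <= t' <= 0 by rewrite !ltW.
  by apply: oppr_inj; rewrite -(cosKN p) ct (cosKN p').
Qed.

Lemma enorm_gt0 x : x != 0 -> 0 < enorm x.
Proof.
move=> x0; rewrite sqrtr_gt0 lt_def addr_ge0 ?sqr_ge0// andbT.
rewrite paddr_eq0 ?sqr_ge0// !sqrf_eq0; apply: contra x0 => /andP[/eqP p /eqP q].
by case: x p q => p q /= -> ->.
Qed.

Lemma polar_ex x : x != 0 ->
  exists2 t, - pi < t <= pi & x = (enorm x * cos t, enorm x * sin t).
Proof.
move=> x0; have n0 := enorm_gt0 x0; set n := enorm x in n0 *.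
have n2 : n ^+ 2 = x.1 ^+ 2 + x.2 ^+ 2 by rewrite sqr_sqrtr// addr_ge0// sqr_ge0.
pose c := x.1 / n; pose s := x.2 / n.
have cs : c ^+ 2 + s ^+ 2 = 1.
  by rewrite /c /s !expr_div_n -mulrDl -n2 divff// gt_eqF// exprn_gt0.
have c1 : -1 <= c <= 1.
  rewrite -ler_norml -(@ler_pXn2r _ 2)// ?nnegrE// expr1n real_normK ?num_real//.
  by rewrite -cs lerDl sqr_ge0.
have xE t : cos t = c -> sin t = s -> x = (n * cos t, n * sin t).
  move=> -> ->; rewrite /c /s !(mulrC n) !divfK ?gt_eqF//; by case: (x).
have acosc : cos (acos c) = c by rewrite acosK// in_itv.
have /andP[c1l c1r] := c1.
have s2 : sin (acos c) = `|s|.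
  rewrite sin_acos// (_ : 1 - c ^+ 2 = s ^+ 2) ?sqrtr_sqr//.
  by rewrite -cs; ring.
have [s0|s0] := leP 0 s.
  exists (acos c); last by apply: xE => //; rewrite s2 ger0_norm.
  by rewrite acos_lepi// andbT (lt_le_trans _ (acos_ge0 c1))// oppr_lt0 pi_gt0.
(* Since [s] is negative, [c = -1] is impossible and the angle stays strictly above [- pi], the end
   that the principal range excludes. *)
exists (- acos c).
  have clt : -1 < c.
    rewrite lt_neqAle c1l andbT; apply/eqP => ce.
    by move: cs; rewrite -ce; have := mulr_gt0 (_ : 0 < - s) (_ : 0 < - s); nra.
  rewrite ltrN2 acos_ltpi ?clt//=.
  by rewrite (le_trans _ (ltW (pi_gt0 _)))// oppr_le0 acos_ge0.
by apply: xE; rewrite ?cosN// sinN s2 ltr0_norm// opprK.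
Qed.

(** [carg] chooses an admissible angle; [cos_sin_inj] says that there is only one. *)
Lemma carg_polar r t : 0 < r -> - pi < t <= pi ->
  carg ((r * cos t) +i* (r * sin t))%C = t.
Proof.
move=> r0 tI; rewrite /carg.
set z := ((r * cos t) +i* (r * sin t))%C.
have nz : Normc.normc z = r.
  rewrite /z /= !exprMn -mulrDr cos2Dsin2 mulr1 sqrtr_sqr gtr0_norm//.
have zE s : z = ((Normc.normc z)%:C * expi s)%C <-> cos t = cos s /\ sin t = sin s.
  rewrite nz /z /expi; split=> [[]|[-> ->]].
    rewrite !mul0r subr0 addr0 => /(mulfI (lt0r_neq0 r0)) -> /(mulfI (lt0r_neq0 r0)) -> //.
  by apply/eqP; rewrite eq_complex /= !mul0r subr0 addr0 !eqxx.
case: xgetP => [s -> [sI /zE[c1 s1]]|/(_ t)]; first by apply: cos_sin_inj.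
by case; split=> //; exact/zE.
Qed.

Lemma rayP th : - pi < th < pi -> ray th = [set x | exists2 r, 0 < r & x = (r * cos th, r * sin th)].
Proof.
move=> /andP[t1 t2]; apply/seteqP; split=> x.
  move=> [x0 +]; have [t tI xE] := polar_ex x0; have n0 := enorm_gt0 x0.
  have cx : carg (x.1 +i* x.2)%C = t by rewrite {1 2}xE /= carg_polar.
  by rewrite cx => <-; exists (enorm x).
move=> [r r0 ->]; split; last by rewrite carg_polar// t1 ltW.
apply/eqP => -[/eqP + /eqP]; rewrite !mulf_eq0 (gt_eqF r0) /= => /eqP c0 /eqP s0.
by have := cos2Dsin2 th; rewrite c0 s0 expr0n /= addr0 => /eqP; rewrite eq_sym oner_eq0.
Qed.

(** In polar form the two inequalities of the wedge read [sin (t - tm) > 0] and [sin (tM - t) > 0].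
    If [t <= tm], either [t - tm] lies in [[- pi, 0]], or it is below [- pi] and then [tM - t] lies
    in [[pi, 2 pi]]; one sine is not positive. The other end is symmetric. *)
Lemma sector_wedge (tm tM : R) : - pi < tm -> tM < pi -> 0 < tM - tm < pi ->
  sector tm tM = wedge (cos tm, sin tm) (cos tM, sin tM).
Proof.
move=> tm1 tM1 /andP[d0 dpi]; have p0 : 0 < pi :> R := pi_gt0 R.
have sneg (s : R) : - pi <= s -> s <= 0 -> sin s <= 0.
  move=> s1 s2; rewrite -[s]opprK sinN oppr_le0; apply: sin_ge0_pi.
  by rewrite oppr_ge0 s2 lerNl.
have sneg' (s : R) : pi <= s -> s <= 2 * pi -> sin s <= 0.
  move=> s1 s2; rewrite -[s](subrK pi) sinDpi oppr_le0; apply: sin_ge0_pi.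
  by lra.
have cross (r t : R) : 0 < r ->
    wedge (cos tm, sin tm) (cos tM, sin tM) (r * cos t, r * sin t) <->
    0 < sin (t - tm) /\ 0 < sin (tM - t).
  move=> r0; rewrite /wedge /= !sinB.
  rewrite (_ : cos tm * (r * sin t) - _ = r * (sin t * cos tm - cos t * sin tm)); last by ring.
  rewrite (_ : r * cos t * sin tM - _ = r * (sin tM * cos t - cos tM * sin t)); last by ring.
  by rewrite !pmulr_rgt0.
apply/seteqP; split=> x.
  move=> [x0 +]; have [t /andP[t1 t2] xE] := polar_ex x0; have n0 := enorm_gt0 x0.
  have cx : carg (x.1 +i* x.2)%C = t by rewrite {1 2}xE /= carg_polar// t1.
  rewrite cx => /andP[a1 a2]; rewrite xE; apply/cross => //.
  by split; apply: sin_gt0_pi; lra.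
move=> wx; have x0 : x != 0.
  by apply: contraPneq wx => ->; rewrite /wedge /= !(mulr0, mul0r) subrr ltxx => -[].
have [t /andP[t1 t2] xE] := polar_ex x0; have n0 := enorm_gt0 x0.
move: wx; rewrite xE => /cross -/(_ n0)[s1 s2]; rewrite -xE; split=> //.
have cx : carg (x.1 +i* x.2)%C = t by rewrite {1 2}xE /= carg_polar// t1.
rewrite cx; apply/andP; split; rewrite ltNge; apply/negP => H.
- have q : t - tm <= 0 by rewrite subr_le0.
  have [h|h] := leP (- pi) (t - tm); first by have := sneg _ h q; rewrite leNgt s1.
  have q1 : pi <= tM - t by lra. have q2 : tM - t <= 2 * pi by lra.
  by have := sneg' _ q1 q2; rewrite leNgt s2.
- have q : tM - t <= 0 by rewrite subr_le0.
  have [h|h] := leP (- pi) (tM - t); first by have := sneg _ h q; rewrite leNgt s2.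
  have q1 : pi <= t - tm by lra. have q2 : t - tm <= 2 * pi by lra.
  by have := sneg' _ q1 q2; rewrite leNgt s1.
Qed.

End sectors.

(** * The boundary of the domain near the vertex *)

Section corner_boundary.
Context {R : realType}.
Local Notation plane := (measurableTypeR R * measurableTypeR R)%type.
Variables (a b : R * R).
Hypothesis a_unit : a.1 ^+ 2 + a.2 ^+ 2 = 1.
Hypothesis b_unit : b.1 ^+ 2 + b.2 ^+ 2 = 1.
Hypothesis D0 : 0 < a.1 * b.2 - a.2 * b.1.
Let D := a.1 * b.2 - a.2 * b.1.

Lemma continuous_enorm : continuous (@enorm R : R * R -> R).
Proof.
move=> x; apply: (@continuous_comp _ _ _ (fun x : R * R => x.1 ^+ 2 + x.2 ^+ 2) Num.sqrt).
  by apply: cvgD; apply: cvgM; do ?[exact: cvg_fst|exact: cvg_snd].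
exact: sqrt_continuous.
Qed.

Lemma open_disc0 r : open (disc 0 r : set (R * R)).
Proof.
rewrite (_ : disc 0 r = [set x | 0 < r - enorm x]).
  apply: open_posf => x; apply: cvgB; [exact: cvg_cst|exact: continuous_enorm].
by apply/seteqP; split=> x; rewrite /disc /= subr0 subr_gt0.
Qed.

Let cont_lin (p q : R) : continuous (fun x : R * R => p * x.2 - q * x.1).
Proof.
by move=> x; apply: cvgB; apply: cvgM; do ?[exact: cvg_cst|exact: cvg_fst|exact: cvg_snd].
Qed.

Variables (Omega : set (R * R)) (h : R).
Hypothesis h0 : 0 < h.
Hypothesis oO : open Omega.
Hypothesis corner : Omega `&` disc 0 h = wedge a b `&` disc 0 h.

(** A boundary point satisfies both inequalities of the wedge weakly, being in the closure, but is
    not in the wedge, as [Omega] is open; so one of its coordinates vanishes. Conversely, adding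
    [e (a + b)] with small [e > 0] moves a point of the sides into the wedge. *)
Lemma boundary_corner (rho : R) : rho <= h ->
  boundary Omega `&` disc 0 rho = bent a b @` `]- rho, rho[.
Proof.
move=> rh; have discE r x : disc 0 r x <-> enorm x < r by rewrite /disc /= subr0.
apply/seteqP; split=> x.
  move=> [[clx +] /discE xr]; rewrite (interior_id _).1// => nOx.
  have nw : ~ wedge a b x.
    move=> wx; apply: nOx; have : (wedge a b `&` disc 0 h) x.
      by split=> //; apply/discE; exact: lt_le_trans rh.
    by rewrite -corner => -[].
  have ge (p q : R) : (forall y, wedge a b y -> 0 <= p * y.2 - q * y.1) ->
      0 <= p * x.2 - q * x.1.
    move=> wpq; rewrite leNgt; apply/negP => neg.
    have oN : open [set y : R * R | 0 < - (p * y.2 - q * y.1)].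
      by apply: open_posf => y; apply: cvgN; exact: cont_lin.
    have nx : nbhs x ([set y | 0 < - (p * y.2 - q * y.1)] `&` disc 0 h).
      apply: open_nbhs_nbhs; split; first by apply: openI => //; exact: open_disc0.
      by split; [rewrite /= oppr_gt0|apply/discE; exact: lt_le_trans rh].
    have [y [Oy [/= yneg yd]]] := clx _ nx.
    have : (Omega `&` disc 0 h) y by [].
    rewrite corner => -[wy _]; have := wpq _ wy; rewrite leNgt -oppr_gt0 yneg//.
  have g1 := ge a.1 a.2 (fun y wy => ltW wy.1).
  have g2 : 0 <= x.1 * b.2 - x.2 * b.1.
    have := ge (- b.1) (- b.2); rewrite (_ : - b.1 * x.2 - - b.2 * x.1 = x.1 * b.2 - x.2 * b.1).
      apply=> y [_ /ltW]; rewrite (_ : - b.1 * y.2 - - b.2 * y.1 = y.1 * b.2 - y.2 * b.1)//.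
      by ring.
    by ring.
  have xE := wptE D0 x.
  set r := _ / _ in xE; set t := (a.1 * _ - _) / _ in xE.
  have r0 : 0 <= r by rewrite divr_ge0// ltW.
  have t0 : 0 <= t by rewrite divr_ge0// ltW.
  have [rz|tz] : r = 0 \/ t = 0.
    have [->|rn] := eqVneq r 0; [by left|right].
    apply/eqP; rewrite eq_le t0 andbT leNgt; apply/negP => tp; apply: nw.
    by rewrite xE; apply/(wedge_wpt D0); split=> //; rewrite lt_neqAle eq_sym rn.
  - have xb : x = bent a b (- t).
      by rewrite bent_le0 ?oppr_le0// opprK xE rz /wpt !mul0r !add0r.
    exists (- t) => //=; rewrite in_itv/= -ltr_norml -(bent_norm a_unit b_unit) -xb//.
  - have xb : x = bent a b r by rewrite bent_ge0// xE tz /wpt !mul0r !addr0.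
    exists r => //=; rewrite in_itv/= -ltr_norml -(bent_norm a_unit b_unit) -xb//.
move=> [r /= rI <-]; have br : disc 0 rho (bent a b r).
  by apply/discE; rewrite bent_norm// ltr_norml; move: rI; rewrite in_itv.
have bh : disc 0 h (bent a b r) by apply/discE; move/discE: br => /lt_le_trans; apply.
split=> //; split.
  move=> B nB; set q := bent a b r.
  pose y (e : R) : R * R := (e * (a.1 + b.1) + q.1, e * (a.2 + b.2) + q.2).
  have yq : y e @[e --> 0^'+] --> q.
    apply: cvg_at_right_filter; rewrite [X in _ --> X](_ : q = (0 * (a.1 + b.1) + q.1, 0 * (a.2 + b.2) + q.2)).
      have c (p p' : R) : (fun e : R => e * p + p') @ 0 --> 0 * p + p'.
        by apply: cvgD; [apply: cvgM => //; exact: cvg_cst|exact: cvg_cst].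
      exact: (cvg_pair (c _ _) (c _ _)).
    by rewrite !mul0r !add0r -surjective_pairing.
  have nBh : nbhs q (B `&` disc 0 h).
    by apply: filterI => //; apply: open_nbhs_nbhs; split=> //; exact: open_disc0.
  have : \forall e \near 0^'+, (B `&` disc 0 h) (y e) /\ 0 < e.
    near=> e; split; last by near: e; exact: nbhs_right_gt.
    by near: e; exact: (yq _ nBh).
  move=> H; have [e He] := @filter_ex _ _ (at_right_proper_filter 0) _ H.
  case: He => -[By yh] e0; exists (y e); split=> //.
  have : (wedge a b `&` disc 0 h) (y e).
    split=> //; have -> : y e = wpt a b (e + Num.max r 0) (e + Num.max (- r) 0).
      by rewrite /y /q /bent /wpt /=; congr pair; ring.
    by apply/(wedge_wpt D0); split; rewrite ltr_pwDl// le_max lexx orbT.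
  by rewrite -corner => -[].
rewrite (interior_id _).1// => Obr.
have : (Omega `&` disc 0 h) (bent a b r) by [].
rewrite corner => -[/(wedge_wpt D0)[+ +] _].
by rewrite !lt_max ltxx !orbF oppr_gt0 => /ltW; rewrite leNgt => /negP.
Unshelve. all: by end_near. Qed.

End corner_boundary.

Lemma poweR_half_le {R : realType} (x : \bar R) (c : R) : (0 <= x)%E -> 0 <= c ->
  (x `^ 2^-1 <= c%:E)%E -> (x <= (c ^+ 2)%:E)%E.
Proof.
move=> x0 c0 xc; have -> : x = ((x `^ 2^-1) `^ 2)%E by rewrite -poweRrM mulVf// poweRe1.
rewrite -powR_mulrn// -poweR_EFin.
by apply: gt0_ler_poweR; rewrite ?in_itv/= ?leey ?andbT ?poweR_ge0 ?lee_fin.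
Qed.

(** * Herglotz waves *)

Section herglotz_bounds.
Context {R : realType}.
Local Notation mu := (@lebesgue_measure R).
Let J : set (measurableTypeR R) := `[- pi, pi]%classic.
Let mJ : measurable J. Proof. exact: measurable_itv. Qed.

Let lip (f df : R -> R) (x y : R) : (forall t : R, is_derive t 1 f (df t)) ->
  (forall t, `|df t| <= 1) -> `|f x - f y| <= `|x - y|.
Proof.
move=> fd df1; wlog xy : x y / x <= y.
  by move=> H; have [xy|/ltW yx] := leP x y; [|rewrite distrC (distrC x)]; exact: H.
have [c _] := @MVT_segment R f df x y xy (fun t _ => fd t)
  (continuous_subspaceT (is_derive_cont fd)).
rewrite distrC => ->; rewrite normrM (distrC x).
by rewrite ler_piMl.
Qed.

Let cos_lip (x y : R) : `|cos x - cos y| <= `|x - y|.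
Proof.
apply: (@lip cos (fun t => - sin t) x y (fun t => is_derive_cos t)) => t.
by rewrite normrN ler_norml sin_geN1 sin_le1.
Qed.

Let sin_lip (x y : R) : `|sin x - sin y| <= `|x - y|.
Proof.
apply: (@lip sin cos x y (fun t => is_derive_sin t)) => t.
by rewrite ler_norml cos_geN1 cos_le1.
Qed.

Variables (k : R) (p q : R -> R).
Hypothesis k0 : 0 < k.
Hypothesis sp : sqint mu J p.
Hypothesis sq : sqint mu J q.

Let th (x : R * R) (t : R) : R := k * (cos t * x.1 + sin t * x.2).

(** The real part of the Herglotz wave with kernel [p + i q]. The imaginary part has the same form,
    with the kernel multiplied by [- i], so one analysis covers both. *)
Definition plane_wave_mean (x : R * R) : R :=
  \int[mu]_(t in J) (cos (th x t) * p t - sin (th x t) * q t).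

Let muJ : (mu J < +oo)%E.
Proof. by rewrite /= lebesgue_measure_itv/=; case: ifP => _; rewrite ?ltry// -EFinD ltry. Qed.

Let ip : rintegrable mu J (fun t => `|p t|).
Proof. by apply: rintegrable_norm => //; exact: sqint_rintegrable. Qed.

Let iq : rintegrable mu J (fun t => `|q t|).
Proof. by apply: rintegrable_norm => //; exact: sqint_rintegrable. Qed.

Let mth x : measurable_fun setT (fun t : measurableTypeR R => th x t).
Proof.
apply: measurable_funM => //; apply: measurable_funD; apply: measurable_funM => //.
- by apply: continuous_measurable_fun => t; exact: continuous_cos.
- by apply: continuous_measurable_fun => t; exact: continuous_sin.
Qed.

Let mcos : measurable_fun setT (@cos R : measurableTypeR R -> measurableTypeR R).
Proof. by apply: continuous_measurable_fun => t; exact: continuous_cos. Qed.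

Let msin : measurable_fun setT (@sin R : measurableTypeR R -> measurableTypeR R).
Proof. by apply: continuous_measurable_fun => t; exact: continuous_sin. Qed.

Let norm_cos (t : R) : `|cos t| <= 1. Proof. by rewrite ler_norml cos_geN1 cos_le1. Qed.
Let norm_sin (t : R) : `|sin t| <= 1. Proof. by rewrite ler_norml sin_geN1 sin_le1. Qed.

Let wave_integrable x :
  rintegrable mu J (fun t => cos (th x t) * p t - sin (th x t) * q t).
Proof.
apply: (le_rintegrable mJ _ (rintegrableD mJ ip iq)).
  apply: measurable_funB; apply: measurable_funM.
  - by apply: measurable_funTS; exact: measurableT_comp mcos (mth x).
  - by case: sp.
  - by apply: measurable_funTS; exact: measurableT_comp msin (mth x).
  - by case: sq.
move=> t _; apply: (le_trans (ler_normB _ _)); rewrite !normrM.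
by apply: lerD; rewrite ler_piMl.
Qed.

Let N : R := \int[mu]_(t in J) (`|p t| + `|q t|).

Let wave_le (C : R) (F : R -> R) : 0 <= C -> rintegrable mu J F ->
  (forall t, `|F t| <= C * (`|p t| + `|q t|)) -> `|\int[mu]_(t in J) F t| <= C * N.
Proof.
move=> C0 iF FC; apply: (le_trans (le_normr_Rintegral mJ iF)).
have ipq := rintegrableD mJ ip iq.
rewrite /N -RintegralZl//; apply: le_Rintegral => //; first exact: rintegrable_norm.
exact: rintegrableZ.
Qed.

Lemma plane_wave_mean_lip x y :
  `|plane_wave_mean x - plane_wave_mean y| <= k * (`|x.1 - y.1| + `|x.2 - y.2|) * N.
Proof.
rewrite /plane_wave_mean -(RintegralB mJ (wave_integrable x) (wave_integrable y)).
apply: wave_le; first by rewrite mulr_ge0 ?addr_ge0// ltW.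
  exact: (rintegrableB mJ (wave_integrable x) (wave_integrable y)).
move=> t; set A := k * _.
have dth : `|th x t - th y t| <= A.
  rewrite /th /A -mulrBr normrM gtr0_norm// ler_wpM2l ?(ltW k0)//.
  rewrite (_ : _ - _ = cos t * (x.1 - y.1) + sin t * (x.2 - y.2)); last by ring.
  apply: (le_trans (ler_normD _ _)); rewrite !normrM.
  by apply: lerD; rewrite ler_piMl.
rewrite (_ : _ - _ = (cos (th x t) - cos (th y t)) * p t -
  (sin (th x t) - sin (th y t)) * q t); last by ring.
apply: (le_trans (ler_normB _ _)); rewrite !normrM mulrDr.
by apply: lerD; apply: ler_wpM2r => //; apply: le_trans dth.
Qed.

Lemma plane_wave_mean_le x : `|plane_wave_mean x| <= N.
Proof.
rewrite -[leRHS]mul1r; apply: wave_le => // t.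
rewrite mul1r; apply: (le_trans (ler_normB _ _)); rewrite !normrM.
by apply: lerD; rewrite ler_piMl.
Qed.

Lemma plane_wave_mean_continuous : continuous plane_wave_mean.
Proof.
have N0 : 0 <= N by apply: Rintegral_ge0 => t _; rewrite addr_ge0.
move=> x; apply/cvgrPdist_le => /= e e0.
pose C := 2 * k * N + 1; have C0 : 0 < C by rewrite ltr_wpDl// !mulr_ge0// ltW.
have := @nbhsx_ballx _ (R * R)%type x (e / C) (divr_gt0 e0 C0).
apply: filterS => y [b1 b2].
apply: (le_trans (plane_wave_mean_lip x y)).
have : `|x.1 - y.1| + `|x.2 - y.2| <= 2 * (e / C).
  by rewrite mulr_natl mulr2n; apply: lerD; apply: ltW.
move=> H; apply: (@le_trans _ _ (k * (2 * (e / C)) * N)).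
  by apply: ler_wpM2r => //; apply: ler_wpM2l => //; exact: ltW.
rewrite (_ : k * _ * N = e * ((2 * k * N) / C)); last by field; rewrite gt_eqF.
by rewrite ler_piMr ?(ltW e0)// ler_pdivrMr// mul1r lerDl.
Qed.

(** Cauchy-Schwarz on a circle of length [2 pi <= 3 ^ 2], once for [p] and once for [q]: hence the
    factor [2 * 3]. *)
Lemma plane_wave_mass (M : R) : 0 <= M ->
  \int[mu]_(t in J) p t ^+ 2 <= M ^+ 2 -> \int[mu]_(t in J) q t ^+ 2 <= M ^+ 2 ->
  N <= 6 * M.
Proof.
move=> M0 pM qM; rewrite /N (RintegralD mJ ip iq).
have s1 : sqint mu J (fun=> 1).
  by apply: bdmeas_sqint => //; split=> //; exists 1 => t _; rewrite normr1.
have I1 : \int[mu]_(t in J) 1 ^+ 2 <= 3 ^+ 2.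
  under eq_Rintegral do rewrite expr1n.
  have E : mu J = (pi + pi)%:E.
    by rewrite /J lebesgue_measure_itv/= lte_fin gtrN ?pi_gt0// -EFinD opprK.
  rewrite Rintegral_cst// mul1r [X in fine X <= _]E /=.
  by have := @pihalf_lt2 R; lra.
have H (f : R -> R) : sqint mu J f -> \int[mu]_(t in J) f t ^+ 2 <= M ^+ 2 ->
    \int[mu]_(t in J) `|f t| <= M * 3.
  move=> sf fM; have := Rintegral_le_CauchySchwarz mJ M0 _ sf s1 fM I1.
  by under eq_Rintegral do rewrite mulr1; exact.
have := H _ sp pM; have := H _ sq qM; lra.
Qed.

End herglotz_bounds.

(** * From Sobolev pairs to corner traces *)

Section weak_derivatives.
Context {R : realType}.
Local Notation mu := (@lebesgue_measure R).
Local Notation line := (measurableTypeR R).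
Local Notation plane := (measurableTypeR R * measurableTypeR R)%type.

Lemma FTC_line (f df : R -> R) (B : R) :
  (forall t : R, is_derive t 1 f (df t)) -> continuous df ->
  (forall t, B < `|t| -> f t = 0) -> (forall t, B < `|t| -> df t = 0) ->
  (\int[mu]_t (df t)%:E = 0)%E.
Proof.
move=> fd cdf f0 df0; pose T := `|B| + 1.
have BT : B < T by rewrite (le_lt_trans (ler_norm B))// ltrDl.
have T0 : 0 < T by rewrite ltr_wpDl.
have TT : - T < T by rewrite gtrN.
have cf := is_derive_cont fd.
transitivity (\int[mu]_(t in `[(- T)%R, T]) (df t)%:E)%E.
  rewrite [RHS]integral_mkcond; apply: eq_integral => t _.
  rewrite /patch mem_setE in_itv/= -ler_norml; case: leP => // Tt.
  by rewrite df0// (lt_trans BT).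
rewrite (continuous_FTC2 TT (F := f)).
- by rewrite !f0 ?sube0// ?normrN gtr0_norm.
- exact: continuous_subspaceT.
- split.
  + by move=> x _; case: (fd x).
  + by apply: cvg_at_right_filter; exact: cf.
  + by apply: cvg_at_left_filter; exact: cf.
- by move=> x _; rewrite derive1E; case: (fd x) => _ ->.
Qed.

Let in_square_measurable (B : R) : measurable (in_square B : set plane).
Proof.
rewrite (_ : in_square B = `[- B, B]%classic `*` `[- B, B]%classic).
  by apply: measurableX; exact: measurable_itv.
by apply/seteqP; split=> x; rewrite /in_square /= !in_itv/= !ler_norml.
Qed.

Let slice1 (F : R * R -> R) (y s : R) : smooth F ->
  is_derive s 1 (fun s => F (s, y)) ('D_e1 F (s, y)).
Proof.
move=> sF; apply: (is_derive_line (g := fun s : R => (s, y)) (w := e1)).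
  by move=> h; rewrite -[RHS]/(h *: 1 + s, h *: 0 + y) scaler0 add0r.
apply: DeriveDef => //; exact: (Ck_derivable (or_introl erefl) (sF 1%N)).
Qed.

Let slice2 (F : R * R -> R) (y s : R) : smooth F ->
  is_derive s 1 (fun s => F (y, s)) ('D_e2 F (y, s)).
Proof.
move=> sF; apply: (is_derive_line (g := fun s : R => (y, s)) (w := e2)).
  by move=> h; rewrite -[RHS]/(h *: 0 + y, h *: 1 + s) scaler0 add0r.
apply: DeriveDef => //; exact: (Ck_derivable (or_intror erefl) (sF 1%N)).
Qed.

(** As the derivative vanishes off [A], the integral is one over the whole plane, where it is 0 on
    each line parallel to [e]; the boundary of [A] does not enter. *)
Lemma integral_partial_compact (e : R * R) (F : R * R -> R) (B : R) (A : set (R * R)) :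
  e = e1 \/ e = e2 -> smooth F -> square_supported B F ->
  (forall x, 'D_e F x != 0 -> A x) ->
  \int[leb2]_(x in (A : set plane)) 'D_e F x = 0.
Proof.
move=> ee sF supF suppA.
have supD : square_supported B (fun x => 'D_e F x) by exact: supported_partial.
have cD : continuous (fun x => 'D_e F x) by exact: (smooth_continuous (smooth_partial ee sF)).
have zero (G : R * R -> R) x : square_supported B G -> ~ in_square B x -> G x = 0.
  by move=> sG nx; apply/eqP; apply: contrapT => /negP/sG.
rewrite Rintegral_mkcond (_ : patch _ _ _ = (fun x => 'D_e F x)); last first.
  apply/funext => x; rewrite /patch; case: ifPn => // /negP nA.
  by apply/esym/eqP; apply: contrapT => /negP/suppA/mem_set.
have iD : leb2.-integrable (setT : set plane) (fun x => ('D_e F x)%:E).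
  have := continuous_rintegrable (in_square_measurable B) (@subset_refl _ _) cD.
  move=> /(integrable_mkcond _ (in_square_measurable B)).1.
  apply: eq_integrable => // x _; rewrite /patch /=; case: ifPn => // /negP nB.
  by rewrite (zero _ _ supD)// => /mem_set.
rewrite /Rintegral.
have out1 (y t : R) : B < `|t| -> ~ in_square B (t, y).
  by move=> Bt [/= ] /(lt_le_trans Bt); rewrite ltxx.
have out2 (y t : R) : B < `|t| -> ~ in_square B (y, t).
  by move=> Bt [_ /= ] /(lt_le_trans Bt); rewrite ltxx.
have cpair1 (y : R) : continuous (fun t : R => (t, y)).
  by move=> t; apply: (cvg_pair cvg_id (cvg_cst _)).
have cpair2 (y : R) : continuous (fun t : R => (y, t)).
  by move=> t; apply: (cvg_pair (cvg_cst _) cvg_id).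
case: ee => ee; move: iD cD supD {suppA}; rewrite ee => iD cD supD.
- rewrite -(@integral21_prod_meas1 _ _ line line R mu mu _ iD) integral0_eq// => y _ /=.
  apply: (@FTC_line (fun t => F (t, y)) (fun t => 'D_e1 F (t, y)) B).
  + by move=> t; exact: slice1.
  + by move=> t; exact: (@continuous_comp _ _ _ (fun t : R => (t, y)) ('D_e1 F) t (cpair1 y t) (cD (t, y))).
  + by move=> t Bt; apply: (zero _ _ supF); exact: out1.
  + by move=> t Bt; apply: (zero _ _ supD); exact: out1.
- rewrite -(@integral12_prod_meas1 _ _ line line R mu mu _ iD) integral0_eq// => y _ /=.
  apply: (@FTC_line (fun t => F (y, t)) (fun t => 'D_e2 F (y, t)) B).
  + by move=> t; exact: slice2.
  + by move=> t; exact: (@continuous_comp _ _ _ (fun t : R => (y, t)) ('D_e2 F) t (cpair2 y t) (cD (y, t))).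
  + by move=> t Bt; apply: (zero _ _ supF); exact: out2.
  + by move=> t Bt; apply: (zero _ _ supD); exact: out2.
Qed.

Lemma supp_subset (phi : R * R -> R) x : phi x != 0 -> supp phi x.
Proof. by move=> px; apply: subset_closure. Qed.

Lemma test_function_square (A : set (R * R)) phi : test_function A phi ->
  exists B, square_supported B phi.
Proof.
move=> [_ cs _]; have [M [_ HM]] := compact_bounded cs.
exists (M + 1) => x /(@supp_subset _ _) px.
have MM : M < M + 1 by rewrite ltrDl.
have /= := HM _ MM _ px; rewrite prod_normE /= ge_max => /andP[].
by [].
Qed.

End weak_derivatives.

Section complex_parts.
Context {R : realType}.

(** Facts about complex functions are proved once for a projection [pr] and used for both parts. *)
Definition is_part (pr : R[i] -> R) : Prop :=
  pr = @complex.Re R \/ pr = @complex.Im R.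

Lemma normc_sqr (z : R[i]) : Normc.normc z ^+ 2 = complex.Re z ^+ 2 + complex.Im z ^+ 2.
Proof. by case: z => x y; rewrite /= sqr_sqrtr// addr_ge0// sqr_ge0. Qed.

Lemma part_sqr_le pr z : is_part pr -> pr z ^+ 2 <= Normc.normc z ^+ 2.
Proof. by case=> ->; rewrite normc_sqr ?lerDl ?lerDr sqr_ge0. Qed.

Lemma partB pr z z' : is_part pr -> pr (z - z') = pr z - pr z'.
Proof. by case=> ->; case: z; case: z'. Qed.

Lemma part_realM pr z (r : R) : is_part pr -> pr (z * (r%:C)%C) = pr z * r.
Proof. by case=> ->; case: z => x y /=; ring. Qed.

Lemma normc_le_parts (z : R[i]) : Normc.normc z <= `|complex.Re z| + `|complex.Im z|.
Proof.
have n0 : 0 <= Normc.normc z by case: (z) => x y; exact: sqrtr_ge0.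
rewrite -(@ler_pXn2r _ 2)// ?nnegrE ?addr_ge0// normc_sqr.
  rewrite -[complex.Re z ^+ 2]real_normK ?num_real// -[complex.Im z ^+ 2]real_normK ?num_real//.
  by rewrite sqrrD -addrA lerD2l lerDr mulrn_wge0// mulr_ge0.
Qed.

Section square_integrable.
Context d (T : measurableType d) (m : {measure set T -> \bar R}) (A : set T).
Hypothesis mA : measurable A.

Let normc_ge0 (f : T -> R[i]) x : (0 <= (Normc.normc (f x) ^+ 2)%:E)%E.
Proof. by rewrite lee_fin sqr_ge0. Qed.

Lemma L2_sqint pr f : is_part pr -> L2 m A f -> sqint m A (fun x => pr (f x)).
Proof.
move=> hpr [[m1 m2] fin]; have mf : measurable_fun A (fun x => pr (f x)) by case: hpr => ->.
split=> //; apply/integrableP; split; first by apply/measurable_EFinP; exact: measurable_funX.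
have : (\int[m]_(x in A) (Normc.normc (f x) ^+ 2)%:E < +oo)%E.
  by apply: (@lty_poweRy _ _ 2^-1) => //; rewrite invr_eq0.
apply: le_lt_trans; apply: ge0_le_integral_set => //.
move=> x Ax; rewrite /patch mem_set//= lee_fin ger0_norm ?sqr_ge0//.
exact: part_sqr_le.
Qed.

Lemma sqint_L2 f : sqint m A (fun x => complex.Re (f x)) ->
  sqint m A (fun x => complex.Im (f x)) -> L2 m A f.
Proof.
move=> [m1 i1] [m2 i2]; split=> //; apply: poweR_lty.
have := integrableP _ _ _ (rintegrableD mA i1 i2) => -[_].
apply: le_lt_trans; apply: ge0_le_integral_set => // x Ax.
by rewrite /patch mem_set//= lee_fin normc_sqr ler_norm.
Qed.

End square_integrable.

(** The first terms of [E] may be infinite, so [X] is only required to obey each finite bound on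
    [E]. *)
Lemma cvg0_poweR_half (E : nat -> \bar R) (X : nat -> R) : (forall n, (0 <= E n)%E) ->
  (forall n c, 0 <= c -> (E n <= c%:E)%E -> 0 <= X n <= c) ->
  (fun n => (E n `^ 2^-1)%E) @ \oo --> 0%E -> X @ \oo --> (0 : R).
Proof.
move=> E0 EX /fine_cvgP[fE cE]; apply/cvgrPdist_le => /= e e0.
pose d := Num.min e 1; have d0 : 0 < d by rewrite lt_min e0 ltr01.
have de : d ^+ 2 <= e.
  rewrite expr2 (@le_trans _ _ (d * 1))//; last by rewrite mulr1 ge_min lexx.
  by apply: ler_wpM2l; [exact: ltW|rewrite ge_min lexx orbT].
move/cvgr0Pnorm_le: cE => /(_ _ d0) cE; near=> n.
have fn : (E n `^ 2^-1)%E \is a fin_num by near: n.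
have nn : `|fine (E n `^ 2^-1)%E| <= d by near: n.
have En : (E n <= (d ^+ 2)%:E)%E.
  apply: poweR_half_le => //; first exact: ltW.
  by rewrite -(fineK fn) lee_fin (le_trans (ler_norm _)).
have /andP[X0 Xd] := EX n _ (sqr_ge0 d) En.
by rewrite sub0r normrN ger0_norm// (le_trans Xd).
Unshelve. all: by end_near. Qed.

End complex_parts.

Section real_weak_partial.
Context {R : realType}.
Local Notation plane := (measurableTypeR R * measurableTypeR R)%type.
Variables (A : set (R * R)) (bd : R).
Hypothesis mA : measurable (A : set plane).
Hypothesis A_bounded : A `<=` in_square bd.
Local Notation A' := (A : set plane).

Definition rweak_partial (e : R * R) (u g : R * R -> R) : Prop :=
  forall phi, test_function A phi ->
  \int[leb2]_(x in A') (u x * 'D_e phi x) = - \int[leb2]_(x in A') (g x * phi x).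

Lemma weak_partial_part pr e u g : is_part pr -> weak_partial A e u g ->
  rweak_partial e (fun x => pr (u x)) (fun x => pr (g x)).
Proof.
move=> hpr [_ wk] phi tphi; have := wk _ tphi; rewrite /cintegral.
have E (f : R * R -> R[i]) (r : R * R -> R) p : is_part p ->
    fine (\int[leb2]_(x in A') (p (f x * (r x)%:C)%C)%:E)%E =
    \int[leb2]_(x in A') (p (f x) * r x).
  by move=> hp; congr fine; apply: eq_integral => x _; rewrite part_realM.
rewrite !E; [|by right|by left|by right|by left].
by case: hpr => -> [].
Qed.

Lemma rweak_partial_weak e u g : L2 leb2 A' g ->
  (forall pr, is_part pr -> rweak_partial e (fun x => pr (u x)) (fun x => pr (g x))) ->
  weak_partial A e u g.
Proof.
move=> Lg wk; split=> // phi tphi; rewrite /cintegral.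
have E (f : R * R -> R[i]) (r : R * R -> R) p : is_part p ->
    fine (\int[leb2]_(x in A') (p (f x * (r x)%:C)%C)%:E)%E =
    \int[leb2]_(x in A') (p (f x) * r x).
  by move=> hp; congr fine; apply: eq_integral => x _; rewrite part_realM.
rewrite !E; [|by right|by left|by right|by left].
by rewrite (wk (@complex.Re R) (or_introl erefl) _ tphi)
  (wk (@complex.Im R) (or_intror erefl) _ tphi).
Qed.

Lemma smooth_rweak_partial e U : e = e1 \/ e = e2 -> smooth U ->
  rweak_partial e U (fun x => 'D_e U x).
Proof.
move=> ee sU phi tphi; have [sphi _ suppA] := tphi.
have [B supB] := test_function_square tphi.
have sF : smooth (fun x => U x * phi x) by exact: smoothM.
have supF : square_supported B (fun x => U x * phi x).
  by move=> x; rewrite mulf_eq0 negb_or => /andP[_ /supB].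
have DF x : 'D_e (fun x => U x * phi x) x = U x * 'D_e phi x + phi x * 'D_e U x.
  exact: smooth_partialM.
have Dphi0 x : 'D_e phi x != 0 -> A x.
  move=> Dx; apply: suppA; apply: contrapT => nx; move: Dx.
  have [V [oV Vx V0]] : exists V, [/\ open V, V x & forall y, V y -> phi y = 0].
    exists (~` supp phi); split=> //; first by apply: closed_openC; exact: closed_closure.
    by move=> y; apply: contra_notP => /eqP; exact: supp_subset.
  have : is_derive x e phi 0.
    apply: (near_eq_is_derive (f := cst 0)).
    by near=> z; rewrite V0//; near: z; exact: open_nbhs_nbhs.
  by case=> _ ->; rewrite eqxx.
have iF : \int[leb2]_(x in A') 'D_e (fun x => U x * phi x) x = 0.
  apply: (integral_partial_compact ee sF supF) => x; rewrite DF => H.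
  apply: contrapT => nA; move: H.
  have -> : 'D_e phi x = 0 by apply/eqP; apply: contra_notT nA; exact: Dphi0.
  have -> : phi x = 0 by apply/eqP; apply: contra_notT nA => /supp_subset; exact: suppA.
  by rewrite mulr0 mul0r addr0 eqxx.
have cU := smooth_continuous sU; have cp := smooth_continuous sphi.
have cDU := smooth_continuous (smooth_partial ee sU).
have cDp := smooth_continuous (smooth_partial ee sphi).
have i1 : rintegrable leb2 A' (fun x => U x * 'D_e phi x).
  by apply: (continuous_rintegrable mA A_bounded) => x; apply: cvgM; [exact: cU|exact: cDp].
have i2 : rintegrable leb2 A' (fun x => 'D_e U x * phi x).
  by apply: (continuous_rintegrable mA A_bounded) => x; apply: cvgM; [exact: cDU|exact: cp].
apply/eqP; rewrite -addr_eq0 -(RintegralD mA i1 i2) -[X in _ == X]iF; apply/eqP.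
by apply: eq_Rintegral => x _; rewrite DF (mulrC (phi x)).
Unshelve. all: by end_near. Qed.

Lemma csmooth_part pr u : is_part pr -> csmooth u -> smooth (fun x : R * R => pr (u x)).
Proof. by case=> -> []. Qed.

(** [wpartial] is a choice with default 0, and [H1norm] of a difference says something only if the
    choice succeeds. The witness [G] is the classical partial of [u] minus the chosen partial of
    [v]. *)
Lemma wpartial_smoothB e (u v : R * R -> R[i]) : e = e1 \/ e = e2 -> csmooth u ->
  L2 leb2 A' v -> weak_partial A e v (wpartial A e v) ->
  weak_partial A e (fun x => u x - v x) (wpartial A e (fun x => u x - v x)).
Proof.
move=> ee cu Lv wv; apply: xgetPex.
pose G x := ('D_e (fun y => complex.Re (u y)) x +i* 'D_e (fun y => complex.Im (u y)) x)%C -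
  wpartial A e v x.
exists G.
have Lw := wv.1.
have cont_sq f : smooth f -> sqint leb2 A' (fun x => 'D_e f x).
  by move=> sf; exact: (continuous_sqint mA A_bounded (smooth_continuous (smooth_partial ee sf))).
have su pr (hpr : is_part pr) := csmooth_part hpr cu.
have eqp pr : is_part pr -> (fun x => pr (G x)) =
    (fun x => 'D_e (fun y => pr (u y)) x - pr (wpartial A e v x)).
  by move=> hpr; apply/funext => x; rewrite partB//; case: hpr => ->.
have sq pr : is_part pr -> sqint leb2 A' (fun x => pr (G x)).
  move=> hpr; rewrite (eqp _ hpr).
  exact: (sqintB mA (cont_sq _ (su _ hpr)) (L2_sqint hpr Lw)).
apply: rweak_partial_weak.
  by apply: sqint_L2 => //; apply: sq; [left|right].
move=> pr hpr phi tphi.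
have [sphi _ _] := tphi.
have cp := smooth_continuous sphi; have cDp := smooth_continuous (smooth_partial ee sphi).
have sp := continuous_sqint mA A_bounded cp; have sDp := continuous_sqint mA A_bounded cDp.
have E1 := smooth_rweak_partial ee (su _ hpr) tphi.
have E2 := weak_partial_part hpr wv tphi.
have svp := L2_sqint hpr Lv; have swp := L2_sqint hpr Lw.
have sup := continuous_sqint mA A_bounded (smooth_continuous (su _ hpr)).
transitivity (\int[leb2]_(x in A') (pr (u x) * 'D_e phi x) - \int[leb2]_(x in A') (pr (v x) * 'D_e phi x)).
  rewrite -RintegralB//; [|exact: sqint_mul|exact: sqint_mul].
  by apply: eq_Rintegral => x _; rewrite partB// mulrBl.
rewrite E1 E2 -opprD; congr (- _).
transitivity (\int[leb2]_(x in A') ('D_e (fun y => pr (u y)) x * phi x) -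
  \int[leb2]_(x in A') (pr (wpartial A e v x) * phi x)) => //.
rewrite -RintegralB//; [|apply: sqint_mul => //; exact: cont_sq _ (su _ hpr)|exact: sqint_mul].
apply: eq_Rintegral => x _; rewrite -mulrBl; congr (_ * _).
exact/esym/(congr1 (@^~ x) (eqp _ hpr)).
Qed.

End real_weak_partial.

(** * The transmission pair near the vertex *)

Section corner_of_domain.
Context {R : realType}.
Local Notation mu := (@lebesgue_measure R).
Local Notation plane := (measurableTypeR R * measurableTypeR R)%type.
Variables (a b : R * R) (Omega : set (R * R)) (h dl bd : R).
Hypothesis a_unit : a.1 ^+ 2 + a.2 ^+ 2 = 1.
Hypothesis b_unit : b.1 ^+ 2 + b.2 ^+ 2 = 1.
Hypothesis D0 : 0 < a.1 * b.2 - a.2 * b.1.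
Hypothesis h0 : 0 < h.
Hypothesis dl0 : 0 < dl.
Hypothesis dlh : 2 * dl <= h.
Hypothesis oO : open Omega.
Hypothesis O_bounded : Omega `<=` in_square bd.
Hypothesis corner : Omega `&` disc 0 h = wedge a b `&` disc 0 h.
Let W : set (R * R) := Omega `&` disc 0 h.
(** The square of half-side [dl] lies in the disc of radius [sqrt 2 * dl < rho], and [dlh] keeps the
    disc of radius [rho] within the corner. *)
Let rho := 2 * dl.
Let T : set plane := boundary Omega `&` disc 0 rho.
Let I : set (measurableTypeR R) := `]0%R, rho[%classic.
Local Notation W' := (W : set plane).
Local Notation O' := (Omega : set plane).
Let mI : measurable I. Proof. exact: measurable_itv. Qed.
Let rho0 : 0 < rho. Proof. exact: mulr_gt0. Qed.

Let discE (r : R) (x : R * R) : disc 0 r x <-> enorm x < r.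
Proof. by rewrite /disc /= subr0. Qed.

Lemma in_square_disc x : in_square dl x -> disc 0 rho x.
Proof.
move=> [x1 x2]; apply/discE; rewrite -(gtr0_norm rho0) -sqrtr_sqr ltr_sqrt ?exprn_gt0//.
have sq (y : R) : `|y| <= dl -> y ^+ 2 <= dl ^+ 2.
  by move=> yd; rewrite -[y ^+ 2]real_normK ?num_real// lerXn2r// ?nnegrE// ltW.
have := sq _ x1; have := sq _ x2; have : 0 < dl ^+ 2 by exact: exprn_gt0.
by rewrite /rho exprMn; lra.
Qed.

Let mO : measurable O'. Proof. exact: open_measurable2. Qed.
Let mdisc r : measurable (disc 0 r : set plane).
Proof. by apply: open_measurable2; exact: open_disc0. Qed.
Let mW : measurable W'. Proof. exact: measurableI. Qed.
Let WO : W `<=` Omega. Proof. by move=> x []. Qed.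
Let W_wedge : W `<=` wedge a b.
Proof. by rewrite /W corner => x []. Qed.
Let wedge_W : wedge a b `&` in_square dl `<=` W.
Proof.
move=> x [wx sx]; rewrite /W corner; split=> //; apply/discE.
by have /discE := in_square_disc sx => /lt_le_trans; apply.
Qed.
Let W_bounded : W `<=` in_square bd. Proof. by move=> x /WO/O_bounded. Qed.
Let O_sq_W : Omega `&` in_square dl `<=` W.
Proof.
move=> x [Ox sx]; split=> //; apply/discE.
by have /discE := in_square_disc sx => /lt_le_trans; apply.
Qed.

Let TE : T = bent a b @` `]- rho, rho[.
Proof. exact: (boundary_corner a_unit b_unit D0 oO corner dlh). Qed.

Let mB : measurable (boundary Omega : set plane).
Proof.
apply: measurableD; last by apply: open_measurable2; exact: open_interior.
rewrite -[closure Omega]setCK; apply: measurableC; apply: open_measurable2.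
by apply: closed_openC; exact: closed_closure.
Qed.
Let mT : measurable T. Proof. exact: measurableI. Qed.
Let TB : T `<=` boundary Omega. Proof. by move=> x []. Qed.

Let rho_ray (e : R * R) : e.1 ^+ 2 + e.2 ^+ 2 = 1 ->
  forall r, rho <= r -> ~ in_square dl (r * e.1, r * e.2).
Proof.
move=> e_unit r rr /in_square_disc /discE.
rewrite /enorm /= !exprMn -mulrDr e_unit mulr1 sqrtr_sqr => /(le_lt_trans (ler_norm _)).
by rewrite ltNge rr.
Qed.
Let rho_a := rho_ray a_unit.
Let rho_b := rho_ray b_unit.

Lemma Rintegral_corner (F : R * R -> R) : (forall x, Omega x -> ~ W x -> F x = 0) ->
  \int[leb2]_(x in O') F x = \int[leb2]_(x in W') F x.
Proof.
move=> F0; rewrite Rintegral_mkcond [RHS]Rintegral_mkcond; congr (Rintegral _ _ _).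
apply/funext => x; rewrite /patch; have [Wx|nW] := pselect (W x).
  by rewrite !mem_set//; exact: WO.
rewrite [in RHS]memNset//; case: ifPn => // /set_mem Ox; exact: F0.
Qed.

Lemma sqint_corner F : sqint leb2 O' F -> sqint leb2 W' F.
Proof.
move=> [mF iF]; split; first exact: measurable_funS mF.
exact: (integrableS mO mW).
Qed.

Lemma le_Rintegral_corner (F : R * R -> R) (c : R) (G : R * R -> \bar R) :
  (forall x, (0 <= G x)%E) -> (forall x, 0 <= F x) ->
  (forall x, Omega x -> ((F x)%:E <= G x)%E) ->
  (\int[leb2]_(x in O') G x <= c%:E)%E -> 0 <= \int[leb2]_(x in W') F x <= c.
Proof.
move=> G0 F0 FG Gc; rewrite Rintegral_ge0//=.
have H : (\int[leb2]_(x in W') (F x)%:E <= c%:E)%E.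
  apply: le_trans Gc; apply: ge0_le_integral_set => // x Wx; first by rewrite lee_fin.
  by rewrite /patch mem_set ?FG//; exact: WO.
have Hf : (\int[leb2]_(x in W') (F x)%:E)%E \is a fin_num.
  rewrite ge0_fin_numE; first by rewrite (le_lt_trans H)// ltry.
  by apply: integral_ge0 => x _; rewrite lee_fin.
by rewrite /Rintegral -lee_fin fineK.
Qed.

(* The two sides carry the positive and the negative half of the bent line. *)
Let side_T (e : R * R) r : e = a \/ e = b -> I r -> T (r * e.1, r * e.2).
Proof.
move=> ee; rewrite /I /= in_itv/= => /andP[r0 rr]; rewrite TE.
case: ee => ->; [exists r; last by rewrite bent_ge0// ltW|
  exists (- r); last by rewrite bent_le0 ?opprK// oppr_le0 ltW].
- by rewrite /= in_itv/= rr andbT (lt_trans _ r0)// oppr_lt0.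
- by rewrite /= in_itv/= ltrN2 rr/= (lt_trans _ rho0)// oppr_lt0.
Qed.

Let side_measurable d' (X : measurableType d') (F : plane -> X) (e : R * R) :
  e = a \/ e = b -> measurable_fun T F ->
  measurable_fun I (fun r : measurableTypeR R => F (r * e.1, r * e.2)).
Proof.
move=> ee mF; apply: (measurable_comp (F := T) (f := F)
  (g := fun r : measurableTypeR R => (r * e.1, r * e.2) : plane)) => //.
  by move=> _ [r Ir <-]; exact: side_T.
apply: measurable_funTS; apply: measurable_fun_pair => /=; exact: measurable_funM.
Qed.

(** Restricting to [T] decreases the boundary integral of a nonnegative function; on [T] it is a sum
    of two nonnegative ray integrals, each of which is then bounded. *)
Let boundary_bound (e : R * R) (F : R * R -> R) (c : R) (G : R * R -> \bar R) :
  e = a \/ e = b -> measurable_fun T F ->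
  (forall x, (0 <= G x)%E) -> (forall x, 0 <= F x) ->
  (forall x, boundary Omega x -> ((F x)%:E <= G x)%E) ->
  (integral hausdorff1 (boundary Omega : set plane) G <= c%:E)%E ->
  rintegrable mu I (fun r => F (r * e.1, r * e.2)) /\
  0 <= \int[mu]_(r in I) F (r * e.1, r * e.2) <= c.
Proof.
move=> ee mF G0 F0 FG Gc.
have mF' : measurable_fun T (EFin \o F) by exact/measurable_EFinP.
have H : (integral hausdorff1 T (EFin \o F) <= c%:E)%E.
  apply: le_trans Gc; apply: ge0_le_integral_set => //; first exact: hausdorff1_0.
    by move=> x _; rewrite lee_fin.
  by move=> x Tx; rewrite /patch mem_set ?FG//; exact: TB.
have E := ge0_integral_hausdorff1 a_unit b_unit D0 rho0 mT TE mF' (fun x _ => F0 x).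
have ge0 e' : (0 <= \int[mu]_(r in I) (EFin \o F) (r * e'.1, r * e'.2)%R)%E.
  by apply: integral_ge0 => r _; rewrite lee_fin.
have He : (\int[mu]_(r in I) (F (r * e.1, r * e.2)%R)%:E <= c%:E)%E.
  apply: le_trans H; rewrite E; case: ee => ->.
    by rewrite leeDl// ge0.
  by rewrite leeDr// ge0.
have Hf : (\int[mu]_(r in I) (F (r * e.1, r * e.2)%R)%:E)%E \is a fin_num.
  by rewrite ge0_fin_numE; [rewrite (le_lt_trans He)// ltry|exact: ge0].
split.
  apply/integrableP; split; first by apply/measurable_EFinP; exact: side_measurable.
  apply: le_lt_trans (ltry c); apply: le_trans He; rewrite le_eqVlt; apply/orP; left; apply/eqP.
  by apply: eq_integral => r _; rewrite /= ger0_norm.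
rewrite Rintegral_ge0//= /Rintegral -lee_fin fineK//.
Qed.

Let integral_set_ge0 (A : set plane) (f : R * R -> R) : (forall x, 0 <= f x) ->
  (0 <= integral hausdorff1 A (EFin \o f))%E.
Proof.
move=> f0; have f0' x : A x -> (0 <= (EFin \o f) x)%E by move=> _; rewrite lee_fin.
rewrite (@ge0_integralE_set _ _ R hausdorff1 A (EFin \o f) hausdorff1_0 f0').
apply: ereal_sup_ubound; exists (@nnsfun0 _ plane R).
  by move=> x /=; apply: erestrict_ge0 => y _; rewrite lee_fin.
rewrite /sintegral fsbig1// => x _; have [->|x0] := eqVneq x 0; first by rewrite mul0e.
rewrite (_ : _ @^-1` _ = set0) ?hausdorff1_0 ?mule0//.
by apply/seteqP; split=> // t /= htx; move: x0; rewrite -htx eqxx.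
Qed.

Section trace.
Variables (v tv : R * R -> R[i]) (pr : R[i] -> R).
Hypothesis hpr : is_part pr.
Hypothesis sv : sobolev 1 Omega v.
Hypothesis trv : is_trace Omega v tv.
Let pv x := pr (v x).
Let pe e x := pr (wpartial Omega e v x).
Let pt (e : R * R) (r : R) := pr (tv (r * e.1, r * e.2)).

Let boundary_L2 f : L2 hausdorff1 (boundary Omega : set plane) f ->
  measurable_fun T (fun x => pr (f x)).
Proof.
move=> [[m1 m2] _]; have : measurable_fun (boundary Omega : set plane) (fun x => pr (f x)).
  by case: hpr => ->.
exact: measurable_funS.
Qed.

Let boundary_sqr e f c : e = a \/ e = b -> 0 <= c ->
  measurable_fun T (fun x => pr (f x)) ->
  (integral hausdorff1 (boundary Omega : set plane) (fun x => (Normc.normc (f x) ^+ 2)%:E) <= c%:E)%E ->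
  rintegrable mu I (fun r => pr (f (r * e.1, r * e.2)) ^+ 2) /\
  0 <= \int[mu]_(r in I) (pr (f (r * e.1, r * e.2)) ^+ 2) <= c.
Proof.
move=> ee c0 mf; apply: (boundary_bound (F := fun x => pr (f x) ^+ 2) ee).
- exact: measurable_funX.
- by move=> x; rewrite lee_fin sqr_ge0.
- by move=> x; exact: sqr_ge0.
- by move=> x _; rewrite lee_fin part_sqr_le.
Qed.

Lemma trace_sqint e : e = a \/ e = b -> sqint mu I (pt e).
Proof.
move=> ee; have [Ltv _] := trv; have mtv := boundary_L2 Ltv.
split; first exact: side_measurable ee mtv.
have [_ fin] := Ltv.
have {}fin : (integral hausdorff1 (boundary Omega : set plane)
    (fun x => (Normc.normc (tv x) ^+ 2)%:E) < +oo)%E.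
  by apply: (@lty_poweRy _ _ 2^-1) => //; rewrite invr_eq0.
have i0 : (0 <= integral hausdorff1 (boundary Omega : set plane)
    (fun x => (Normc.normc (tv x) ^+ 2)%:E))%E.
  by apply: integral_set_ge0 => x; exact: sqr_ge0.
have [] := boundary_sqr (f := tv) (c := fine (integral hausdorff1 (boundary Omega : set plane)
    (fun x => (Normc.normc (tv x) ^+ 2)%:E))) ee; last 1 first.
- by move=> + _; exact.
- exact: fine_ge0.
- exact: mtv.
- by rewrite fineK// ge0_fin_numE.
Qed.

(** The sequence that defines the trace feeds [side_identity] and [side_trace]: convergence in H^1
    on [Omega] bounds the functions and the weak partials of the differences on [W], and convergence
    of boundary values restricts to each side. *)
Lemma corner_trace_part : corner_trace a b W dl rho pv (pe e1) (pe e2) (pt a) (pt b).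
Proof.
have [Ltv [u_ [su Hu Bu]]] := trv.
have [Lv dv] := sv.
have [wv1 [Lv1 _]] := dv e1 (or_introl erefl).
have [wv2 [Lv2 _]] := dv e2 (or_intror erefl).
pose U n x := pr (u_ n x).
pose g e n x := pr (wpartial Omega e (fun x => u_ n x - v x) x).
have sU n : smooth (U n) := csmooth_part hpr (su n).
have wn n e (ee : e = e1 \/ e = e2) := wpartial_smoothB mO O_bounded ee (su n) Lv
  ((dv e ee).1).
have sgO n e (ee : e = e1 \/ e = e2) : sqint leb2 O' (g e n) := L2_sqint hpr (wn n e ee).1.
have svO : sqint leb2 O' pv := L2_sqint hpr Lv.
have seO e (ee : e = e1 \/ e = e2) : sqint leb2 O' (pe e) := L2_sqint hpr (dv e ee).1.1.
pose E n x := Normc.normc (u_ n x - v x) ^+ 2 +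
      Normc.normc (wpartial Omega e1 (fun x => u_ n x - v x) x) ^+ 2 +
      Normc.normc (wpartial Omega e2 (fun x => u_ n x - v x) x) ^+ 2.
have E0 n x : (0 <= (E n x)%:E)%E by rewrite lee_fin !addr_ge0 ?sqr_ge0.
have conv (F : nat -> R * R -> R) : (forall n x, 0 <= F n x) -> (forall n x, F n x <= E n x) ->
    (fun n => \int[leb2]_(x in W') F n x) @ \oo --> (0 : R).
  move=> F0 FE; apply: (cvg0_poweR_half _ _ Hu).
    by move=> n; apply: integral_ge0 => x _; exact: E0.
  move=> n c c0; apply: le_Rintegral_corner; first exact: E0.
    exact: F0.
  by move=> x _; rewrite lee_fin FE.
have Uu : (fun n => \int[leb2]_(x in W') (U n x - pv x) ^+ 2) @ \oo --> (0 : R).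
  apply: conv => n x; first exact: sqr_ge0.
  rewrite /U /pv -partB// /E -addrA (le_trans (part_sqr_le _ hpr))// lerDl.
  by rewrite addr_ge0 ?sqr_ge0.
have g1_0 : (fun n => \int[leb2]_(x in W') g e1 n x ^+ 2) @ \oo --> (0 : R).
  apply: conv => n x; first exact: sqr_ge0.
  rewrite /E addrAC (le_trans (part_sqr_le _ hpr))// lerDr.
  by rewrite addr_ge0 ?sqr_ge0.
have g2_0 : (fun n => \int[leb2]_(x in W') g e2 n x ^+ 2) @ \oo --> (0 : R).
  apply: conv => n x; first exact: sqr_ge0.
  rewrite /E (le_trans (part_sqr_le _ hpr))// lerDr.
  by rewrite addr_ge0 ?sqr_ge0.
(* Combines the weak-partial identities of [u_ n], [v] and their difference on [Omega], for which a
   test function of [W] is admissible. *)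
have ort e (ee : e = e1 \/ e = e2) n phi : test_function W phi ->
    \int[leb2]_(x in W') (('D_e (U n) x - pe e x - g e n x) * phi x) = 0.
  move=> [sphi cphi sW]; have tO : test_function Omega phi.
    by split=> //; exact: subset_trans WO.
  have cp := continuous_sqint mO O_bounded (smooth_continuous sphi).
  have cDp := continuous_sqint mO O_bounded (smooth_continuous (smooth_partial ee sphi)).
  have cU := continuous_sqint mO O_bounded (smooth_continuous (sU n)).
  have cDU := continuous_sqint mO O_bounded (smooth_continuous (smooth_partial ee (sU n))).
  rewrite -Rintegral_corner; last first.
    move=> x _ nW; have -> : phi x = 0; last by rewrite mulr0.
    by apply/eqP; apply: contra_notT nW => /supp_subset /sW.
  have Eu := smooth_rweak_partial mO O_bounded ee (sU n) tO.
  have Ev := weak_partial_part hpr (dv e ee).1 tO.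
  have Euv := weak_partial_part hpr (wn n e ee) tO.
  have Euv' : \int[leb2]_(x in O') (pr (u_ n x - v x) * 'D_e phi x) =
    \int[leb2]_(x in O') (U n x * 'D_e phi x) - \int[leb2]_(x in O') (pv x * 'D_e phi x).
    rewrite -(RintegralB mO (sqint_mul mO cU cDp) (sqint_mul mO svO cDp)).
    by apply: eq_Rintegral => x _; rewrite partB// mulrBl.
  have i1 := sqint_mul mO cDU cp; have i2 := sqint_mul mO (seO e ee) cp.
  have i3 := sqint_mul mO (sgO n e ee) cp; have i12 := rintegrableB mO i1 i2.
  transitivity (\int[leb2]_(x in O') ('D_e (U n) x * phi x) -
    \int[leb2]_(x in O') (pe e x * phi x) - \int[leb2]_(x in O') (g e n x * phi x)).
    rewrite -(RintegralB mO i1 i2) -(RintegralB mO i12 i3).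
    by apply: eq_Rintegral => x _; rewrite !mulrBl.
  move: Euv; rewrite Euv' Eu Ev /pe /g.
  by move: (Rintegral _ _ _) (Rintegral _ _ _) (Rintegral _ _ _) => p q r; lra.
have Utc e : e = a \/ e = b ->
    (fun n => \int[mu]_(r in I) (U n (r * e.1, r * e.2) - pt e r) ^+ 2) @ \oo --> (0 : R).
  move=> ee; apply: (cvg0_poweR_half _ _ Bu).
    by move=> n; apply: integral_set_ge0 => x; exact: sqr_ge0.
  move=> n c c0 Hc.
  have mf : measurable_fun T (fun x => pr (u_ n x - tv x)).
    rewrite (_ : (fun x => _) = (fun x => U n x - pr (tv x))); last first.
      by apply/funext => x; rewrite partB.
    apply: measurable_funB; last exact: boundary_L2 Ltv.
    exact: continuous_measurable2 (smooth_continuous (sU n)).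
  have [_] := boundary_sqr ee c0 mf Hc.
  by under eq_Rintegral => r _ do rewrite partB//.
have sW := sqint_corner svO; have s1 := sqint_corner (seO e1 (or_introl erefl)).
have s2 := sqint_corner (seO e2 (or_intror erefl)).
have sg1 n := sqint_corner (sgO n e1 (or_introl erefl)).
have sg2 n := sqint_corner (sgO n e2 (or_intror erefl)).
have o1 := ort e1 (or_introl erefl); have o2 := ort e2 (or_intror erefl).
have sa := trace_sqint (or_introl erefl : a = a \/ a = b).
have sb := trace_sqint (or_intror erefl : b = a \/ b = b).
have ua := Utc a (or_introl erefl); have ub := Utc b (or_intror erefl).
have da := divergence_b D0 mW W_wedge wedge_W W_bounded rho_a.
have db := divergence_a D0 mW W_wedge wedge_W W_bounded rho_b.
have ta := trace_b D0 mW W_wedge wedge_W W_bounded rho_a.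
have tb := trace_a D0 mW W_wedge wedge_W W_bounded rho_b.
have schi := square_bump_smooth dl; have supp_chi := @square_bump_supported R dl.
have chi01 x : 0 <= square_bump dl x <= 1 by rewrite square_bump_ge0 square_bump_le1.
split; first exact: (And5 sW s1 s2 sa sb).
split.
- exact: (side_identity D0 mW W_wedge wedge_W W_bounded sW s1 s2 sU sg1 sg2 Uu g1_0 g2_0 o1 o2 sa ua da).
- exact: (side_identity D0 mW W_wedge wedge_W W_bounded sW s1 s2 sU sg1 sg2 Uu g1_0 g2_0 o1 o2 sb ub db).
- exact: (side_trace D0 mW W_wedge wedge_W W_bounded sW s1 s2 sU sg1 sg2 Uu g1_0 g2_0 o1 o2 sa ua ta
    schi supp_chi chi01).
- exact: (side_trace D0 mW W_wedge wedge_W W_bounded sW s1 s2 sU sg1 sg2 Uu g1_0 g2_0 o1 o2 sb ub tb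
    schi supp_chi chi01).
Qed.

End trace.

Section pair.
Variables (Gamma : set (R * R)) (v w tv tw : R * R -> R[i]).
Hypothesis GB : Gamma `<=` boundary Omega.
Hypothesis TG : T `<=` Gamma.
Hypothesis sv : sobolev 1 Omega v.
Hypothesis sw : sobolev 1 Omega w.
Hypothesis trv : is_trace Omega v tv.
Hypothesis trw : is_trace Omega w tw.
Hypothesis tvw : \forall x \ae hausdorff1, Gamma x -> tw x = tv x.

(** A [hausdorff1]-null set pulls back along [bent] to a Lebesgue-null set. *)
Let ae_side e : e = a \/ e = b ->
  {ae mu, forall r, I r -> tw (r * e.1, r * e.2) = tv (r * e.1, r * e.2)}.
Proof.
move=> ee; have [A [mA A0 sA]] := tvw.
have mN : measurable (bent a b @^-1` A).
  by rewrite -[X in measurable X]setTI; apply: measurable_bent.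
have N0 : mu (bent a b @^-1` A) = 0%E.
  apply/eqP; rewrite eq_le measure_ge0 andbT -[leRHS]A0.
  exact: (@hausdorff1_bent_ge R (bent a b) _ A D0 (bent_isometric a_unit b_unit)
    (bent_separated a_unit b_unit D0)).
have inA r : I r -> ~ (tw (r * e.1, r * e.2) = tv (r * e.1, r * e.2)) -> A (r * e.1, r * e.2).
  by move=> Ir ne; apply: sA => /= H; apply: ne; apply: H; apply: TG; exact: side_T.
have pos r : I r -> 0 < r by rewrite /I /= in_itv/= => /andP[].
have nimp r : ~ (I r -> tw (r * e.1, r * e.2) = tv (r * e.1, r * e.2)) ->
    I r /\ A (r * e.1, r * e.2).
  by move=> /not_implyP[Ir ne]; split=> //; exact: inA.
case: ee => ee; rewrite ee in nimp *.
  exists (bent a b @^-1` A); split=> // r /nimp[Ir Ar].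
  by rewrite /preimage /= bent_ge0// ltW// pos.
(* [bent] runs along [b] for negative parameters, so the null set is reflected. *)
exists [set t : measurableTypeR R | (bent a b @^-1` A) (-1 * t + 0)]; split.
- by rewrite -[X in measurable X]setTI; apply: (measurable_affine (-1) 0).
- have n1 : (-1 : R) != 0 by rewrite oppr_eq0 oner_eq0.
  by have := lebesgue_measure_affine 0 n1 mN; rewrite normrN1 mul1e N0.
- move=> r /nimp[Ir Ar]; rewrite /= mulN1r addr0 /preimage /= bent_le0 ?opprK//.
  by rewrite oppr_le0 ltW// pos.
Qed.

Let side_integral_eq pr e psi : is_part pr -> e = a \/ e = b -> smooth psi ->
  \int[mu]_(r in I) (pr (tw (r * e.1, r * e.2)) * psi (r * e.1, r * e.2)) =
  \int[mu]_(r in I) (pr (tv (r * e.1, r * e.2)) * psi (r * e.1, r * e.2)).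
Proof.
move=> hpr ee spsi; congr fine.
have mpsi : measurable_fun I (fun r : measurableTypeR R => psi (r * e.1, r * e.2)).
  exact: (continuous_ray_measurable _ (smooth_continuous spsi)).
apply: ae_eq_integral => //.
- by apply/measurable_EFinP; apply: measurable_funM => //; case: (trace_sqint hpr trw ee).
- by apply/measurable_EFinP; apply: measurable_funM => //; case: (trace_sqint hpr trv ee).
- by apply: filterS (ae_side ee) => r H Ir; rewrite (H Ir).
Qed.

Let du (pr : R[i] -> R) (x : R * R) : R := pr (w x) - pr (v x).
Let dp (pr : R[i] -> R) (e x : R * R) : R := pr (wpartial Omega e w x) - pr (wpartial Omega e v x).

Let zero_green pr c d psi : is_part pr -> (c = a /\ d = b \/ c = b /\ d = a) ->
  smooth psi -> square_supported dl psi ->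
  rintegrable leb2 W' (fun x => du pr x * Ddir d psi x + (d.1 * dp pr e1 x + d.2 * dp pr e2 x) * psi x) /\
  \int[leb2]_(x in W') (du pr x * Ddir d psi x + (d.1 * dp pr e1 x + d.2 * dp pr e2 x) * psi x) = 0.
Proof.
move=> hpr cd sp supp_p.
have [[v0 v1 v2 _ _] [vab vba _ _]] := corner_trace_part hpr sv trv.
have [[w0 w1 w2 _ _] [wab wba _ _]] := corner_trace_part hpr sw trw.
have cp := continuous_sqint mW W_bounded (smooth_continuous sp).
have cDp := continuous_sqint mW W_bounded (smooth_continuous (Ddir_smooth d sp)).
have comb (f1 f2 : R * R -> R) : sqint leb2 W' f1 -> sqint leb2 W' f2 ->
    sqint leb2 W' (fun x => d.1 * f1 x + d.2 * f2 x).
  by move=> s1 s2; exact: (sqintD mW (sqintZ mW _ s1) (sqintZ mW _ s2)).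
have iw := rintegrableD mW (sqint_mul mW w0 cDp) (sqint_mul mW (comb _ _ w1 w2) cp).
have iv := rintegrableD mW (sqint_mul mW v0 cDp) (sqint_mul mW (comb _ _ v1 v2) cp).
have alg (q s p0 p1 p2 r0 r1 r2 : R) : p0 * q + (d.1 * p1 + d.2 * p2) * s -
    (r0 * q + (d.1 * r1 + d.2 * r2) * s) =
    (p0 - r0) * q + (d.1 * (p1 - r1) + d.2 * (p2 - r2)) * s by ring.
have E x : pr (w x) * Ddir d psi x + (d.1 * pr (wpartial Omega e1 w x) +
      d.2 * pr (wpartial Omega e2 w x)) * psi x -
    (pr (v x) * Ddir d psi x + (d.1 * pr (wpartial Omega e1 v x) +
      d.2 * pr (wpartial Omega e2 v x)) * psi x) =
    du pr x * Ddir d psi x + (d.1 * dp pr e1 x + d.2 * dp pr e2 x) * psi x.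
  exact: alg.
split; first exact: (eq_rintegrable mW (fun x _ => E x) (rintegrableB mW iw iv)).
transitivity (\int[leb2]_(x in W') (pr (w x) * Ddir d psi x + (d.1 * pr (wpartial Omega e1 w x) +
      d.2 * pr (wpartial Omega e2 w x)) * psi x) -
  \int[leb2]_(x in W') (pr (v x) * Ddir d psi x + (d.1 * pr (wpartial Omega e1 v x) +
      d.2 * pr (wpartial Omega e2 v x)) * psi x)).
  by rewrite -(RintegralB mW iw iv); apply: eq_Rintegral => x _; rewrite E.
apply/eqP; rewrite subr_eq0; apply/eqP.
case: cd => -[_ ->].
  rewrite (wab _ sp supp_p) (vab _ sp supp_p); congr (- (_ * _)).
  exact: (side_integral_eq hpr (or_introl erefl) sp).
rewrite (wba _ sp supp_p) (vba _ sp supp_p); congr (- (_ * _)).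
exact: (side_integral_eq hpr (or_intror erefl) sp).
Qed.

(** Equal traces give equal right-hand sides in Green's identity along [a] and along [b]. Inverting
    the matrix of the two directions, of determinant [D], gives the identities along the axes. *)
Lemma zero_trace pr psi : is_part pr -> smooth psi -> square_supported dl psi ->
  \int[leb2]_(x in W') (du pr x * 'D_e1 psi x + dp pr e1 x * psi x) = 0 /\
  \int[leb2]_(x in W') (du pr x * 'D_e2 psi x + dp pr e2 x * psi x) = 0.
Proof.
move=> hpr sp supp_p; have Dn : a.1 * b.2 - a.2 * b.1 != 0 by rewrite gt_eqF.
have [ia Za] := zero_green hpr (or_intror (conj erefl erefl)) sp supp_p.
have [ib Zb] := zero_green hpr (or_introl (conj erefl erefl)) sp supp_p.
pose Ga x := du pr x * Ddir a psi x + (a.1 * dp pr e1 x + a.2 * dp pr e2 x) * psi x.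
pose Gb x := du pr x * Ddir b psi x + (b.1 * dp pr e1 x + b.2 * dp pr e2 x) * psi x.
have lin (p q : R) : \int[leb2]_(x in W') (p * Ga x + q * Gb x) = 0.
  rewrite (RintegralD mW (rintegrableZ mW p ia) (rintegrableZ mW q ib)) RintegralZl// RintegralZl//.
  by rewrite Za Zb !mulr0 addr0.
have alg1 (y p q r1 r2 s : R) : y * r1 + p * s =
    b.2 / (a.1 * b.2 - a.2 * b.1) * (y * (a.1 * r1 + a.2 * r2) + (a.1 * p + a.2 * q) * s) +
    - a.2 / (a.1 * b.2 - a.2 * b.1) * (y * (b.1 * r1 + b.2 * r2) + (b.1 * p + b.2 * q) * s).
  by field.
have alg2 (y p q r1 r2 s : R) : y * r2 + q * s =
    - b.1 / (a.1 * b.2 - a.2 * b.1) * (y * (a.1 * r1 + a.2 * r2) + (a.1 * p + a.2 * q) * s) +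
    a.1 / (a.1 * b.2 - a.2 * b.1) * (y * (b.1 * r1 + b.2 * r2) + (b.1 * p + b.2 * q) * s).
  by field.
split.
  rewrite -[RHS](lin (b.2 / (a.1 * b.2 - a.2 * b.1)) (- a.2 / (a.1 * b.2 - a.2 * b.1))).
  by apply: eq_Rintegral => x _; exact: alg1.
rewrite -[RHS](lin (- b.1 / (a.1 * b.2 - a.2 * b.1)) (a.1 / (a.1 * b.2 - a.2 * b.1))).
by apply: eq_Rintegral => x _; exact: alg2.
Qed.

Variables (eta lv lw : R * R -> R[i]) (al H : R).
Hypothesis al0 : 0 < al.
Hypothesis al1 : al < 1.
Hypothesis H0 : 0 <= H.
Hypothesis Llv : L2 leb2 O' lv.
Hypothesis Llw : L2 leb2 O' lw.
Hypothesis meta : cmeasurable (boundary Omega : set plane) eta.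
Hypothesis eta_holder : forall e pr, e = a \/ e = b -> is_part pr ->
  forall r, I r -> `|pr (eta (r * e.1, r * e.2)) - pr (eta 0)| <= H * r `^ al.
Hypothesis eta_n0 : eta 0 != 0.
Hypothesis conductive : forall phi, boundary_test_function Omega Gamma phi ->
  normal_derivative Omega w lw phi = normal_derivative Omega v lv phi +
  cintegral hausdorff1 Gamma (fun x => eta x * tv x * ((phi x)%:C)%C).

Let mpart (pr : R[i] -> R) (f : R * R -> R[i]) : is_part pr -> cmeasurable (boundary Omega : set plane) f ->
  measurable_fun T (fun x => pr (f x)).
Proof.
move=> hpr [m1 m2]; have : measurable_fun (boundary Omega : set plane) (fun x => pr (f x)).
  by case: hpr => ->.
exact: measurable_funS.
Qed.

Let ray_eta e pr : e = a \/ e = b -> is_part pr ->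
  ray_holder_at rho al H (fun r => pr (eta (r * e.1, r * e.2))) (pr (eta 0)).
Proof.
move=> ee hpr; split; last exact: eta_holder.
exact: (side_measurable ee (mpart hpr meta)).
Qed.

Let ray_eta_bd e pr : e = a \/ e = b -> is_part pr ->
  bdmeas I (fun r => pr (eta (r * e.1, r * e.2))).
Proof.
move=> ee hpr; have [m mH] := ray_eta ee hpr.
split=> //; exists (`|pr (eta 0)| + H * rho `^ al) => r Ir.
rewrite -[pr (eta (_, _))](subrK (pr (eta 0))) addrC; apply: (le_trans (ler_normD _ _)).
rewrite lerD2l; apply: (le_trans (mH _ Ir)); apply: ler_wpM2l => //.
move: Ir; rewrite /I /= in_itv/= => /andP[r0 rrho].
by apply: ge0_ler_powR; rewrite ?nnegrE ltW// (lt_trans r0).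
Qed.

Let re := @complex.Re R.
Let im := @complex.Im R.
Let hre : is_part re. Proof. by left. Qed.
Let him : is_part im. Proof. by right. Qed.

Let green pr (f lf : R * R -> R[i]) psi : is_part pr ->
  sobolev 1 Omega f -> L2 leb2 O' lf -> smooth psi -> square_supported dl psi ->
  rintegrable leb2 W' (fun x => pr (wpartial Omega e1 f x) * 'D_e1 psi x +
    pr (wpartial Omega e2 f x) * 'D_e2 psi x + pr (lf x) * psi x) /\
  pr (normal_derivative Omega f lf psi) =
  \int[leb2]_(x in W') (pr (wpartial Omega e1 f x) * 'D_e1 psi x +
    pr (wpartial Omega e2 f x) * 'D_e2 psi x + pr (lf x) * psi x).
Proof.
move=> hpr [_ df] Llf sp supp_p.
have s e (ee : e = e1 \/ e = e2) : sqint leb2 W' (fun x => pr (wpartial Omega e f x)).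
  exact: sqint_corner (L2_sqint hpr (df e ee).1.1).
have cD e (ee : e = e1 \/ e = e2) := continuous_sqint mW W_bounded
  (smooth_continuous (smooth_partial ee sp)).
have i e (ee : e = e1 \/ e = e2) := sqint_mul mW (s e ee) (cD e ee).
have il := sqint_mul mW (sqint_corner (L2_sqint hpr Llf))
  (continuous_sqint mW W_bounded (smooth_continuous sp)).
split; first exact: (rintegrableD mW (rintegrableD mW (i e1 (or_introl erefl)) (i e2 (or_intror erefl))) il).
rewrite -Rintegral_corner; last first.
  move=> x Ox nW; have nx : ~ in_square dl x by move=> sx; apply: nW; exact: O_sq_W.
  have z (G : R * R -> R) : square_supported dl G -> G x = 0.
    by move=> sG; apply/eqP; apply: contra_notT nx => /sG.
  have alg (p q r p' q' r' : R) : p' = 0 -> q' = 0 -> r' = 0 -> p * p' + q * q' + r * r' = 0.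
    by move=> -> -> ->; rewrite !mulr0 !addr0.
  apply: alg; last exact: z.
    exact: (z _ (supported_partial (or_introl erefl) sp supp_p)).
  exact: (z _ (supported_partial (or_intror erefl) sp supp_p)).
have E (z1 z2 z3 : R[i]) (r1 r2 r3 : R) :
    pr (z1 * r1%:C + z2 * r2%:C + z3 * r3%:C)%C = pr z1 * r1 + pr z2 * r2 + pr z3 * r3.
  have prD z z' : pr (z + z') = pr z + pr z' by case: hpr => ->; case: z; case: z'.
  by rewrite !prD !part_realM.
rewrite /normal_derivative /green_pairing /cintegral.
by case: hpr E => -> E /=; congr fine; apply: eq_integral => x _; congr EFin; exact: E.
Qed.

(** The support of [psi] meets [Gamma] only in [T], where the [hausdorff1] integral is the sum of
    the two ray integrals. *)
Let boundary_pairing pr psi : is_part pr -> smooth psi -> square_supported dl psi ->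
  pr (cintegral hausdorff1 Gamma (fun x => eta x * tv x * ((psi x)%:C)%C)) =
  \int[mu]_(r in I) (pr (eta (r * a.1, r * a.2) * tv (r * a.1, r * a.2)) * psi (r * a.1, r * a.2)) +
  \int[mu]_(r in I) (pr (eta (r * b.1, r * b.2) * tv (r * b.1, r * b.2)) * psi (r * b.1, r * b.2)).
Proof.
move=> hpr sp supp_p.
pose f x := pr (eta x * tv x) * psi x.
have mtv := trv.1.1; have cp := smooth_continuous sp.
have mf : measurable_fun T f.
  apply: measurable_funM; last exact: continuous_measurable2.
  have me1 := mpart hre meta; have me2 := mpart him meta.
  have mt1 := mpart hre mtv; have mt2 := mpart him mtv.
  case: hpr => ->.
    rewrite (_ : (fun x => _) = (fun x => re (eta x) * re (tv x) - im (eta x) * im (tv x))).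
      by apply: measurable_funB; exact: measurable_funM.
    by apply/funext => x; rewrite /re /im; case: (eta x) => ? ?; case: (tv x).
  rewrite (_ : (fun x => _) = (fun x => re (eta x) * im (tv x) + im (eta x) * re (tv x))).
    by apply: measurable_funD; exact: measurable_funM.
  by apply/funext => x; rewrite /re /im; case: (eta x) => ? ?; case: (tv x).
have ray e : e = a \/ e = b -> rintegrable mu I (fun r => f (r * e.1, r * e.2)).
  move=> ee; have t1 := trace_sqint hre trv ee; have t2 := trace_sqint him trv ee.
  have b1 := ray_eta_bd ee hre; have b2 := ray_eta_bd ee him.
  have spsi : sqint mu I (fun r : measurableTypeR R => psi (r * e.1, r * e.2)).
    split; first exact: (continuous_ray_measurable _ cp).
    have c2 : continuous (fun x => psi x ^+ 2) by move=> x; apply: cvgM; exact: cp.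
    exact: (continuous_ray_integrable rho e c2).
  have s11 := sqint_bdmeas mI t1 b1; have s22 := sqint_bdmeas mI t2 b2.
  have s12 := sqint_bdmeas mI t1 b2; have s21 := sqint_bdmeas mI t2 b1.
  case: hpr @f mf => -> f mf.
    apply: (eq_rintegrable mI _ (sqint_mul mI (sqintB mI s11 s22) spsi)) => r _.
    rewrite /f /re /im; case: (eta _) => ? ?; case: (tv _) => ? ? /=; ring.
  apply: (eq_rintegrable mI _ (sqint_mul mI (sqintD mI s12 s21) spsi)) => r _.
  rewrite /f /re /im; case: (eta _) => ? ?; case: (tv _) => ? ? /=; ring.
have iH := integral_hausdorff1 a_unit b_unit D0 rho0 mT TE mf (ray _ (or_introl erefl))
  (ray _ (or_intror erefl)).
have restr : integral hausdorff1 Gamma (fun x => (pr (eta x * tv x * ((psi x)%:C)%C))%:E) =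
    integral hausdorff1 T (EFin \o f).
  rewrite /integral; have -> : (fun x => (pr (eta x * tv x * ((psi x)%:C)%C))%:E) \_ Gamma =
    (EFin \o f) \_ T; last by [].
  apply/funext => x; rewrite /patch /= /f.
  have [Tx|nT] := pselect (T x); first by rewrite !mem_set ?part_realM//; exact: TG.
  rewrite (memNset nT); case: ifPn => // /set_mem Gx.
  have -> : psi x = 0; last by rewrite part_realM// mulr0.
  apply/eqP; apply: contra_notT nT => /supp_p sx; split; first exact: GB.
  exact: in_square_disc.
by move: restr iH; rewrite /cintegral; case: hpr @f mf ray => -> f mf ray /= -> ->.
Qed.

(** Taking parts of the jump condition gives the two relations of [corner_value_small]:
    multiplication by [eta] acts on real and imaginary parts as a rotation and scaling, so the
    determinant at the vertex is [|eta 0|^2]. *)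
Lemma domain_corner_value : exists2 C, 0 <= C & forall e, 0 < e -> exists2 s0, 1 <= s0 &
  forall s g g' g0 g0' B L, s0 <= s ->
  corner_approx W (fun x => complex.Re (v x)) g g0 B L ->
  corner_approx W (fun x => complex.Im (v x)) g' g0' B L ->
  `|g0| <= e + C * (s * B + L * s `^ (- al)) /\
  `|g0'| <= e + C * (s * B + L * s `^ (- al)).
Proof.
have N0 : 0 < re (eta 0) ^+ 2 + im (eta 0) ^+ 2.
  rewrite lt_def addr_ge0 ?sqr_ge0// andbT paddr_eq0 ?sqr_ge0// !sqrf_eq0.
  by rewrite /re /im; move: eta_n0; rewrite eq_complex.
have test psi : smooth psi -> square_supported dl psi -> boundary_test_function Omega Gamma psi.
  move=> sp supp_p; have cS := @square_compact R dl.
  have sS : supp psi `<=` in_square dl.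
    have clS : closed (in_square dl : set (R * R)).
      by apply: compact_closed; [exact: norm_hausdorff|exact: cS].
    by rewrite ((closure_id _).1 clS); apply: closureS => x /supp_p.
  split=> //; first exact: (subclosed_compact (@closed_closure _ _) cS sS).
  by move=> x [/sS sx Bx]; apply: TG; split=> //; exact: in_square_disc.
have sq pr f : is_part pr -> L2 leb2 O' f -> sqint leb2 W' (fun x => pr (f x)).
  by move=> hpr Lf; exact: sqint_corner (L2_sqint hpr Lf).
have sqw e (ee : e = e1 \/ e = e2) pr (hpr : is_part pr) := sq pr _ hpr (sw.2 e ee).1.1.
have sqv e (ee : e = e1 \/ e = e2) pr (hpr : is_part pr) := sq pr _ hpr (sv.2 e ee).1.1.
have o1 : @e1 R = e1 \/ @e1 R = e2 by left.
have o2 : @e2 R = e1 \/ @e2 R = e2 by right.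
pose dF (pr : R[i] -> R) (x : R * R) : R := pr (lw x) - pr (lv x).
have four pr : is_part pr -> [/\ sqint leb2 W' (du pr), sqint leb2 W' (dp pr e1),
    sqint leb2 W' (dp pr e2) & sqint leb2 W' (dF pr)].
  move=> hpr; split.
  - exact: (sqintB mW (sq _ _ hpr sw.1) (sq _ _ hpr sv.1)).
  - exact: (sqintB mW (sqw _ o1 _ hpr) (sqv _ o1 _ hpr)).
  - exact: (sqintB mW (sqw _ o2 _ hpr) (sqv _ o2 _ hpr)).
  - exact: (sqintB mW (sq _ _ hpr Llw) (sq _ _ hpr Llv)).
have rel pr psi : is_part pr -> smooth psi -> square_supported dl psi ->
    \int[leb2]_(x in W') (dp pr e1 x * 'D_e1 psi x + dp pr e2 x * 'D_e2 psi x + dF pr x * psi x) =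
    \int[mu]_(r in I) (pr (eta (r * a.1, r * a.2) * tv (r * a.1, r * a.2)) * psi (r * a.1, r * a.2)) +
    \int[mu]_(r in I) (pr (eta (r * b.1, r * b.2) * tv (r * b.1, r * b.2)) * psi (r * b.1, r * b.2)).
  move=> hpr sp supp_p; rewrite -(boundary_pairing hpr sp supp_p).
  have [iw Ew] := green hpr sw Llw sp supp_p; have [iv Ev] := green hpr sv Llv sp supp_p.
  have prD z z' : pr (z + z') = pr z + pr z' by case: hpr => ->; case: z; case: z'.
  have := congr1 pr (conductive (test _ sp supp_p)); rewrite prD Ew Ev => /eqP.
  rewrite addrC -subr_eq => /eqP <-; rewrite -(RintegralB mW iw iv).
  have alg (q1 q2 q p1 p2 p r1 r2 r : R) : (p1 - r1) * q1 + (p2 - r2) * q2 + (p - r) * q =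
    p1 * q1 + p2 * q2 + p * q - (r1 * q1 + r2 * q2 + r * q) by ring.
  by apply: eq_Rintegral => x _; exact: alg.
have cva := corner_trace_part hre sv trv; have cvb := corner_trace_part him sv trv.
have zer psi : smooth psi -> square_supported dl psi ->
    [/\ \int[leb2]_(x in W') (du re x * 'D_e1 psi x + dp re e1 x * psi x) = 0,
    \int[leb2]_(x in W') (du re x * 'D_e2 psi x + dp re e2 x * psi x) = 0,
    \int[leb2]_(x in W') (du im x * 'D_e1 psi x + dp im e1 x * psi x) = 0 &
    \int[leb2]_(x in W') (du im x * 'D_e2 psi x + dp im e2 x * psi x) = 0].
  move=> sp supp_p; have [z1 z2] := zero_trace hre sp supp_p.
  have [z3 z4] := zero_trace him sp supp_p; exact: (And4 z1 z2 z3 z4).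
have reM z z' : re (z * z') = re z * re z' - im z * im z' by case: z; case: z'.
have imM z z' : im (z * z') = im z * re z' + re z * im z'.
  by case: z => ? ?; case: z' => ? ?; rewrite /re /im /= addrC.
have rel1 psi : smooth psi -> square_supported dl psi ->
    \int[leb2]_(x in W') (dp re e1 x * 'D_e1 psi x + dp re e2 x * 'D_e2 psi x + dF re x * psi x) =
    \int[mu]_(r in I) ((re (eta (r * a.1, r * a.2)) * re (tv (r * a.1, r * a.2)) -
      im (eta (r * a.1, r * a.2)) * im (tv (r * a.1, r * a.2))) * psi (r * a.1, r * a.2)) +
    \int[mu]_(r in I) ((re (eta (r * b.1, r * b.2)) * re (tv (r * b.1, r * b.2)) -
      im (eta (r * b.1, r * b.2)) * im (tv (r * b.1, r * b.2))) * psi (r * b.1, r * b.2)).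
  move=> sp supp_p; rewrite (rel _ _ hre sp supp_p).
  by congr (_ + _); apply: eq_Rintegral => r _; rewrite reM.
have rel2 psi : smooth psi -> square_supported dl psi ->
    \int[leb2]_(x in W') (dp im e1 x * 'D_e1 psi x + dp im e2 x * 'D_e2 psi x + dF im x * psi x) =
    \int[mu]_(r in I) ((im (eta (r * a.1, r * a.2)) * re (tv (r * a.1, r * a.2)) +
      re (eta (r * a.1, r * a.2)) * im (tv (r * a.1, r * a.2))) * psi (r * a.1, r * a.2)) +
    \int[mu]_(r in I) ((im (eta (r * b.1, r * b.2)) * re (tv (r * b.1, r * b.2)) +
      re (eta (r * b.1, r * b.2)) * im (tv (r * b.1, r * b.2))) * psi (r * b.1, r * b.2)).
  move=> sp supp_p; rewrite (rel _ _ him sp supp_p).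
  by congr (_ + _); apply: eq_Rintegral => r _; rewrite imM.
exact: (corner_value_small a_unit b_unit D0 dl0 mW W_wedge wedge_W W_bounded rho_a rho_b al0 al1 H0
  (four _ hre) (four _ him) zer cva cvb
  (ray_eta (or_introl erefl) hre) (ray_eta (or_intror erefl) hre)
  (ray_eta (or_introl erefl) him) (ray_eta (or_intror erefl) him) rel1 rel2 N0).
Qed.

End pair.

End corner_of_domain.

Lemma powR_cvg0 {R : realType} (d e : R) : 0 < d -> 0 < e ->
  exists2 s0, 1 <= s0 & forall s, s0 <= s -> s `^ (- d) <= e.
Proof.
move=> d0 e0; exists (1 + e^-1 `^ d^-1); first by rewrite lerDl powR_ge0.
move=> s ss; have s0 : 0 < s by apply: lt_le_trans ss; rewrite ltr_pwDl// powR_ge0.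
rewrite powRN -[leRHS]invrK lef_pV2 ?posrE ?powR_gt0 ?invr_gt0//.
have -> : e^-1 = (e^-1 `^ d^-1) `^ d.
  by rewrite -powRrM mulVf ?gt_eqF// powRr1// invr_ge0 ltW.
apply: ge0_ler_powR; rewrite ?nnegrE ?powR_ge0// ?ltW//.
by apply: lt_le_trans ss; rewrite ltrDr.
Qed.

(** * Averages at the vertex *)

Section averages.
Context {R : realType}.
Local Notation mu := (@lebesgue_measure R).
Local Notation plane := (measurableTypeR R * measurableTypeR R)%type.

Lemma ge0_Rintegral_le_bound {d} {T : measurableType d} (nu : {measure set T -> \bar R})
  (A : set T) (F : T -> R) (c : R) (G : T -> \bar R) :
  (forall x, (0 <= G x)%E) -> (forall x, 0 <= F x) ->
  (forall x, A x -> ((F x)%:E <= G x)%E) ->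
  (\int[nu]_(x in A) G x <= c%:E)%E -> \int[nu]_(x in A) F x <= c.
Proof.
move=> G0 F0 FG Gc.
have H : (\int[nu]_(x in A) (F x)%:E <= c%:E)%E.
  apply: le_trans Gc; apply: ge0_le_integral_set => // x Ax; first by rewrite lee_fin.
  by rewrite /patch mem_set ?FG.
have Hf : (\int[nu]_(x in A) (F x)%:E)%E \is a fin_num.
  rewrite ge0_fin_numE; first by rewrite (le_lt_trans H)// ltry.
  by apply: integral_ge0 => x _; rewrite lee_fin.
by rewrite /Rintegral -lee_fin fineK.
Qed.

Lemma Rintegral_le_bound (A : set (R * R)) (F : R * R -> R) (c : R) (G : R * R -> \bar R) :
  (forall x, (0 <= G x)%E) -> (forall x, 0 <= F x) ->
  (forall x, A x -> ((F x)%:E <= G x)%E) ->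
  (\int[leb2]_(x in (A : set plane)) G x <= c%:E)%E -> \int[leb2]_(x in (A : set plane)) F x <= c.
Proof. exact: (@ge0_Rintegral_le_bound _ plane leb2). Qed.

(** The parallelogram of the points [r a + t b] with [r] and [t] between 0 and [lam / 2] lies in the
    wedge and in the disc; this is its area. *)
Lemma wedge_disc_area (a b : R * R) (lam : R) :
  a.1 ^+ 2 + a.2 ^+ 2 = 1 -> b.1 ^+ 2 + b.2 ^+ 2 = 1 ->
  0 < a.1 * b.2 - a.2 * b.1 -> 0 < lam ->
  (((a.1 * b.2 - a.2 * b.1) * (lam / 2) ^+ 2)%:E <= leb2 (wedge a b `&` disc 0%R lam : set plane))%E.
Proof.
move=> a_unit b_unit D0 lam0.
have mS : measurable (wedge a b `&` disc 0 lam : set plane).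
  apply: measurableI; first exact: measurable_wedge.
  by apply: open_measurable2; exact: open_disc0.
have l20 : 0 < lam / 2 by rewrite divr_gt0.
pose Q : set plane := `]0%R, (lam / 2)%R[%classic `*` `]0%R, (lam / 2)%R[%classic.
have mQ : measurable Q by apply: measurableX; exact: measurable_itv.
pose f (x : plane) : \bar R := (\1_(wedge a b `&` disc 0 lam) x)%:E.
have mf : measurable_fun setT f by apply/measurable_EFinP; exact: measurable_indic.
have f0 x : (0 <= f x)%E by rewrite lee_fin.
have D1 : a.1 * b.2 - a.2 * b.1 != 0 by rewrite gt_eqF.
have := ge0_integral_linear2 D1 mf f0; rewrite integral_indic// setIT => ->.
rewrite (gtr0_norm D0) EFinM lee_pmul2l//.
apply: (@le_trans _ _ (leb2 Q)).
  rewrite /leb2 product_measure1E//; try exact: measurable_itv.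
  have E : mu `]0%R, (lam / 2)%R[%classic = (lam / 2)%:E.
    by rewrite lebesgue_measure_itv/= lte_fin l20 -EFinB subr0.
  by rewrite [X in (_ <= X * _)%E]E [X in (_ <= _ * X)%E]E -EFinM lee_fin expr2.
have -> : leb2 Q = (\int[leb2]_x (\1_Q x)%:E)%E by rewrite integral_indic// setIT.
apply: ge0_le_integral => //.
- by apply/measurable_EFinP; exact: measurable_indic.
- exact: (measurableT_comp mf (measurable_linear2 _ _ _ _)).
move=> x _; rewrite /f lee_fin !indicE; have [Qx|nQ] := pselect (Q x); last by rewrite memNset.
rewrite (mem_set Qx) mem_set//.
move: Qx => [/=]; rewrite !in_itv/= => /andP[x0 x1] /andP[y0 y1].
split; first by apply/(wedge_wpt D0).
rewrite /disc /= subr0.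
have tri (p q : R * R) : p.1 ^+ 2 + p.2 ^+ 2 <= (lam / 2) ^+ 2 -> q.1 ^+ 2 + q.2 ^+ 2 < (lam / 2) ^+ 2 ->
    enorm (p.1 + q.1, p.2 + q.2) < lam.
  move=> hp hq; rewrite -(gtr0_norm lam0) -sqrtr_sqr ltr_sqrt ?exprn_gt0//=.
  rewrite (_ : lam ^+ 2 = 2 * (lam / 2) ^+ 2 + 2 * (lam / 2) ^+ 2); last by field.
  have := sqr_ge0 (p.1 - q.1); have := sqr_ge0 (p.2 - q.2).
  by move: hp hq; move: (p.1) (p.2) (q.1) (q.2) ((lam / 2) ^+ 2) => *; rewrite !sqrrD; nra.
have sc (e : R * R) (t : R) : e.1 ^+ 2 + e.2 ^+ 2 = 1 -> 0 < t -> t < lam / 2 ->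
    (t * e.1) ^+ 2 + (t * e.2) ^+ 2 < (lam / 2) ^+ 2.
  by move=> e_unit t0 tl; rewrite !(exprMn _ t) -mulrDr e_unit mulr1 ltr_pXn2r// nnegrE ltW.
exact: (tri (x.1 * a.1, x.1 * a.2) (x.2 * b.1, x.2 * b.2) (ltW (sc _ _ a_unit x0 x1)) (sc _ _ b_unit y0 y1)).
Qed.

(** The three terms come from Cauchy-Schwarz for [f - g], from the variation of [g] on a square of
    half-side [lam], and from the constant [g0]. *)
Lemma average_part (W S : set (R * R)) (f g : R * R -> R) (g0 B L lam : R) (bd : R) :
  measurable (W : set plane) -> measurable (S : set plane) -> S `<=` W -> W `<=` in_square bd ->
  S `<=` in_square lam -> sqint leb2 (W : set plane) f -> corner_approx W f g g0 B L ->
  \int[leb2]_(x in (S : set plane)) `|f x| <=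
  B * Num.sqrt (fine (leb2 (S : set plane))) + (2 * lam * L + `|g0|) * fine (leb2 (S : set plane)).
Proof.
move=> mW mS SW Wbd Slam sf [cg B0 L0 fg [_ gL]].
have Sbd : S `<=` in_square bd by apply: subset_trans Wbd.
have sfS : sqint leb2 (S : set plane) f.
  by case: sf => mf i; split; [exact: measurable_funS mf|exact: (integrableS mW mS)].
have sgS := continuous_sqint mS Sbd cg.
have sgW := continuous_sqint mW Wbd cg.
have s1 : sqint leb2 (S : set plane) (fun=> 1) := continuous_sqint mS Sbd (@cst_continuous _ _ (1 : R)).
have sfg := sqintB mS sfS sgS.
have m0 : 0 <= fine (leb2 (S : set plane)) by rewrite fine_ge0.
set m := fine _ in m0 *.
have i1 : \int[leb2]_(x in (S : set plane)) 1 ^+ 2 <= Num.sqrt m ^+ 2.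
  under eq_Rintegral do rewrite expr1n.
  by rewrite Rintegral_cst// mul1r sqr_sqrtr.
have fgS : \int[leb2]_(x in (S : set plane)) (f x - g x) ^+ 2 <= B ^+ 2.
  apply: le_trans fg; apply: (Rintegral_le_bound (G := fun x => ((f x - g x) ^+ 2 * \1_W x)%:E)) => //.
  - by move=> x; rewrite lee_fin mulr_ge0// sqr_ge0.
  - by move=> x; exact: sqr_ge0.
  - by move=> x Sx; rewrite lee_fin indicE mem_set ?mulr1//; exact: SW.
  have sfgW := sqintB mW sf sgW.
  have fin := integrable_fin_num mW sfgW.2.
  rewrite /Rintegral fineK//; apply: ge0_le_integral_set => //.
  - by move=> x _; rewrite lee_fin mulr_ge0// sqr_ge0.
  - by move=> x _; rewrite lee_fin sqr_ge0.
  - by move=> x Sx; rewrite /patch (mem_set (SW _ Sx)) lee_fin indicE (mem_set (SW _ Sx)) mulr1.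
have CS := Rintegral_le_CauchySchwarz mS B0 (sqrtr_ge0 m) sfg s1 fgS i1.
have ifg : rintegrable leb2 (S : set plane) (fun x => `|(f x - g x) * 1|).
  by apply: rintegrable_norm => //; exact: sqint_mul.
have ic : rintegrable leb2 (S : set plane) (fun=> 2 * lam * L + `|g0|).
  exact: (continuous_rintegrable mS Sbd (@cst_continuous _ _ (_ : R))).
have ifS : rintegrable leb2 (S : set plane) (fun x => `|f x|).
  apply: (eq_rintegrable mS _ (sqint_mul mS (sqint_norm mS sfS) s1)) => x _.
  by rewrite mulr1.
apply: (@le_trans _ _ (\int[leb2]_(x in (S : set plane))
    (`|(f x - g x) * 1| + (2 * lam * L + `|g0|)))).
  apply: le_Rintegral => //; first exact: rintegrableD.
  move=> x Sx; rewrite mulr1.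
  have -> : f x = (f x - g x) + ((g x - g0) + g0) by ring.
  apply: (le_trans (ler_normD _ _)).
  have E : f x - g x + (g x - g0 + g0) - g x = f x - g x by ring.
  rewrite E lerD2l; apply: (le_trans (ler_normD _ _)); rewrite lerD2r.
  apply: (le_trans (gL _ (SW _ Sx))); rewrite mulrC; apply: ler_wpM2r => //.
  by have [] := Slam _ Sx; lra.
rewrite (RintegralD mS ifg ic); apply: lerD => //.
by rewrite Rintegral_cst.
Qed.

End averages.

(** * Herglotz waves as corner approximations *)

Section herglotz_approximation.
Context {R : realType}.
Local Notation mu := (@lebesgue_measure R).
Local Notation plane := (measurableTypeR R * measurableTypeR R)%type.

Lemma herglotz_part (k : R) (g : R * R -> R[i]) (pr : R[i] -> R) : is_part pr ->
  exists p q : R -> R, [/\ (fun x => pr (herglotz k g x)) = plane_wave_mean k p q,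
    (forall t, p t ^+ 2 <= Normc.normc (on_circle g t) ^+ 2),
    (forall t, q t ^+ 2 <= Normc.normc (on_circle g t) ^+ 2) &
    L2_circle g -> sqint mu `[- pi, pi] p /\ sqint mu `[- pi, pi] q].
Proof.
have hre : is_part (@complex.Re R) by left. have him : is_part (@complex.Im R) by right.
case=> ->.
- exists (fun t => complex.Re (on_circle g t)), (fun t => complex.Im (on_circle g t)); split.
  + apply/funext => x; rewrite /herglotz /cintegral /=; congr fine.
    apply: eq_integral => t _; congr EFin; rewrite /on_circle /expi /edot /=.
    by case: (g _) => u w.
  + by move=> t; exact: part_sqr_le.
  + by move=> t; exact: part_sqr_le.
  + by move=> Lg; split; exact: L2_sqint Lg.
- exists (fun t => complex.Im (on_circle g t)), (fun t => - complex.Re (on_circle g t)); split.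
  + apply/funext => x; rewrite /herglotz /cintegral /=; congr fine.
    apply: eq_integral => t _; congr EFin; rewrite /on_circle /expi /edot /=.
    by case: (g _) => u w /=; rewrite mulrN opprK.
  + by move=> t; exact: part_sqr_le.
  + by move=> t; rewrite sqrrN; exact: part_sqr_le.
  + by move=> Lg; split; [|apply: sqintN => //]; exact: L2_sqint Lg.
Qed.

(** The mass of the kernel is at most [6 * M]; it bounds the values of the wave, and [k] times it
    the Lipschitz constant. The factor [k + 1] covers both. *)
Lemma herglotz_corner_approx (W : set (R * R)) (k M B : R) (g v : R * R -> R[i]) (pr : R[i] -> R) :
  is_part pr -> 0 < k -> 0 <= M -> 0 <= B ->
  L2_circle g -> (L2norm_circle g <= M%:E)%E ->
  (H1norm W (fun x => (v x - herglotz k g x)%R) <= B%:E)%E ->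
  corner_approx W (fun x => pr (v x)) (fun x => pr (herglotz k g x)) (pr (herglotz k g 0))
    B (6 * (k + 1) * M).
Proof.
move=> hpr k0 M0 B0 Lg gM vB.
have [p [q [E p2 q2 /(_ Lg)[sp sq]]]] := herglotz_part k g hpr.
have gM2 : (\int[mu]_(t in `[(- pi : R)%R, (pi : R)%R]) (Normc.normc (on_circle g t) ^+ 2)%R%:E <= (M ^+ 2)%R%:E)%E.
  by apply: poweR_half_le => //; apply: integral_ge0 => t _; rewrite lee_fin sqr_ge0.
have bd (f : R -> R) : sqint mu `[- pi, pi] f ->
    (forall t, f t ^+ 2 <= Normc.normc (on_circle g t) ^+ 2) ->
    \int[mu]_(t in `[- pi, pi]) f t ^+ 2 <= M ^+ 2.
  move=> _ fg; apply: (@ge0_Rintegral_le_bound R _ (measurableTypeR R) mu _ _ _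
    (fun t => (Normc.normc (on_circle g t) ^+ 2)%:E) _ _ _ gM2) => t; rewrite ?lee_fin ?sqr_ge0//.
have N6 := plane_wave_mass sp sq M0 (bd _ sp p2) (bd _ sq q2).
have L0 : 0 <= 6 * (k + 1) * M by rewrite !mulr_ge0// addr_ge0// ltW.
have E0 x : pr (herglotz k g x) = plane_wave_mean k p q x by rewrite -E.
split=> //.
- by rewrite E; exact: (plane_wave_mean_continuous k0 sp sq).
- apply: (Rintegral_le_bound (G := fun x => (Normc.normc (v x - herglotz k g x) ^+ 2 +
      Normc.normc (wpartial W e1 (fun x => v x - herglotz k g x) x) ^+ 2 +
      Normc.normc (wpartial W e2 (fun x => v x - herglotz k g x) x) ^+ 2)%R%:E)).
  + by move=> x; rewrite lee_fin !addr_ge0 ?sqr_ge0.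
  + by move=> x; exact: sqr_ge0.
  + move=> x _; rewrite lee_fin -partB// -addrA (le_trans (part_sqr_le _ hpr))// lerDl.
    by rewrite addr_ge0 ?sqr_ge0.
  + apply: poweR_half_le => //; apply: integral_ge0 => x _.
    by rewrite lee_fin !addr_ge0 ?sqr_ge0.
split.
  rewrite E0; apply: (le_trans (plane_wave_mean_le k sp sq 0)); apply: (le_trans N6).
  by apply: ler_wpM2r => //; rewrite mulrDr mulr1 lerDr mulr_ge0// ltW.
move=> x _; rewrite !E0; apply: (le_trans (plane_wave_mean_lip k0 sp sq x 0)); rewrite !subr0.
rewrite [leRHS]mulrC mulrAC [leRHS]mulrC; apply: ler_wpM2r; first exact: addr_ge0.
apply: (@le_trans _ _ (k * (6 * M))); first by apply: ler_wpM2l => //; exact: ltW.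
by rewrite (_ : 6 * (k + 1) * M = k * (6 * M) + 6 * M); [rewrite lerDl mulr_ge0|ring].
Qed.

End herglotz_approximation.

(* With [s = 1 / lam] and [j] about [s `^ th], the two error terms are powers
   of [lam] with positive exponents exactly when [1 / be < th < al / ga]. *)
Lemma exponent_choice {R : realType} (al be ga : R) : 0 < al -> 0 < be -> 0 < ga ->
  ga < al * be -> exists th d : R, [/\ 0 < d, 0 < th & forall s : R, 1 <= s ->
    exists2 j : nat, (0 < j)%N &
      s * j%:R `^ (- be) <= s `^ (- d) /\ j%:R `^ ga * s `^ (- al) <= 2 `^ ga * s `^ (- d)].
Proof.
move=> al0 be0 ga0 gab.
have lt : be^-1 < al / ga by rewrite ltr_pdivlMr// mulrC ltr_pdivrMr.
pose th := (be^-1 + al / ga) / 2.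
have bi0 : 0 < be^-1 by rewrite invr_gt0.
have [t1 t2] : be^-1 < th /\ th < al / ga by rewrite /th; split; lra.
have th0 : 0 < th by exact: lt_trans t1.
have d1 : 0 < th * be - 1 by rewrite subr_gt0 -ltr_pdivrMr// mul1r.
have d2 : 0 < al - th * ga by rewrite subr_gt0 -ltr_pdivlMr.
pose d := Num.min (th * be - 1) (al - th * ga).
exists th, d; split=> //; first by rewrite lt_min d1.
move=> s s1; have s0 : 0 < s by exact: lt_le_trans s1.
pose x := s `^ th; have x0 : 0 < x by exact: powR_gt0.
have x1 : 1 <= x by rewrite -(powRr0 s); apply: ler_powR => //; exact: ltW.
(* The successor of the integer part satisfies [x <= j <= 2 x], since [x >= 1]; the upper estimate
   is the origin of the factor [2 ^ ga]. *)
have xt := trunc_itv (ltW x0); pose j := (Num.trunc x).+1.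
have /andP[j1 j2] := xt.
have xj : x <= j%:R by exact: ltW.
have jx : j%:R <= 2 * x by rewrite /j -natr1; lra.
have j0 : 0 < j%:R :> R by exact: lt_le_trans xj.
exists j => //; split.
  apply: (@le_trans _ _ (s * x `^ (- be))).
    apply: ler_wpM2l; first exact: ltW.
    rewrite !powRN lef_pV2 ?posrE ?powR_gt0//.
    by apply: ge0_ler_powR; rewrite ?nnegrE// ltW.
  rewrite /x -powRrM -{1}[s]powRr1 ?(ltW s0)// -powRD; last by rewrite (gt_eqF s0) implybT.
  by apply: ler_powR => //; rewrite mulrN lerNr opprD opprK addrC ge_min lexx.
apply: (@le_trans _ _ ((2 * x) `^ ga * s `^ (- al))).
  apply: ler_wpM2r; first exact: powR_ge0.
  by apply: ge0_ler_powR; rewrite ?nnegrE ?mulr_ge0// ltW.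
rewrite (powRM _ _ (ltW x0))// -mulrA; apply: ler_wpM2l; first exact: powR_ge0.
rewrite /x -powRrM -powRD; last by rewrite (gt_eqF s0) implybT.
by apply: ler_powR => //; rewrite lerNr opprD opprK addrC ge_min lexx orbT.
Qed.

Theorem theorem3p1 (R : realType)
  (Omega Gamma : set (R * R)) (k : R) (V q eta v w : R * R -> R[i])
  (theta_m theta_M h alpha beta gamma : R) (g : nat -> R * R -> R[i])
  (hOmega : bounded_lipschitz_domain Omega)
  (hOmegaC : connected (~` Omega))
  (hGamma : exists2 U : set (R * R), open U & Gamma = boundary Omega `&` U)
  (hk : 0 < k)
  (hV : Linfty leb2 Omega V)
  (hq : q = (fun x => 1 + V x))
  (heta : Linfty hausdorff1 (boundary Omega) eta)
  (hvw : conductive_transmission_eigenfunctions Omega Gamma k q eta v w)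
  (h0 : Gamma 0)
  (hh : 0 < h)
  (hcorner : Omega `&` disc 0 h = truncated_sector theta_m theta_M h)
  (hqH2 : sobolev 2 (truncated_sector theta_m theta_M h) q)
  (halpha : 0 < alpha < 1)
  (hetaC : holder_on
     (closure ((ray theta_m `|` ray theta_M) `&` disc 0 h)) alpha eta)
  (hbeta : 0 < beta) (hgamma : 0 < gamma) (hgab : gamma < alpha * beta)
  (hg : forall j : nat, (0 < j)%N ->
     [/\ L2_circle (g j),
         (H1norm (truncated_sector theta_m theta_M h)
            (fun x => (v x - herglotz k (g j) x)%R) <= (j%:R `^ (- beta))%:E)%E &
         (L2norm_circle (g j) <= (j%:R `^ gamma)%:E)%E])
  (heta0 : eta 0 != 0)
  (htheta : - pi < theta_m /\ theta_m < theta_M /\ theta_M < pi)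
  (hopen : 0 < theta_M - theta_m < pi) :
  (fun lambda : R =>
     (fine (leb2 (disc 0 lambda `&` Omega)))^-1 *
     fine (\int[leb2]_(x in disc 0%R lambda `&` Omega)
             (Normc.normc (v x))%:E)%E) @ 0^'+ --> (0 : R).
Proof.
have [_ oO _ bO _] := hOmega.
have [U oU GE] := hGamma.
have [/andP[d0 dpi]] := (hopen : 0 < theta_M - theta_m < pi).
have [tm1 [tmM tM1]] := htheta.
have [/andP[al0 al1]] := (halpha : 0 < alpha < 1).
pose a : R * R := (cos theta_m, sin theta_m); pose b : R * R := (cos theta_M, sin theta_M).
have a_unit : a.1 ^+ 2 + a.2 ^+ 2 = 1 by exact: cos2Dsin2.
have b_unit : b.1 ^+ 2 + b.2 ^+ 2 = 1 by exact: cos2Dsin2.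
have D0 : 0 < a.1 * b.2 - a.2 * b.1.
  rewrite (_ : _ - _ = sin (theta_M - theta_m)); first by apply: sin_gt0_pi; rewrite d0.
  by rewrite sinB /=; ring.
have corner : Omega `&` disc 0 h = wedge a b `&` disc 0 h.
  by rewrite hcorner /truncated_sector sector_wedge.
have [bd Obd] : exists bd, Omega `<=` in_square bd.
  have [M [_ HM]] := bO; exists (M + 1) => x Ox.
  have MM : M < M + 1 by rewrite ltrDl.
  by have /= := HM _ MM _ Ox; rewrite prod_normE /= ge_max => /andP[].
have [r r0 rU] : exists2 r : R, 0 < r & forall x, in_square r x -> U x.
  have : nbhs (0 : R * R) U.
    by apply: open_nbhs_nbhs; split=> //; move: h0; rewrite GE => -[].
  move=> /nbhs_ballP[r /= r0 rU]; exists (r / 2); first by rewrite divr_gt0.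
  move=> x [x1 x2]; apply: rU; split; rewrite /ball /= sub0r normrN.
    by apply: le_lt_trans x1 _; rewrite ltr_pdivrMr// ltr_pMr// ltr1n.
  by apply: le_lt_trans x2 _; rewrite ltr_pdivrMr// ltr_pMr// ltr1n.
(* [r] keeps the boundary points near the vertex in [Gamma], [h] keeps the disc in the corner. *)
pose dl := Num.min r h / 2.
have m0 : 0 < Num.min r h by rewrite lt_min r0.
have dl0 : 0 < dl by rewrite divr_gt0.
have dl2 : 2 * dl = Num.min r h by rewrite /dl; field.
have dlh : 2 * dl <= h by rewrite dl2 ge_min lexx orbT.
have comp_le (x : R * R) : `|x.1| <= enorm x /\ `|x.2| <= enorm x.
  by rewrite -!sqrtr_sqr; split; apply: ler_wsqrtr; rewrite ?lerDl ?lerDr sqr_ge0.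
have discE (rr : R) (x : R * R) : disc 0 rr x <-> enorm x < rr by rewrite /disc /= subr0.
have TG : boundary Omega `&` disc 0 (2 * dl) `<=` Gamma.
  move=> x [Bx /discE xd]; rewrite GE; split=> //; apply: rU.
  have xr : enorm x <= r by apply: ltW; apply: lt_le_trans xd _; rewrite dl2 ge_min lexx.
  by have [n1 n2] := comp_le x; split; apply: le_trans xr.
have GB : Gamma `<=` boundary Omega by rewrite GE => x [].
have [[sv sw] _ lapw lapv [tv [tw [trv trw tvw cond]]]] := hvw.
have [C0 holder] := hetaC.
have rayP_m : ray theta_m = [set x | exists2 r, 0 < r & x = (r * a.1, r * a.2)].
  by apply: rayP; rewrite tm1 (lt_trans tmM).
have rayP_M : ray theta_M = [set x | exists2 r, 0 < r & x = (r * b.1, r * b.2)].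
  by apply: rayP; rewrite tM1 andbT (lt_trans tm1).
have side_norm (e : R * R) (t : R) : e = a \/ e = b -> 0 < t -> enorm (t * e.1, t * e.2) = t.
  move=> ee t0; have eu : e.1 ^+ 2 + e.2 ^+ 2 = 1 by case: ee => ->.
  by rewrite /enorm /= !(exprMn _ t) -mulrDr eu mulr1 sqrtr_sqr gtr0_norm.
pose sides := (ray theta_m `|` ray theta_M) `&` disc 0 h.
have side_in (e : R * R) (t : R) : e = a \/ e = b -> 0 < t -> t < h -> sides (t * e.1, t * e.2).
  move=> ee t0 th; split; last by apply/discE; rewrite side_norm.
  by case: ee => ->; [left; rewrite rayP_m|right; rewrite rayP_M]; exists t.
(* The rays omit the vertex, which lies only in their closure; this is what lets the Hoelder
   condition compare [eta] with [eta 0]. *)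
have cl0 : closure sides 0.
  move=> B /nbhs_ballP[e /= e0 eB].
  pose t := Num.min (e / 2) (h / 2).
  have t0 : 0 < t by rewrite lt_min !divr_gt0.
  have half (y : R) : 0 < y -> y / 2 < y by move=> y0; rewrite ltr_pdivrMr// ltr_pMr// ltr1n.
  have th : t < h by rewrite gt_min (half h)// orbT.
  have te : t < e by rewrite gt_min half.
  exists (t * a.1, t * a.2); split; first exact: side_in (or_introl erefl) t0 th.
  have [n1 n2] := comp_le (t * a.1, t * a.2); rewrite (side_norm a _ (or_introl erefl) t0) in n1 n2.
  by apply: eB; split; rewrite /ball /= sub0r normrN; apply: le_lt_trans te.
(* The Hoelder constant comes without a sign. *)
have H0 : 0 <= `|C0| by [].
have eta_holder : forall e pr, e = a \/ e = b -> is_part pr ->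
    forall t, (`]0, 2 * dl[%classic : set (measurableTypeR R)) t ->
    `|pr (eta (t * e.1, t * e.2)) - pr (eta 0)| <= `|C0| * t `^ alpha.
  move=> e pr ee hpr t; rewrite /= in_itv/= => /andP[t0 tdl].
  have th : t < h by exact: lt_le_trans dlh.
  have := holder _ _ (subset_closure (side_in _ _ ee t0 th)) cl0.
  rewrite subr0 side_norm// => H; rewrite -partB//.
  apply: (@le_trans _ _ (C0 * t `^ alpha)); last by rewrite ler_wpM2r ?powR_ge0// ler_norm.
  apply: le_trans H.
  have n0 z : 0 <= Normc.normc z :> R by case: z => ? ?; exact: sqrtr_ge0.
  by rewrite -(@ler_pXn2r _ 2)// ?nnegrE// real_normK ?num_real//; exact: part_sqr_le.
have [C CC0 core] := domain_corner_value a_unit b_unit D0 dl0 dlh oO Obd corner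
  GB TG sv sw trv trw tvw al0 al1 H0 lapv.1 lapw.1 heta.1 eta_holder heta0 cond.
pose W : set (R * R) := Omega `&` disc 0 h.
have WE : truncated_sector theta_m theta_M h = W by rewrite -hcorner.
have mdisc (rr : R) : measurable (disc 0 rr : set (measurableTypeR R * measurableTypeR R)).
  by apply: open_measurable2; exact: open_disc0.
have mO : measurable (Omega : set (measurableTypeR R * measurableTypeR R)) by exact: open_measurable2.
have mW : measurable (W : set (measurableTypeR R * measurableTypeR R)) by exact: measurableI.
have Wbd : W `<=` in_square bd by move=> x [/Obd].
have spart pr : is_part pr -> sqint leb2 (W : set (measurableTypeR R * measurableTypeR R))
    (fun x => pr (v x)).
  move=> hpr; have [mf i] := L2_sqint hpr sv.1.
  split; first by apply: measurable_funS mf => // x [].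
  by apply: (integrableS mO mW) i => x [].
have hre : is_part (@complex.Re R) by left.
have him : is_part (@complex.Im R) by right.
have [th [d [dd0 th0 choice]]] := exponent_choice al0 hbeta hgamma hgab.
pose D := a.1 * b.2 - a.2 * b.1.
pose k6 := 6 * (k + 1).
have k60 : 0 <= k6 by rewrite mulr_ge0// addr_ge0// ltW.
(* The area [m] of the sector of radius [1 / s] satisfies [sqrt m >= sqrt D / (2 s)], hence
   [B / sqrt m <= c1 * (s * B)]. *)
pose c1 := 2 / Num.sqrt D.
have sD : 0 < Num.sqrt D by rewrite sqrtr_gt0.
have c10 : 0 <= c1 by rewrite divr_ge0// ltW.
pose P := 2 `^ gamma.
have P0 : 0 <= P by exact: powR_ge0.
(* The outer factor counts the real and imaginary parts. Inside are the contributions of the L^2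
   error, of the variation of the wave, and of its value at the vertex. *)
pose K := 2 * (c1 + 2 * (k6 * P) + C * (1 + k6 * P)).
have kP : 0 <= k6 * P by exact: mulr_ge0.
have kP1 : 0 <= 1 + k6 * P by exact: addr_ge0.
have K0 : 0 <= K.
  exact: (mulr_ge0 (ler0n _ 2) (addr_ge0 (addr_ge0 c10 (mulr_ge0 (ler0n _ 2) kP)) (mulr_ge0 CC0 kP1))).
(* Everything except the smallness parameter of the corner estimate decays. *)
have main e : 0 < e -> exists2 s0, 1 <= s0 & forall s, s0 <= s ->
    0 <= (fine (leb2 (disc 0 s^-1 `&` Omega)))^-1 *
      fine (\int[leb2]_(x in disc 0%R s^-1 `&` Omega) (Normc.normc (v x))%:E)%E <=
    2 * e + K * s `^ (- d).
  move=> e0; have [s0 s01 Hs] := core e e0.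
  have s00 : 0 < s0 by exact: lt_le_trans s01.
  (* The summand [h^-1] makes [s^-1 <= h], so that the disc of radius [s^-1] sees only the
     corner. *)
  exists (s0 + h^-1); first by rewrite -[leLHS]addr0 lerD// invr_ge0 ltW.
  move=> s ss; have hi0 : 0 < h^-1 by rewrite invr_gt0.
  have ss0 : s0 <= s by apply: le_trans ss; rewrite lerDl ltW.
  have s1 : 1 <= s by exact: le_trans s01 ss0.
  have sp : 0 < s by exact: lt_le_trans s1.
  have lh : s^-1 <= h.
    by rewrite -[leRHS]invrK lef_pV2 ?posrE//; apply: le_trans ss; rewrite lerDr ltW.
  pose S := disc 0 s^-1 `&` Omega.
  have mS : measurable (S : set (measurableTypeR R * measurableTypeR R)) by exact: measurableI.
  have SW : S `<=` W.
    move=> x [/discE xs Ox]; split=> //; apply/discE; exact: lt_le_trans lh.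
  have Sl : S `<=` in_square s^-1.
    by move=> x [/discE/ltW xs _]; have [n1 n2] := comp_le x; split; apply: le_trans xs.
  have [j j0 [jb jg]] := choice s s1.
  have [Lg H1 gn] := hg j j0.
  set B := j%:R `^ (- beta) in H1 jb; set M := j%:R `^ gamma in gn jg.
  have B0 : 0 <= B by exact: powR_ge0.
  have M0 : 0 <= M by exact: powR_ge0.
  rewrite WE in H1.
  have apr := herglotz_corner_approx hre hk M0 B0 Lg gn H1.
  have api := herglotz_corner_approx him hk M0 B0 Lg gn H1.
  have [vr vi] := Hs _ _ _ _ _ _ _ ss0 apr api.
  have Ar := average_part mW mS SW Wbd Sl (spart _ hre) apr.
  have Ai := average_part mW mS SW Wbd Sl (spart _ him) api.
  rewrite -/k6 in vr vi Ar Ai.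
  set m := fine (leb2 S) in Ar Ai *.
  have area : D * (s^-1 / 2) ^+ 2 <= m.
    have Sfin : (leb2 (S : set (measurableTypeR R * measurableTypeR R)) < +oo)%E.
      apply: (@le_lt_trans _ _ (leb2 (W : set (measurableTypeR R * measurableTypeR R)))).
        by apply: le_measure; rewrite ?inE.
      exact: leb2_W_fin mW Wbd.
    have := wedge_disc_area a_unit b_unit D0 (_ : 0 < s^-1); rewrite invr_gt0 => /(_ sp).
    have -> : wedge a b `&` disc 0 s^-1 = S.
      apply/seteqP; split=> x [wx xs]; split=> //.
      - have : (wedge a b `&` disc 0 h) x.
          by split=> //; apply/discE; move/discE: xs => /lt_le_trans; apply.
        by rewrite -corner => -[].
      - have : (Omega `&` disc 0 h) x.
          by split=> //; apply/discE; move/discE: wx => /lt_le_trans; apply.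
        by rewrite corner => -[].
    by rewrite -[X in (_ <= X)%E -> _]fineK ?ge0_fin_numE// lee_fin.
  have D1 : 0 < D by [].
  have m1 : 0 < m by apply: lt_le_trans area; rewrite mulr_gt0// exprn_gt0// divr_gt0// invr_gt0.
  have sm : 0 < Num.sqrt m by rewrite sqrtr_gt0.
  have sqm : Num.sqrt D / (2 * s) <= Num.sqrt m.
    have q0 : 0 <= s^-1 / 2 by rewrite divr_ge0// invr_ge0 ltW.
    have -> : Num.sqrt D / (2 * s) = Num.sqrt (D * (s^-1 / 2) ^+ 2).
      rewrite sqrtrM ?(ltW D1)// sqrtr_sqr ger0_norm//; congr (_ * _).
      by field; rewrite gt_eqF.
    exact: ler_wsqrtr.
  have Bm : B / Num.sqrt m <= c1 * (s * B).
    rewrite ler_pdivrMr// /c1.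
    have c0' : 0 <= 2 / Num.sqrt D * (s * B) by rewrite mulr_ge0// mulr_ge0// ltW.
    apply: le_trans (ler_wpM2l c0' sqm); rewrite le_eqVlt; apply/orP; left; apply/eqP.
    by field; rewrite !gt_eqF.
  have nn z : 0 <= Normc.normc z :> R by case: z => ? ?; exact: sqrtr_ge0.
  have I0 : 0 <= fine (\int[leb2]_(x in (S : set (measurableTypeR R * measurableTypeR R))) (Normc.normc (v x))%:E)%E.
    by apply: fine_ge0; apply: integral_ge0 => x _; rewrite lee_fin.
  have sS pr (hpr : is_part pr) : rintegrable leb2 (S : set (measurableTypeR R * measurableTypeR R))
      (fun x => `|pr (v x)|).
    have [mf i] := spart _ hpr; have Sbd : S `<=` in_square bd := subset_trans SW Wbd.
    apply: rintegrable_norm => //; apply: sqint_rintegrable => //.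
      exact: leb2_W_fin mS Sbd.
    by split; [exact: measurable_funS mf|exact: (integrableS mW mS)].
  have iS := rintegrableD mS (sS _ hre) (sS _ him).
  have IS : \int[leb2]_(x in (S : set (measurableTypeR R * measurableTypeR R))) Normc.normc (v x) <=
      \int[leb2]_(x in (S : set (measurableTypeR R * measurableTypeR R))) (`|complex.Re (v x)| + `|complex.Im (v x)|).
    apply: (Rintegral_le_bound (G := fun x => (`|complex.Re (v x)| + `|complex.Im (v x)|)%:E)) => //.
    - by move=> x _; rewrite lee_fin normc_le_parts.
    - by rewrite /Rintegral fineK// integrable_fin_num.
  rewrite (RintegralD mS (sS _ hre) (sS _ him)) in IS.
  rewrite mulr_ge0 ?invr_ge0 ?(ltW m1)//=.
  have tot := le_trans IS (lerD Ar Ai).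
  set g0 := complex.Re (herglotz _ _ _) in vr tot; set g0' := complex.Im (herglotz _ _ _) in vi tot.
  rewrite mulrC ler_pdivrMr//.
  apply: (le_trans tot).
  have Bm' : B * Num.sqrt m <= c1 * (s * B) * m.
    rewrite -{2}(sqr_sqrtr (ltW m1)) expr2 mulrA; apply: ler_wpM2r; first exact: ltW.
    by rewrite -ler_pdivrMr.
  have p0 : 0 <= s `^ (- d) by exact: powR_ge0.
  have sal : s^-1 <= s `^ (- alpha).
    rewrite powRN lef_pV2 ?posrE ?powR_gt0//.
    by rewrite -[leRHS]powRr1 ?(ltW sp)//; apply: ler_powR => //; exact: ltW.
  have Lal : k6 * M * s `^ (- alpha) <= k6 * P * s `^ (- d).
    by rewrite -(mulrA k6 M) -(mulrA k6 P); exact: ler_wpM2l k60 _ _ jg.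
  have Ls : s^-1 * (k6 * M) <= k6 * P * s `^ (- d).
    by apply: le_trans Lal; rewrite mulrC; apply: ler_wpM2l => //; exact: mulr_ge0.
  have E1 : s * B + k6 * M * s `^ (- alpha) <= (1 + k6 * P) * s `^ (- d).
    by rewrite mulrDl mul1r; apply: lerD.
  have CE := ler_wpM2l CC0 E1.
  have cB := ler_wpM2l c10 jb.
  have one (gg : R) : gg <= e + C * (s * B + k6 * M * s `^ (- alpha)) ->
      B * Num.sqrt m + (2 * s^-1 * (k6 * M) + gg) * m <= (e + K / 2 * s `^ (- d)) * m.
    move=> Hg; apply: (@le_trans _ _ ((c1 * (s * B) + (2 * s^-1 * (k6 * M) + gg)) * m)).
      by rewrite [leRHS]mulrDl lerD2r.
    apply: ler_wpM2r; first exact: ltW.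
    have -> : K / 2 * s `^ (- d) = c1 * s `^ (- d) + 2 * (k6 * P * s `^ (- d)) +
      C * ((1 + k6 * P) * s `^ (- d)) by rewrite /K; field.
    have Hg' := le_trans Hg (lerD (lexx e) CE).
    have L2 : 2 * s^-1 * (k6 * M) <= 2 * (k6 * P * s `^ (- d)).
      by rewrite -mulrA; apply: ler_wpM2l.
    have := lerD cB (lerD L2 Hg'); congr (_ <= _); ring.
  have := lerD (one _ vr) (one _ vi).
  have -> : (e + K / 2 * s `^ (- d)) * m + (e + K / 2 * s `^ (- d)) * m =
    (2 * e + K * s `^ (- d)) * m by field.
  exact.
apply/cvgrPdist_le => /= e e0.
(* [2 * (e / 4)] and a decaying term at most [e / 2] add up to [e]; the latter is arranged with
   [K + 1] in the denominator, as [K] may vanish. *)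
have e4 : 0 < e / 4 by rewrite divr_gt0.
have [s0 s01 Hs0] := main _ e4.
have Kp : 0 < K + 1 by rewrite ltr_wpDl.
have eK : 0 < e / (2 * (K + 1)) by rewrite divr_gt0// mulr_gt0.
have [s2 s21 Hs2] := powR_cvg0 dd0 eK.
pose l0 := (s0 + s2)^-1.
have s0p : 0 < s0 by exact: lt_le_trans s01.
have s2p : 0 < s2 by exact: lt_le_trans s21.
have l00 : 0 < l0 by rewrite invr_gt0 addr_gt0.
near=> lam.
have lam0 : 0 < lam by near: lam; exact: nbhs_right_gt.
have laml : lam <= l0 by near: lam; exact: nbhs_right_le.
have si : s0 + s2 <= lam^-1 by rewrite -[leLHS]invrK lef_pV2 ?posrE.
have q0 : s0 <= lam^-1 by apply: le_trans si; rewrite lerDl ltW.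
have q2 : s2 <= lam^-1 by apply: le_trans si; rewrite lerDr ltW.
have := Hs0 _ q0; rewrite invrK => /andP[X0 X1].
rewrite sub0r normrN ger0_norm//; apply: (le_trans X1).
have := ler_wpM2l K0 (Hs2 _ q2).
have : K * (e / (2 * (K + 1))) <= e / 2.
  rewrite (_ : K * _ = e / 2 * (K / (K + 1))); last by field; rewrite gt_eqF.
  by rewrite ler_piMr ?divr_ge0 ?(ltW e0)// ler_pdivrMr// mul1r lerDl.
move: (K * _) (K * _) => y1 y2; lra.
Unshelve. all: by end_near. Qed.
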